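(* Let $d\ge 1$ and let $\mu$ be a probability measure on $(0,+\infty)$. Consider Deijfen's growth model driven by $\mu$ (defined in the context), with covered set $S_t$ at time $t$ started from the closed unit ball $B$. 1. If $$\int_0^{+\infty}\left(\int_x^{+\infty} r\,\mu(dr)\right)^{1/d}dx<+\infty,$$ then there exists $\lambda\in(0,+\infty)$ such that, almost surely, for all $\epsilon>0$, for all large enough $t$, $$B_{(1-\epsilon)/\lambda}\subset \frac{S_t}{t}\subset B_{(1+\epsilon)/\lambda}.$$ 2. If $$\int_0^{+\infty} r^{d+1}\,\mu(dr)=+\infty,$$ then, almost surely, for all $M>0$, for all large enough $t$, $B_M\subset \frac{S_t}{t}$.
   Context: $\|\cdot\|$ is the Euclidean norm on $\mathbb{R}^d$ and $B_r$ the closed Euclidean ball of radius $r$ centered at $0$; $B=B_1$. Let $\chi$ be a Poisson point process on $\mathbb{R}^d\times[0,+\infty)\times(0,+\infty)$ whose intensity is the product of Lebesgue measure on $\mathbb{R}^d\times[0,+\infty)$ and $\mu$. Passage times $\tau(x,y)\in[0,+\infty]$ for ordered pairs of points of $\mathbb{R}^d$: $\tau(x,x)=0$; for each $(c,t,r)\in\chi$ and each $y\in(c+B_r)\setminus\{c\}$, $\tau(c,y)=t$; all other pairs get $\tau(x,y)=+\infty$. A path from $a$ to $b$ is a finite sequence $\pi=(a=x_0,\dots,x_k=b)$ of distinct points of $\mathbb{R}^d$, with passage time $T(\pi)=\sum_{i=0}^{k-1}\tau(x_i,x_{i+1})$. For $A\subset\mathbb{R}^d$ and $x\in\mathbb{R}^d$,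 $T(A,x)=\inf\{T(\pi): \pi \text{ a path from some } a\in A \text{ to } x\}$. Finally $S_t=\{x\in\mathbb{R}^d: T(B,x)\le t\}$. *)

(* Defs.v *)
From HB Require Import structures.
From mathcomp Require Import all_boot all_order all_algebra.
From mathcomp Require Import all_classical all_reals all_analysis.
Set Implicit Arguments. Unset Strict Implicit. Unset Printing Implicit Defensive.
Import Order.TTheory GRing.Theory Num.Theory.
Import numFieldNormedType.Exports.
Local Open Scope classical_set_scope.
Local Open Scope ring_scope.

Section Deijfen.
Context {R : realType} (d : nat).

Notation pt := 'rV[R]_d.

Definition enorm (x : pt) : R := Num.sqrt (\sum_(i < d) (x ord0 i) ^+ 2).

Definition eball (r : R) : set pt := [set x | enorm x <= r].

(* marked points (c, (t, r)) : centre, time, radius *)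
Definition mpoint := (pt * (R * R))%type.

Definition card_is (X : set mpoint) (k : nat) : Prop :=
  exists s : seq mpoint, [/\ uniq s, size s = k & X = [set x | x \in s]].

Definition poisson_mass (m : R) (k : nat) : R :=
  expR (- m) * m ^+ k / (k`!)%:R.

(* Rectangles  [a,b) x [s,u) x J  with a <= b coordinatewise, 0 <= s <= u,
   J a Borel subset of (0,+oo); they form a semiring generating the
   Borel sets of R^d x [0,+oo) x (0,+oo). *)
Record rect := Rect { r_a : pt; r_b : pt; r_s : R; r_u : R; r_J : set R }.

Definition rect_ok (Q : rect) : Prop :=
  [/\ forall i, r_a Q ord0 i <= r_b Q ord0 i, 0 <= r_s Q, r_s Q <= r_u Q,
      measurable (r_J Q) & r_J Q `<=` `]0, +oo[%classic].

Definition rect_set (Q : rect) : set mpoint :=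
  [set p : mpoint | (forall i, r_a Q ord0 i <= p.1 ord0 i < r_b Q ord0 i) /\
           (r_s Q <= p.2.1 < r_u Q) /\ r_J Q p.2.2].

Definition rect_intensity (mu : probability R R) (Q : rect) : R :=
  (\prod_(i < d) (r_b Q ord0 i - r_a Q ord0 i)) * (r_u Q - r_s Q)
  * fine (mu (r_J Q)).

(* chi is a Poisson point process on R^d x [0,+oo) x (0,+oo) with intensity
   Leb_d (x) Leb (x) mu : every configuration lies in the state space, and for
   every finite family of pairwise disjoint rectangles the counts are jointly
   distributed as independent Poisson variables with the intensities as means
   (the events involved being measurable). *)
Definition is_PPP {dO : measure_display} {Omega : measurableType dO}
  (P : probability Omega R) (mu : probability R R)
  (chi : Omega -> set mpoint) : Prop :=
  (forall w p, chi w p -> 0 <= p.2.1 /\ 0 < p.2.2) /\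
  (forall (n : nat) (Q : 'I_n -> rect) (k : 'I_n -> nat),
     (forall i, rect_ok (Q i)) ->
     (forall i j, i != j -> rect_set (Q i) `&` rect_set (Q j) = set0) ->
     (forall i, measurable [set w | card_is (chi w `&` rect_set (Q i)) (k i)]) /\
     P (\bigcap_(i in [set: 'I_n]) [set w | card_is (chi w `&` rect_set (Q i)) (k i)])
     = (\prod_(i < n) poisson_mass (rect_intensity mu (Q i)) (k i))%:E).

Local Open Scope ereal_scope.

Definition tau (X : set mpoint) (x y : pt) : \bar R :=
  if x == y then 0
  else ereal_inf [set (p.2.1)%:E | p in
         [set p : mpoint | X p /\ p.1 = x /\ y != x /\ (enorm (y - x) <= p.2.2)%R]].

Fixpoint path_time (X : set mpoint) (x : pt) (s : seq pt) : \bar R :=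
  match s with
  | [::] => 0
  | y :: s' => tau X x y + path_time X y s'
  end.

Definition passT (X : set mpoint) (A : set pt) (x : pt) : \bar R :=
  ereal_inf [set v | exists (a : pt) (s : seq pt),
     [/\ A a, uniq (a :: s), last a s = x & v = path_time X a s]].

Definition covered (X : set mpoint) (t : R) : set pt :=
  [set x | passT X (eball 1) x <= t%:E].

End Deijfen.

(* Main.v *)
Require Import Defs.
From HB Require Import structures.
From mathcomp Require Import all_boot all_order all_algebra.
From mathcomp Require Import all_classical all_reals all_analysis.
From mathcomp Require Import measurable_realfun.
From mathcomp Require Import ring lra.
Set Implicit Arguments. Unset Strict Implicit. Unset Printing Implicit Defensive.
Import Order.TTheory GRing.Theory Num.Theory.
Import numFieldNormedType.Exports.
Local Open Scope classical_set_scope.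
Local Open Scope ring_scope.

(** A transmission from [c] of radius [r] at cost [t] is an open relation between
    marked points, so "a chain of points of the process inside an open set of marks
    leads from near [x] to near [y] in time less than [t]" is an increasing limit of
    events about the occupation of dyadic boxes.  This gives measurability,
    independence for disjoint sets of marks, and invariance in law under shears,
    reflections and rotations, hence a direction-free time constant [lam], the
    infimum of expected passage times over the distance.

    The upper bound follows from Chebyshev's inequality for independent blocks.  The
    lower bound along a direction follows from an argument of Katznelson and Weiss:
    if abnormally fast passages occurred infinitely often with positive probability,
    then chopping a long segment greedily into fast passages would contradict the
    convergence in probability of the rescaled passage time.  It extends to all
    directions because a chain can be cut at its last ball that is not tiny, tiny
    balls being unable to travel far.  Closed transmissions are reduced to open ones
    by the contraction [(c, t, r) -> (k c, k^-d t, r)], which preserves the law.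

    The constant is positive under the integral condition by a greedy lattice animal
    bound for each dyadic class of radii, summed with Markov's inequality.  When the
    moment of order [d + 1] is infinite, the second Borel-Cantelli lemma yields
    infinitely many scales with a huge and cheap transmission near the origin, which
    contradicts the two bounds unless the constant vanishes. *)

(** * Chains of transmissions *)

Section Euclid.
Context {R : realType} {d : nat}.
Implicit Types x y z : 'rV[R]_d.

Lemma sumsq_ge0 x : 0 <= \sum_(i < d) (x ord0 i) ^+ 2.
Proof. by apply: sumr_ge0 => i _; exact: sqr_ge0. Qed.

Lemma enorm_ge0 x : 0 <= enorm x. Proof. exact: sqrtr_ge0. Qed.

Lemma enorm_sqr x : enorm x ^+ 2 = \sum_(i < d) (x ord0 i) ^+ 2.
Proof. by rewrite sqr_sqrtr// sumsq_ge0. Qed.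

Lemma enorm_eq x y : \sum_(i < d) (x ord0 i) ^+ 2 = \sum_(i < d) (y ord0 i) ^+ 2 ->
  enorm x = enorm y.
Proof. by rewrite /enorm => ->. Qed.

Lemma enorm0 : enorm (0 : 'rV[R]_d) = 0.
Proof. by rewrite /enorm big1 ?sqrtr0// => i _; rewrite mxE expr0n. Qed.

Lemma enormN x : enorm (- x) = enorm x.
Proof. by apply: enorm_eq; apply: eq_bigr => i _; rewrite mxE sqrrN. Qed.

Lemma enormB x y : enorm (x - y) = enorm (y - x).
Proof. by rewrite -enormN opprB. Qed.

Lemma enormZ (a : R) x : enorm (a *: x) = `|a| * enorm x.
Proof.
rewrite /enorm -sqrtr_sqr -sqrtrM ?sqr_ge0// mulr_sumr; congr Num.sqrt.
by apply: eq_bigr => i _; rewrite mxE exprMn.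
Qed.

Lemma coord_le_enorm x i : `|x ord0 i| <= enorm x.
Proof.
rewrite -sqrtr_sqr ler_wsqrtr// (bigD1 i)//= lerDl.
by apply: sumr_ge0 => j _; exact: sqr_ge0.
Qed.

Lemma CauchySchwarz x y :
  \sum_(i < d) x ord0 i * y ord0 i <= enorm x * enorm y.
Proof.
have [x0|x0] := eqVneq (enorm x) 0.
  rewrite x0 mul0r; rewrite big1 // => i _.
  have := coord_le_enorm x i; rewrite x0 normr_le0 => /eqP ->; exact: mul0r.
have [y0|y0] := eqVneq (enorm y) 0.
  rewrite y0 mulr0; rewrite big1 // => i _.
  have := coord_le_enorm y i; rewrite y0 normr_le0 => /eqP ->; exact: mulr0.
have xp : 0 < enorm x by rewrite lt0r x0 enorm_ge0.
have yp : 0 < enorm y by rewrite lt0r y0 enorm_ge0.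
have : 0 <= \sum_(i < d) (x ord0 i / enorm x - y ord0 i / enorm y) ^+ 2.
  by apply: sumr_ge0 => i _; exact: sqr_ge0.
have -> : \sum_(i < d) (x ord0 i / enorm x - y ord0 i / enorm y) ^+ 2 =
   (enorm x) ^- 2 * (\sum_(i < d) (x ord0 i)^+2)
   + (enorm y) ^- 2 * (\sum_(i < d) (y ord0 i)^+2)
   - 2 / (enorm x * enorm y) * \sum_(i < d) x ord0 i * y ord0 i.
  rewrite !mulr_sumr -big_split/= -sumrB; apply: eq_bigr => i _.
  by field; rewrite x0 y0.
rewrite -!enorm_sqr !mulVf ?sqrf_eq0// => h.
rewrite -(@ler_pM2l _ (2 / (enorm x * enorm y))); last by rewrite divr_gt0// mulr_gt0.
apply: (@le_trans _ _ 2); first by rewrite -subr_ge0; move: h; congr (0 <= _); ring.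
by rewrite -mulrA mulVf ?mulr1// mulf_neq0.
Qed.

Lemma enormD x y : enorm (x + y) <= enorm x + enorm y.
Proof.
rewrite -(@ler_pXn2r _ 2)// ?nnegrE ?addr_ge0 ?enorm_ge0//.
rewrite sqrrD !enorm_sqr.
have -> : \sum_(i < d) (x + y) ord0 i ^+ 2 =
   \sum_(i < d) x ord0 i ^+ 2 + (\sum_(i < d) x ord0 i * y ord0 i) *+ 2
   + \sum_(i < d) y ord0 i ^+ 2.
  rewrite -sumrMnl -!big_split/=; apply: eq_bigr => i _.
  by rewrite mxE sqrrD.
rewrite lerD2r lerD2l lerMn2r/= CauchySchwarz//.
Qed.

Lemma enorm_tri z x y : enorm (x - y) <= enorm (x - z) + enorm (z - y).
Proof. by apply: le_trans (enormD _ _); rewrite addrA subrK. Qed.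

Lemma enorm_triB x y : enorm x - enorm y <= enorm (x - y).
Proof. by rewrite lerBlDr; apply: le_trans (enormD _ _); rewrite subrK. Qed.

Lemma enorm_le_sum x : enorm x <= \sum_(i < d) `|x ord0 i|.
Proof.
have s0 : 0 <= \sum_(i < d) `|x ord0 i| by apply: sumr_ge0.
rewrite -(@ler_pXn2r _ 2)// ?nnegrE ?enorm_ge0//.
rewrite enorm_sqr expr2 mulr_suml; apply: ler_sum => i _.
rewrite -real_normK ?num_real// expr2; apply: ler_wpM2l => //.
by rewrite (bigD1 i)//= lerDl; apply: sumr_ge0.
Qed.

Lemma enorm_le_coord x (e : R) : (forall i, `|x ord0 i| <= e) -> enorm x <= d%:R * e.
Proof.
move=> h; apply: le_trans (enorm_le_sum _) _.
apply: le_trans (ler_sum _ (fun i _ => h i)) _.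
by rewrite sumr_const card_ord mulr_natl.
Qed.

Lemma sum_le_enorm x : \sum_(i < d) `|x ord0 i| <= d%:R * enorm x.
Proof.
apply: le_trans (ler_sum _ (fun i _ => coord_le_enorm x i)) _.
by rewrite sumr_const card_ord mulr_natl.
Qed.

Fixpoint plen x (s : seq 'rV[R]_d) : R :=
  if s is y :: s' then enorm (y - x) + plen y s' else 0.

Lemma plen_ge0 x s : 0 <= plen x s.
Proof. by elim: s x => //= y s ih x; rewrite addr_ge0 ?enorm_ge0. Qed.

Lemma plen_head x y s : plen x s <= enorm (y - x) + plen y s.
Proof.
case: s => [|z s]/=; first by rewrite addr0 enorm_ge0.
by rewrite addrA lerD2r addrC; exact: enorm_tri.
Qed.

Lemma plen_subseq x s1 s2 : subseq s1 s2 -> plen x s1 <= plen x s2.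
Proof.
elim: s2 x s1 => [x s1|y s2 ih x s1]; first by rewrite subseq0 => /eqP ->.
case: s1 => [_|z s1]; first exact: plen_ge0.
rewrite /=; case: eqP => [-> h|_ h]; first by rewrite lerD2l ih.
apply: le_trans (plen_head x y (z :: s1)) _; rewrite lerD2l; exact: ih.
Qed.

Lemma dist_le_plen x s : enorm (last x s - x) <= plen x s.
Proof.
elim: s x => [x|y s ih x]/=; first by rewrite subrr enorm0.
by apply: le_trans (enorm_tri y _ _) _; rewrite addrC lerD2l.
Qed.

End Euclid.

Section Chains.
Context {R : realType} {d : nat}.
Local Notation pt := 'rV[R]_d.
Local Notation mpt := (@mpoint R d).
Implicit Types (X : set mpt) (x y z : pt) (p q : mpt) (s : seq mpt).

Definition mctr p : pt := p.1.
Definition mtim p : R := p.2.1.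
Definition mrad p : R := p.2.2.

Definition lk : rel mpt := fun p q => enorm (mctr q - mctr p) < mrad p.
Definition lkc : rel mpt := fun p q => enorm (mctr q - mctr p) <= mrad p.

Definition stime s : R := \sum_(q <- s) mtim q.

(* The last ball contains the ball of radius [r2] around [y], which is what lets
   chains be concatenated. *)
Definition conn X (r1 r2 : R) x y (t : R) : Prop := exists p s,
  [/\ forall q, q \in p :: s -> X q, enorm (mctr p - x) < r1, path lk p s,
      enorm (mctr (last p s) - y) + r2 < mrad (last p s) & stime (p :: s) < t].

Lemma stime_cons p s : stime (p :: s) = mtim p + stime s.
Proof. exact: big_cons. Qed.

Lemma stime_cat s1 s2 : stime (s1 ++ s2) = stime s1 + stime s2.
Proof. exact: big_cat. Qed.

Lemma conn_cat X r1 r2 r3 x y z t1 t2 :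
  conn X r1 r2 x y t1 -> conn X r2 r3 y z t2 -> conn X r1 r3 x z (t1 + t2).
Proof.
move=> [p [s [Xp px ps ly pt]]] [q [s' [Xq qy qs lz qt]]].
exists p, (s ++ q :: s'); split=> //.
- move=> a; rewrite -cat_cons mem_cat => /orP[]; [exact: Xp|exact: Xq].
- rewrite cat_path ps /= qs andbT /lk.
  apply: le_lt_trans (enorm_tri y _ _) _; rewrite (enormB y).
  by move: ly qy; lra.
- by rewrite last_cat.
- by rewrite -cat_cons stime_cat ltrD.
Qed.

Lemma conn_mono X Y r1 r2 r1' r2' x y x' y' t t' :
  X `<=` Y -> enorm (x' - x) + r1 <= r1' -> enorm (y' - y) + r2' <= r2 -> t <= t' ->
  conn X r1 r2 x y t -> conn Y r1' r2' x' y' t'.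
Proof.
move=> XY hx hy tt [p [s [Xp px ps ly pt]]]; exists p, s; split => //.
- by move=> q /Xp /XY.
- apply: le_lt_trans (enorm_tri x _ _) _; rewrite (enormB x); move: px hx; lra.
- apply: le_lt_trans ly; apply: le_trans (lerD (enorm_tri y _ _) (lexx _)) _.
  rewrite (enormB y); move: hy; lra.
- exact: lt_le_trans pt tt.
Qed.

Lemma connW X Y r1 r2 x y t t' : X `<=` Y -> t <= t' ->
  conn X r1 r2 x y t -> conn Y r1 r2 x y t'.
Proof. by move=> XY tt; apply: conn_mono => //; rewrite subrr enorm0 add0r. Qed.

Lemma tau_le X x y p : 0 <= mtim p -> X p -> mctr p = x -> enorm (y - x) <= mrad p ->
  (tau X x y <= (mtim p)%:E)%E.
Proof.
move=> t0 Xp px yx; rewrite /tau; case: eqP => [_|/eqP xy]; first by rewrite lee_fin.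
by apply: ereal_inf_lbound; exists p => //; rewrite eq_sym.
Qed.

Lemma tau_ge0 X x y : (forall p, X p -> 0 <= mtim p) -> (0 <= tau X x y)%E.
Proof.
move=> X0; rewrite /tau; case: eqP => // _; apply: le_ereal_inf_tmp => _ [p [Xp _] <-].
by rewrite lee_fin X0.
Qed.

Lemma path_time_ge0 X x l : (forall p, X p -> 0 <= mtim p) -> (0 <= path_time X x l)%E.
Proof. by move=> X0; elim: l x => //= y l ih x; rewrite adde_ge0 ?tau_ge0. Qed.

Lemma path_time_cat X x l1 l2 :
  path_time X x (l1 ++ l2) = (path_time X x l1 + path_time X (last x l1) l2)%E.
Proof. by elim: l1 x => [x|y l ih x]/=; rewrite ?add0e// ih addeA. Qed.

Lemma loop_erasure X a (l : seq pt) : (forall p, X p -> 0 <= mtim p) ->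
  exists l', [/\ uniq (a :: l'), last a l' = last a l &
    (path_time X a l' <= path_time X a l)%E].
Proof.
move=> X0; elim: l a => [a|y l ih a]; first by exists [::].
have [l' [ul ll tl]] := ih y.
have [al|al] := boolP (a \in y :: l'); last first.
  exists (y :: l'); split => //=; first by rewrite al.
  by rewrite leeD2l.
have {}tl : (path_time X y l' <= path_time X a (y :: l))%E.
  by apply: le_trans tl _ => /=; rewrite leeDr ?tau_ge0.
have {}ll : last a (y :: l') = last a (y :: l) by [].
move: al; rewrite inE => /orP[/eqP ay|al]; first by exists l'; subst a; split.
case/splitPr: al ul ll tl => l1 l2 ul ll tl.
exists l2; split.
- by move: ul; rewrite -cat_cons cat_uniq => /and3P[].
- by rewrite -ll /= last_cat.
- apply: le_trans tl; rewrite path_time_cat /= addeA leeDr// adde_ge0//.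
    exact: path_time_ge0.
  exact: tau_ge0.
Qed.

Lemma passT_le_chain X p s z : (forall p, X p -> 0 <= mtim p) ->
  (forall q, q \in p :: s -> X q) -> enorm (mctr p) <= 1 -> path lkc p s ->
  enorm (z - mctr (last p s)) <= mrad (last p s) ->
  (passT X (eball 1) z <= (stime (p :: s))%:E)%E.
Proof.
move=> X0 Xp p1 ps lz.
have h : (path_time X (mctr p) (rcons [seq mctr q | q <- s] z) <= (stime (p :: s))%:E)%E.
  elim: s p Xp ps lz {p1} => [p Xp _ lz|q s ih p Xp /= /andP[pq qs] lz].
    rewrite /= adde0 stime_cons /stime big_nil addr0; apply: tau_le => //; last exact: Xp (mem_head _ _).
    by apply: X0; apply: Xp; rewrite mem_head.
  rewrite stime_cons EFinD; apply: leeD.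
    by apply: tau_le => //; [apply: X0|]; apply: Xp; rewrite mem_head.
  by apply: ih => // a as_; apply: Xp; rewrite inE as_ orbT.
have [l [ul ll tl]] := loop_erasure (mctr p) (rcons [seq mctr q | q <- s] z) X0.
apply: le_trans h; apply: le_trans tl; apply: ereal_inf_lbound.
exists (mctr p), l; split => //; by rewrite ll last_rcons.
Qed.

Lemma path_lk_lkc p s : path lk p s -> path lkc p s.
Proof. by apply: sub_path => a b; exact: ltW. Qed.

Lemma passT_le_conn X r1 r2 x z t : (forall p, X p -> 0 <= mtim p) ->
  r1 <= 1 -> conn X r1 r2 0 x t -> enorm (z - x) <= r2 ->
  (passT X (eball 1) z <= t%:E)%E.
Proof.
move=> X0 r11 [p [s [Xp px ps ly pt]]] zx.
apply: le_trans (passT_le_chain X0 Xp _ (path_lk_lkc ps) _) _.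
- by move: px; rewrite subr0 => /ltW h; apply: le_trans h _.
- apply: le_trans (enorm_tri x _ _) _; rewrite (enormB x); move: ly zx; lra.
- by rewrite lee_fin ltW.
Qed.

Lemma passT_lt_chain X z t : (forall p, X p -> 0 <= mtim p) ->
  (passT X (eball 1) z < t%:E)%E ->
  enorm z <= 1 \/ exists p s,
   [/\ (forall q, q \in p :: s -> X q), enorm (mctr p) <= 1 & path lkc p s] /\
   [/\ enorm (z - mctr (last p s)) <= mrad (last p s), stime (p :: s) < t &
     uniq [seq mctr q | q <- p :: s]].
Proof.
move=> X0 /ereal_inf_lt[_ [a [l [Ba ul lz ->]]]] lt.
case: l => [|y l] in ul lz lt *; first by left; move: Ba; rewrite /= in lz; rewrite -lz.
right.
have h : forall l a y u, uniq (a :: y :: l) -> (path_time X a (y :: l) < u%:E)%E ->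
  exists p s, [/\ (forall q, q \in p :: s -> X q), mctr p = a & path lkc p s] /\
   [/\ enorm (last y l - mctr (last p s)) <= mrad (last p s), stime (p :: s) < u &
     [seq mctr q | q <- p :: s] = belast a (y :: l)].
  elim=> [|w l' ih] {Ba ul lz lt}a {}y u ua.
    rewrite /= adde0 /tau; case: eqP => [ay|/eqP ay]; first by move: ua; rewrite ay /= inE eqxx.
    move=> /ereal_inf_lt[_ [p [Xp [pa [ya h]]] <-]]; rewrite lte_fin => tu.
    exists p, [::]; split; split => //=.
    + by move=> q; rewrite inE => /eqP ->.
    + by rewrite /mctr pa.
    + by rewrite stime_cons /stime big_nil addr0.
    + by rewrite /mctr pa.
  have -> : path_time X a (y :: w :: l') = (tau X a y + path_time X y (w :: l'))%E by [].
  move=> lu; have ay : a != y by move: ua; rewrite /= inE negb_or => /andP[/andP[]].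
  have p0 := @path_time_ge0 X y (w :: l') X0.
  have t0 := @tau_ge0 X a y X0.
  have pf : path_time X y (w :: l') \is a fin_num.
    by rewrite ge0_fin_numE//; apply: le_lt_trans (lt_trans lu (ltry _)); rewrite leeDr.
  have tf : tau X a y \is a fin_num.
    by rewrite ge0_fin_numE//; apply: le_lt_trans (lt_trans lu (ltry _)); rewrite leeDl.
  pose e := (u - fine (tau X a y) - fine (path_time X y (w :: l'))) / 2.
  have e0 : 0 < e.
    rewrite /e divr_gt0// -addrA -opprD subr_gt0 -lte_fin EFinD !fineK//.
  have tl : (tau X a y < (fine (tau X a y) + e)%:E)%E by rewrite -{1}(fineK tf) lte_fin ltrDl.
  move: tl; rewrite {1}/tau (negbTE ay).
  move=> /ereal_inf_lt[_ [p [Xp [pa [ya h]]] <-]]; rewrite lte_fin => tu.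
  have u1 : uniq [:: y, w & l'] by move: ua => /andP[].
  have u2 : (path_time X y (w :: l') < (fine (path_time X y (w :: l')) + e)%:E)%E.
    by rewrite -[ltLHS](fineK pf) lte_fin ltrDl.
  have [q [s [[Xq qy qs] [ll lt' bl]]]] := ih y w _ u1 u2.
  exists p, (q :: s); split; split => //=.
  + by move=> b; rewrite inE => /orP[/eqP -> //|]; exact: Xq.
  + by rewrite qs andbT /lkc qy /mctr pa.
  + rewrite stime_cons; apply: lt_le_trans (ltrD tu lt') _; rewrite /e; lra.
  + by rewrite -/(map _ (q :: s)) bl /mctr pa.
have [p [s [[Xp pa ps] [ll lt' bl]]]] := h _ _ _ _ ul lt.
exists p, s; split; split => //.
- by rewrite pa; exact: Ba.
- by move: lz => /= <-.
- rewrite bl; move: ul; rewrite lastI rcons_uniq => /andP[]//.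
Qed.

End Chains.

(** * Counts of the Poisson process *)

Section Probability.
Context {R : realType} {dO : measure_display} {Omega : measurableType dO}.
Variable P : probability Omega R.
Implicit Types A B : set Omega.

Definition pr A : R := fine (P A).

Lemma prE A : measurable A -> P A = (pr A)%:E.
Proof.
move=> mA; rewrite /pr fineK// ge0_fin_numE//.
by apply: le_lt_trans (probability_le1 _ mA) _; rewrite ltry.
Qed.

Lemma pr_ge0 A : 0 <= pr A. Proof. by apply: fine_ge0. Qed.

Lemma pr_le1 A : measurable A -> pr A <= 1.
Proof. by move=> mA; rewrite -lee_fin -prE// probability_le1. Qed.

Lemma prT : pr setT = 1. Proof. by rewrite /pr probability_setT. Qed.

Lemma pr0 : pr set0 = 0. Proof. by rewrite /pr measure0. Qed.

Lemma pr_mono A B : measurable A -> measurable B -> A `<=` B -> pr A <= pr B.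
Proof. by move=> mA mB AB; rewrite -lee_fin -!prE// le_measure ?inE. Qed.

Lemma prC A : measurable A -> pr (~` A) = 1 - pr A.
Proof.
move=> mA; apply: EFin_inj; rewrite -prE; last exact: measurableC.
by rewrite probability_setC// prE// EFinB.
Qed.

Lemma prIC A B : measurable A -> measurable B -> pr (A `&` ~` B) = pr A - pr (A `&` B).
Proof.
move=> mA mB; apply: EFin_inj; rewrite -prE; last by apply: measurableI => //; exact: measurableC.
have mAB : measurable (A `&` B) by exact: measurableI.
rewrite -setDE measureD//; last by apply: le_lt_trans (probability_le1 _ mA) (ltry _).
by rewrite EFinB; congr (_ - _)%E; exact: prE.
Qed.

Lemma prU_le A B : measurable A -> measurable B -> pr (A `|` B) <= pr A + pr B.
Proof.
move=> mA mB; rewrite -lee_fin EFinD -!prE//; last exact: measurableU.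
exact: measureU2.
Qed.

Lemma prU A B : measurable A -> measurable B -> A `&` B = set0 -> pr (A `|` B) = pr A + pr B.
Proof.
move=> mA mB AB; apply: EFin_inj; rewrite EFinD -!prE//; last exact: measurableU.
by rewrite measureU.
Qed.

Lemma measurable_exists_in (I : eqType) (s : seq I) (F : I -> set Omega) :
  (forall i, i \in s -> measurable (F i)) ->
  measurable [set w | exists2 i, i \in s & F i w].
Proof.
elim: s => [|j s ih] mF.
  by rewrite [X in measurable X](_ : _ = set0)// -subset0 => w [].
rewrite [X in measurable X](_ : _ = F j `|` [set w | exists2 i, i \in s & F i w]).
  apply: measurableU; first by apply: mF; rewrite mem_head.
  by apply: ih => i si; apply: mF; rewrite inE si orbT.
apply/seteqP; split => w /=.
  by move=> [i]; rewrite inE => /orP[/eqP ->|si] Fi; [left|right; exists i].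
by move=> [Fj|[i si Fi]]; [exists j; rewrite ?mem_head|exists i; rewrite ?inE ?si ?orbT].
Qed.

Lemma pr_exists_in (I : eqType) (s : seq I) (F : I -> set Omega) :
  (forall i, i \in s -> measurable (F i)) ->
  pr [set w | exists2 i, i \in s & F i w] <= \sum_(i <- s) pr (F i).
Proof.
elim: s => [|j s ih] mF.
  by rewrite big_nil [X in pr X](_ : _ = set0) ?pr0// -subset0 => w [].
have ms : forall i, i \in s -> measurable (F i).
  by move=> i si; apply: mF; rewrite inE si orbT.
rewrite big_cons [X in pr X](_ : _ = F j `|` [set w | exists2 i, i \in s & F i w]).
  apply: le_trans (prU_le _ _) _; first by apply: mF; rewrite mem_head.
    exact: measurable_exists_in.
  by rewrite lerD2l ih.
apply/seteqP; split => w /=.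
  by move=> [i]; rewrite inE => /orP[/eqP ->|si] Fi; [left|right; exists i].
by move=> [Fj|[i si Fi]]; [exists j; rewrite ?mem_head|exists i; rewrite ?inE ?si ?orbT].
Qed.

Lemma measurable_exists_fin (I : finType) (F : I -> set Omega) :
  (forall i, measurable (F i)) -> measurable [set w | exists i, F i w].
Proof.
move=> mF; rewrite [X in measurable X](_ : _ = [set w | exists2 i, i \in enum I & F i w]).
  exact: measurable_exists_in.
apply/seteqP; split => w /= [i Fi]; [by exists i; rewrite ?mem_enum|by exists i].
Qed.

Lemma pr_exists_fin (I : finType) (F : I -> set Omega) :
  (forall i, measurable (F i)) ->
  pr [set w | exists i, F i w] <= \sum_i pr (F i).
Proof.
move=> mF; rewrite [X in pr X](_ : _ = [set w | exists2 i, i \in enum I & F i w]).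
  by apply: le_trans (pr_exists_in _) _ => //; rewrite big_enum.
apply/seteqP; split => w /= [i Fi]; [by exists i; rewrite ?mem_enum|by exists i].
Qed.

Lemma measurable_forall_fin (I : finType) (F : I -> set Omega) :
  (forall i, measurable (F i)) -> measurable [set w | forall i, F i w].
Proof.
move=> mF; rewrite [X in measurable X](_ : _ = ~` [set w | exists i, (~` F i) w]).
  by apply: measurableC; apply: measurable_exists_fin => i; exact: measurableC.
apply/seteqP; split => w /=; first by move=> h [i].
by move=> h i; apply: contrapT => hi; apply: h; exists i.
Qed.

Lemma measurable_forall_in (I : finType) (D : {set I}) (F : I -> set Omega) :
  (forall i, measurable (F i)) -> measurable [set w | forall i, i \in D -> F i w].
Proof.
move=> mF; rewrite [X in measurable X](_ : _ =
    [set w | forall i, [set w | i \in D -> F i w] w]) //.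
apply: measurable_forall_fin => i; have [iD|iD] := boolP (i \in D).
  rewrite [X in measurable X](_ : _ = F i)//.
  by apply/seteqP; split => w /=; [apply|].
by rewrite [X in measurable X](_ : _ = setT)//; apply/seteqP; split.
Qed.

Lemma measurable_exists_nat (F : nat -> set Omega) :
  (forall i, measurable (F i)) -> measurable [set w | exists i, F i w].
Proof.
move=> mF; rewrite [X in measurable X](_ : _ = \bigcup_i F i).
  exact: bigcupT_measurable.
by apply/seteqP; split => w /= [i]; [exists i|move=> _; exists i].
Qed.

Lemma ae_forall_nat (Q : nat -> Omega -> Prop) :
  (forall n, {ae P, forall w, Q n w}) -> {ae P, forall w, forall n, Q n w}.
Proof.
move=> h; have := @negligible_bigcup _ _ _ P _ h; apply: negligibleS.
by move=> w /= /existsNP[n hn]; exists n.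
Qed.

Lemma borel_cantelli (F : nat -> set Omega) (C : R) :
  (forall n, measurable (F n)) -> (forall N, \sum_(n < N) pr (F n) <= C) ->
  {ae P, forall w, exists n0, forall n, (n0 <= n)%N -> ~ F n w}.
Proof.
move=> mF hC; exists (lim_sup_set F); split.
- apply: bigcapT_measurable => n; apply: bigcup_measurable => k _; exact: mF.
- apply: lim_sup_set_cvg0 => //.
  apply: (@le_lt_trans _ _ C%:E); last exact: ltry.
  apply: lime_le; first exact: is_cvg_nneseries.
  apply: nearW => N; rewrite big_mkord.
  rewrite (eq_bigr (fun i : 'I_N => (pr (F i))%:E)) => [|i _]; last exact: prE.
  by rewrite sumEFin lee_fin; exact: hC.
- move=> w /= h n _; apply: contrapT => hn; apply: h; exists n => k nk Fk.
  by apply: hn; exists k.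
Qed.

End Probability.

Lemma leq_fact_addl a k : (a`! <= (k + a)`!)%N.
Proof.
by elim: k => // l ihl; rewrite addSn factS; apply: leq_trans ihl _; rewrite leq_pmull.
Qed.

Section Counts.
Context {R : realType} {d : nat}.
Implicit Types (X : set (@mpoint R d)).

Definition hask (k : nat) X := exists s : seq (@mpoint R d),
  [/\ uniq s, size s = k & forall x, x \in s -> X x].

Lemma haskN k X : ~ hask k X <-> exists2 j, (j < k)%N & card_is X j.
Proof.
split; last first.
  move=> [j jk [s [us ss eX]]] [s' [us' ss' sX']].
  have : (size s' <= size s)%N.
    by apply: uniq_leq_size => // x /sX'; rewrite eX.
  by rewrite ss ss' leqNgt jk.
elim: k => [|k ih] h; first by exfalso; apply: h; exists [::].
have [hk|/ih[j jk hj]] := pselect (hask k X); last by exists j => //; exact: leqW.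
exists k => //; case: hk => s [us ss sX]; exists s; split => //.
apply/seteqP; split => x /=; last exact: sX.
move=> Xx; apply: contrapT => /negP xs; apply: h; exists (x :: s); split => /=.
- by rewrite xs.
- by rewrite ss.
- by move=> y; rewrite inE => /orP[/eqP ->|/sX].
Qed.

Lemma card_is0 X : card_is X 0 <-> X = set0.
Proof.
split=> [[s [_ /size0nil -> ->]]|->].
  by rewrite -subset0 => x.
by exists [::]; split => //; apply/esym; rewrite -subset0 => x.
Qed.

Lemma hask1 X : hask 1 X <-> X !=set0.
Proof.
split=> [[[|x s] [_ //= _ sX]]|[x Xx]]; first by exists x; apply: sX; rewrite mem_head.
by exists [:: x]; split => // y; rewrite inE => /eqP ->.
Qed.

Lemma card_is_inj X j k : card_is X j -> card_is X k -> j = k.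
Proof.
move=> [s [us ss eX]] [s' [us' ss' eX']].
rewrite -ss -ss'; apply/eqP; rewrite -uniq_size_uniq//.
rewrite eX in eX'; case/seteqP: eX' => h1 h2.
by move=> x; apply/idP/idP => [/h2|/h1].
Qed.

End Counts.

Section PoissonProcess.
Context {R : realType} {d : nat} {dO : measure_display} {Omega : measurableType dO}.
Variables (P : probability Omega R) (mu : probability R R).
Variable chi : Omega -> set (@mpoint R d).
Hypothesis hchi : is_PPP P mu chi.
Local Notation pr := (pr P).
Local Notation rint := (@rect_intensity R d mu).

Lemma ppp_tim w p : chi w p -> 0 <= mtim p.
Proof. by have [h _] := hchi; move=> /h[]. Qed.

Lemma ppp_rad w p : chi w p -> 0 < mrad p.
Proof. by have [h _] := hchi; move=> /h[]. Qed.

Lemma rint_ge0 Q : rect_ok Q -> 0 <= rint Q.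
Proof.
move=> [ab s0 su mJ _]; rewrite !mulr_ge0// ?subr_ge0//; last exact: fine_ge0.
by apply: prodr_ge0 => i _; rewrite subr_ge0.
Qed.

Definition cnt (Q : @rect R d) k : set Omega := [set w | card_is (chi w `&` rect_set Q) k].
Definition cge (Q : @rect R d) k : set Omega := [set w | hask k (chi w `&` rect_set Q)].
Definition occ (Q : @rect R d) : set Omega := [set w | (chi w `&` rect_set Q) !=set0].

Lemma measurable_cnt Q k : rect_ok Q -> measurable (cnt Q k).
Proof.
move=> okQ; have [_ /(_ 1%N (fun=> Q) (fun=> k))] := hchi.
by case=> // [i j|/(_ ord0)//]; rewrite !ord1.
Qed.

Lemma cgeE Q k : cge Q k = ~` [set w | exists2 j, j \in iota 0 k & cnt Q j w].
Proof.
apply/seteqP; split => w /=.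
  by move=> hk [j]; rewrite mem_iota/= add0n => jk cj; move: hk; apply/haskN; exists j.
move=> h; apply: contrapT => /haskN[j jk cj]; apply: h; exists j => //.
by rewrite mem_iota.
Qed.

Lemma measurable_cge Q k : rect_ok Q -> measurable (cge Q k).
Proof.
move=> okQ; rewrite cgeE; apply: measurableC.
by apply: measurable_exists_in => j _; exact: measurable_cnt.
Qed.

Lemma measurable_occ Q : rect_ok Q -> measurable (occ Q).
Proof.
move=> okQ; rewrite [occ Q](_ : _ = cge Q 1); first exact: measurable_cge.
by apply/seteqP; split => w /= /hask1.
Qed.

Variables (I : finType) (Q : I -> @rect R d).
Hypothesis okQ : forall i, rect_ok (Q i).
Hypothesis djQ : forall i j, i != j -> rect_set (Q i) `&` rect_set (Q j) = set0.

Lemma ppp_cnt (B : {set I}) (k : I -> nat) :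
  pr [set w | forall i, i \in B -> cnt (Q i) (k i) w] =
  \prod_(i in B) poisson_mass (rint (Q i)) (k i).
Proof.
have [_ /(_ #|B| (fun a => Q (enum_val a)) (fun a => k (enum_val a)))] := hchi.
case=> [a|a b ab|_ h]; first exact: okQ.
  by apply: djQ; rewrite (inj_eq enum_val_inj).
rewrite /pr [X in P X](_ : _ = \bigcap_(i in [set: 'I_#|B|])
  [set w | card_is (chi w `&` rect_set (Q (enum_val i))) (k (enum_val i))]).
  by rewrite h /= -(big_enum_val (fun i => poisson_mass (rint (Q i)) (k i))).
apply/seteqP; split => w /=.
  by move=> hw a _; apply: hw; exact: enum_valP.
move=> hw i iB; have := hw (enum_rank_in iB i) Logic.I.
by rewrite /= enum_rankK_in.
Qed.

Definition ptail (m : R) k := 1 - \sum_(j < k) poisson_mass m j.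

Lemma ppp_mix (A B : {set I}) (k j : I -> nat) : (forall i, i \in A -> i \notin B) ->
  pr [set w | (forall i, i \in A -> cge (Q i) (k i) w) /\
              (forall i, i \in B -> cnt (Q i) (j i) w)] =
  (\prod_(i in A) ptail (rint (Q i)) (k i)) *
  \prod_(i in B) poisson_mass (rint (Q i)) (j i).
Proof.
have [n] := ubnP #|A|; elim: n => // n ih in A B j * => An dAB.
have [->|[a aA]] := set_0Vmem A.
  rewrite big_set0 mul1r -ppp_cnt; congr pr.
  by apply/seteqP; split => w /=; [case|split => // i; rewrite inE].
set E := [set w | _].
pose A' := A :\ a; pose F := [set w | (forall i, i \in A' -> cge (Q i) (k i) w) /\
              (forall i, i \in B -> cnt (Q i) (j i) w)].
have mF : measurable F.
  apply: measurableI; apply: measurable_forall_in => i;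
  [exact: measurable_cge|exact: measurable_cnt].
pose G l := F `&` cnt (Q a) l.
have mG l : measurable (G l) by apply: measurableI => //; exact: measurable_cnt.
have EF : E = F `&` ~` [set w | exists2 l, l \in iota 0 (k a) & cnt (Q a) l w].
  rewrite -cgeE; apply/seteqP; split => w /=.
    move=> [h1 h2]; split; last exact: h1.
    by split => // i; rewrite !inE => /andP[_]; exact: h1.
  move=> [[h1 h2] h3]; split => // i iA; have [->//|ia] := eqVneq i a.
  by apply: h1; rewrite !inE ia.
have dA'B : forall i, i \in A' -> i \notin B by move=> i; rewrite !inE => /andP[_ /dAB].
have A'n : (#|A'| < n)%N by rewrite -ltnS; apply: leq_trans An; rewrite (cardsD1 a A) aA.
have aB : a \notin B by exact: dAB.
have prG l : pr (G l) = pr F * poisson_mass (rint (Q a)) l.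
  pose j' i := if i == a then l else j i.
  have -> : G l = [set w | (forall i, i \in A' -> cge (Q i) (k i) w) /\
              (forall i, i \in a |: B -> cnt (Q i) (j' i) w)].
    apply/seteqP; split => w /=.
      move=> [[h1 h2] h3]; split => // i; rewrite !inE /j' => /orP[/eqP ->|iB].
        by rewrite eqxx.
      by rewrite (negbTE (memPn aB _ iB)); exact: h2.
    move=> [h1 h2]; split; last by have := h2 a; rewrite !inE eqxx /j' eqxx; apply.
    split => // i iB; have := h2 i; rewrite !inE iB orbT /j' (negbTE (memPn aB _ iB)).
    exact.
  rewrite (ih A' (a |: B) j')//; last first.
    by move=> i iA'; rewrite !inE negb_or dA'B// andbT; move: iA'; rewrite !inE => /andP[].
  rewrite (ih A' B j)// -mulrA; congr (_ * _).
  rewrite big_setU1//= mulrC /j' eqxx; congr (_ * _); apply: eq_bigr => i iB.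
  by rewrite (negbTE (memPn aB _ iB)).
have prD : forall m, pr (F `&` [set w | exists2 l, l \in iota 0 m & cnt (Q a) l w]) =
    \sum_(l < m) pr (G l).
  elim=> [|m ihm].
    rewrite big_ord0 [X in pr X](_ : _ = set0) ?pr0// -subset0 => w /= [_ [l]].
    by rewrite in_nil.
  rewrite big_ord_recr/= -ihm -prU//.
  - congr pr; apply/seteqP; split => w.
      move=> [Fw [l]]; rewrite -/(iota 0 m.+1) mem_iota => /andP[_]; rewrite add0n ltnS leq_eqVlt => /orP[/eqP ->|lm] h.
        by right.
      by left; split => //; exists l => //; rewrite mem_iota.
    move=> [[Fw [l]]|[Fw h]]; last by split => //; exists m => //; rewrite -/(iota 0 m.+1) mem_iota add0n leqnn.
    rewrite mem_iota => /andP[_ lm] h; split => //; exists l => //.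
    by rewrite -/(iota 0 m.+1) mem_iota leq0n leqW.
  - by apply: measurableI => //; apply: measurable_exists_in => l _; exact: measurable_cnt.
  - rewrite -subset0 => w /= [[_ [l]]]; rewrite mem_iota/= add0n => lm h1 [_ h2].
    by move: lm; rewrite (card_is_inj h1 h2) ltnn.
rewrite EF prIC//; last by apply: measurable_exists_in => l _; exact: measurable_cnt.
rewrite prD (eq_bigr _ (fun (l : 'I_(k a)) _ => prG l)).
rewrite -mulr_sumr (ih A' B j)// (big_setD1 a aA)/= /ptail; ring.
Qed.

Lemma ptail_le (m : R) k : 0 <= m -> ptail m k <= m ^+ k.
Proof.
move=> m0; have e0 := expR_gt0 m.
suff : expR m - \sum_(j < k) m ^+ j / j`!%:R <= m ^+ k * expR m.
  rewrite /ptail /poisson_mass.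
  have -> : \sum_(j < k) expR (- m) * m ^+ j / j`!%:R = expR (- m) * \sum_(j < k) m ^+ j / j`!%:R.
    by rewrite mulr_sumr; apply: eq_bigr => i _; rewrite mulrA.
  set S := \sum_(j < k) _ => h.
  have -> : 1 - expR (- m) * S = expR (- m) * (expR m - S) by rewrite mulrBr -expRD addNr expR0.
  apply: le_trans (ler_wpM2l (expR_ge0 _) h) _.
  by rewrite mulrCA -expRD addNr expR0 mulr1.
rewrite lerBlDr.
rewrite [leLHS](_ : _ = lim (series (exp_coeff m) @ \oo)) ; last by [].
apply: limr_le; first exact: is_cvg_series_exp_coeff.
exists k => // n /= kn; rewrite seriesEord /=.
rewrite -(subnKC kn) big_split_ord/= addrC lerD2r.
under eq_bigr do rewrite /exp_coeff /=.
apply: (@le_trans _ _ (\sum_(i < n - k) m ^+ k * exp_coeff m i)).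
  apply: ler_sum => i _; rewrite exprD /exp_coeff/= -mulrA ler_wpM2l ?exprn_ge0//.
  rewrite ler_wpM2l ?exprn_ge0// lef_pV2 ?posrE ?ltr0n ?fact_gt0// ler_nat.
  exact: leq_fact_addl.
rewrite -mulr_sumr ler_wpM2l ?exprn_ge0//.
have h : series (exp_coeff m) (n - k)%N <= expR m.
  apply: nondecreasing_cvgn_le; last exact: is_cvg_series_exp_coeff.
  apply/nondecreasing_seqP => i; rewrite /series/= big_nat_recr//= lerDl.
  by rewrite /exp_coeff/= divr_ge0 ?exprn_ge0.
by move: h; rewrite seriesEord.
Qed.

Lemma ppp_cge_le (k : I -> nat) (th : R) : (forall i, rint (Q i) <= th) ->
  pr [set w | forall i, cge (Q i) (k i) w] <= th ^+ \sum_i k i.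
Proof.
move=> hth.
rewrite [X in pr X](_ : _ = [set w | (forall i, i \in [set: I]%SET -> cge (Q i) (k i) w) /\
              (forall i, i \in @finset.set0 I -> cnt (Q i) (k i) w)]); last first.
  apply/seteqP; split => w /=; first by move=> h; split => // i; rewrite inE.
  by move=> [h _] i; apply: h.
rewrite ppp_mix ?big_set0 ?mulr1; last by move=> i; rewrite !inE.
rewrite -prodrXr; rewrite [leRHS](eq_bigl (fun i => i \in [set: I]%SET)); last by move=> i; rewrite inE.
apply: ler_prod => i _; have r0 := rint_ge0 (okQ i); apply/andP; split; last first.
  apply: le_trans (ptail_le _ r0) _; rewrite lerXn2r// ?nnegrE//.
  exact: le_trans r0 (hth i).
have := @ppp_mix [set i]%SET (@finset.set0 I) (fun=> k i) (fun=> 0%N).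
rewrite big_set0 big_set1 mulr1 => <-; first exact: pr_ge0.
by move=> l; rewrite !inE.
Qed.

Lemma ppp_void (B : {set I}) :
  pr [set w | forall i, i \in B -> ~ occ (Q i) w] = expR (- \sum_(i in B) rint (Q i)).
Proof.
rewrite [X in pr X](_ : _ = [set w | forall i, i \in B -> cnt (Q i) 0 w]).
  rewrite (ppp_cnt B (fun=> 0%N)) -sumrN expR_sum; apply: eq_bigr => i _.
  by rewrite /poisson_mass expr0 fact0 mulr1 divr1.
apply/seteqP; split => w /= h i /h; first by move=> /set0P/negP/negPn/eqP; rewrite -card_is0.
by rewrite /cnt /= card_is0 => /eqP/negPn/negP/set0P.
Qed.

End PoissonProcess.

(** * Events decided by dyadic boxes *)

Section Patterns.
Context {R : realType} {dO : measure_display} {Omega : measurableType dO}.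
Variable P : probability Omega R.
Local Notation pr := (pr P).
Variables (I : finType) (V : I -> set Omega) (v : I -> R).
Hypothesis mV : forall i, measurable (V i).
Hypothesis prV : forall B : {set I},
  pr [set w | forall i, i \in B -> V i w] = \prod_(i in B) v i.

Lemma pr_compl_mix (A B : {set I}) : (forall i, i \in A -> i \notin B) ->
  pr [set w | (forall i, i \in A -> ~ V i w) /\ (forall i, i \in B -> V i w)] =
  (\prod_(i in A) (1 - v i)) * \prod_(i in B) v i.
Proof.
have [n] := ubnP #|A|; elim: n => // n ih in A B * => An dAB.
have [->|[a aA]] := set_0Vmem A.
  rewrite big_set0 mul1r -prV; congr pr.
  by apply/seteqP; split => w /=; [case|split => // i; rewrite inE].
pose A' := A :\ a; pose F := [set w | (forall i, i \in A' -> ~ V i w) /\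
              (forall i, i \in B -> V i w)].
have mF : measurable F.
  apply: measurableI; apply: measurable_forall_in => i //; exact: measurableC.
have EF : [set w | (forall i, i \in A -> ~ V i w) /\ (forall i, i \in B -> V i w)] =
    F `&` ~` V a.
  apply/seteqP; split => w /=.
    move=> [h1 h2]; split; last exact: h1.
    by split => // i; rewrite !inE => /andP[_]; exact: h1.
  move=> [[h1 h2] h3]; split => // i iA; have [->//|ia] := eqVneq i a.
  by apply: h1; rewrite !inE ia.
have dA'B : forall i, i \in A' -> i \notin B by move=> i; rewrite !inE => /andP[_ /dAB].
have A'n : (#|A'| < n)%N by rewrite -ltnS; apply: leq_trans An; rewrite (cardsD1 a A) aA.
have aB : a \notin B by exact: dAB.
have -> : \prod_(i in A) (1 - v i) = (1 - v a) * \prod_(i in A') (1 - v i).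
  by rewrite (big_setD1 a aA).
rewrite EF prIC// (ih A' B)//.
have -> : F `&` V a = [set w | (forall i, i \in A' -> ~ V i w) /\
              (forall i, i \in a |: B -> V i w)].
  apply/seteqP; split => w /=.
    move=> [[h1 h2] h3]; split => // i; rewrite !inE => /orP[/eqP ->//|]; exact: h2.
  move=> [h1 h2]; split; last by apply: h2; rewrite !inE eqxx.
  by split => // i iB; apply: h2; rewrite !inE iB orbT.
rewrite (ih A' (a |: B))//; first by rewrite big_setU1//=; ring.
by move=> i iA'; rewrite !inE negb_or dA'B// andbT; move: iA'; rewrite !inE => /andP[].
Qed.

Definition pattern w : {set I} := [set i | ~~ `[< V i w >]]%SET.

Definition pat_prob (u : I -> R) (g : pred {set I}) : R :=
  \sum_(S : {set I} | g S) \prod_i (if i \in S then 1 - u i else u i).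

Lemma patternE S : [set w | pattern w = S] =
  [set w | (forall i, i \in S -> ~ V i w) /\ (forall i, i \in ~: S -> V i w)].
Proof.
apply/seteqP; split => w /=.
  by move=> <-; split => i; rewrite !inE ?negbK => /asboolP.
move=> [h1 h2]; apply/setP => i; rewrite inE; have [iS|iS] := boolP (i \in S).
  by apply/asboolPn; exact: h1.
by apply/negbTE; rewrite negbK; apply/asboolP; apply: h2; rewrite inE.
Qed.

Lemma measurable_pattern (g : pred {set I}) : measurable [set w | g (pattern w)].
Proof.
rewrite [X in measurable X](_ : _ = [set w | exists2 S, S \in enum g & [set w | pattern w = S] w]).
  apply: measurable_exists_in => S _; rewrite patternE.
  apply: measurableI; apply: measurable_forall_in => i //; exact: measurableC.
apply/seteqP; split => w /=; first by move=> gw; exists (pattern w) => //; rewrite mem_enum.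
by move=> [S]; rewrite mem_enum => gS ->.
Qed.

Lemma pr_pattern (g : pred {set I}) : pr [set w | g (pattern w)] = pat_prob v g.
Proof.
have mE S : measurable [set w | pattern w = S].
  rewrite patternE.
  apply: measurableI; apply: measurable_forall_in => i //; exact: measurableC.
rewrite /pat_prob; set r := index_enum _.
have ur : uniq r := index_enum_uniq _.
have mr S : S \in r := mem_index_enum S.
rewrite -big_filter.
rewrite [X in pr X](_ : _ = [set w | exists2 S, S \in [seq S <- r | g S]
   & [set w | pattern w = S] w]); last first.
  apply/seteqP; split => w /=.
    by move=> gw; exists (pattern w) => //; rewrite mem_filter gw mr.
  by move=> [S]; rewrite mem_filter => /andP[gS _] ->.
have := filter_uniq g ur.
elim: [seq x <- r | g x] => [_|S s ih /= /andP[Ss us]].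
  by rewrite big_nil [X in pr X](_ : _ = set0) ?pr0// -subset0 => w [].
rewrite big_cons -ih//.
rewrite [X in pr X](_ : _ = [set w | pattern w = S] `|`
   [set w | exists2 S, S \in s & [set w | pattern w = S] w]); last first.
  apply/seteqP; split => w /=.
    by move=> [i]; rewrite inE => /orP[/eqP ->|si] Fi; [left|right; exists i].
  by move=> [Fj|[i si Fi]]; [exists S; rewrite ?mem_head|exists i; rewrite ?inE ?si ?orbT].
rewrite prU//; last 2 first.
- by apply: measurable_exists_in => i _.
- by rewrite -subset0 => w /= [-> [T Ts ST]]; rewrite ST Ts in Ss.
congr (_ + _); rewrite patternE pr_compl_mix; last by move=> i; rewrite inE => ->.
rewrite [RHS](bigID (fun i => i \in S))/=; congr (_ * _).
  by apply: eq_bigr => i ->.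
rewrite (eq_bigl (fun i => i \notin S)); last by move=> i; rewrite inE.
by apply: eq_bigr => i /negbTE ->.
Qed.

End Patterns.

Section PatternLip.
Context {R : realType} (I : finType).
Implicit Types u v : I -> R.

Lemma prod_lip (s : seq I) u v (c : I -> R) :
  (forall i, 0 <= u i <= 1) -> (forall i, 0 <= v i <= 1) ->
  (forall i, `|u i - v i| <= c i) ->
  `|\prod_(i <- s) u i - \prod_(i <- s) v i| <= \sum_(i <- s) c i.
Proof.
move=> hu hv hc; elim: s => [|i s ih]; first by rewrite !big_nil subrr normr0.
rewrite !big_cons.
have -> : u i * \prod_(j <- s) u j - v i * \prod_(j <- s) v j =
  (u i - v i) * \prod_(j <- s) u j + v i * (\prod_(j <- s) u j - \prod_(j <- s) v j) by ring.
apply: le_trans (ler_normD _ _) _; apply: lerD; rewrite normrM.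
- have p0 : 0 <= \prod_(j <- s) u j by apply: prodr_ge0 => j _; case/andP: (hu j).
  rewrite (ger0_norm p0) -[leRHS]mulr1; apply: ler_pM => //.
  suff : 0 <= \prod_(j <- s) u j <= 1 by case/andP.
  apply: (big_ind (fun x => 0 <= x <= 1)); [by rewrite ler01 lexx| |by move=> j _; exact: hu].
  by move=> x y /andP[x0 x1] /andP[y0 y1]; rewrite mulr_ge0// mulr_ile1.
- case/andP: (hv i) => v0 v1; rewrite (ger0_norm v0) -[leRHS]mul1r; exact: ler_pM.
Qed.

Lemma pat_prob_lip u v (g : pred {set I}) (e : R) :
  (forall i, 0 <= u i <= 1) -> (forall i, 0 <= v i <= 1) ->
  (forall i, `|u i - v i| <= e) ->
  pat_prob u g <= pat_prob v g + (\sum_(S : {set I}) \sum_(i : I) 1) * e.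
Proof.
move=> hu hv he; rewrite -lerBlDl /pat_prob -sumrB.
have e0 : 0 <= \sum_(i : I) e.
  by apply: sumr_ge0 => i _; apply: le_trans (he i).
apply: le_trans (ler_sum _ (fun S _ => _ : _ <= \sum_(i : I) e)) _.
  move=> S _; apply: le_trans (ler_norm _) _.
  have h (w : I -> R) (hw : forall i, 0 <= w i <= 1) i : 0 <= (if i \in S then 1 - w i else w i) <= 1.
    by case: ifP => _; move: (hw i); lra.
  apply: (@prod_lip _ _ _ (fun=> e)) => [i|i|i]; [exact: h|exact: h|].
  case: ifP => _ //; rewrite [X in `|X|](_ : _ = - (u i - v i)); last by ring.
  by rewrite normrN.
rewrite (le_trans (_ : _ <= \sum_(S : {set I}) \sum_(i : I) e))//.
  by rewrite [leRHS](bigID g)/= lerDl; apply: sumr_ge0 => S _; exact: e0.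
rewrite mulr_suml; apply: ler_sum => S _; rewrite mulr_suml.
by apply: ler_sum => i _; rewrite mul1r.
Qed.

Lemma expRN_lip (a b : R) : 0 <= b -> b <= a -> `|expR (- a) - expR (- b)| <= a - b.
Proof.
move=> b0 ba; rewrite distrC ger0_norm; last by rewrite subr_ge0 ler_expR lerN2.
have -> : expR (- b) - expR (- a) = expR (- b) * (1 - expR (- (a - b))).
  by rewrite mulrBr mulr1 -expRD; congr (_ - expR _); ring.
have h : 1 - expR (- (a - b)) <= a - b by have := expR_ge1Dx (- (a - b)); lra.
have h0 : 0 <= 1 - expR (- (a - b)).
  by rewrite subr_ge0 -[leRHS]expR0 ler_expR oppr_le0 subr_ge0.
apply: le_trans h; rewrite -[leRHS]mul1r; apply: ler_pM => //.
by rewrite -[leRHS]expR0 ler_expR oppr_le0.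
Qed.

End PatternLip.

Section Grid.
Context {R : realType} {d : nat}.
Local Notation mpt := (@mpoint R d).
Implicit Types (p q : mpt) (l : nat).

Definition gM l := (2 * 4 ^ l).-1.
Definition gI l : finType := ({ffun 'I_d -> 'I_(gM l).+1} * ('I_(gM l).+1 * 'I_(gM l).+1))%type.

Lemma gMS l : (gM l).+1 = (2 * 4 ^ l)%N.
Proof. by rewrite prednK// muln_gt0 expn_gt0. Qed.

Definition gcell l (i : gI l) : @rect R d :=
  Rect (\row_k ((i.1 k)%:R / 2 ^+ l - 2 ^+ l)) (\row_k ((i.1 k).+1%:R / 2 ^+ l - 2 ^+ l))
       (i.2.1%:R / 2 ^+ l) (i.2.1.+1%:R / 2 ^+ l)
       (`[i.2.2%:R / 2 ^+ l, i.2.2.+1%:R / 2 ^+ l[ `&` `]0, +oo[)%classic.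

Lemma gcell_ok l (i : gI l) : rect_ok (gcell i).
Proof.
have h (k : nat) : k%:R / 2 ^+ l <= k.+1%:R / 2 ^+ l :> R.
  by rewrite ler_pM2r ?invr_gt0 ?exprn_gt0// ler_nat.
split => //=.
- by move=> k; rewrite !mxE lerD2r.
- by apply: measurableI; exact: measurable_itv.
Qed.

Lemma gcellP l (i : gI l) p : rect_set (gcell i) p <->
  [/\ forall k, (i.1 k)%:R / 2 ^+ l - 2 ^+ l <= p.1 ord0 k < (i.1 k).+1%:R / 2 ^+ l - 2 ^+ l,
      i.2.1%:R / 2 ^+ l <= p.2.1 < i.2.1.+1%:R / 2 ^+ l,
      i.2.2%:R / 2 ^+ l <= p.2.2 < i.2.2.+1%:R / 2 ^+ l & 0 < p.2.2].
Proof.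
rewrite /rect_set /=; split.
  move=> [h1 [h2 [h3 h4]]]; split => //.
  - by move=> k; have := h1 k; rewrite !mxE.
  - by have := h4; rewrite /= in_itv /= andbT.
move=> [h1 h2 h3 h4]; split; first by move=> k; rewrite !mxE.
by split => //; split; rewrite /= in_itv/= ?h3// h4.
Qed.

Lemma nat_itv_eq (a b : nat) (x c : R) : 0 < c ->
  a%:R / c <= x < a.+1%:R / c -> b%:R / c <= x < b.+1%:R / c -> a = b.
Proof.
move=> c0; rewrite !ler_pdivrMr// !ltr_pdivlMr// => h1 h2.
by rewrite -(truncn_def h1) (truncn_def h2).
Qed.

Lemma gcell_disj l (i j : gI l) : i != j ->
  rect_set (gcell i) `&` rect_set (gcell j) = set0.
Proof.
move=> ij; rewrite -subset0 => p [/gcellP[h1 h2 h3 _] /gcellP[h1' h2' h3' _]].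
have c0 : (0 : R) < 2 ^+ l by rewrite exprn_gt0.
move: ij => /negP; apply; apply/eqP; case: i j h1 h2 h3 h1' h2' h3' => [i1 [i2 i3]] [j1 [j2 j3]] /= h1 h2 h3 h1' h2' h3'.
congr (_, (_, _)); [|exact/val_inj/(nat_itv_eq c0 h2 h2')|exact/val_inj/(nat_itv_eq c0 h3 h3')].
apply/ffunP => k; apply: val_inj => /=; apply: (@nat_itv_eq _ _ (p.1 ord0 k + 2 ^+ l) (2 ^+ l)) => //.
  by have := h1 k; lra.
by have := h1' k; lra.
Qed.

Definition inwin l p := [/\ forall k, - 2 ^+ l <= p.1 ord0 k < 2 ^+ l,
  0 <= p.2.1 < 2 * 2 ^+ l & 0 < p.2.2 < 2 * 2 ^+ l].

Definition gnat l (x : R) : 'I_(gM l).+1 := inord (Num.truncn (x * 2 ^+ l)).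

Lemma gnatP l x : 0 <= x < 2 * 2 ^+ l ->
  (gnat l x)%:R / 2 ^+ l <= x < (gnat l x).+1%:R / 2 ^+ l.
Proof.
move=> /andP[x0 xl]; have c0 : (0 : R) < 2 ^+ l by rewrite exprn_gt0.
have y0 : 0 <= x * 2 ^+ l by rewrite mulr_ge0// ltW.
rewrite /gnat inordK; first by rewrite ler_pdivrMr// ltr_pdivlMr//; exact: truncn_itv.
rewrite gMS -(ltr_nat R); apply: le_lt_trans (_ : x * 2 ^+ l < _).
  by case/andP: (truncn_itv y0).
rewrite natrM natrX.
have -> : (4%:R : R) ^+ l = 2 ^+ l * 2 ^+ l by rewrite -exprMn; congr (_ ^+ _); ring.
by rewrite mulrA ltr_pM2r.
Qed.

Definition gidx l p : gI l := ([ffun k => gnat l (p.1 ord0 k + 2 ^+ l)], (gnat l p.2.1, gnat l p.2.2)).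

Lemma gidxP l p : inwin l p -> rect_set (gcell (gidx l p)) p.
Proof.
move=> [h1 h2 h3]; have c0 : (0 : R) < 2 ^+ l by rewrite exprn_gt0.
apply/gcellP; split => /=; last by case/andP: h3.
- move=> k; rewrite ffunE.
  have := @gnatP l (p.1 ord0 k + 2 ^+ l); move: (h1 k) => hk.
  by move=> /(_ ltac:(lra)); set a := _ / _; set b := _ / _; lra.
- exact: gnatP.
- by apply: gnatP; case/andP: h3 => /ltW -> ->.
Qed.

Lemma gcell_inwin l (i : gI l) p : rect_set (gcell i) p -> inwin l p.
Proof.
move=> /gcellP[h1 h2 h3 h4]; have c0 : (0 : R) < 2 ^+ l by rewrite exprn_gt0.
have lb (k : 'I_(gM l).+1) : (0 : R) <= k%:R / 2 ^+ l by rewrite divr_ge0// ltW.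
have ub (k : 'I_(gM l).+1) : k.+1%:R / 2 ^+ l <= 2 * 2 ^+ l :> R.
  rewrite ler_pdivrMr//.
  have -> : (2 : R) * 2 ^+ l * 2 ^+ l = (2 * 4 ^ l)%N%:R.
    rewrite natrM natrX -mulrA; congr (_ * _); rewrite -exprMn; congr (_ ^+ _); ring.
  by rewrite ler_nat -gMS ltn_ord.
split.
- by move=> k; move: (h1 k) (lb (i.1 k)) (ub (i.1 k)); lra.
- by move: (h2) (lb i.2.1) (ub i.2.1); lra.
- by move: (h3) (lb i.2.2) (ub i.2.2); lra.
Qed.

Lemma inwin_mono l p : inwin l p -> inwin l.+1 p.
Proof.
move=> [h1 h2 h3]; have c0 : (0 : R) < 2 ^+ l by rewrite exprn_gt0.
by rewrite /inwin exprS; split => [k||]; [move: (h1 k)|move: h2|move: h3]; lra.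
Qed.

Lemma dyadic_child (k k' : nat) (m : nat) (x c : R) : 0 < c ->
  k%:R / c <= x < k.+1%:R / c ->
  k'%:R / (2 * c) <= x + m%:R / c < k'.+1%:R / (2 * c) ->
  k%:R / c + m%:R / c <= k'%:R / (2 * c) /\ k'.+1%:R / (2 * c) <= k.+1%:R / c + m%:R / c.
Proof.
move=> c0 /andP[]; rewrite ler_pdivrMr// ltr_pdivlMr// => h1 h2.
have c2 : 0 < 2 * c by rewrite mulr_gt0.
move=> /andP[]; rewrite ler_pdivrMr// ltr_pdivlMr// => h3 h4.
have e1 : (x + m%:R / c) * (2 * c) = 2 * (x * c) + 2 * m%:R by field; rewrite gt_eqF.
rewrite e1 in h3 h4.
have k1 : (2 * k + 2 * m < k'.+1)%N.
  by rewrite -(ltr_nat R) natrD !natrM; move: h1 h4; rewrite -natr1; lra.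
have k2 : (k' < 2 * k.+1 + 2 * m)%N.
  by rewrite -(ltr_nat R) natrD !natrM; move: h2 h3; lra.
rewrite -!mulrDl -!natrD; split.
  rewrite ler_pdivlMr// mulrAC ler_pdivrMr//.
  have -> : (k + m)%:R * (2 * c) = (2 * k + 2 * m)%N%:R * c by rewrite [in RHS]natrD !natrM natrD; ring.
  by rewrite ler_pM2r// ler_nat -ltnS.
rewrite ler_pdivrMr// mulrAC ler_pdivlMr//.
have -> : (k.+1 + m)%:R * (2 * c) = (2 * k.+1 + 2 * m)%N%:R * c by rewrite [in RHS]natrD !natrM natrD; ring.
by rewrite ler_pM2r// ler_nat.
Qed.

Lemma gcell_child l (i : gI l) p : rect_set (gcell i) p ->
  rect_set (gcell (gidx l.+1 p)) p /\ rect_set (gcell (gidx l.+1 p)) `<=` rect_set (gcell i).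
Proof.
move=> pi; have c0 : (0 : R) < 2 ^+ l by rewrite exprn_gt0.
have pj := gidxP (inwin_mono (gcell_inwin pi)); split=> // q /gcellP[q1 q2 q3 q4].
move: (gidx _ _) pj q1 q2 q3 => j /gcellP[j1 j2 j3 _] q1 q2 q3.
move/gcellP: pi => [h1 h2 h3 _]; apply/gcellP; split => //.
- move=> k; move: (q1 k) (j1 k) (h1 k); rewrite exprS => qk jk hk.
  have e4 : (4 ^ l)%N%:R / 2 ^+ l = 2 ^+ l :> R.
    rewrite natrX; have -> : (4%:R : R) ^+ l = 2 ^+ l * 2 ^+ l.
      by rewrite -exprMn; congr (_ ^+ _); ring.
    by rewrite mulfK// gt_eqF.
  have [] := @dyadic_child (i.1 k) (j.1 k) (4 ^ l) (p.1 ord0 k + 2 ^+ l) _ c0 _ _.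
  + by move: hk; set a := _ / _; set b := _ / _; lra.
  + by rewrite e4; move: jk; set a := _ / _; set b := _ / _; lra.
  by rewrite e4; move: qk; set a := _ / _; set b := _ / _; set a' := _ / _; set b' := _ / _; lra.
- rewrite exprS in j2 q2; have [] := @dyadic_child i.2.1 j.2.1 0 p.2.1 _ c0 h2 _.
    by rewrite mul0r addr0.
  by rewrite mul0r !addr0; move: q2; set a := _ / _; set b := _ / _; set a' := _ / _; set b' := _ / _; lra.
- rewrite exprS in j3 q3; have [] := @dyadic_child i.2.2 j.2.2 0 p.2.2 _ c0 h3 _.
    by rewrite mul0r addr0.
  by rewrite mul0r !addr0; move: q3; set a := _ / _; set b := _ / _; set a' := _ / _; set b' := _ / _; lra.
Qed.

Lemma gcell_nonempty l (i : gI l) : exists p, rect_set (gcell i) p.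
Proof.
have c0 : (0 : R) < 2 ^+ l by rewrite exprn_gt0.
have h (k : nat) : k%:R / 2 ^+ l < k.+1%:R / 2 ^+ l :> R.
  by rewrite ltr_pM2r ?invr_gt0// ltr_nat.
have lb (k : nat) : (0 : R) <= k%:R / 2 ^+ l by rewrite divr_ge0// ltW.
exists (\row_k ((i.1 k)%:R / 2 ^+ l - 2 ^+ l), (i.2.1%:R / 2 ^+ l,
   (i.2.2%:R / 2 ^+ l + i.2.2.+1%:R / 2 ^+ l) / 2)).
apply/gcellP; split => /=.
- by move=> k; rewrite mxE lexx ltrD2r h.
- by rewrite lexx h.
- by have := h i.2.2; set a := _ / _; set b := _ / _; lra.
- by have := h i.2.2; have := lb i.2.2; set a := _ / _; set b := _ / _; lra.
Qed.

Definition mclose (e : R) p q := [/\ forall k, `|q.1 ord0 k - p.1 ord0 k| < e,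
  `|q.2.1 - p.2.1| < e & `|q.2.2 - p.2.2| < e].

Lemma gcell_close l (i : gI l) p q : rect_set (gcell i) p -> rect_set (gcell i) q ->
  mclose (2 ^- l) p q.
Proof.
have h (k : nat) : k.+1%:R / 2 ^+ l = k%:R / 2 ^+ l + 2 ^- l :> R.
  by rewrite -natr1 mulrDl mul1r.
move=> /gcellP[p1 p2 p3 _] /gcellP[q1 q2 q3 _]; split.
- by move=> k; move: (p1 k) (q1 k); rewrite h ltr_norml; set a := _ / _; lra.
- by move: p2 q2; rewrite h ltr_norml; set a := _ / _; lra.
- by move: p3 q3; rewrite h ltr_norml; set a := _ / _; lra.
Qed.

Lemma exists_pow2_gt (x : R) : exists l0, forall l, (l0 <= l)%N -> x < 2 ^+ l.
Proof.
exists (Num.truncn `|x|).+1 => l hl; apply: le_lt_trans (ler_norm x) _.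
case/andP: (truncn_itv (normr_ge0 x)) => _ h; apply: lt_le_trans h _.
apply: (@le_trans _ _ l%:R); first by rewrite ler_nat.
by rewrite -natrX ler_nat ltnW// ltn_expl.
Qed.

Lemma exists_inwin p : 0 <= p.2.1 -> 0 < p.2.2 ->
  exists l0, forall l, (l0 <= l)%N -> inwin l p.
Proof.
move=> t0 r0; have [l0 hl] := exists_pow2_gt (\sum_k `|p.1 ord0 k| + p.2.1 + p.2.2).
exists l0 => l /hl h.
have s0 : 0 <= \sum_k `|p.1 ord0 k| by apply: sumr_ge0.
split; [|by move: h s0 t0 r0; lra|by move: h s0 t0 r0; lra].
move=> k; have : `|p.1 ord0 k| <= \sum_k `|p.1 ord0 k|.
  by rewrite (bigD1 k)//= lerDl; apply: sumr_ge0.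
by rewrite ler_norml; move: h t0 r0; lra.
Qed.

End Grid.

Section Events.
Context {R : realType} {d : nat}.
Local Notation mpt := (@mpoint R d).
Implicit Types (C : seq mpt -> Prop) (X : set mpt) (ps qs : seq mpt).

Definition p0 : mpt := (0, (0, 0)).

Definition evt C X := exists2 ps, (forall q, q \in ps -> X q) & C ps.

Definition openev C := forall ps, (forall q, q \in ps -> 0 <= mtim q /\ 0 < mrad q) -> C ps ->
  exists2 e, 0 < e & forall qs, size qs = size ps ->
    (forall j, (j < size ps)%N -> mclose e (nth p0 ps j) (nth p0 qs j)) -> C qs.

Definition gmatch l (is_ : seq (gI (d:=d) l)) qs := size qs = size is_ /\
  forall j, (j < size is_)%N -> rect_set (gcell (nth (gidx l p0) is_ j)) (nth p0 qs j).

Definition ggood l C (S : {set gI (d:=d) l}) := exists2 is_, {subset is_ <= S} &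
  forall qs, gmatch is_ qs -> C qs.

(* Preimages of rectangles under a shear are not rectangles: filling them up to
   small intensity by disjoint rectangles is enough to compare laws. *)
Definition icp (mu : probability R R) (S : mpt -> mpt) := forall Q, rect_ok Q -> forall e : R, 0 < e ->
  exists (I : finType) (F : I -> @rect R d),
  [/\ forall k, rect_ok (F k), forall k, rect_set (F k) `<=` S @^-1` rect_set Q,
     forall j k, j != k -> rect_set (F j) `&` rect_set (F k) = set0 &
     rect_intensity mu Q - e <= \sum_k rect_intensity mu (F k) <= rect_intensity mu Q].

Lemma icp_comp mu S1 S2 : icp mu S1 -> icp mu S2 -> icp mu (S1 \o S2).
Proof.
move=> h1 h2 Q okQ e e0.
have e20 : 0 < e / 2 by rewrite divr_gt0.
have [I [F [okF sF dF /andP[F1 F2]]]] := h1 Q okQ (e / 2) e20.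
pose e' := e / 2 / (#|I|%:R + 1).
have n0 : (0 : R) < #|I|%:R + 1 by rewrite ltr_wpDl.
have e'0 : 0 < e' by rewrite !divr_gt0.
have /choice[J hJ] : forall k, exists J : {J : finType & J -> @rect R d},
  [/\ forall a, rect_ok (projT2 J a), forall a, rect_set (projT2 J a) `<=` S2 @^-1` rect_set (F k),
     forall a b, a != b -> rect_set (projT2 J a) `&` rect_set (projT2 J b) = set0 &
     rect_intensity mu (F k) - e' <= \sum_a rect_intensity mu (projT2 J a) <= rect_intensity mu (F k)].
  by move=> k; have [J [G hG]] := h2 (F k) (okF k) e' e'0; exists (existT _ J G).
exists {k : I & projT1 (J k)}, (fun x => projT2 (J (tag x)) (tagged x)); split.
- by move=> x; have [h _ _ _] := hJ (tag x); exact: h.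
- move=> x p px; have [_ sG _ _] := hJ (tag x); apply: (sF (tag x)); exact: sG px.
- move=> [i a] [j b] ab /=; have [ij|ij] := eqVneq i j.
    subst j; have [_ _ dG _] := hJ i; apply: dG; apply: contraNneq ab => ->; exact: eqxx.
  rewrite -subset0 => p [pa pb]; have := dF i j ij; rewrite -subset0 => /(_ (S2 p)); apply.
  have [_ sa _ _] := hJ i; have [_ sb _ _] := hJ j.
  by split; [exact: sa pa|exact: sb pb].
- rewrite -(@sig_big_dep _ _ _ I (fun k => projT1 (J k)) xpredT (fun _ _ => true) (fun k a => rect_intensity mu (projT2 (J k) a)))/=.
  apply/andP; split.
    apply: le_trans (_ : \sum_k (rect_intensity mu (F k) - e') <= _).
      rewrite sumrB sumr_const -mulr_natl.
      have : #|I|%:R * e' <= e / 2.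
        by rewrite /e' mulrCA -[leRHS]mulr1 ler_pM2l ?divr_gt0// ler_pdivrMr// mul1r lerDl.
      move: F1; set x := \sum_k _; set y := _ * e'; lra.
    by apply: ler_sum => k _; have [_ _ _ /andP[]] := hJ k.
  apply: le_trans F2; apply: ler_sum => k _; by have [_ _ _ /andP[]] := hJ k.
Qed.

End Events.

Section Law.
Context {R : realType} {d : nat} {dO : measure_display} {Omega : measurableType dO}.
Variables (P : probability Omega R) (mu : probability R R).
Variable chi : Omega -> set (@mpoint R d).
Hypothesis hchi : is_PPP P mu chi.
Local Notation pr := (pr P).
Local Notation rint := (@rect_intensity R d mu).
Local Notation mpt := (@mpoint R d).
Local Notation occ := (occ chi).
Implicit Types (C : seq mpt -> Prop) (Lam : set mpt).

Definition gvoid l (i : gI (d:=d) l) : set Omega := ~` occ (gcell i).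

Lemma measurable_gvoid l (i : gI l) : measurable (gvoid i).
Proof. by apply: measurableC; apply: measurable_occ hchi _ _; exact: gcell_ok. Qed.

Definition goodb l C : pred {set gI (d:=d) l} := fun S => `[< ggood C S >].

Definition Elev l C : set Omega := [set w | goodb C (pattern (@gvoid l) w)].

Lemma in_gpattern l (i : gI l) w : (i \in pattern (@gvoid l) w) = `[< occ (gcell i) w >].
Proof.
rewrite inE; apply/idP/idP => /asboolP h; apply/asboolP; last by move=> h'; apply: h'.
exact: contrapT.
Qed.

Lemma Elev_points l C w : Elev l C w -> exists is_ (f : gI l -> mpt),
  (forall i, i \in is_ -> chi w (f i) /\ rect_set (gcell i) (f i)) /\
  (forall qs, gmatch is_ qs -> C qs).
Proof.
move=> /asboolP[is_ sub hC].
have /choice[f hf] : forall i : gI l, exists p, i \in is_ -> chi w p /\ rect_set (gcell i) p.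
  move=> i; have [ii|] := boolP (i \in is_); last by move=> _; exists (@p0 R d).
  by have := sub _ ii; rewrite in_gpattern => /asboolP[p [h1 h2]]; exists p.
by exists is_, f.
Qed.

Lemma Elev_evt l C w : Elev l C w -> evt C (chi w).
Proof.
move=> /Elev_points[is_ [f [hf hC]]]; exists (map f is_).
  by move=> q /mapP[i ii ->]; case: (hf _ ii).
apply: hC; split; first by rewrite size_map.
move=> j jl; rewrite (nth_map (gidx l (@p0 R d)))//.
by have [] := hf _ (mem_nth (gidx l (@p0 R d)) jl).
Qed.

Lemma Elev_mono l C : Elev l C `<=` Elev l.+1 C.
Proof.
move=> w /Elev_points[is_ [f [hf hC]]]; apply/asboolP.
exists (map (fun i => gidx l.+1 (f i)) is_).
  move=> _ /mapP[i ii ->]; rewrite in_gpattern; apply/asboolP; exists (f i).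
  by have [h1 h2] := hf _ ii; split => //; have [] := gcell_child h2.
move=> qs [sq hq]; apply: hC; rewrite size_map in sq hq; split => // j jl.
have := hq j jl; rewrite (nth_map (gidx l (@p0 R d)))//.
have [_ h2] := hf _ (mem_nth (gidx l (@p0 R d)) jl).
by have [_] := gcell_child h2; apply.
Qed.

Lemma evt_Elev C w : openev C -> evt C (chi w) -> exists l, Elev l C w.
Proof.
move=> oC [ps hps Cps].
have [|e e0 he] := oC ps _ Cps.
  by move=> q /hps cq; split; [exact: ppp_tim hchi _ _ cq|exact: ppp_rad hchi _ _ cq].
have [l0 hl0] : exists l0, forall l, (l0 <= l)%N -> forall q, q \in ps -> inwin l q.
  elim: ps hps {Cps he} => [_|p s ih hps]; first by exists 0%N.
  have [|l1 h1] := ih; first by move=> q qs; apply: hps; rewrite inE qs orbT.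
  have cp : chi w p by apply: hps; rewrite mem_head.
  have [l2 h2] := exists_inwin (ppp_tim hchi cp) (ppp_rad hchi cp).
  exists (maxn l1 l2) => l; rewrite geq_max => /andP[hl1 hl2] q.
  by rewrite inE => /orP[/eqP ->|]; [exact: h2|exact: h1].
have [l1 hl1] := exists_pow2_gt e^-1.
exists (maxn l0 l1); set l := maxn _ _.
have hw q : q \in ps -> inwin l q by apply: hl0; exact: leq_maxl.
have he2 : 2 ^- l < e.
  by rewrite -[ltRHS]invrK ltf_pV2 ?posrE ?exprn_gt0 ?invr_gt0//; apply: hl1; exact: leq_maxr.
apply/asboolP; exists (map (gidx l) ps).
  move=> _ /mapP[q qs ->]; rewrite in_gpattern; apply/asboolP; exists q.
  by split; [exact: hps|exact/gidxP/hw].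
move=> qs []; rewrite size_map => sq hq; apply: he => // j jl.
have := hq j jl; rewrite (nth_map (@p0 R d))// => h1.
have h2 := gidxP (hw _ (mem_nth (@p0 R d) jl)).
have [c1 c2 c3] := gcell_close h2 h1.
by split => [k||]; apply: lt_trans he2.
Qed.

Definition ev C : set Omega := [set w | evt C (chi w)].

Lemma evE C : openev C -> ev C = \bigcup_l Elev l C.
Proof.
move=> oC; apply/seteqP; split => w; first by move=> /(evt_Elev oC)[l hl]; exists l.
by move=> [l _ /Elev_evt].
Qed.

Lemma measurable_Elev l C : measurable (Elev l C).
Proof. by apply: measurable_pattern => i; exact: measurable_gvoid. Qed.

Lemma measurable_ev C : openev C -> measurable (ev C).
Proof. by move=> oC; rewrite evE//; apply: bigcupT_measurable => l; exact: measurable_Elev. Qed.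

Lemma pr_ev_approx C (e : R) : openev C -> 0 < e -> exists l, pr (ev C) <= pr (Elev l C) + e.
Proof.
move=> oC e0.
have mU : measurable (\bigcup_l Elev l C) by apply: bigcupT_measurable => l; exact: measurable_Elev.
have nd : nondecreasing_seq (fun l => Elev l C).
  by apply/nondecreasing_seqP => l; apply/subsetPset; exact: Elev_mono.
have := nondecreasing_cvg_mu (mu := P) (fun l => measurable_Elev l C) mU nd.
rewrite -evE// => h.
have {h} : (fun l => pr (Elev l C)) @ \oo --> pr (ev C).
  have /fine_cvgP[_ h2] : (P \o (fun l => Elev l C)) @ \oo --> (pr (ev C))%:E.
    by rewrite -prE//; exact: measurable_ev.
  exact: h2.
move=> /cvgrPdist_le /(_ e e0)[l _ /(_ l (leqnn l))/= h]; exists l.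
by move: h; rewrite ler_norml; lra.
Qed.

Lemma pr_gvoid l (B : {set gI (d:=d) l}) :
  pr [set w | forall i, i \in B -> gvoid i w] = \prod_(i in B) expR (- rint (gcell i)).
Proof.
rewrite -expR_sum sumrN -(ppp_void hchi (@gcell_ok R d l) (@gcell_disj R d l)).
by congr pr.
Qed.

Theorem law_le (S : mpt -> mpt) C : icp mu S -> openev C ->
  measurable (ev (C \o map S)) -> pr (ev C) <= pr (ev (C \o map S)).
Proof.
move=> hS oC mCS; apply/ler_addgt0Pr => eta eta0.
have [l hl] := pr_ev_approx oC (divr_gt0 eta0 (ltr0Sn _ 1)).
pose K : R := \sum_(S : {set gI (d:=d) l}) \sum_(i : gI (d:=d) l) 1.
have K0 : 0 <= K by apply: sumr_ge0 => ? _; apply: sumr_ge0.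
pose e := eta / 2 / (K + 1).
have e0 : 0 < e by rewrite !divr_gt0// ltr_wpDl.
have /choice[J hJ] : forall k : gI (d:=d) l, exists J : {J : finType & J -> @rect R d},
  [/\ forall a, rect_ok (projT2 J a), forall a, rect_set (projT2 J a) `<=` S @^-1` rect_set (gcell k),
     forall a b, a != b -> rect_set (projT2 J a) `&` rect_set (projT2 J b) = set0 &
     rint (gcell k) - e <= \sum_a rint (projT2 J a) <= rint (gcell k)].
  by move=> k; have [J [G hG]] := hS (gcell k) (gcell_ok k) e e0; exists (existT _ J G).
pose m k := \sum_a rint (projT2 (J k) a).
pose T : finType := {k : gI (d:=d) l & projT1 (J k)}.
pose Q (x : T) := projT2 (J (tag x)) (tagged x).
have okQ x : rect_ok (Q x) by have [h _ _ _] := hJ (tag x); exact: h.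
have djQ x y : x != y -> rect_set (Q x) `&` rect_set (Q y) = set0.
  case: x y => [i a] [j b] ab; rewrite /Q /=; have [ij|ij] := eqVneq i j.
    subst j; have [_ _ dG _] := hJ i; apply: dG; apply: contraNneq ab => ->; exact: eqxx.
  rewrite -subset0 => p [pa pb]; have := gcell_disj (R := R) ij; rewrite -subset0 => /(_ (S p)); apply.
  have [_ sa _ _] := hJ i; have [_ sb _ _] := hJ j.
  by split; [exact: sa pa|exact: sb pb].
pose V k : set Omega := [set w | forall a, ~ occ (projT2 (J k) a) w].
have mV k : measurable (V k).
  apply: measurable_forall_fin => a; apply: measurableC.
  by apply: measurable_occ hchi _ _; have [h _ _ _] := hJ k; exact: h.
have prV (B : {set gI l}) : pr [set w | forall k, k \in B -> V k w] = \prod_(k in B) expR (- m k).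
  rewrite [X in pr X](_ : _ = [set w | forall x, x \in [set x : T | tag x \in B]%SET -> ~ occ (Q x) w]); last first.
    apply/seteqP; split => w /=; first by move=> h x; rewrite inE => xB; exact: h.
    move=> h k kB a; have := h (existT (fun k => projT1 (J k)) k a).
    by rewrite inE /= => /(_ kB).
  rewrite (ppp_void hchi okQ djQ) -expR_sum sumrN; congr (expR (- _)).
  rewrite /m (@sig_big_dep _ _ _ _ (fun k => projT1 (J k)) (mem B) (fun _ _ => true) (fun k a => rint (projT2 (J k) a)))/=.
  by apply: eq_bigl => x; rewrite inE andbT.
have sub : [set w | goodb C (pattern V w)] `<=` ev (C \o map S).
  move=> w /asboolP[is_ sub hC].
  have /choice[f hf] : forall i : gI l, exists p, i \in is_ -> chi w p /\ rect_set (gcell i) (S p).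
    move=> i; have [ii|] := boolP (i \in is_); last by move=> _; exists (@p0 R d).
    have := sub _ ii; rewrite inE => /asboolP/existsNP[a /contrapT[p [h1 h2]]]; exists p => _.
    by split => //; have [_ sa _ _] := hJ i; exact: sa h2.
  exists (map f is_); first by move=> q /mapP[i ii ->]; case: (hf _ ii).
  apply: hC; split; first by rewrite !size_map.
  move=> j jl; rewrite -map_comp (nth_map (gidx l (@p0 R d)))//=.
  by have [] := hf _ (mem_nth (gidx l (@p0 R d)) jl).
have h1 : pr (Elev l C) = pat_prob (fun k => expR (- rint (gcell k))) (@goodb l C).
  by apply: pr_pattern; [move=> k; exact: measurable_gvoid|exact: pr_gvoid].
have h2 : pr [set w | goodb C (pattern V w)] = pat_prob (fun k => expR (- m k)) (@goodb l C).
  by apply: pr_pattern; [exact: mV|exact: prV].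
have m0 k : 0 <= m k.
  by apply: sumr_ge0 => a _; apply: rint_ge0; have [h _ _ _] := hJ k; exact: h.
have bd (x : R) : 0 <= x -> 0 <= expR (- x) <= 1.
  by move=> x0; rewrite expR_ge0 -[leRHS]expR0 ler_expR oppr_le0.
have h3 : pr (Elev l C) <= pr [set w | goodb C (pattern V w)] + K * e.
  rewrite h1 h2; apply: pat_prob_lip => [k|k|k]; [apply: bd|exact: bd|].
    by apply: rint_ge0; exact: gcell_ok.
  have [_ _ _ /andP[b1 b2]] := hJ k.
  apply: le_trans (expRN_lip (m0 k) b2) _; by rewrite lerBlDl -lerBlDr.
apply: le_trans hl _.
have h4 : pr [set w | goodb C (pattern V w)] <= pr (ev (C \o map S)).
  by apply: pr_mono => //; exact: measurable_pattern.
have h5 : K * e <= eta / 2.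
  by rewrite /e mulrCA -[leRHS]mulr1 ler_pM2l ?divr_gt0// ler_pdivrMr ?ltr_wpDl// mul1r lerDl.
lra.
Qed.

Definition voidev l (S : {set gI (d:=d) l}) : set Omega := [set w | forall i, i \in S -> gvoid i w].

Definition piG Lam : set (set Omega) := [set V | exists l (S : {set gI (d:=d) l}),
  (forall i, i \in S -> rect_set (gcell i) `<=` Lam) /\ V = voidev S].

Definition Gs Lam := <<s piG Lam >>.

Lemma voidev_raise Lam l (S : {set gI (d:=d) l}) l' : (l <= l')%N ->
  (forall i, i \in S -> rect_set (gcell i) `<=` Lam) ->
  exists S' : {set gI (d:=d) l'}, (forall i, i \in S' -> rect_set (gcell i) `<=` Lam) /\
    voidev S = voidev S'.
Proof.
elim: l' => [|l' ih]; first by rewrite leqn0 => /eqP e; subst l => h; exists S.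
rewrite leq_eqVlt => /orP[/eqP e|]; first by subst l => h; exists S.
rewrite ltnS => ll hS; have [S' [hS' ->]] := ih ll hS.
exists [set j | `[< exists2 i, i \in S' & rect_set (gcell (R:=R) j) `<=` rect_set (gcell i) >]]%SET; split.
  by move=> j; rewrite inE => /asboolP[i iS ji]; apply: subset_trans (hS' _ iS).
apply/seteqP; split => w /= h.
  move=> j; rewrite inE => /asboolP[i iS ji] [p [h1 h2]]; apply: (h _ iS).
  by exists p; split => //; exact: ji.
move=> i iS [p [h1 h2]]; have [c1 c2] := gcell_child h2.
apply: (h (gidx l'.+1 p)); last by exists p.
by rewrite inE; apply/asboolP; exists i.
Qed.

Lemma piG_setI Lam : setI_closed (piG Lam).
Proof.
move=> _ _ [l [S [hS ->]]] [l' [S' [hS' ->]]].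
have [T [hT ->]] := voidev_raise (leq_maxl l l') hS.
have [T' [hT' ->]] := voidev_raise (leq_maxr l l') hS'.
exists (maxn l l'), (T :|: T'); split.
  by move=> i; rewrite inE => /orP[/hT|/hT'].
apply/seteqP; split => w /=.
  by move=> [h1 h2] i; rewrite inE => /orP[/h1|/h2].
by move=> h; split => i iT; apply: h; rewrite inE iT ?orbT.
Qed.

Lemma measurable_voidev l (S : {set gI (d:=d) l}) : measurable (voidev S).
Proof. by apply: measurable_forall_in => i; exact: measurable_gvoid. Qed.

Lemma Gs_measurable Lam A : Gs Lam A -> measurable A.
Proof.
apply; split.
  split; [exact: measurable0| |by move=> F mF; exact: bigcupT_measurable].
  by move=> B mB; rewrite setTD; exact: measurableC.
by move=> _ [l [S [_ ->]]]; exact: measurable_voidev.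
Qed.

Lemma GsC Lam A : Gs Lam A -> Gs Lam (~` A).
Proof. by have [_ h _] := smallest_sigma_algebra setT (piG Lam); move=> /h; rewrite setTD. Qed.

Lemma Gs0 Lam : Gs Lam set0.
Proof. by have [h _ _] := smallest_sigma_algebra setT (piG Lam). Qed.

Lemma Gs_bigcup Lam (F : nat -> set Omega) : (forall n, Gs Lam (F n)) -> Gs Lam (\bigcup_n F n).
Proof. by have [_ _ h] := smallest_sigma_algebra setT (piG Lam); exact: h. Qed.

Lemma GsU Lam A B : Gs Lam A -> Gs Lam B -> Gs Lam (A `|` B).
Proof.
by move=> hA hB; rewrite -bigcup2E; apply: Gs_bigcup => -[|[|n]] //=; exact: Gs0.
Qed.

Lemma Gs_exists_in Lam (I : eqType) (s : seq I) (F : I -> set Omega) :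
  (forall i, i \in s -> Gs Lam (F i)) -> Gs Lam [set w | exists2 i, i \in s & F i w].
Proof.
elim: s => [|j s ih] mF.
  by rewrite [X in Gs _ X](_ : _ = set0) -?subset0 => [|w []//]; exact: Gs0.
rewrite [X in Gs _ X](_ : _ = F j `|` [set w | exists2 i, i \in s & F i w]).
  apply: GsU; first by apply: mF; rewrite mem_head.
  by apply: ih => i si; apply: mF; rewrite inE si orbT.
apply/seteqP; split => w /=.
  by move=> [i]; rewrite inE => /orP[/eqP ->|si] Fi; [left|right; exists i].
by move=> [Fj|[i si Fi]]; [exists j; rewrite ?mem_head|exists i; rewrite ?inE ?si ?orbT].
Qed.

Lemma Gs_forall_in Lam (I : eqType) (s : seq I) (F : I -> set Omega) :
  (forall i, i \in s -> Gs Lam (F i)) -> Gs Lam [set w | forall i, i \in s -> F i w].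
Proof.
move=> mF; rewrite [X in Gs _ X](_ : _ = ~` [set w | exists2 i, i \in s & (~` F i) w]).
  by apply: GsC; apply: Gs_exists_in => i si; apply: GsC; exact: mF.
apply/seteqP; split => w /=; first by move=> h [i si]; apply; exact: h.
by move=> h i si; apply: contrapT => hi; apply: h; exists i.
Qed.

Lemma Gs_ev Lam C : openev C -> (forall ps, C ps -> forall q, q \in ps -> Lam q) ->
  Gs Lam (ev C).
Proof.
move=> oC CL; rewrite evE//; apply: Gs_bigcup => l.
pose S0 := [seq S : {set gI (d:=d) l} <- enum {set gI (d:=d) l} | `[< forall i, i \in S -> rect_set (gcell i) `<=` Lam >]
   && goodb C S].
rewrite [X in Gs _ X](_ : _ = [set w | exists2 S : {set gI (d:=d) l}, S \in S0 &
    [set w | forall i, i \in enum S -> (~` gvoid i) w] w]).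
  apply: Gs_exists_in => S; rewrite mem_filter => /andP[/andP[/asboolP hS _] _].
  apply: Gs_forall_in => i; rewrite mem_enum => iS; apply: GsC; apply: sub_sigma_algebra.
  exists l, [set i]%SET; split; first by move=> j; rewrite inE => /eqP ->; exact: hS.
  apply/seteqP; split => w /=; first by move=> h j; rewrite inE => /eqP ->.
  by apply; rewrite inE.
apply/seteqP; split => w /=.
  move=> /Elev_points[is_ [f [hf hC]]].
  have fm : gmatch is_ (map f is_).
    split; first by rewrite size_map.
    move=> j jl; rewrite (nth_map (gidx l (@p0 R d)))//.
    by have [] := hf _ (mem_nth (gidx l (@p0 R d)) jl).
  exists [set i | i \in is_]%SET; last first.
    move=> i; rewrite mem_enum inE => ii; apply; exists (f i).
    by have [] := hf _ ii.
  rewrite mem_filter mem_enum andbT; apply/andP; split; apply/asboolP; last first.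
    by exists is_ => // i ii; rewrite inE.
  move=> i; rewrite inE => ii p pi.
  pose g k := if k == i then p else f k.
  have : C (map g is_).
    apply: hC; split; first by rewrite size_map.
    move=> j jl; rewrite (nth_map (gidx l (@p0 R d)))// /g; case: eqP => [-> //|_].
    by have [] := hf _ (mem_nth (gidx l (@p0 R d)) jl).
  move=> /CL; apply; apply/mapP; exists i => //; by rewrite /g eqxx.
move=> [S]; rewrite mem_filter => /andP[/andP[_ /asboolP[is_ sub hC]] _] h.
apply/asboolP; exists is_ => // i /sub iS; rewrite in_gpattern; apply/asboolP.
by apply: contrapT; apply: h; rewrite mem_enum.
Qed.

Lemma indep_dynkin B : measurable B ->
  lambda_system setT [set A | measurable A /\ pr (A `&` B) = pr A * pr B].
Proof.
move=> mB; apply/dynkin_lambda_system; split.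
- by split => //; rewrite setTI prT mul1r.
- move=> A [mA hA]; split; first exact: measurableC.
  by rewrite setIC prIC// setIC hA prC//; ring.
- move=> F tF hF; have mF n : measurable (F n) by case: (hF n).
  have mU : measurable (\bigcup_k F k) by exact: bigcupT_measurable.
  split => //; apply: EFin_inj; rewrite EFinM -!prE//; last exact: measurableI.
  rewrite setI_bigcupl measure_semi_bigcup//; last 3 first.
  - by move=> i; exact: measurableI.
  - by under eq_fun do rewrite setIC; exact: trivIset_setIl.
  - by rewrite -setI_bigcupl; exact: measurableI.
  rewrite [P (\bigcup_k F k)]measure_semi_bigcup// muleC [P B]prE// -nneseriesZl//.
  apply: eq_eseriesr => n _; transitivity ((pr (F n) * pr B)%:E).
    by case: (hF n) => _ <-; apply: prE; exact: measurableI.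
  by rewrite EFinM muleC; congr (_ * _)%E; apply/esym; exact: prE.
Qed.

Theorem Gs_indep Lam Lam' A B : Lam `&` Lam' = set0 -> Gs Lam A -> Gs Lam' B ->
  pr (A `&` B) = pr A * pr B.
Proof.
move=> LL GA GB.
have h1 l (S S' : {set gI (d:=d) l}) : (forall i, i \in S -> rect_set (gcell i) `<=` Lam) ->
  (forall i, i \in S' -> rect_set (gcell i) `<=` Lam') ->
  pr (voidev S `&` voidev S') = pr (voidev S) * pr (voidev S').
  move=> hS hS'.
  have -> : voidev S `&` voidev S' = voidev (S :|: S').
    apply/seteqP; split => w /=.
      by move=> [h1 h2] i; rewrite inE => /orP[/h1|/h2].
    by move=> h; split => i iT; apply: h; rewrite inE iT ?orbT.
  rewrite /voidev !pr_gvoid (bigID (mem S))/=; congr (_ * _); apply: eq_bigl => i; rewrite inE.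
    by case: (i \in S); rewrite ?andbT ?andbF.
  have [iS|iS] := boolP (i \in S); last by rewrite /= andbT.
  rewrite /=.
  apply/esym/negbTE/negP => iS'; have [p pi] := @gcell_nonempty R d l i.
  by have := LL; rewrite -subset0 => /(_ p); apply; split; [exact: (hS _ iS)|exact: (hS' _ iS')].
have h2 V V' : piG Lam V -> piG Lam' V' -> pr (V `&` V') = pr V * pr V'.
  move=> [l [S [hS ->]]] [l' [S' [hS' ->]]].
  have [T [hT ->]] := voidev_raise (leq_maxl l l') hS.
  have [T' [hT' ->]] := voidev_raise (leq_maxr l l') hS'.
  exact: h1.
have h3 V : piG Lam V -> pr (V `&` B) = pr V * pr B.
  move=> pV; have mV : measurable V by apply: (@Gs_measurable Lam); exact: sub_sigma_algebra.
  rewrite setIC mulrC.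
  have := @lambda_system_subset _ (piG Lam') (@piG_setI Lam') setT _ (indep_dynkin mV).
  move=> /(_ _ _ B GB)[] // V' pV'; split.
    by apply: (@Gs_measurable Lam'); exact: sub_sigma_algebra.
  by rewrite setIC mulrC; exact: h2.
have := @lambda_system_subset _ (piG Lam) (@piG_setI Lam) setT _ (indep_dynkin (Gs_measurable GB)).
move=> /(_ _ _ A GA)[] // V pV; split; last exact: h3.
by apply: (@Gs_measurable Lam); exact: sub_sigma_algebra.
Qed.

End Law.

(** * Invariance in law *)

Section OpenChains.
Context {R : realType} {d : nat}.
Local Notation mpt := (@mpoint R d).
Local Notation p0 := (@p0 R d).
Implicit Types (C D : seq mpt -> Prop) (X Lam : set mpt) (ps qs : seq mpt).

Definition openL Lam := forall p, Lam p -> exists2 e : R, 0 < e & forall q, mclose e p q -> Lam q.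

Lemma mclose_le (e e' : R) (p q : mpt) : e <= e' -> mclose e p q -> mclose e' p q.
Proof. by move=> ee [h1 h2 h3]; split=> [k||]; apply: lt_le_trans ee. Qed.

Lemma openev_and C D : openev C -> openev D -> openev (fun ps => C ps /\ D ps).
Proof.
move=> oC oD ps hps [Cp Dp]; have [e e0 he] := oC _ hps Cp; have [f f0 hf] := oD _ hps Dp.
exists (Num.min e f); first by rewrite lt_min e0.
move=> qs sq hq; split; [apply: he|apply: hf] => // j jl; apply: mclose_le (hq j jl);
by rewrite ge_min lexx ?orbT.
Qed.

Lemma openev_nil : openev (fun ps => ps != [::]).
Proof. by move=> ps _ hp; exists 1 => // qs sq _; rewrite -size_eq0 sq size_eq0. Qed.

Lemma openev_all Lam : openL Lam -> openev (fun ps => forall q, q \in ps -> Lam q).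
Proof.
move=> oL; elim=> [|p ps ih] hps hp; first by exists 1 => // qs /size0nil ->.
have [||e e0 he] := ih; [by move=> q qp; apply: hps; rewrite inE qp orbT|by move=> q qp; apply: hp; rewrite inE qp orbT|].
have [f f0 hf] := oL p (hp _ (mem_head _ _)).
exists (Num.min e f); first by rewrite lt_min e0.
case=> // q qs [sq] hq a; rewrite inE => /orP[/eqP ->|].
  by apply: hf; apply: mclose_le (hq 0%N isT); rewrite ge_min lexx orbT.
apply: he => // j jl; apply: mclose_le (hq j.+1 jl); by rewrite ge_min lexx.
Qed.

Lemma mclose_enorm (e : R) (p q : mpt) : mclose e p q -> enorm (mctr q - mctr p) <= d%:R * e.
Proof. by move=> [h _ _]; apply: enorm_le_coord => k; rewrite !mxE ltW// h. Qed.

Lemma openev_head x r : openev (fun ps => enorm (mctr (head p0 ps) - x) < r).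
Proof.
case=> [_ hp|p ps _ /= hp]; first by exists 1 => // qs /size0nil ->.
pose e := (r - enorm (mctr p - x)) / (d%:R + 1).
have n0 : (0 : R) < d%:R + 1 by rewrite ltr_wpDl.
have e0 : 0 < e by rewrite divr_gt0// subr_gt0.
exists e => // -[|q qs]// [sq] /(_ 0%N isT)/= /mclose_enorm h.
apply: le_lt_trans (enorm_tri (mctr p) _ _) _.
have : d%:R * e < r - enorm (mctr p - x).
  rewrite /e mulrCA -[ltRHS]mulr1 ltr_pM2l ?subr_gt0// ltr_pdivrMr// mul1r.
  by rewrite ltrDl.
by move: h; set a := _ * e; lra.
Qed.

Lemma openev_last y r : openev (fun ps => enorm (mctr (last p0 ps) - y) + r < mrad (last p0 ps)).
Proof.
move=> ps _ hp; set p := last p0 ps in hp *; pose e := (mrad p - (enorm (mctr p - y) + r)) / (d%:R + 2).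
have n0 : (0 : R) < d%:R + 2 by rewrite ltr_wpDl.
have e0 : 0 < e by rewrite divr_gt0// subr_gt0.
exists e => // qs sq hq.
have pq : mclose e p (last p0 qs).
  case: (posnP (size ps)) => [s0|sp].
    have := sq; rewrite s0 => /size0nil ->; rewrite /p (size0nil s0) /=.
    by split => [k||]; rewrite subrr normr0.
  rewrite /p -!nth_last sq; apply: hq; by rewrite prednK.
have h := mclose_enorm pq; have [_ _ h3] := pq.
have he : (d%:R + 2) * e = mrad p - (enorm (mctr p - y) + r) by rewrite /e mulrCA divff ?mulr1// gt_eqF.
have h4 := enorm_tri (mctr p) (mctr (last p0 qs)) y.
move: h3; rewrite ltr_norml -/(mrad p) -/(mrad (last p0 qs)) => /andP[h3 _].
have {}he : d%:R * e + 2 * e = mrad p - (enorm (mctr p - y) + r) by rewrite -he; ring.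
move: h h4 he h3 e0; set a := _ * e; lra.
Qed.

Lemma openev_sorted : openev (fun ps => sorted lk ps).
Proof.
case=> [_ _|p ps hps /= hp]; first by exists 1 => // qs /size0nil ->.
elim: ps p {hps} hp => [p _|q ps ih p /= /andP[pq qs]].
  by exists 1 => // -[|? [|]].
have [e e0 he] := ih q qs.
pose f := (mrad p - enorm (mctr q - mctr p)) / (d%:R + d%:R + 2).
have n0 : (0 : R) < d%:R + d%:R + 2 by rewrite ltr_wpDl.
have f0 : 0 < f by rewrite divr_gt0// subr_gt0.
exists (Num.min e f); first by rewrite lt_min e0.
case=> // p' [|q' s']// [sq] hq /=; apply/andP; split; last first.
  apply: (he (q' :: s')); first by rewrite /= sq.
  move=> j jl; apply: mclose_le (hq j.+1 jl); by rewrite ge_min lexx.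
have h1 : mclose f p p' by apply: mclose_le (hq 0%N isT); rewrite ge_min lexx orbT.
have h2 : mclose f q q' by apply: mclose_le (hq 1%N isT); rewrite ge_min lexx orbT.
have g1 := mclose_enorm h1; have g2 := mclose_enorm h2.
have [_ _] := h1; rewrite ltr_norml -/(mrad p) -/(mrad p') => /andP[g3 _].
have hf : d%:R * f + d%:R * f + 2 * f = mrad p - enorm (mctr q - mctr p).
  by rewrite -!mulrDl /f mulrCA divff ?mulr1// gt_eqF.
have g4 := enorm_tri (mctr q) (mctr q') (mctr p').
have g5 := enorm_tri (mctr p) (mctr q) (mctr p'); rewrite (enormB (mctr p)) in g5.
by rewrite /lk; move: g1 g2 g3 g4 g5 hf f0; set a := _ * f; lra.
Qed.

Lemma openev_stime t : openev (fun ps => stime ps < t).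
Proof.
move=> ps _ hp; pose e := (t - stime ps) / ((size ps)%:R + 1).
have n0 : (0 : R) < (size ps)%:R + 1 by rewrite ltr_wpDl.
have e0 : 0 < e by rewrite divr_gt0// subr_gt0.
exists e => // qs sq hq.
have : stime qs <= stime ps + (size ps)%:R * e.
  move: (e) sq hq => e' {e e0 n0 hp}; elim: ps qs => [|p ps ih] [|q qs]//= => [_ _|[sq] hq].
    by rewrite mul0r addr0.
  rewrite !stime_cons; have := ih qs sq (fun j => hq j.+1).
  have [_ + _] := hq 0%N isT; rewrite ltr_norml /= -/(mtim p) -/(mtim q) => /andP[_].
  by rewrite -natr1 mulrDl mul1r; set a := _ * e'; lra.
have : (size ps)%:R * e < t - stime ps.
  rewrite /e mulrCA -[ltRHS]mulr1 ltr_pM2l ?subr_gt0// ltr_pdivrMr// mul1r.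
  by rewrite ltrDl.
by set a := _ * e; lra.
Qed.

Definition Cconn Lam (r1 r2 : R) x y t ps :=
  (ps != [::] /\ forall q, q \in ps -> Lam q) /\
  ((enorm (mctr (head p0 ps) - x) < r1 /\ sorted lk ps) /\
  (enorm (mctr (last p0 ps) - y) + r2 < mrad (last p0 ps) /\ stime ps < t)).

Lemma openev_conn Lam r1 r2 x y t : openL Lam -> openev (Cconn Lam r1 r2 x y t).
Proof.
move=> oL; apply: openev_and; first by apply: openev_and; [exact: openev_nil|exact: openev_all].
apply: openev_and; apply: openev_and;
  [exact: openev_head|exact: openev_sorted|exact: openev_last|exact: openev_stime].
Qed.

Lemma conn_evt X Lam r1 r2 x y t : conn (X `&` Lam) r1 r2 x y t <-> evt (Cconn Lam r1 r2 x y t) X.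
Proof.
split.
  move=> [p [s [Xp px ps ly st]]]; exists (p :: s); first by move=> q /Xp[].
  by do ![split] => // q /Xp[].
move=> [[|p s] Xp [[//= _ hL] [[h1 h2] [h3 h4]]]]; exists p, s; split => //.
by move=> q qp; split; [exact: Xp|exact: hL].
Qed.

Definition lift (f : 'rV[R]_d -> 'rV[R]_d) (p : mpt) : mpt := (f p.1, p.2).

Lemma Cconn_lift f (Lam Lam' : set mpt) r1 r2 x y t ps :
  (forall u v, enorm (f u - f v) = enorm (u - v)) ->
  (forall p, Lam' (lift f p) <-> Lam p) ->
  Cconn Lam' r1 r2 (f x) (f y) t (map (lift f) ps) <-> Cconn Lam r1 r2 x y t ps.
Proof.
move=> iso hL; rewrite /Cconn.
have hs : stime (map (lift f) ps) = stime ps by rewrite /stime big_map.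
case: ps hs => [|p s] hs; first by split=> -[[]].
rewrite hs /=.
have -> : path lk (lift f p) (map (lift f) s) = path lk p s.
  by elim: s p {hs} => //= q s ih p; rewrite ih /lk /mctr /= iso.
have -> : last (lift f p) (map (lift f) s) = lift f (last p s) by rewrite last_map.
rewrite /mctr /mrad /= !iso.
suff h : (forall q, q \in lift f p :: map (lift f) s -> Lam' q) <-> (forall q, q \in p :: s -> Lam q).
  split => -[[_ h2] h3]; (split; last exact: h3); split => //.
    exact: (proj1 h h2).
  exact: (proj2 h h2).
rewrite -map_cons; split => h q.
  by move=> qp; apply/hL; apply: h; exact: map_f.
by move=> /mapP[a ap ->]; apply/hL; exact: h.
Qed.

End OpenChains.

Section Icp.
Context {R : realType} {d : nat} (mu : probability R R).
Local Notation mpt := (@mpoint R d).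
Local Notation rint := (@rect_intensity R d mu).
Local Notation pt := 'rV[R]_d.

Lemma sum_unit (F : unit -> R) : \sum_k F k = F tt.
Proof. by apply: big_pred1 => -[]. Qed.

Lemma icp_exact (S : mpt -> mpt) :
  (forall Q, rect_ok Q -> exists Q', [/\ rect_ok Q', rect_set Q' `<=` S @^-1` rect_set Q & rint Q' = rint Q]) ->
  icp mu S.
Proof.
move=> h Q okQ e e0; have [Q' [ok' sub e']] := h Q okQ.
exists unit, (fun=> Q'); split; [by move=> _|by move=> _|by move=> [] []|].
by rewrite sum_unit e' lexx andbT gerBl ltW.
Qed.

Lemma icp_id : icp mu (id : mpt -> mpt).
Proof. by apply: icp_exact => Q okQ; exists Q; split. Qed.

Lemma icp_trans (a : pt) : icp mu (lift (fun u => u + a)).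
Proof.
apply: icp_exact => Q [h1 h2 h3 h4 h5].
exists (Rect (r_a Q - a) (r_b Q - a) (r_s Q) (r_u Q) (r_J Q)); split.
- by split => //= i; rewrite !mxE lerD2r.
- move=> p [/= k1 k2]; split => //= i; have := k1 i; rewrite !mxE; lra.
- by rewrite /rect_intensity /=; congr (_ * _ * _); apply: eq_bigr => i _; rewrite !mxE; ring.
Qed.

Definition mscale (k : R) (p : mpt) : mpt := (k *: p.1, (k ^- d * p.2.1, p.2.2)).

Lemma mscale_preim (k : R) Q : 0 < k -> rect_ok Q ->
  exists Q', [/\ rect_ok Q', rect_set Q' = mscale k @^-1` rect_set Q & rint Q' = rint Q].
Proof.
move=> k0 [h1 h2 h3 h4 h5].
have kd : 0 < k ^+ d by rewrite exprn_gt0.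
exists (Rect (k^-1 *: r_a Q) (k^-1 *: r_b Q) (k ^+ d * r_s Q) (k ^+ d * r_u Q) (r_J Q)); split.
- split => //=.
  + by move=> i; rewrite !mxE ler_pM2l// invr_gt0.
  + by rewrite mulr_ge0// ltW.
  + by rewrite ler_pM2l.
- apply/seteqP; split => p /=; rewrite /rect_set /= => -[q1 [q2 q3]]; split.
  + by move=> i; have := q1 i; rewrite !mxE !(mulrC k^-1) ler_pdivrMr// ltr_pdivlMr// (mulrC k).
  + by split => //; move: q2; rewrite !(mulrC (k ^+ d)) (mulrC _ p.2.1) ler_pdivlMr// ltr_pdivrMr.
  + by move=> i; have := q1 i; rewrite !mxE !(mulrC k^-1) ler_pdivrMr// ltr_pdivlMr// (mulrC k).
  + by split => //; move: q2; rewrite !(mulrC (k ^+ d)) (mulrC _ p.2.1) ler_pdivlMr// ltr_pdivrMr.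
- rewrite /rect_intensity /= -mulrBr.
  have -> : \prod_(i < d) ((k^-1 *: r_b Q) ord0 i - (k^-1 *: r_a Q) ord0 i) =
      k ^- d * \prod_(i < d) (r_b Q ord0 i - r_a Q ord0 i).
    rewrite -exprVn -[in X in k^-1 ^+ X](card_ord d) -prodr_const -big_split/=.
    by apply: eq_bigr => i _; rewrite !mxE; ring.
  by field; rewrite gt_eqF.
Qed.

Lemma icp_mscale (k : R) : 0 < k -> icp mu (mscale k).
Proof.
move=> k0; apply: icp_exact => Q okQ; have [Q' [h1 h2 h3]] := mscale_preim k0 okQ.
by exists Q'; rewrite h2; split.
Qed.

Definition reflc (i : 'I_d) (u : pt) : pt := \row_k (if k == i then - u ord0 k else u ord0 k).

Lemma icp_refl i : icp mu (lift (reflc i)).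
Proof.
move=> Q okQ e e0; have m0 := rint_ge0 mu okQ.
case: (okQ) => h1 h2 h3 h4 h5.
pose th := e / (rint Q + e).
have te : 0 < rint Q + e by rewrite ltr_wpDl.
have th0 : 0 < th by rewrite divr_gt0.
have th1 : th <= 1 by rewrite ler_pdivrMr// mul1r lerDr.
have the : th * rint Q <= e by rewrite /th mulrAC ler_pdivrMr// ler_pM2l// lerDl ltW.
pose w := r_b Q ord0 i - r_a Q ord0 i.
have w0 : 0 <= w by rewrite subr_ge0.
exists unit, (fun=> Rect (\row_k (if k == i then - r_b Q ord0 k + th * w else r_a Q ord0 k))
   (\row_k (if k == i then - r_a Q ord0 k else r_b Q ord0 k)) (r_s Q) (r_u Q) (r_J Q)); split.
- have tw : th * w <= w by rewrite -[leRHS]mul1r ler_wpM2r.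
  move=> _; split => //= k; rewrite !mxE; case: eqP => [->|_]; last exact: h1.
  by move: tw; rewrite {2}/w; set a := th * w; lra.
- move=> _ p [/= q1 q2]; split => //= k; have := q1 k; rewrite !mxE; case: eqP => // -> /andP[a1 a2].
  have [w1|w1] := ltrP 0 w; last first.
    have we : w = 0 by apply/eqP; rewrite eq_le w1.
    have tw0 : th * w = 0 by rewrite we mulr0.
    by move: a1 a2 we; rewrite tw0 /w; lra.
  have := mulr_gt0 th0 w1; move: a1 a2; set b := th * w; lra.
- by move=> [] [].
- rewrite sum_unit.
  have -> : rint (Rect (\row_k (if k == i then - r_b Q ord0 k + th * w else r_a Q ord0 k))
     (\row_k (if k == i then - r_a Q ord0 k else r_b Q ord0 k)) (r_s Q) (r_u Q) (r_J Q)) =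
     (1 - th) * rint Q.
    rewrite /rect_intensity /= (bigD1 i)//= [in RHS](bigD1 i)//= !mxE eqxx.
    rewrite (eq_bigr (fun k => r_b Q ord0 k - r_a Q ord0 k)); last first.
      by move=> k /negbTE ki; rewrite !mxE ki.
    by rewrite /w; ring.
  apply/andP; split; first by move: the; rewrite mulrBl mul1r; lra.
  by rewrite -[leRHS]mul1r ler_wpM2r// gerBl ltW.
Qed.

Definition shear (i j : 'I_d) (a : R) (u : pt) : pt :=
  \row_k (if k == j then u ord0 j + a * u ord0 i else u ord0 k).

Lemma icp_shear i j a : i != j -> icp mu (lift (shear i j a)).
Proof.
move=> ij Q okQ e e0; have m0 := rint_ge0 mu okQ.
case: (okQ) => h1 h2 h3 h4 h5.
pose wi := r_b Q ord0 i - r_a Q ord0 i.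
pose wj := r_b Q ord0 j - r_a Q ord0 j.
have wi0 : 0 <= wi by rewrite subr_ge0.
have wj0 : 0 <= wj by rewrite subr_ge0.
have [wj1|wj1] := ltrP 0 wj; last first.
  exists void, (fun v : void => match v with end); split; try by case.
  rewrite big_pred0; last by case.
  have -> : rint Q = 0.
    rewrite /rect_intensity (bigD1 j)//= -/wj.
    by have -> : wj = 0; [apply/eqP; rewrite eq_le wj1|rewrite !mul0r].
  by rewrite sub0r lexx oppr_le0 ltW.
pose th := e / (rint Q + e).
have te : 0 < rint Q + e by rewrite ltr_wpDl.
have th0 : 0 < th by rewrite divr_gt0.
have th1 : th <= 1 by rewrite ler_pdivrMr// mul1r lerDr.
have the : th * rint Q <= e by rewrite /th mulrAC ler_pdivrMr// ler_pM2l// lerDl ltW.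
pose N := (Num.truncn (`|a| * wi / (th * wj))).+1.
have twj : 0 < th * wj by rewrite mulr_gt0.
have N0 : (0 : R) < N%:R by rewrite ltr0n.
have hN : `|a| * (wi / N%:R) <= th * wj.
  rewrite mulrA ler_pdivrMr// [leRHS]mulrC.
  case/andP: (truncn_itv (divr_ge0 (mulr_ge0 (normr_ge0 a) wi0) (ltW twj))) => _.
  by rewrite ltr_pdivrMr// => /ltW.
pose lo (k : nat) := r_a Q ord0 i + k%:R * (wi / N%:R).
pose mk (k : nat) := Num.min (a * lo k) (a * lo k.+1).
pose F (k : 'I_N) := Rect
  (\row_l (if l == i then lo k else if l == j then r_a Q ord0 j - mk k else r_a Q ord0 l))
  (\row_l (if l == i then lo k.+1 else if l == j then r_a Q ord0 j - mk k + (1 - th) * wj else r_b Q ord0 l))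
  (r_s Q) (r_u Q) (r_J Q).
have wN : 0 <= wi / N%:R by rewrite divr_ge0// ltW.
have loS k : lo k.+1 = lo k + wi / N%:R by rewrite /lo -natr1; ring.
have ji : (j == i) = false by rewrite eq_sym (negbTE ij).
exists 'I_N, F; split.
- move=> k; split => //= l; rewrite !mxE; case: eqP => _; first by rewrite loS lerDl.
  by case: eqP => _; rewrite ?lerDl// mulr_ge0// subr_ge0.
- move=> k p [/= q1 q2]; split => //= l; have := q1 l; rewrite !mxE.
  have := q1 i; rewrite !mxE eqxx => /andP[i1 i2].
  have lo_ge : r_a Q ord0 i <= lo k by rewrite /lo lerDl mulr_ge0.
  have lo_le : lo k.+1 <= r_b Q ord0 i.
    have : k.+1%:R * (wi / N%:R) <= wi.
      by rewrite mulrA ler_pdivrMr// mulrC ler_wpM2l// ler_nat ltn_ord.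
    by rewrite /lo /wi; lra.
  have [-> |lj] := eqVneq l j; last first.
    by case: eqP => [-> _|//]; rewrite (le_trans lo_ge i1) (lt_le_trans i2 lo_le).
  rewrite ji => /andP[j1 j2].
  have wj_ : r_b Q ord0 j = r_a Q ord0 j + wj by rewrite /wj; ring.
  rewrite wj_.
  have b1 : mk k <= a * p.1 ord0 i.
    rewrite /mk ge_min; have [a0|a0] := lerP 0 a.
      by rewrite ler_wpM2l.
    by apply/orP; right; rewrite ler_nM2l// ltW.
  have b2 : a * p.1 ord0 i <= mk k + th * wj.
    apply: le_trans (_ : mk k + `|a| * (wi / N%:R) <= _); last by rewrite lerD2l.
    rewrite /mk loS; have [a0|a0] := lerP 0 a.
      have h : a * (lo k) <= a * (lo k + wi / N%:R) by rewrite ler_wpM2l// lerDl.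
      rewrite min_l// ger0_norm//.
      by rewrite -mulrDr ler_wpM2l// -loS ltW.
    have h : a * (lo k + wi / N%:R) <= a * (lo k) by rewrite ler_nM2l// lerDl.
    rewrite min_r// ltr0_norm//.
    have -> : a * (lo k + wi / N%:R) + - a * (wi / N%:R) = a * lo k by ring.
    by rewrite ler_nM2l.
  move: j1 j2 b1 b2; have -> : (1 - th) * wj = wj - th * wj by ring.
  set x := a * _; set y := th * wj; lra.
- move=> k k' kk; rewrite -subset0 => p [[/= q1 _] [/= q2 _]].
  have := q1 i; have := q2 i; rewrite !mxE eqxx => /andP[a1 a2] /andP[a3 a4].
  have hh (x y : nat) : (x < y)%N -> lo x.+1 <= lo y.
    by move=> xy; rewrite /lo lerD2l ler_wpM2r// ler_nat.
  case: (ltngtP k k') => [/hh|/hh|/val_inj/eqP]; [lra|lra|by rewrite (negbTE kk)].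
- have FE k : rint (F k) = N%:R^-1 * ((1 - th) * rint Q).
    rewrite /rect_intensity /= (bigD1 i)//= [in RHS](bigD1 i)//= !mxE eqxx.
    rewrite (bigD1 j)/= ?ji// [in RHS](bigD1 j)/= ?ji// !mxE ji eqxx loS.
    rewrite (eq_bigr (fun l => r_b Q ord0 l - r_a Q ord0 l)); last first.
      by move=> l /andP[/negbTE li /negbTE lj]; rewrite !mxE li lj.
    by rewrite -/wi -/wj; ring.
  rewrite (eq_bigr _ (fun k _ => FE k)) sumr_const card_ord -(mulr_natl (_ * (_ * _)) N) mulVKf ?gt_eqF//.
  apply/andP; split; first by move: the; rewrite mulrBl mul1r; lra.
  by rewrite -[leRHS]mul1r ler_wpM2r// gerBl ltW.
Qed.

Definition isom (f : pt -> pt) := [/\ forall u v, enorm (f u - f v) = enorm (u - v), f 0 = 0 & icp mu (lift f)].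

Definition isopair (f g : pt -> pt) := [/\ isom f, isom g & cancel f g].

Lemma isom_comp f g : isom f -> isom g -> isom (f \o g).
Proof.
move=> [f1 f2 f3] [g1 g2 g3]; split; first by move=> u v; rewrite /= f1 g1.
  by rewrite /= g2 f2.
exact: icp_comp f3 g3.
Qed.

Lemma isopair_comp f g f' g' : isopair f g -> isopair f' g' -> isopair (f \o f') (g' \o g).
Proof.
move=> [h1 h2 h3] [k1 k2 k3]; split; [exact: isom_comp|exact: isom_comp|].
by move=> u /=; rewrite h3 k3.
Qed.

Lemma isopair_id : isopair id id.
Proof. by split => //; split => //; exact: icp_id. Qed.

Lemma isopair_refl i : isopair (reflc i) (reflc i).
Proof.
have h : isom (reflc i).
  split; last exact: icp_refl.
    move=> u v; apply: enorm_eq; apply: eq_bigr => k _; rewrite !mxE.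
    by case: eqP => // _; ring.
  by apply/rowP => k; rewrite !mxE oppr0 if_same.
by split => // u; apply/rowP => k; rewrite !mxE; case: eqP => //; rewrite opprK.
Qed.

Definition rot (i j : 'I_d) (c s : R) (u : pt) : pt :=
  \row_k (if k == i then c * u ord0 i - s * u ord0 j else
          if k == j then s * u ord0 i + c * u ord0 j else u ord0 k).

Lemma isom_rot i j c s : i != j -> c ^+ 2 + s ^+ 2 = 1 -> 0 <= c -> isom (rot i j c s).
Proof.
move=> ij cs c0.
have ji : (j == i) = false by rewrite eq_sym (negbTE ij).
have ij' : (i == j) = false by rewrite (negbTE ij).
split.
- move=> u v; apply: enorm_eq.
  rewrite (bigD1 i)//= [RHS](bigD1 i)//= (bigD1 j)/= ?ji// [in RHS](bigD1 j)/= ?ji// !addrA.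
  congr (_ + _); last first.
    by apply: eq_bigr => k /andP[/negbTE ki /negbTE kj]; rewrite !mxE ki kj.
  rewrite !mxE !eqxx ji.
  set a := u ord0 i; set b := u ord0 j; set a' := v ord0 i; set b' := v ord0 j.
  transitivity ((c ^+ 2 + s ^+ 2) * ((a - a') ^+ 2 + (b - b') ^+ 2)); first by ring.
  by rewrite cs mul1r.
- by apply/rowP => k; rewrite !mxE !mulr0 subrr addr0 !if_same.
- pose t := s / (1 + c).
  have c1 : 1 + c != 0 by rewrite gt_eqF// ltr_pwDl.
  have t1 : 1 - t * s = c.
    have -> : t * s = s ^+ 2 / (1 + c) by rewrite /t; ring.
    have -> : s ^+ 2 = 1 - c ^+ 2 by rewrite -cs; ring.
    have -> : 1 - c ^+ 2 = (1 - c) * (1 + c) by ring.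
    by rewrite mulfK//; ring.
  have t2 : t * (1 + c) = s by rewrite /t divfK.
  have -> : lift (rot i j c s) = lift (shear j i (- t)) \o (lift (shear i j s) \o lift (shear j i (- t))).
    apply/funext => p; rewrite /lift /=; congr (_, _); apply/rowP => k; rewrite !mxE !eqxx ji ij'.
    set a := p.1 ord0 i; set b := p.1 ord0 j.
    case: eqP => [_|ki].
      have -> : c * a - s * b = (1 - t * s) * a - (t * (1 + (1 - t * s))) * b by rewrite t1 t2.
      by ring.
    case: eqP => // _.
    have -> : s * a + c * b = s * a + (1 - t * s) * b by rewrite t1.
    by ring.
  apply: icp_comp; first by apply: icp_shear; rewrite eq_sym.
  by apply: icp_comp; apply: icp_shear => //; rewrite eq_sym.
Qed.

Lemma isopair_rot i j c s : i != j -> c ^+ 2 + s ^+ 2 = 1 -> 0 <= c ->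
  isopair (rot i j c s) (rot i j c (- s)).
Proof.
move=> ij cs c0; split; [exact: isom_rot|by apply: isom_rot => //; rewrite sqrrN|].
have ji : (j == i) = false by rewrite eq_sym (negbTE ij).
move=> u; apply/rowP => k; rewrite !mxE !eqxx ji; set a := u ord0 i; set b := u ord0 j.
case: eqP => [->|_].
  transitivity ((c ^+ 2 + s ^+ 2) * a); first by ring.
  by rewrite cs mul1r.
case: eqP => [->|//].
transitivity ((c ^+ 2 + s ^+ 2) * b); first by ring.
by rewrite cs mul1r.
Qed.

Definition eb (i : 'I_d) : pt := \row_k (k == i)%:R.

Lemma enorm_eb i : enorm (eb i) = 1.
Proof.
rewrite /enorm (bigD1 i)//= big1 => [|k /negbTE ki]; rewrite mxE ?eqxx ?ki ?expr0n//.
by rewrite expr1n addr0 sqrtr1.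
Qed.

Lemma iso_to_axis (i : 'I_d) (x : pt) : exists f g, isopair f g /\ f x = enorm x *: eb i.
Proof.
have h1 : exists f g, isopair f g /\ 0 <= f x ord0 i.
  have [x0|x0] := lerP 0 (x ord0 i); first by exists id, id; split => //; exact: isopair_id.
  exists (reflc i), (reflc i); split; first exact: isopair_refl.
  by rewrite mxE eqxx oppr_ge0 ltW.
have h2 : forall s : seq 'I_d, i \notin s -> exists f g, [/\ isopair f g, 0 <= f x ord0 i &
    forall j, j \in s -> f x ord0 j = 0].
  elim=> [_|j s ih]; first by have [f [g [fg fx]]] := h1; exists f, g; split.
  rewrite inE negb_or => /andP[ij iS]; have [f [g [fg fi fs]]] := ih iS.
  set y := f x in fi fs.
  pose n := Num.sqrt (y ord0 i ^+ 2 + y ord0 j ^+ 2).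
  have n2 : n ^+ 2 = y ord0 i ^+ 2 + y ord0 j ^+ 2 by rewrite sqr_sqrtr// addr_ge0 ?sqr_ge0.
  have [n0|n0] := eqVneq n 0.
    exists f, g; split => // k; rewrite inE => /orP[/eqP ->|]; last exact: fs.
    apply/eqP; rewrite -sqrf_eq0; apply/eqP; move: n2; rewrite n0 expr0n /=.
    by move: (sqr_ge0 (y ord0 i)) (sqr_ge0 (y ord0 j)); rewrite -/y; lra.
  have ji : (j == i) = false by rewrite eq_sym (negbTE ij).
  exists (rot i j (y ord0 i / n) (- y ord0 j / n) \o f), (g \o rot i j (y ord0 i / n) (- (- y ord0 j / n))); split.
  - apply: isopair_comp => //; apply: isopair_rot => //; last by rewrite divr_ge0// sqrtr_ge0.
    by rewrite !exprMn sqrrN -mulrDl -n2 -exprMn divff// expr1n.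
  - rewrite /= mxE eqxx -/y.
    have -> : y ord0 i / n * y ord0 i - - y ord0 j / n * y ord0 j = n ^+ 2 / n by rewrite n2; ring.
    by rewrite divr_ge0 ?sqr_ge0// sqrtr_ge0.
  - move=> k; rewrite inE /= mxE -/y => kjs; case: eqP => [ki|ki].
      move: kjs; rewrite ki (negbTE iS) orbF => /eqP e; by move: ij; rewrite e eqxx.
    case: eqP => [kj|kj]; first by ring.
    by move: kjs => /orP[/eqP//|]; exact: fs.
have [f [g [fg fi fs]]] := h2 [seq j <- enum 'I_d | j != i] ltac:(by rewrite mem_filter eqxx).
exists f, g; split => //.
have fj j : j != i -> f x ord0 j = 0 by move=> ji; apply: fs; rewrite mem_filter ji mem_enum.
have -> : enorm x = f x ord0 i.
  have [[f1 f2 _] _ _] := fg.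
  rewrite -[x]subr0 -f1 f2 !subr0 /enorm (bigD1 i)//= big1 => [|j /fj ->]; last by rewrite expr0n.
  by rewrite addr0 sqrtr_sqr ger0_norm.
apply/rowP => j; rewrite !mxE; case: eqP => [->|/eqP/fj ->]; by rewrite ?mulr1 ?mulr0.
Qed.

End Icp.

Section ConnLaw.
Context {R : realType} {d : nat} {dO : measure_display} {Omega : measurableType dO}.
Variables (P : probability Omega R) (mu : probability R R).
Variable chi : Omega -> set (@mpoint R d).
Hypothesis hchi : is_PPP P mu chi.
Local Notation pr := (pr P).
Local Notation pt := 'rV[R]_d.

Definition cev Lam (r1 r2 : R) (x y : pt) (t : R) : set Omega :=
  [set w | conn (chi w `&` Lam) r1 r2 x y t].

Lemma cevE Lam r1 r2 x y t : cev Lam r1 r2 x y t = ev chi (Cconn Lam r1 r2 x y t).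
Proof. by apply/seteqP; split => w /conn_evt. Qed.

Lemma measurable_cev Lam r1 r2 x y t : openL Lam -> measurable (cev Lam r1 r2 x y t).
Proof. by move=> oL; rewrite cevE; apply: (measurable_ev hchi); exact: openev_conn. Qed.

Lemma Gs_cev Lam Lam' r1 r2 x y t : openL Lam -> Lam `<=` Lam' -> Gs chi Lam' (cev Lam r1 r2 x y t).
Proof.
move=> oL LL; rewrite cevE; apply: (Gs_ev hchi); first exact: openev_conn.
by move=> ps [[_ h] _] q /h /LL.
Qed.

Lemma openLT : openL ([set: @mpoint R d]).
Proof. by move=> p _; exists 1. Qed.

Lemma cev_lift_le f Lam Lam' r1 r2 x y t : openL Lam -> openL Lam' ->
  (forall u v, enorm (f u - f v) = enorm (u - v)) -> icp mu (lift f) ->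
  (forall p, Lam' (lift f p) <-> Lam p) ->
  pr (cev Lam' r1 r2 (f x) (f y) t) <= pr (cev Lam r1 r2 x y t).
Proof.
move=> oL oL' iso icpf hL; rewrite !cevE.
have e : ev chi (Cconn Lam' r1 r2 (f x) (f y) t \o map (lift f)) = ev chi (Cconn Lam r1 r2 x y t).
  by apply/seteqP; split => w [ps h1 h2]; exists ps => //; have H := Cconn_lift r1 r2 x y t ps iso hL; exact/H.
rewrite -e; apply: (law_le hchi) => //; first exact: openev_conn.
by rewrite e; apply: (measurable_ev hchi); exact: openev_conn.
Qed.

Lemma cev_trans a Lam Lam' r1 r2 x y t : openL Lam -> openL Lam' ->
  (forall p, Lam' (lift (fun u => u + a) p) <-> Lam p) ->
  pr (cev Lam' r1 r2 (x + a) (y + a) t) = pr (cev Lam r1 r2 x y t).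
Proof.
move=> oL oL' hL; apply/eqP; rewrite eq_le; apply/andP; split.
  apply: (@cev_lift_le (fun u => u + a)) => //; last exact: icp_trans.
  by move=> u v; congr enorm; rewrite opprD addrACA subrr addr0.
rewrite -{1}[x](addrK a) -{1}[y](addrK a).
apply: (@cev_lift_le (fun u => u - a)) => //; last 2 first.
- exact: icp_trans.
- move=> p; rewrite -hL.
  by have -> : lift (fun u => u + a) (lift (fun u => u - a) p) = p by case: p => p1 p2; rewrite /lift /= subrK.
by move=> u v; congr enorm; rewrite opprD addrACA subrr addr0.
Qed.

Lemma cev_isom f r1 r2 x y t : isom mu f ->
  pr (cev setT r1 r2 (f x) (f y) t) <= pr (cev setT r1 r2 x y t).
Proof. by move=> [f1 _ f3]; apply: cev_lift_le => //; exact: openLT. Qed.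

Theorem cev_law (hd : (0 < d)%N) r1 r2 x y x' y' t : enorm (y - x) = enorm (y' - x') ->
  pr (cev setT r1 r2 x y t) = pr (cev setT r1 r2 x' y' t).
Proof.
pose i : 'I_d := Ordinal hd.
have h u v : pr (cev setT r1 r2 u v t) = pr (cev setT r1 r2 0 (enorm (v - u) *: eb i) t).
  have e := @cev_trans (- u) setT setT r1 r2 u v t openLT openLT (fun p => iff_refl _).
  rewrite -e subrr; set z := v - u.
  have [f [g [[If Ig fg] fz]]] := iso_to_axis mu i z.
  have f0 : f 0 = 0 by case: If.
  have g0 : g 0 = 0 by case: Ig.
  have gz : g (enorm z *: eb i) = z by rewrite -fz fg.
  apply/eqP; rewrite eq_le; apply/andP; split.
    by rewrite -{1}g0 -{1}gz; exact: cev_isom.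
  by rewrite -fz -{1}f0; exact: cev_isom.
by move=> e; rewrite h [RHS]h e.
Qed.

End ConnLaw.

(** * Local connections *)

Lemma le_of_eq {R : realType} (x y : R) : x = y -> x <= y.
Proof. by move=> ->. Qed.

Section Local.
Context {R : realType} {d : nat} {dO : measure_display} {Omega : measurableType dO}.
Variables (P : probability Omega R) (mu : probability R R).
Variable chi : Omega -> set (@mpoint R d).
Hypothesis hchi : is_PPP P mu chi.
Hypothesis hd : (0 < d)%N.
Local Notation pr := (pr P).
Local Notation pt := 'rV[R]_d.
Local Notation mpt := (@mpoint R d).
Variables (r0 R1 : R).
Hypothesis r00 : 0 < r0.
Let J0 : set R := `]r0, R1[%classic.
Hypothesis pJ0 : 0 < fine (mu J0).

Definition rho : R := r0 / 8.

Lemma rhoE : rho = r0 / 8.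
Proof. by []. Qed.

Definition tube (x y : pt) : set mpt := [set p | 0 <= mtim p /\ r0 < mrad p < R1 /\
  exists2 th : R, 0 <= th <= 1 & enorm (mctr p - (x + th *: (y - x))) <= rho].

Let h : R := rho / (2 * d%:R).
Let b : R := 3 / (h ^+ d * fine (mu J0)).
Let sig : R := r0 / 4.

Let d0 : (0 : R) < d%:R. Proof. by rewrite ltr0n. Qed.
Let rho0 : 0 < rho. Proof. by rewrite divr_gt0. Qed.
Let h0 : 0 < h. Proof. by rewrite divr_gt0// mulr_gt0. Qed.
Let b0 : 0 < b. Proof. by rewrite divr_gt0// mulr_gt0// exprn_gt0. Qed.
Let sig0 : 0 < sig. Proof. by rewrite divr_gt0. Qed.

Definition brect (z : pt) (a T : R) : @rect R d := Rect z (z + const_mx a) 0 T J0.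

Lemma J0_gt0 : J0 `<=` `]0, +oo[%classic.
Proof.
by move=> r; rewrite /J0 /= !in_itv/= andbT => /andP[hr _]; exact: lt_trans hr.
Qed.

Lemma brect_ok z a T : 0 <= a -> 0 <= T -> rect_ok (brect z a T).
Proof.
move=> a0 T0; split => //=; [by move=> i; rewrite !mxE lerDl|exact: measurable_itv|exact: J0_gt0].
Qed.

Lemma brect_int z a T : rect_intensity mu (brect z a T) = a ^+ d * T * fine (mu J0).
Proof.
rewrite /rect_intensity /= subr0; congr (_ * _ * _).
rewrite (eq_bigr (fun=> a)); first by rewrite prodr_const card_ord.
by move=> i _; rewrite !mxE; ring.
Qed.

Lemma brect_near z a T p : rect_set (brect z a T) p ->
  [/\ enorm (mctr p - z) <= d%:R * a, 0 <= mtim p < T & r0 < mrad p < R1].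
Proof.
move=> [/= h1 [h2 h3]]; split; [|exact: h2|by move: h3; rewrite /J0 /= in_itv].
by apply: enorm_le_coord => i; have := h1 i; rewrite !mxE ler_norml; lra.
Qed.

Lemma pr_hop (s : R) Lam (x : pt) (sg : R) : openL Lam -> tube x x `<=` Lam -> 0 < sg -> sg <= rho ->
  0 <= s -> pr (~` cev chi Lam sg (2 * rho) x x s) <=
  expR (- ((sg / (2 * d%:R)) ^+ d * fine (mu J0) * s)).
Proof.
move=> oL tL sg0 sgr s0; set a := sg / (2 * d%:R).
have a0 : 0 < a by rewrite divr_gt0// mulr_gt0.
have da : d%:R * a = sg / 2 by rewrite /a; field; rewrite gt_eqF.
have okq : rect_ok (brect x a s) by apply: brect_ok => //; exact: ltW.
have mo := measurable_occ hchi okq.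
have sub : ~` cev chi Lam sg (2 * rho) x x s `<=` ~` occ chi (brect x a s).
  apply: subsetC => w [p [cp /brect_near[p1 p2 p3]]].
  rewrite da in p1.
  exists p, [::]; split => //=.
  - move=> q; rewrite inE => /eqP ->; split => //; apply: tL; split; first by case/andP: p2.
    split => //; exists 0; first by rewrite lexx ler01.
    by rewrite scale0r addr0; move: p1 sgr sg0; lra.
  - by move: p1 sg0; lra.
  - by case/andP: p3 => p3 _; move: p1 p3 sgr sg0; rewrite /rho; lra.
  - by rewrite stime_cons /stime big_nil addr0; case/andP: p2.
apply: le_trans (pr_mono P _ _ sub) _; [by apply: measurableC; exact: (measurable_cev hchi)|exact: measurableC|].
have dj : forall i j : unit, i != j -> rect_set (brect x a s) `&` rect_set (brect x a s) = set0 by move=> [] [].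
have /= := @ppp_void _ _ _ _ P mu chi hchi unit (fun=> brect x a s) (fun=> okq) dj [set: unit]%SET.
rewrite (big_pred1 tt) => [e|[]]; last by rewrite inE.
rewrite [X in pr X](_ : _ = [set w | forall i : unit, i \in [set: unit]%SET -> ~ occ chi (brect x a s) w]).
  by rewrite e brect_int; apply: le_of_eq; congr (expR (- _)); ring.
by apply/seteqP; split => w /=; [move=> ? ?|move=> /(_ tt); rewrite inE; apply].
Qed.

Definition Nl (D : R) : nat := (Num.truncn (D / sig)).+1.

Lemma Nl_le D : 0 <= D -> D <= sig * (Nl D)%:R /\ (Nl D)%:R <= D / sig + 1.
Proof.
move=> D0; have /truncn_itv/andP[h1 h2] : 0 <= D / sig by rewrite divr_ge0// ltW.
split; last by rewrite /Nl -natr1 lerD2r.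
by move: h2; rewrite ltr_pdivrMr// mulrC => /ltW.
Qed.

Lemma pr_local_aux Lam (x y : pt) (s : nat) : openL Lam -> tube x y `<=` Lam ->
  forall N, N = Nl (enorm (y - x)) ->
  pr (~` cev chi Lam rho (2 * rho) x y (b * (2 * N%:R + s%:R))) <= 4 ^- s.
Proof.
move=> oL tL [|N0_]// NE; set N := N0_.+1 in NE *; set D := enorm (y - x) in NE.
have D0 : 0 <= D by exact: enorm_ge0.
have [N1 N2] := Nl_le D0; rewrite -NE in N1 N2.
have N0' : (0 < N)%N by rewrite NE.
have N0 : (0 : R) < N%:R by rewrite ltr0n.
pose n := (N + s)%N.
pose X (j : 'I_N) : pt := x + (j%:R / N%:R) *: (y - x).
pose Q (f : {ffun 'I_N -> 'I_n.+1}) j := brect (X j) h (b * (f j)%:R).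
have okQ f j : rect_ok (Q f j).
  by apply: brect_ok; [exact: ltW|rewrite mulr_ge0// ltW].
have djX (j k : 'I_N) : (j < k)%N -> exists i, h <= `|X j ord0 i - X k ord0 i|.
  move=> jk; have N2' : (2 <= N)%N by apply: leq_ltn_trans (ltn_ord k); exact: leq_ltn_trans jk.
  have DN : rho <= D / N%:R.
    have : 0 <= D / sig by rewrite divr_ge0// ltW.
    move=> /truncn_itv/andP[h1 _].
    have : sig * (N%:R / 2) <= D.
      rewrite mulrC -ler_pdivlMr//; apply: le_trans h1.
      have -> : (Num.truncn (D / sig))%:R = N%:R - 1 :> R by rewrite NE /Nl -natr1 addrK.
      have : (2 : R) <= N%:R by rewrite ler_nat.
      lra.
    rewrite ler_pdivlMr//; apply: le_trans; rewrite /rho /sig.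
    by apply: le_of_eq; field.
  apply: contrapT => hn.
  have hi i : `|X j ord0 i - X k ord0 i| <= h.
    by rewrite leNgt; apply/negP => hh; apply: hn; exists i; exact: ltW.
  have := @enorm_le_coord _ _ (X j - X k) h (fun i => _).
  have -> : X j - X k = ((j%:R - k%:R) / N%:R) *: (y - x).
    by rewrite /X opprD addrACA subrr add0r -scalerBl mulrBl.
  rewrite enormZ -/D => /(_ _) hh.
  have {}hh : `|(j%:R - k%:R) / N%:R| * D <= d%:R * h.
    apply: hh => i; have := hi i; congr (_ <= _); rewrite /X !mxE; congr (`|_|); ring.
  have jk1 : 1 <= `|j%:R - k%:R| :> R.
    rewrite distrC -natrB 1?ltnW// normr_nat ler1n subn_gt0//.
  have : D / N%:R <= d%:R * h.
    apply: le_trans hh; rewrite normrM [`|N%:R^-1|]ger0_norm; last by rewrite invr_ge0 ltW.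
    rewrite -mulrA (mulrC _ D).
    by rewrite -[leLHS]mul1r ler_wpM2r// divr_ge0// ltW.
  have -> : d%:R * h = rho / 2 by rewrite /h; field; rewrite gt_eqF.
  by move: DN rho0; lra.
have djQ f j k : j != k -> rect_set (Q f j) `&` rect_set (Q f k) = set0.
  have key : forall j k : 'I_N, (j < k)%N -> rect_set (Q f j) `&` rect_set (Q f k) = set0.
    move=> {j k} j k jk; have [i hi] := djX j k jk.
    rewrite -subset0 => p [[/= /(_ i) a1 _] [/= /(_ i) a2 _]].
    by move: a1 a2 hi; rewrite !mxE ler_normr; lra.
  move=> jk; case: (ltngtP j k) => [/key//|/key|/val_inj/eqP]; last by rewrite (negbTE jk).
  by rewrite setIC.
pose V f : set Omega := [set w | forall j, j \in [set: 'I_N]%SET -> ~ occ chi (Q f j) w].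
have mV f : measurable (V f).
  apply: measurable_forall_in => j; apply: measurableC; exact: (measurable_occ hchi).
have prVf f : pr (V f) = expR (- 3) ^+ (\sum_j (f j : nat)).
  rewrite (ppp_void hchi (okQ f) (djQ f)) -expRM_natl mulr_natl -mulr_natr natr_sum mulr_sumr -sumrN.
  congr expR; apply: eq_big => [j|j _]; first by rewrite inE.
  rewrite brect_int /b; have q0 : h ^+ d != 0 by rewrite gt_eqF// exprn_gt0.
  have m0 : fine (mu J0) != 0 by rewrite gt_eqF.
  by move: q0 m0; set q := h ^+ d; set m := fine _ => q0 m0; field; rewrite q0 m0.
pose G := [pred f : {ffun 'I_N -> 'I_n.+1} | (n <= \sum_j (f j : nat))%N].
have sub : ~` cev chi Lam rho (2 * rho) x y (b * (2 * N%:R + s%:R)) `<=`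
    [set w | exists2 f, f \in enum G & V f w].
  move=> w /= nc; apply: contrapT => nf; apply: nc.
  pose void (j : 'I_N) (k : nat) := ~ occ chi (brect (X j) h (b * k%:R)) w.
  have void0 j : void j 0%N.
    by move=> [p [_ /brect_near[_ + _]]]; rewrite mulr0 => /andP[a1 a2]; move: (lt_le_trans a2 a1); rewrite ltxx.
  have /choice[g hg] : forall j : 'I_N, exists k : 'I_n.+1, void j k /\ ((k < n)%N -> ~ void j k.+1).
    move=> j; have exk : exists k, `[< void j k >] && (k <= n)%N.
      by exists 0%N; apply/andP; split => //; exact/asboolP.
    have bdk k : `[< void j k >] && (k <= n)%N -> (k <= n)%N by case/andP.
    case: (ex_maxnP exk bdk) => k /andP[/asboolP vk kn] mx.
    exists (Ordinal (kn : (k < n.+1)%N)); split => //= kn1 vk1.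
    by have := mx k.+1; rewrite kn1 andbT ltnn => /(_ (introT (asboolP _) vk1)).
  have sn : (\sum_j (g j : nat) < n)%N.
    rewrite ltnNge; apply/negP => hn; apply: nf; exists (finfun g).
      by rewrite mem_enum /G inE/=; apply: leq_trans hn _; rewrite leq_eqVlt; apply/orP; left; apply/eqP; apply: eq_bigr => j _; rewrite ffunE.
    by move=> j _; rewrite /Q ffunE; have [] := hg j.
  have gn j : (g j < n)%N by apply: leq_ltn_trans sn; rewrite (bigD1 j)//= leq_addr.
  have /choice[q hq] : forall j : 'I_N, exists p, chi w p /\ rect_set (brect (X j) h (b * (g j).+1%:R)) p.
    move=> j; have [_ /(_ (gn j)) /contrapT[p [c1 c2]]] := hg j; by exists p.
  have dh : d%:R * h = rho / 2 by rewrite /h; field; rewrite gt_eqF.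
  have qn j := brect_near (hq j).2.
  have inL j : (chi w `&` Lam) (q j).
    split; first exact: (hq j).1.
    apply: tL; have [q1 q2 q3] := qn j; split; first by case/andP: q2.
    split => //; exists (j%:R / N%:R); last by rewrite dh in q1; move: q1 rho0; rewrite /X; lra.
    by rewrite divr_ge0 ?(ltW N0)//= ler_pdivrMr// mul1r ler_nat ltnW.
  have step u v : enorm (X u - X v) = `|u%:R - v%:R| * (D / N%:R).
    have -> : X u - X v = ((u%:R - v%:R) / N%:R) *: (y - x).
      by rewrite /X opprD addrACA subrr add0r -scalerBl mulrBl.
    by rewrite enormZ -/D normrM [`|N%:R^-1|]ger0_norm ?invr_ge0 ?ltW//; ring.
  have DNs : D / N%:R <= sig by rewrite ler_pdivrMr.
  pose q' (k : nat) := q (inord k : 'I_N0_.+1).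
  have link k : (k.+1 < N)%N -> lk (q' k) (q' k.+1).
    move=> kN; rewrite /lk; have [q1 _ /andP[q3 _]] := qn (inord k : 'I_N0_.+1).
    have [q1' _ _] := qn (inord k.+1 : 'I_N0_.+1).
    apply: le_lt_trans q3; rewrite -/(q' k) -/(q' k.+1) in q1 q1' *.
    apply: le_trans (enorm_tri (X (inord k.+1 : 'I_N0_.+1)) _ _) _.
    have t2 := enorm_tri (X (inord k : 'I_N0_.+1)) (X (inord k.+1 : 'I_N0_.+1)) (mctr (q' k)).
    have t3 := step (inord k.+1 : 'I_N0_.+1) (inord k : 'I_N0_.+1).
    rewrite !inordK ?(ltnW kN)// -natrB ?leqnSn// subSnn normr1 mul1r in t3.
    rewrite (enormB (X (inord k : 'I_N0_.+1))) in t2.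
    rewrite dh in q1 q1'; move: q1 q1' t2 t3 DNs rho0; rewrite /sig /rho; lra.
  exists (q' 0%N), [seq q' k | k <- iota 1 N0_].
  have lastq : last (q' 0%N) [seq q' k | k <- iota 1 N0_] = q' N0_.
    rewrite last_map; congr q'.
    by rewrite (last_nth 0%N) size_iota -[_ :: iota 1 N0_]/(iota 0 N0_.+1) nth_iota.
  split.
  - by move=> a; rewrite -map_cons => /mapP[k _ ->]; exact: inL.
  - have [q1 _ _] := qn (inord 0 : 'I_N0_.+1); rewrite -/(q' 0%N) in q1.
    have X0 : X (inord 0 : 'I_N0_.+1) = x by rewrite /X inordK// mul0r scale0r addr0.
    by rewrite X0 dh in q1; apply: le_lt_trans q1 _; move: rho0; lra.
  - rewrite -[path _ _ _]/(sorted lk (map q' (iota 0 N0_.+1))).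
    apply/(sortedP (q' 0%N)) => k; rewrite size_map size_iota => kN.
    rewrite !(nth_map 0%N) ?size_iota ?(ltnW kN)// !nth_iota ?(ltnW kN)// !add0n.
    exact: link.
  - rewrite lastq; have [q1 _ /andP[q3 _]] := qn (inord N0_ : 'I_N0_.+1).
    rewrite -/(q' N0_) in q1 q3; apply: le_lt_trans q3.
    have t2 := enorm_tri (X (inord N0_ : 'I_N0_.+1)) (mctr (q' N0_)) y.
    have t3 : enorm (X (inord N0_ : 'I_N0_.+1) - y) = D / N%:R.
      have -> : X (inord N0_ : 'I_N0_.+1) - y = (- N%:R^-1) *: (y - x).
        rewrite /X inordK//.
        have -> : N0_%:R / N%:R = 1 - N%:R^-1 :> R.
          have -> : N0_%:R = N%:R - 1 :> R by rewrite /N -natr1 addrK.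
          by rewrite mulrBl divff ?gt_eqF// mul1r.
        by rewrite scalerBl scale1r addrA subrKC scaleNr addrAC subrr add0r.
      by rewrite enormZ normrN ger0_norm ?invr_ge0 ?ltW// mulrC.
    rewrite dh in q1; move: q1 t2 t3 DNs r00; rewrite /sig /rho; lra.
  - rewrite -map_cons -[_ :: iota _ _]/(iota 0 N0_.+1) /stime big_map.
    apply: lt_le_trans (_ : \sum_(j : 'I_N) (b * (g j).+1%:R) <= _).
      have -> : \sum_(k <- iota 0 N0_.+1) mtim (q' k) = \sum_(j : 'I_N) mtim (q j).
        rewrite -[iota 0 _]/(index_iota 0 N) big_mkord; apply: eq_bigr => j _.
        by rewrite /q' inord_val.
      apply: ltr_sum; last by move=> j _; have [_ /andP[]] := qn j.
      by apply/hasP; exists (inord 0 : 'I_N0_.+1) => //; exact: mem_index_enum.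
    rewrite -mulr_sumr ler_pM2l// -natr_sum -natrM -natrD ler_nat.
    have -> : (\sum_(j < N) (g j).+1 = \sum_(j < N) g j + N)%N.
      rewrite (eq_bigr (fun j => g j + 1)%N) => [|j _]; last by rewrite addn1.
      by rewrite big_split/= sum_nat_const card_ord muln1.
    rewrite mul2n -addnn -addnA addnC leq_add2l; apply: ltnW; exact: sn.
apply: le_trans (pr_mono P _ _ sub) _.
- by apply: measurableC; exact: (measurable_cev hchi).
- by apply: measurable_exists_in => f _.
apply: le_trans (pr_exists_in P _) _ => //.
rewrite big_enum /=.
have e8 : expR (- 3) <= 8^-1 :> R.
  rewrite expRN lef_pV2 ?posrE ?expR_gt0//.
  have -> : (3 : R) = 3%:R * 1 by rewrite mulr1.
  rewrite expRM_natl.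
  apply: le_trans (_ : (2 : R) ^+ 3 <= _); first by apply: le_of_eq; ring.
  by rewrite lerXn2r ?nnegrE ?expR_ge0//; have := expR_ge1Dx (1 : R); lra.
apply: le_trans (_ : \sum_(f in G) (4 ^- n * \prod_j (2^-1) ^+ (f j)) <= _).
  apply: ler_sum => f; rewrite inE /= => fn; rewrite prVf.
  apply: le_trans (_ : (8^-1 : R) ^+ (\sum_j (f j : nat)) <= _).
    by rewrite lerXn2r ?nnegrE ?expR_ge0.
  rewrite -prodrXr.
  have -> : (8^-1 : R) = 4^-1 * 2^-1 by rewrite -invfM; congr (_^-1); ring.
  rewrite (eq_bigr (fun j => (4^-1 : R) ^+ (f j) * 2^-1 ^+ (f j))) => [|j _]; last by rewrite exprMn.
  rewrite big_split/=; apply: ler_wpM2r; first by apply: prodr_ge0 => j _; rewrite exprn_ge0.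
  rewrite prodrXr -exprVn; apply: ler_wiXn2l => //; lra.
apply: le_trans (_ : \sum_(f : {ffun 'I_N -> 'I_n.+1}) (4 ^- n * \prod_j (2^-1) ^+ (f j)) <= _).
  rewrite [leRHS](bigID (mem G))/= lerDl; apply: sumr_ge0 => f _.
  by rewrite mulr_ge0 ?invr_ge0 ?exprn_ge0// prodr_ge0// => j _; rewrite exprn_ge0.
rewrite -mulr_sumr -(bigA_distr_bigA (fun (j : 'I_N) (k : 'I_n.+1) => (2^-1 : R) ^+ k)).
rewrite prodr_const card_ord.
have g2 m : \sum_(k < m) (2^-1 : R) ^+ k <= 2.
  have : \sum_(k < m) (2^-1 : R) ^+ k = 2 - 2 * 2^-1 ^+ m.
    elim: m => [|m ih]; first by rewrite big_ord0 expr0; lra.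
    by rewrite big_ord_recr/= ih exprS; lra.
  by move=> ->; rewrite gerBl mulr_ge0// exprn_ge0.
apply: le_trans (_ : 4 ^- n * 2 ^+ N <= _).
  rewrite ler_wpM2l ?invr_ge0 ?exprn_ge0// lerXn2r ?nnegrE ?g2//.
  by apply: sumr_ge0 => k _; rewrite exprn_ge0.
rewrite /n exprD invfM mulrAC -[leRHS]mul1r ler_wpM2r ?invr_ge0 ?exprn_ge0//.
rewrite mulrC ler_pdivrMr ?exprn_gt0// mul1r lerXn2r ?nnegrE//; lra.
Qed.

Definition C1 : R := 2 * b * (sig^-1 + 1).

Lemma C1_gt0 : 0 < C1.
Proof.
by apply: mulr_gt0; [exact: mulr_gt0|apply: addr_gt0 => //; rewrite invr_gt0].
Qed.

Lemma pr_local Lam (x y : pt) (s : nat) (t : R) : openL Lam -> tube x y `<=` Lam ->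
  C1 * (enorm (y - x) + 1 + s%:R) <= t ->
  pr (~` cev chi Lam rho (2 * rho) x y t) <= 4 ^- s.
Proof.
move=> oL tL ht; apply: le_trans (pr_local_aux s oL tL erefl).
apply: pr_mono; [by apply: measurableC; exact: (measurable_cev hchi)|by apply: measurableC; exact: (measurable_cev hchi)|].
apply: subsetC => w; apply: connW => //; apply: le_trans ht.
set D := enorm _; have D0 : 0 <= D by exact: enorm_ge0.
have [_ N2] := Nl_le D0; rewrite (_ : C1 * _ = b * (2 * ((sig^-1 + 1) * (D + 1 + s%:R)))); last by rewrite /C1; ring.
rewrite ler_pM2l//.
have s0 : (0 : R) <= s%:R by [].
have i0 : 0 < sig^-1 by rewrite invr_gt0.
have v0 : 0 <= sig^-1 * s%:R by rewrite mulr_ge0// ltW.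
have u0 : 0 <= sig^-1 * D by rewrite mulr_ge0// ltW.
have -> : 2 * ((sig^-1 + 1) * (D + 1 + s%:R)) =
  2 * (sig^-1 * D) + 2 * sig^-1 + 2 * (sig^-1 * s%:R) + 2 * D + 2 + 2 * s%:R by ring.
move: N2; rewrite (mulrC D); move: u0 v0; set u := sig^-1 * D; set v := _ * s%:R; lra.
Qed.

End Local.

(** * The time constant *)

Section FiniteExpectation.
Context {R : realType} {dO : measure_display} {Omega : measurableType dO}.
Variable P : probability Omega R.
Local Notation pr := (pr P).

Definition ind (B : set Omega) w : R := (`[< B w >] : bool)%:R.

Lemma pr_pattern_sum (I : finType) (V : I -> set Omega) (g : pred {set I}) :
  (forall i, measurable (V i)) ->
  pr [set w | g (pattern V w)] = \sum_(S : {set I} | g S) pr [set w | pattern V w = S].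
Proof.
move=> mV.
have mE S : measurable [set w | pattern V w = S].
  rewrite patternE.
  apply: measurableI; apply: measurable_forall_in => i //; exact: measurableC.
set r := index_enum _.
have ur : uniq r := index_enum_uniq _.
have mr S : S \in r := mem_index_enum S.
rewrite -big_filter.
rewrite [X in pr X](_ : _ = [set w | exists2 S, S \in [seq S <- r | g S]
   & [set w | pattern V w = S] w]); last first.
  apply/seteqP; split => w /=.
    by move=> gw; exists (pattern V w) => //; rewrite mem_filter gw mr.
  by move=> [S]; rewrite mem_filter => /andP[gS _] ->.
have := filter_uniq g ur.
elim: [seq x <- r | g x] => [_|S s ih /= /andP[Ss us]].
  by rewrite big_nil [X in pr X](_ : _ = set0) ?pr0// -subset0 => w [].
rewrite big_cons -ih//.
rewrite [X in pr X](_ : _ = [set w | pattern V w = S] `|`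
   [set w | exists2 S, S \in s & [set w | pattern V w = S] w]); last first.
  apply/seteqP; split => w /=.
    by move=> [i]; rewrite inE => /orP[/eqP ->|si] Fi; [left|right; exists i].
  by move=> [Fj|[i si Fi]]; [exists S; rewrite ?mem_head|exists i; rewrite ?inE ?si ?orbT].
rewrite prU//.
  by apply: measurable_exists_in => i _.
by rewrite -subset0 => w /= [-> [T Ts ST]]; rewrite ST Ts in Ss.
Qed.

Lemma exp_le (I : finType) (B : I -> set Omega) (c : I -> R) :
  (forall i, measurable (B i)) ->
  (forall w, 0 <= \sum_i c i * ind (B i) w) -> 0 <= \sum_i c i * pr (B i).
Proof.
move=> mB h; pose V i := ~` B i.
have mV i : measurable (V i) by exact: measurableC.
have Bp i w : (i \in pattern V w) = `[< B i w >].
  by rewrite inE /V /setC /= asbool_neg negbK.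
have -> : \sum_i c i * pr (B i) = \sum_(S : {set I}) (\sum_i c i * (i \in S)%:R) * pr [set w | pattern V w = S].
  have e i : pr (B i) = \sum_(S : {set I}) (i \in S)%:R * pr [set w | pattern V w = S].
    rewrite [B i](_ : _ = [set w | (fun S : {set I} => i \in S) (pattern V w)]); last first.
      by apply/seteqP; split => w /=; rewrite Bp => /asboolP.
    rewrite (@pr_pattern_sum I V (fun S => i \in S))// big_mkcond/=; apply: eq_bigr => S _.
    by case: (i \in S); rewrite ?mul1r ?mul0r.
  under eq_bigr do rewrite e mulr_sumr.
  rewrite exchange_big/=; apply: eq_bigr => S _; rewrite mulr_suml; apply: eq_bigr => i _.
  by rewrite mulrA.
apply: sumr_ge0 => S _.
have [[w wS]|nw] := pselect (exists w, pattern V w = S).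
  apply: mulr_ge0; last exact: pr_ge0.
  have := h w; congr (0 <= _); apply: eq_bigr => i _.
  by rewrite -wS Bp.
rewrite [X in pr X](_ : _ = set0) ?pr0 ?mulr0// -subset0 => w wS.
by apply: nw; exists w.
Qed.

Lemma indP (B : set Omega) w : (ind B w = 1 /\ B w) \/ (ind B w = 0 /\ ~ B w).
Proof. by rewrite /ind; case: asboolP; [left|right]. Qed.

Lemma ind_ge0 (B : set Omega) w : 0 <= ind B w.
Proof. by case: (indP B w) => -[-> _]. Qed.

Lemma indI (A B : set Omega) w : ind (A `&` B) w = ind A w * ind B w.
Proof.
case: (indP A w) => -[-> a]; case: (indP B w) => -[-> b]; case: (indP (A `&` B) w) => -[-> ab];
  rewrite ?(mulr0,mul0r,mulr1)//; [by case: ab|by case: ab|by case: ab|by case: ab].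
Qed.

Lemma measurable_sum_ind (I : finType) (B : I -> set Omega) (c : R) :
  (forall i, measurable (B i)) -> measurable [set w | c <= \sum_i ind (B i) w].
Proof.
move=> mB; pose V i := ~` B i.
have Bp i w : (i \in pattern V w) = `[< B i w >].
  by rewrite inE /V /setC /= asbool_neg negbK.
rewrite [X in measurable X](_ : _ = [set w | (fun S : {set I} => c <= \sum_(i : I) (i \in S)%:R) (pattern V w)]).
  apply: (@measurable_pattern _ _ _ V _ (fun S : {set I} => c <= \sum_(i : I) (i \in S)%:R)) => i; exact: measurableC.
apply/seteqP; split => w /=; congr (_ <= _); apply: eq_bigr => i _; by rewrite Bp.
Qed.

Lemma chebyshev_ind (I : finType) (B : I -> set Omega) (c u : R) :
  (forall i, measurable (B i)) -> 0 < u ->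
  u ^+ 2 * pr [set w | c + u <= \sum_i ind (B i) w] <=
  \sum_(i : I) \sum_(j : I) pr (B i `&` B j) - 2 * c * (\sum_i pr (B i)) + c ^+ 2.
Proof.
move=> mB u0; pose T : finType := (I * I + (I + bool))%type.
pose D := [set w | c + u <= \sum_i ind (B i) w].
have mD : measurable D by exact: measurable_sum_ind.
pose F (x : T) := match x with inl p => B p.1 `&` B p.2 | inr (inl i) => B i
  | inr (inr true) => setT | inr (inr false) => D end.
pose k (x : T) := match x with inl p => 1 | inr (inl i) => - 2 * c
  | inr (inr true) => c ^+ 2 | inr (inr false) => - u ^+ 2 end.
have mF x : measurable (F x) by case: x => [[i j]|[i|[]]] //=; exact: measurableI.
have sumT (f : T -> R) : \sum_x f x = \sum_i \sum_j f (inl (i, j)) + (\sum_i f (inr (inl i)) +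
   (f (inr (inr true)) + f (inr (inr false)))).
  rewrite big_sumType/= big_sumType/= pair_bigA/=; congr (_ + (_ + _)); first by apply: eq_bigr => -[].
  by rewrite big_bool.
have := @exp_le T F k mF.
rewrite sumT /= prT mulr1 => h.
have : 0 <= \sum_i \sum_j 1 * pr (B i `&` B j) + (\sum_i - 2 * c * pr (B i) + (c ^+ 2 + - u ^+ 2 * pr D)).
  apply: h => w; rewrite sumT /=.
  set S := \sum_i ind (B i) w.
  have -> : \sum_i \sum_j 1 * ind (B i `&` B j) w = S * S.
    rewrite /S mulr_suml; apply: eq_bigr => i _; rewrite mulr_sumr; apply: eq_bigr => j _.
    by rewrite mul1r indI.
  rewrite -mulr_sumr -/S.
  have -> : ind setT w = 1 by case: (indP setT w) => -[]//= _; case.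
  have -> : S * S + (- 2 * c * S + (c ^+ 2 * 1 + - u ^+ 2 * ind D w)) = (S - c) ^+ 2 - u ^+ 2 * ind D w by ring.
  case: (indP D w) => -[-> hD]; last by rewrite mulr0 subr0 sqr_ge0.
  have hh : u <= S - c by move: hD; rewrite /D /= -/S; lra.
  by rewrite mulr1 subr_ge0 lerXn2r ?nnegrE ?(ltW u0) ?(le_trans (ltW u0) hh).
rewrite -mulr_sumr.
rewrite (eq_bigr (fun i => \sum_j pr (B i `&` B j))) => [|i _]; last by apply: eq_bigr => j _; rewrite mul1r.
rewrite -/D; lra.
Qed.

Lemma pr_nd_approx (F : nat -> set Omega) (e : R) : (forall n, measurable (F n)) ->
  (forall n, F n `<=` F n.+1) -> 0 < e ->
  exists n, pr [set w | exists n, F n w] <= pr (F n) + e.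
Proof.
move=> mF ndF e0; have -> : [set w | exists n, F n w] = \bigcup_n F n.
  by apply/seteqP; split => w /=; [move=> [n]; exists n|move=> [n _]; exists n].
have mU : measurable (\bigcup_n F n) by exact: bigcupT_measurable.
have nd : nondecreasing_seq F by apply/nondecreasing_seqP => l; apply/subsetPset; exact: ndF.
have h := nondecreasing_cvg_mu (mu := P) mF mU nd.
have {h} : (fun l => pr (F l)) @ \oo --> pr (\bigcup_n F n).
  have /fine_cvgP[_ h2] : (P \o F) @ \oo --> (pr (\bigcup_n F n))%:E by rewrite -prE.
  exact: h2.
move=> /cvgrPdist_le /(_ e e0)[l _ /(_ l (leqnn l))/= h]; exists l.
by move: h; rewrite ler_norml; lra.
Qed.

End FiniteExpectation.

Section TailSum.
Context {R : realType}.

Lemma tail_sum (q : nat -> R) (K N : nat) : (forall j, 0 <= q j) ->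
  (forall s j, (K * (N + s) <= j)%N -> q j <= 4 ^- s) ->
  forall s H, \sum_(K * (N + s) <= j < H) q j <= 2 * K%:R * 4 ^- s.
Proof.
move=> q0 hq s H.
have key m : \sum_(K * (N + s) <= j < K * (N + (s + m))) q j <= 2 * K%:R * (4 ^- s - 4 ^- (s + m)).
  elim: m => [|m ih]; first by rewrite addn0 big_geq// subrr mulr0.
  have le1 : (K * (N + s) <= K * (N + (s + m)))%N by rewrite leq_mul2l leq_add2l leq_addr orbT.
  have le2 : (K * (N + (s + m)) <= K * (N + (s + m.+1)))%N by rewrite leq_mul2l leq_add2l leq_add2l leqnSn orbT.
  rewrite (big_cat_nat _ (n := (K * (N + (s + m)))%N))//=.
  have h : \sum_(K * (N + (s + m)) <= j < K * (N + (s + m.+1))) q j <= K%:R * 4 ^- (s + m).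
    apply: le_trans (_ : \sum_(K * (N + (s + m)) <= j < K * (N + (s + m.+1))) 4 ^- (s + m) <= _).
      rewrite big_nat [leRHS]big_nat; apply: ler_sum => j /andP[h1 _]; exact: hq.
    rewrite sumr_const_nat -(mulr_natl (4 ^- (s + m))) ler_wpM2r ?invr_ge0 ?exprn_ge0// ler_nat.
    by rewrite -mulnBr addnS addnS subSnn muln1.
  have K0 : (0 : R) <= K%:R by [].
  have e4 : 4 ^- (s + m.+1) = 4 ^- (s + m) / 4 :> R by rewrite addnS exprSr invfM mulrC.
  rewrite e4; apply: le_trans (lerD ih h) _.
  have : 0 <= K%:R * 4 ^- (s + m) :> R by rewrite mulr_ge0// invr_ge0 exprn_ge0.
  set a := K%:R * 4 ^- (s + m) => a0.
  have -> : 2 * K%:R * (4 ^- s - 4 ^- (s + m)) = 2 * K%:R * 4 ^- s - 2 * a by rewrite /a; ring.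
  have -> : 2 * K%:R * (4 ^- s - 4 ^- (s + m) / 4) = 2 * K%:R * 4 ^- s - a / 2.
    by rewrite /a; set y := 4 ^- (s + m); set x := 4 ^- s; field.
  lra.
have g0 m : 0 <= 2 * K%:R * 4 ^- m :> R by rewrite mulr_ge0 ?mulr_ge0// invr_ge0 exprn_ge0.
have [HK|HK] := leqP H (K * (N + s))%N; first by rewrite big_geq.
case: K => [|K] in hq key g0 HK *.
  rewrite mul0n in HK *; rewrite big1_seq ?mulr0 ?mul0r// => j _; apply/eqP; rewrite eq_le q0 andbT.
  apply/ler_addgt0Pr => e e0; rewrite add0r.
  have [l hl] := exists_pow2_gt e^-1.
  apply: le_trans (hq l j _) _; first by rewrite mul0n.
  rewrite -[leRHS]invrK lef_pV2 ?posrE ?exprn_gt0 ?invr_gt0// ltW//.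
  apply: lt_le_trans (hl l (leqnn l)) _; rewrite lerXn2r ?nnegrE//; lra.
have hH : (H <= K.+1 * (N + (s + H)))%N by rewrite addnA mulnDr (leq_trans _ (leq_addl _ _))// leq_pmull.
apply: le_trans (_ : \sum_(K.+1 * (N + s) <= j < K.+1 * (N + (s + H))) q j <= _).
  rewrite [leRHS](big_cat_nat _ (n := H))//= ?(ltnW HK)// lerDl; exact: sumr_ge0.
apply: le_trans (key H) _; rewrite mulrBr gerBl; exact: g0.
Qed.

Lemma pow4V_small (e : R) : 0 < e -> exists s, 4 ^- s < e.
Proof.
move=> e0; have [l hl] := exists_pow2_gt e^-1; exists l.
rewrite -[ltRHS]invrK ltf_pV2 ?posrE ?exprn_gt0 ?invr_gt0//.
apply: lt_le_trans (hl l (leqnn l)) _; rewrite lerXn2r ?nnegrE//; lra.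
Qed.

Lemma natceil (x : R) : exists n : nat, x <= n%:R.
Proof.
exists (Num.truncn `|x|).+1; apply: le_trans (ler_norm x) _; apply: ltW.
by case/andP: (truncn_itv (normr_ge0 x)).
Qed.

End TailSum.

Section TimeConstant.
Context {R : realType} {d : nat} {dO : measure_display} {Omega : measurableType dO}.
Variables (P : probability Omega R) (mu : probability R R).
Variable chi : Omega -> set (@mpoint R d).
Hypothesis hchi : is_PPP P mu chi.
Hypothesis hd : (0 < d)%N.
Local Notation pr := (pr P).
Local Notation pt := 'rV[R]_d.
Local Notation mpt := (@mpoint R d).
Variables (r0 R1 : R).
Hypothesis r00 : 0 < r0.
Hypothesis pJ0 : 0 < fine (mu `]r0, R1[%classic).
Local Notation rho := (rho r0).
Local Notation C1 := (@C1 R d mu r0 R1).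
Local Notation tube := (@tube R d r0 R1).

Definition e1 : pt := eb (Ordinal hd).

Definition qf (y : R) (j : nat) : R := pr (~` cev chi setT rho rho 0 (y *: e1) j%:R).

Lemma enorm_e1 : enorm e1 = 1. Proof. exact: enorm_eb. Qed.

Lemma rho_gt0 : 0 < rho. Proof. by rewrite divr_gt0. Qed.

Lemma qfE x y j : pr (~` cev chi setT rho rho x y j%:R) = qf (enorm (y - x)) j.
Proof.
rewrite /qf !prC; last 2 first.
- exact: (measurable_cev hchi) openLT.
- exact: (measurable_cev hchi) openLT.
congr (1 - _); apply: (cev_law hchi hd).
by rewrite subr0 enormZ enorm_e1 mulr1 ger0_norm// enorm_ge0.
Qed.

Lemma pr_local' Lam (x y : pt) (s : nat) (t : R) : openL Lam -> tube x y `<=` Lam ->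
  C1 * (enorm (y - x) + 1 + s%:R) <= t ->
  pr (~` cev chi Lam rho rho x y t) <= 4 ^- s.
Proof.
move=> oL tL ht; apply: le_trans (pr_local hchi hd r00 pJ0 oL tL ht).
apply: pr_mono; [by apply: measurableC; exact: (measurable_cev hchi)|by apply: measurableC; exact: (measurable_cev hchi)|].
apply: subsetC => w; apply: conn_mono => //; rewrite subrr enorm0 add0r//.
have := rho_gt0; lra.
Qed.

Definition K1 : nat := (Num.truncn C1).+1.

Lemma C1K1 : C1 <= K1%:R.
Proof.
apply: ltW; have := C1_gt0 hd r00 pJ0 => /ltW/truncn_itv/andP[_ h].
exact: h.
Qed.

Lemma cev_tail Lam x y (N s j : nat) : openL Lam -> tube x y `<=` Lam -> enorm (y - x) + 1 <= N%:R ->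
  (K1 * (N + s) <= j)%N -> pr (~` cev chi Lam rho rho x y j%:R) <= 4 ^- s.
Proof.
move=> oL tL hN hj; apply: pr_local' => //.
apply: le_trans (_ : K1%:R * (N + s)%:R <= _); last by rewrite -natrM ler_nat.
apply: ler_pM; [exact: ltW (C1_gt0 hd r00 pJ0)| |exact: C1K1|by rewrite natrD lerD2r].
by rewrite addr_ge0// addr_ge0// enorm_ge0.
Qed.

Definition Nof (y : R) : nat := (Num.truncn y).+2.

Lemma Nof_ge y : 0 <= y -> y + 1 <= (Nof y)%:R.
Proof. by move=> /truncn_itv/andP[_ h]; rewrite /Nof -natr1 lerD2r ltW. Qed.

Lemma qf_tail y s j : 0 <= y -> (K1 * (Nof y + s) <= j)%N -> qf y j <= 4 ^- s.
Proof.
move=> y0 hj; apply: cev_tail hj => //; first exact: openLT.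
by rewrite subr0 enormZ enorm_e1 mulr1 ger0_norm// Nof_ge.
Qed.

Lemma qf_ge0 y j : 0 <= qf y j. Proof. exact: pr_ge0. Qed.

Lemma qf_le1 y j : qf y j <= 1.
Proof. by apply: pr_le1; apply: measurableC; exact: (measurable_cev hchi) openLT. Qed.

Definition qsum y H := \sum_(j < H) qf y j.

Lemma qsum_le y H : 0 <= y -> qsum y H <= (K1 * Nof y)%:R + 2 * K1%:R.
Proof.
move=> y0; rewrite /qsum -(big_mkord xpredT (qf y)).
have h := tail_sum (qf_ge0 y) (fun s j => @qf_tail y s j y0) 0 H.
rewrite addn0 expr0 invr1 mulr1 in h.
have [HK|HK] := leqP H (K1 * Nof y)%N.
  apply: le_trans (_ : H%:R <= _).
    apply: le_trans (_ : \sum_(0 <= j < H) 1 <= _); first by apply: ler_sum => j _; exact: qf_le1.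
    by rewrite sumr_const_nat subn0.
  apply: le_trans (_ : (K1 * Nof y)%:R <= _); first by rewrite ler_nat.
  by rewrite lerDl mulr_ge0.
rewrite (big_cat_nat _ (n := (K1 * Nof y)%N))//= ?(ltnW HK)//; apply: lerD => //.
apply: le_trans (_ : \sum_(0 <= j < K1 * Nof y) 1 <= _); first by apply: ler_sum => j _; exact: qf_le1.
by rewrite sumr_const_nat subn0.
Qed.

(* The sum of the tails is the expectation of the passage time rounded up. *)
Definition alpha y := sup [set qsum y H | H in [set: nat]].

Lemma has_sup_qsum y : 0 <= y -> has_sup [set qsum y H | H in [set: nat]].
Proof.
move=> y0; split; first by exists (qsum y 0), 0%N.
by exists ((K1 * Nof y)%:R + 2 * K1%:R) => _ [H _ <-]; exact: qsum_le.
Qed.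

Lemma qsum_alpha y H : 0 <= y -> qsum y H <= alpha y.
Proof. by move=> y0; apply: (ub_le_sup (has_sup_qsum y0).2); exists H. Qed.

Lemma alpha_le y z : 0 <= y -> (forall H, qsum y H <= z) -> alpha y <= z.
Proof. by move=> y0 h; apply: (ge_sup (has_sup_qsum y0).1) => _ [H _ <-]. Qed.

Lemma alpha_ge0 y : 0 <= y -> 0 <= alpha y.
Proof. by move=> y0; apply: le_trans (qsum_alpha 0 y0); rewrite /qsum big_ord0. Qed.

Definition lam := inf [set alpha y / y | y in [set y : R | 1 <= y]].

Lemma has_inf_lam : has_inf [set alpha y / y | y in [set y : R | 1 <= y]].
Proof.
split; first by exists (alpha 1 / 1), 1 => //=.
by exists 0 => _ [y /= y1 <-]; rewrite divr_ge0 ?alpha_ge0//; move: y1; lra.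
Qed.

Lemma lam_ge0 : 0 <= lam.
Proof.
apply: (lb_le_inf has_inf_lam.1) => _ [y /= y1 <-].
by rewrite divr_ge0 ?alpha_ge0//; move: y1; lra.
Qed.

Lemma lam_le y : 1 <= y -> lam * y <= alpha y.
Proof.
move=> y1; rewrite -ler_pdivlMr; last by move: y1; lra.
by apply: (ge_inf has_inf_lam.2); exists y.
Qed.

Lemma lam_approx (e : R) : 0 < e -> exists2 m, 1 <= m & alpha m < (lam + e) * m.
Proof.
move=> e0; have [_ [m m1 <-] h] := inf_adherent e0 has_inf_lam.
by exists m => //; rewrite -ltr_pdivrMr//; move: m1 => /=; lra.
Qed.

End TimeConstant.

(** * The upper bound *)

Section Elementary.
Context {R : realType}.

Lemma near_count (k K i : nat) :
  (\sum_(i' < k) (((i < i' + K) && (i' < i + K))%N : nat) <= 2 * K)%N.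
Proof.
rewrite -(big_mkord xpredT (fun i' => (((i < i' + K) && (i' < i + K))%N : nat))).
rewrite (eq_bigr (fun i' => if ((i < i' + K) && (i' < i + K))%N then 1%N else 0%N)); last first.
  by move=> i' _; case: (_ && _).
rewrite -big_mkcond sum1_count -size_filter.
rewrite -[leqRHS](size_iota (i - K)); apply: uniq_leq_size.
  by rewrite filter_uniq// iota_uniq.
move=> x; rewrite mem_filter mem_iota => /andP[/andP[h1 h2] _].
apply/andP; split; first by rewrite leq_subLR addnC ltnW.
have [iK|iK] := leqP K i.
  by rewrite mul2n -addnn addnA subnK.
have -> : (i - K = 0)%N by apply/eqP; rewrite subn_eq0 ltnW.
by rewrite add0n mul2n -addnn (leq_trans h2)// leq_add2r ltnW.
Qed.

Lemma lin_pow2 (A : R) : exists n0, forall n, (n0 <= n)%N -> A * n.+1%:R <= 2 ^+ n.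
Proof.
have [l hl] := exists_pow2_gt (2 * A); exists l.*2 => n ln.
have lh : (l <= n./2)%N by rewrite -[l]doubleK half_leq.
have [A0|A0] := lerP A 0.
  by apply: le_trans (_ : 0 <= _); rewrite ?exprn_ge0// mulr_le0_ge0.
set h := n./2; have hn : n = (odd n + h.*2)%N by rewrite odd_double_half.
have n1 : (n.+1 <= h.+1.*2)%N by rewrite hn doubleS -add1n -add2n addnA leq_add2r; case: (odd n).
apply: le_trans (_ : A * (2 * h.+1%:R) <= _).
  by rewrite ler_pM2l// -natrM ler_nat mul2n.
apply: le_trans (_ : 2 ^+ h * 2 ^+ h <= _); last first.
  by rewrite -exprD addnn ler_eXn2l ?ltr1n// [leqRHS]hn leq_addl.
rewrite mulrCA mulrA mulrC; apply: ler_pM; rewrite ?ler0n//; first by rewrite mulr_ge0// ltW.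
  by rewrite -natrX ler_nat ltn_expl.
exact: ltW (hl h lh).
Qed.

Lemma sum_lin_pow2V N : \sum_(n < N) (n.+1%:R / 2 ^+ n) <= 4 :> R.
Proof.
suff -> : \sum_(n < N) (n.+1%:R / 2 ^+ n) = 4 - (2 * N%:R + 4) / 2 ^+ N :> R.
  by rewrite gerBl divr_ge0 ?exprn_ge0// addr_ge0// mulr_ge0.
elim: N => [|N ih]; first by rewrite big_ord0 expr0 mulr0 add0r divr1 subrr.
rewrite big_ord_recr/= ih exprS -!natr1.
have p0 : (2 : R) ^+ N != 0 by rewrite expf_neq0.
by field.
Qed.

Lemma sum_ord_const k (a : R) : \sum_(i < k) a = k%:R * a.
Proof. by rewrite sumr_const card_ord mulr_natl. Qed.

Lemma sum_pair (I J : finType) (f : I * J -> R) : \sum_a f a = \sum_i \sum_j f (i, j).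
Proof. by rewrite pair_bigA; apply: eq_bigr => -[]. Qed.

End Elementary.

Section Grids.
Context {R : realType} {d : nat}.

Definition gpt (g : R) (M : nat) (z : {ffun 'I_d -> 'I_(2 * M).+1}) : 'rV[R]_d :=
  \row_i (g * ((z i)%:R - M%:R)).

Lemma gpt_approx (g : R) (M : nat) (x : 'rV[R]_d) : 0 < g ->
  (forall i, `|x ord0 i| <= g * M%:R) -> exists z : {ffun 'I_d -> 'I_(2 * M).+1}, enorm (x - gpt g z) <= d%:R * g.
Proof.
move=> g0 hx.
have h i : exists k : 'I_(2 * M).+1, `|x ord0 i - g * (k%:R - M%:R)| <= g.
  have /andP[h1 h2] : - (g * M%:R) <= x ord0 i <= g * M%:R by rewrite -ler_norml.
  have y0 : 0 <= x ord0 i / g + M%:R by rewrite -(pmulr_rge0 _ g0) mulrDr mulrCA divff ?gt_eqF// mulr1; lra.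
  have /andP[t1 t2] := truncn_itv y0.
  have kM : (Num.truncn (x ord0 i / g + M%:R) < (2 * M).+1)%N.
    rewrite ltnS -(ler_nat R); apply: le_trans t1 _.
    rewrite natrM mulr_natl mulr2n lerD2r ler_pdivrMr// mulrC; exact: h2.
  exists (Ordinal kM) => /=; set k := Num.truncn _ in t1 t2 kM *.
  have e : x ord0 i = g * (x ord0 i / g) by rewrite mulrCA divff ?gt_eqF// mulr1.
  rewrite {1}e -mulrBr normrM (gtr0_norm g0) -[leRHS]mulr1 ler_pM2l//.
  by rewrite ler_norml; move: t1 t2; rewrite -natr1; lra.
have [f hf] := choice h; exists (finfun f); apply: enorm_le_coord => i.
by rewrite !mxE ffunE.
Qed.

End Grids.

Section UpperBound.
Context {R : realType} {d : nat} {dO : measure_display} {Omega : measurableType dO}.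
Variables (P : probability Omega R) (mu : probability R R).
Variable chi : Omega -> set (@mpoint R d).
Hypothesis hchi : is_PPP P mu chi.
Hypothesis hd : (0 < d)%N.
Local Notation pr := (pr P).
Local Notation pt := 'rV[R]_d.
Local Notation mpt := (@mpoint R d).
Variables (r0 R1 : R).
Hypothesis r00 : 0 < r0.
Hypothesis pJ0 : 0 < fine (mu `]r0, R1[%classic).
Local Notation rho := (rho r0).
Local Notation C1 := (@C1 R d mu r0 R1).
Local Notation tube := (@tube R d r0 R1).
Local Notation K1 := (@K1 R d mu r0 R1).
Local Notation alpha := (alpha P chi hd r0).
Local Notation lam := (lam P chi hd r0).
Local Notation qf := (qf P chi hd r0).

Definition Lb (a : pt) (r : R) : set mpt := [set p | enorm (mctr p - a) < r].

Lemma openL_Lb a r : openL (Lb a r).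
Proof.
move=> p hp; pose e := (r - enorm (mctr p - a)) / (d%:R + 1).
have n0 : (0 : R) < d%:R + 1 by rewrite ltr_wpDl.
have e0 : 0 < e by rewrite divr_gt0// subr_gt0.
exists e => // q /mclose_enorm h.
apply: le_lt_trans (enorm_tri (mctr p) _ _) _.
have : d%:R * e < r - enorm (mctr p - a).
  by rewrite /e mulrCA -[ltRHS]mulr1 ltr_pM2l ?subr_gt0// ltr_pdivrMr// mul1r ltrDl.
by move: h; set b := _ * e; lra.
Qed.

Lemma tube_Lb x y a r : enorm (x - a) + enorm (y - x) + rho < r -> tube x y `<=` Lb a r.
Proof.
move=> h p [_ [_ [th /andP[t0 t1] hp]]]; apply: le_lt_trans h.
apply: le_trans (enorm_tri (x + th *: (y - x)) _ _) _.
rewrite addrC lerD//.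
have -> : x + th *: (y - x) - a = (x - a) + th *: (y - x) by rewrite addrAC.
apply: le_trans (enormD _ _) _; rewrite enormZ ger0_norm// lerD2l.
by rewrite -[leRHS]mul1r ler_wpM2r// enorm_ge0.
Qed.

Lemma measC Lam r1 r2 x y t : openL Lam -> measurable (~` cev chi Lam r1 r2 x y t).
Proof. by move=> oL; apply: measurableC; exact: (measurable_cev hchi). Qed.

Lemma restricted_alpha (e : pt) (m z : R) : enorm e = 1 -> 1 <= m -> alpha m < z ->
  exists R0, exists2 z', z' < z & [/\ 0 < R0, tube 0 (m *: e) `<=` Lb 0 R0 &
    forall H, \sum_(j < H) pr (~` cev chi (Lb 0 R0) rho rho 0 (m *: e) j%:R) <= z'].
Proof.
move=> e1 m1 az; have m0 : 0 <= m by move: m1; lra.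
pose dl := z - alpha m; have dl0 : 0 < dl by rewrite subr_gt0.
have nm : enorm (m *: e) = m by rewrite enormZ e1 mulr1 ger0_norm.
have rp : 0 < rho := rho_gt0 r00.
pose Rn (n : nat) := m + rho + 1 + n%:R.
have tubeR n : tube 0 (m *: e) `<=` Lb 0 (Rn n).
  apply: tube_Lb; rewrite subr0 enorm0 subr0 nm /Rn.
  by have : (0 : R) <= n%:R by []; lra.
have K10 : (0 : R) < K1%:R by rewrite ltr0n.
have [s hs] := pow4V_small (divr_gt0 dl0 (mulr_gt0 (ltr0Sn R 7) K10)).
set J := (K1 * (Nof m + s))%N.
have appr j : exists n, forall n', (n <= n')%N ->
    pr (~` cev chi (Lb 0 (Rn n')) rho rho 0 (m *: e) j%:R) <= qf m j + dl / 4 / J.+1%:R.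
  have de : 0 < dl / 4 / J.+1%:R by rewrite !divr_gt0// ltr0n.
  have mono n n' : (n <= n')%N -> cev chi (Lb 0 (Rn n)) rho rho 0 (m *: e) j%:R `<=` cev chi (Lb 0 (Rn n')) rho rho 0 (m *: e) j%:R.
    move=> nn w; apply: connW => // p [h1 h2]; split => //; apply: lt_le_trans h2 _.
    by rewrite /Rn lerD2l ler_nat.
  have [||n hn] := @pr_nd_approx _ _ _ P (fun n => cev chi (Lb 0 (Rn n)) rho rho 0 (m *: e) j%:R) _ _ _ de.
  - by move=> n; apply: (measurable_cev hchi); exact: openL_Lb.
  - by move=> n; exact: mono.
  exists n => n' nn.
  have mc k : measurable (cev chi (Lb 0 (Rn k)) rho rho 0 (m *: e) j%:R).
    by apply: (measurable_cev hchi); exact: openL_Lb.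
  have : pr (cev chi setT rho rho 0 (m *: e) j%:R) <=
     pr [set w | exists n, cev chi (Lb 0 (Rn n)) rho rho 0 (m *: e) j%:R w].
    apply: pr_mono; [by apply: (measurable_cev hchi); exact: openLT|exact: measurable_exists_nat|].
    move=> w [p [sq [hp h1 h2 h3 h4]]].
    have [n1 hn1] := natceil (\sum_(q <- p :: sq) enorm (mctr q)).
    exists n1, p, sq; split => // q qp; split; first by case: (hp q qp).
    rewrite /Lb /= subr0.
    apply: le_lt_trans (_ : n1%:R < _); last by rewrite /Rn; move: m1 rp; lra.
    apply: le_trans hn1; rewrite (big_rem q)//= lerDl; apply: sumr_ge0 => ? _; exact: enorm_ge0.
  have : pr (cev chi (Lb 0 (Rn n)) rho rho 0 (m *: e) j%:R) <= pr (cev chi (Lb 0 (Rn n')) rho rho 0 (m *: e) j%:R).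
    by apply: pr_mono => //; exact: mono.
  have := qfE hchi hd r0 0 (m *: e) j; rewrite subr0 nm => <-.
  rewrite !prC//; last by apply: (measurable_cev hchi); exact: openLT.
  move=> h1 h2; have h3 := le_trans (le_trans h2 hn) (lerD h1 (lexx _)).
  have aux (a b c : R) : b <= a + c -> 1 - a <= 1 - b + c by lra.
  exact: aux h3.
have [n hn] : exists n, forall j, (j < J)%N ->
    pr (~` cev chi (Lb 0 (Rn n)) rho rho 0 (m *: e) j%:R) <= qf m j + dl / 4 / J.+1%:R.
  elim: (J) (dl / 4 / J.+1%:R) appr => [|J' ih] c appr; first by exists 0%N.
  have [n1 h1] : exists n, forall n', (n <= n')%N -> forall j, (j < J')%N ->
    pr (~` cev chi (Lb 0 (Rn n')) rho rho 0 (m *: e) j%:R) <= qf m j + c.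
    elim: J' {ih} => [|J' [n ih]]; first by exists 0%N.
    have [n2 h2] := appr J'; exists (maxn n n2) => n'; rewrite geq_max => /andP[a1 a2] j.
    by rewrite ltnS leq_eqVlt => /orP[/eqP ->|jJ]; [exact: h2|exact: ih].
  have [n2 h2] := appr J'; exists (maxn n1 n2) => j.
  rewrite ltnS leq_eqVlt => /orP[/eqP ->|jJ]; [apply: h2|apply: h1 => //]; rewrite ?leq_maxr ?leq_maxl//.
exists (Rn n), (alpha m + dl / 2); first by rewrite /dl; lra.
split => //; first by rewrite /Rn; have : (0 : R) <= n%:R by []; move: rp m1; lra.
move=> H; pose q j := pr (~` cev chi (Lb 0 (Rn n)) rho rho 0 (m *: e) j%:R).
have q0 j : 0 <= q j by exact: pr_ge0.
have qt s' j : (K1 * (Nof m + s') <= j)%N -> q j <= 4 ^- s'.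
  move=> hj; apply: (cev_tail hchi hd r00 pJ0) hj => //; first exact: openL_Lb.
  by rewrite subr0 nm Nof_ge.
have T := tail_sum q0 qt s H; rewrite -/J in T.
have {}T : \sum_(J <= j < H) q j <= dl / 4.
  apply: le_trans T _; move/ltW: hs; rewrite ler_pdivlMr ?mulr_gt0//.
  by move=> hs; apply: le_trans (_ : 4 ^- s * (8 * K1%:R) / 4 <= _); [apply: le_of_eq; field; rewrite expf_neq0|lra].
have A : \sum_(0 <= j < J) q j <= alpha m + dl / 4.
  apply: le_trans (_ : \sum_(0 <= j < J) (qf m j + dl / 4 / J.+1%:R) <= _).
    rewrite big_nat [leRHS]big_nat; apply: ler_sum => j /andP[_ jJ]; exact: hn.
  rewrite big_split/= sumr_const_nat subn0 -(mulr_natl (dl / 4 / J.+1%:R)).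
  apply: lerD.
    by rewrite big_mkord; apply: (qsum_alpha hchi hd r00 pJ0).
  rewrite mulrCA -[leRHS]mulr1 ler_pM2l ?divr_gt0// ler_pdivrMr ?ltr0n// mul1r ler_nat; exact: leqnSn.
rewrite -(big_mkord xpredT q).
have [HJ|HJ] := leqP H J.
  apply: le_trans (_ : \sum_(0 <= j < J) q j <= _); last by move: A dl0; lra.
  by rewrite [leRHS](big_cat_nat _ (n := H))//= lerDl sumr_ge0.
rewrite (big_cat_nat _ (n := J))//= ?(ltnW HJ)//; move: A T; lra.
Qed.

Lemma upper_lln (e : pt) (m z : R) : enorm e = 1 -> 1 <= m -> alpha m < z ->
  exists2 C, 0 <= C & forall k s, (0 < k)%N ->
  pr (~` cev chi setT rho rho 0 ((k%:R * m) *: e) (k%:R * z)) <=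
  k%:R * 4 ^- s + C * (Nof m + s)%:R / k%:R.
Proof.
move=> e1 m1 az; have m0 : 0 <= m by move: m1; lra.
have [R0 [z' z'z [R00 tubeR hz']]] := restricted_alpha e1 m1 az.
have z'0 : 0 <= z' by apply: le_trans (hz' 0%N); rewrite big_ord0.
have [K hK] := natceil (2 * R0 / m).
have mgt0 : 0 < m by move: m1; lra.
exists (2 * K%:R * z' * K1%:R / (z - z') ^+ 2).
  by rewrite !mulr_ge0// invr_ge0 sqr_ge0.
move=> k s k0; set H := (K1 * (Nof m + s))%N.
pose x (i : nat) : pt := (i%:R * m) *: e.
have xD i : x i.+1 = m *: e + x i by rewrite /x -natr1 mulrDl mul1r scalerDl addrC.
pose q j := pr (~` cev chi (Lb 0 R0) rho rho 0 (m *: e) j%:R).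
pose B (a : 'I_k * 'I_H) := ~` cev chi (Lb (x a.1) R0) rho rho (x a.1) (x a.1.+1) (a.2)%:R.
have mB a : measurable (B a) by apply: measC; exact: openL_Lb.
have prB (i j : nat) : pr (~` cev chi (Lb (x i) R0) rho rho (x i) (x i.+1) j%:R) = q j.
  rewrite /q !prC; last 2 first.
  - by apply: (measurable_cev hchi); exact: openL_Lb.
  - by apply: (measurable_cev hchi); exact: openL_Lb.
  congr (1 - _); rewrite xD -{2}[x i]add0r.
  apply: (cev_trans hchi); [exact: openL_Lb|exact: openL_Lb|].
  by move=> p; rewrite /Lb /lift /mctr /= subr0 addrK.
pose zH := \sum_(j < H) q j.
have zHz : zH <= z' by exact: hz'.
have zH0 : 0 <= zH by apply: sumr_ge0 => j _; exact: pr_ge0.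
have kR0 : (0 : R) < k%:R by rewrite ltr0n.
pose F i := ~` cev chi (Lb (x i) R0) rho rho (x i) (x i.+1) H%:R.
have mF i : measurable (F i) by apply: measC; exact: openL_Lb.
pose G := [set w | k%:R * z <= \sum_a ind (B a) w].
have mG : measurable G by exact: measurable_sum_ind.
have sub : ~` cev chi setT rho rho 0 (x k) (k%:R * z) `<=` [set w | exists2 i, i \in iota 0 k & F i w] `|` G.
  move=> w nc; apply: contrapT => /not_orP[nF nG]; apply: nc.
  have cH i : (i < k)%N -> cev chi (Lb (x i) R0) rho rho (x i) (x i.+1) H%:R w.
    by move=> ik; apply: contrapT => h; apply: nF; exists i => //; rewrite mem_iota.
  have /choice[Z hZ] : forall i, exists j : nat, (i < k)%N -> [/\ (j <= H)%N,
      cev chi (Lb (x i) R0) rho rho (x i) (x i.+1) j%:R w &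
      forall j', (j' < j)%N -> ~ cev chi (Lb (x i) R0) rho rho (x i) (x i.+1) j'%:R w].
    move=> i; have [ik|_] := ltnP i k; last by exists 0%N.
    have ex : exists j, `[< cev chi (Lb (x i) R0) rho rho (x i) (x i.+1) j%:R w >] by exists H; apply/asboolP; exact: cH.
    case: (ex_minnP ex) => j /asboolP cj mn; exists j => _; split => //.
      by apply: mn; apply/asboolP; exact: cH.
    by move=> j' jj cj'; have := mn j' (introT (asboolP _) cj'); rewrite leqNgt jj.
  have sumZ : \sum_(i < k) ((Z i)%:R : R) <= \sum_a ind (B a) w.
    rewrite sum_pair; apply: ler_sum => i _.
    have [ZH cZ nZ] := hZ i (ltn_ord i).
    apply: le_trans (_ : \sum_(j < H | (j < Z i)%N) ind (B (i, j)) w <= _); last first.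
      by rewrite [leRHS](bigID (fun j : 'I_H => (j < Z i)%N))/= lerDl sumr_ge0// => j _; exact: ind_ge0.
    rewrite (eq_bigr (fun=> 1)); last first.
      by move=> j jZ; case: (indP (R := R) (B (i, j)) w) => -[-> //] nb; case: nb; exact: (nZ j jZ).
    rewrite -(big_mkord (fun j => j < Z i)%N (fun=> 1)) -(big_nat_widen 0 (Z i) H xpredT) //.
    by rewrite sumr_const_nat subn0.
  have tot : \sum_(i < k) ((Z i)%:R : R) < k%:R * z by apply: le_lt_trans sumZ _; rewrite ltNge; apply/negP.
  have cc n : (n < k)%N -> conn (chi w `&` setT) rho rho 0 (x n.+1) (\sum_(i < n.+1) (Z i)%:R).
    elim: n => [|n ih] nk.
      have [_ + _] := hZ 0%N nk; rewrite big_ord_recr big_ord0 /= add0r.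
      by rewrite {1 2}/x mul0r scale0r; apply: connW => // p [].
    have [_ cn _] := hZ n.+1 nk; rewrite big_ord_recr/=.
    apply: conn_cat (ih (ltnW nk)) _; move: cn; apply: connW => // p [] //.
  by move: (cc k.-1); rewrite prednK// => /(_ (leqnn k)); apply: connW => //; exact: ltW.
apply: le_trans (pr_mono P _ _ sub) _.
- by apply: measC; exact: openLT.
- by apply: measurableU => //; apply: measurable_exists_in => i _.
apply: le_trans (prU_le P _ mG) _; first by apply: measurable_exists_in => i _.
apply: lerD.
  apply: le_trans (pr_exists_in P _) _ => //.
  apply: le_trans (_ : \sum_(i <- iota 0 k) 4 ^- s <= _).
    apply: ler_sum => i _; rewrite prB; apply: (cev_tail hchi hd r00 pJ0) (leqnn _) => //; first exact: openL_Lb.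
    by rewrite subr0 enormZ e1 mulr1 ger0_norm// Nof_ge.
  by rewrite big_const_seq count_predT size_iota iter_addr_0 mulr_natl.
pose c := k%:R * zH; pose u := k%:R * z - c.
have u1 : k%:R * (z - z') <= u by rewrite /u /c -mulrBr ler_pM2l// lerB.
have zz' : 0 < z - z' by rewrite subr_gt0.
have u0 : 0 < u by apply: lt_le_trans u1; rewrite mulr_gt0.
have ch := chebyshev_ind P c mB u0.
have e2 : c + u = k%:R * z by rewrite /u addrC subrK.
rewrite e2 -/G in ch.
have sB : \sum_a pr (B a) = c.
  rewrite sum_pair.
  rewrite (eq_bigr (fun=> zH)); last by move=> i _; apply: eq_bigr => j _; exact: prB.
  by rewrite /c sumr_const card_ord mulr_natl.
have far (i i' : 'I_k) : ~~ ((i < i' + K) && (i' < i + K))%N -> Lb (x i) R0 `&` Lb (x i') R0 = set0.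
  move=> hf; rewrite -subset0 => p [p1 p2].
  have : enorm (x i - x i') < 2 * R0.
    apply: le_lt_trans (enorm_tri (mctr p) _ _) _; rewrite (enormB (x i)).
    by move: p1 p2; rewrite /Lb /=; lra.
  rewrite /x -scalerBl -mulrBl enormZ e1 mulr1 normrM (ger0_norm m0) -ltr_pdivlMr//.
  move=> hlt; have := lt_le_trans hlt hK.
  move: hf; rewrite negb_and -!leqNgt => /orP[h|h].
    rewrite -natrB ?(leq_trans (leq_addr _ _) h)// normr_nat ltr_nat ltnNge => /negP; apply.
    by rewrite leq_subRL ?(leq_trans (leq_addr _ _) h).
  rewrite distrC -natrB ?(leq_trans (leq_addr _ _) h)// normr_nat ltr_nat ltnNge => /negP; apply.
  by rewrite leq_subRL ?(leq_trans (leq_addr _ _) h).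
have cov (i i' : 'I_k) : \sum_(j : 'I_H) \sum_(j' : 'I_H) pr (B (i, j) `&` B (i', j')) <=
    zH * zH + ((i < i' + K) && (i' < i + K))%N%:R * (H%:R * zH).
  have [near|nf] := boolP ((i < i' + K) && (i' < i + K))%N; last first.
    rewrite mul0r addr0; apply: le_of_eq.
    rewrite {2}/zH mulr_sumr exchange_big /=.
    apply: eq_bigr => j' _; rewrite /zH mulr_suml; apply: eq_bigr => j _.
    rewrite (@Gs_indep _ _ _ _ P mu chi hchi (Lb (x i) R0) (Lb (x i') R0)) ?prB//.
    - exact: far.
    - by apply: GsC; apply: (Gs_cev hchi) => //; exact: openL_Lb.
    - by apply: GsC; apply: (Gs_cev hchi) => //; exact: openL_Lb.
  rewrite mul1r; apply: le_trans (_ : H%:R * zH <= _); last by rewrite lerDr mulr_ge0.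
  rewrite /zH mulr_sumr; apply: ler_sum => j _.
  apply: le_trans (_ : \sum_(j' : 'I_H) q j <= _); last by rewrite sumr_const card_ord mulr_natl.
  apply: ler_sum => j' _; rewrite -(prB i j); apply: pr_mono; [exact: measurableI|exact: (mB (i, j))|by move=> w []].
have tot : \sum_a \sum_b pr (B a `&` B b) <= c ^+ 2 + k%:R * ((2 * K)%:R * (H%:R * zH)).
  rewrite sum_pair.
  apply: le_trans (_ : \sum_(i < k) (\sum_(i' < k) (zH * zH + ((i < i' + K) && (i' < i + K))%N%:R * (H%:R * zH))) <= _).
    apply: ler_sum => i _.
    rewrite (eq_bigr (fun j => \sum_(i' < k) \sum_(j' < H) pr (B (i, j) `&` B (i', j')))) => [|j _]; last first.
      by rewrite sum_pair.
    rewrite exchange_big /=; apply: ler_sum => i' _; exact: cov.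
  apply: le_trans (_ : \sum_(i < k) (k%:R * (zH * zH) + (2 * K)%:R * (H%:R * zH)) <= _); last first.
    apply: le_of_eq; transitivity (k%:R * (k%:R * (zH * zH) + (2 * K)%:R * (H%:R * zH))).
      exact: sum_ord_const.
    by rewrite mulrDr; congr (_ + _); rewrite /c; ring.
  apply: ler_sum => i _; rewrite big_split/= sum_ord_const lerD2l -mulr_suml.
  rewrite ler_wpM2r ?mulr_ge0// -natr_sum ler_nat; exact: near_count.
have {}ch : u ^+ 2 * pr G <= k%:R * ((2 * K)%:R * (H%:R * zH)).
  apply: le_trans ch _; rewrite sB; move: tot; rewrite expr2; lra.
have u2 : (k%:R * (z - z')) ^+ 2 <= u ^+ 2.
  by rewrite lerXn2r ?nnegrE ?(ltW u0)// ltW// mulr_gt0.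
have {}ch : (k%:R * (z - z')) ^+ 2 * pr G <= k%:R * ((2 * K)%:R * (H%:R * z')).
  apply: le_trans (ler_wpM2r (pr_ge0 P G) u2) _; apply: le_trans ch _.
  by rewrite !ler_wpM2l.
rewrite -ler_pdivlMl ?exprn_gt0 ?mulr_gt0// in ch.
apply: le_trans ch _; apply: le_of_eq; rewrite /H !natrM.
by field; rewrite !gt_eqF.
Qed.

End UpperBound.

Section Rates.
Context {R : realType} {d : nat} {dO : measure_display} {Omega : measurableType dO}.
Variables (P : probability Omega R) (mu : probability R R).
Variable chi : Omega -> set (@mpoint R d).
Hypothesis hchi : is_PPP P mu chi.
Hypothesis hd : (0 < d)%N.
Local Notation pr := (pr P).
Local Notation pt := 'rV[R]_d.
Local Notation mpt := (@mpoint R d).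
Variables (r0 R1 : R).
Hypothesis r00 : 0 < r0.
Hypothesis pJ0 : 0 < fine (mu `]r0, R1[%classic).
Local Notation rho := (rho r0).
Local Notation C1 := (@C1 R d mu r0 R1).
Local Notation tube := (@tube R d r0 R1).
Local Notation K1 := (@K1 R d mu r0 R1).
Local Notation alpha := (alpha P chi hd r0).
Local Notation lam := (lam P chi hd r0).
Local Notation qf := (qf P chi hd r0).
Let C10 : 0 < C1 := C1_gt0 hd r00 pJ0.

Lemma pow4V_le n : 4 ^- n <= n.+1%:R / 2 ^+ n :> R.
Proof.
have p2 : (0 : R) < 2 ^+ n by rewrite exprn_gt0.
have -> : (4 : R) ^- n = 2 ^- n * 2 ^- n by rewrite -invfM -exprMn; congr (_ ^- _); ring.
rewrite ler_pM2r ?invr_gt0//; apply: le_trans (_ : 1 <= _); last by rewrite ler1n.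
by rewrite invf_le1// -natrX ler1n expn_gt0.
Qed.

Lemma pr_cat_le Lam r1 r2 r3 x y z t1 t2 t : openL Lam -> t1 + t2 <= t ->
  pr (~` cev chi Lam r1 r3 x z t) <=
  pr (~` cev chi Lam r1 r2 x y t1) + pr (~` cev chi Lam r2 r3 y z t2).
Proof.
move=> oL tt; have mc r r' u v s := @measC _ _ _ _ P mu chi hchi Lam r r' u v s oL.
apply: le_trans (prU_le P (mc _ _ _ _ _) (mc _ _ _ _ _)).
apply: pr_mono => //; first exact: measurableU.
move=> w nc; apply: contrapT => /not_orP[/contrapT h1 /contrapT h2]; apply: nc.
by apply: connW (conn_cat h1 h2).
Qed.

Lemma trunc_div (y m : R) : 0 < m -> 0 <= y ->
  (Num.truncn (y / m))%:R * m <= y /\ y < (Num.truncn (y / m)).+1%:R * m.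
Proof.
move=> m0 y0; have /truncn_itv/andP[h1 h2] : 0 <= y / m by rewrite divr_ge0// ltW.
by rewrite -ler_pdivlMr// -ltr_pdivrMr.
Qed.

Lemma upper_rate_unit (e : pt) (L eps : R) : enorm e = 1 -> 0 < L -> 0 < eps ->
  exists C n0, forall n, (n0 <= n)%N -> forall y, L * 2 ^+ n <= y <= 2 * L * 2 ^+ n ->
  pr (~` cev chi setT rho rho 0 (y *: e) ((lam + eps) * y)) <= C * (n.+1%:R / 2 ^+ n).
Proof.
move=> e1 L0 eps0.
have e20 : 0 < eps / 2 by rewrite divr_gt0.
have [m m1 am] := lam_approx hchi hd r00 pJ0 e20.
have m0 : 0 < m by move: m1; lra.
have [C C0 hC] := upper_lln hchi r00 pJ0 e1 m1 am.
have [n1 hn1] := lin_pow2 (C1 * (m + 1) / (eps / 2 * L)).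
have [n2 hn2] := exists_pow2_gt (2 * m / L).
exists (2 * L + C * (Nof m)%:R * (2 * m / L) + 1), (maxn n1 n2) => n.
rewrite geq_max => /andP[nn1 nn2] y /andP[y1 y2].
have p2 : (0 : R) < 2 ^+ n by rewrite exprn_gt0.
have y0 : 0 < y by apply: lt_le_trans y1; rewrite mulr_gt0.
have [k1 k2] := trunc_div m0 (ltW y0).
set k := Num.truncn (y / m) in k1 k2.
have kb : L * 2 ^+ n / (2 * m) <= k%:R.
  have : 2 * m <= L * 2 ^+ n.
    by have := hn2 n nn2; rewrite ltr_pdivrMr// => /ltW; rewrite (mulrC _ L).
  rewrite ler_pdivrMr ?mulr_gt0//; move: k2 y1; rewrite -natr1 mulrDl mul1r.
  have -> : k%:R * (2 * m) = 2 * (k%:R * m) by ring.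
  set a := k%:R * m; lra.
have k0 : (0 < k)%N by rewrite -(ltr_nat R); apply: lt_le_trans kb; rewrite divr_gt0 ?mulr_gt0.
have kR0 : (0 : R) < k%:R by rewrite ltr0n.
have ku : k%:R <= 2 * L * 2 ^+ n.
  apply: le_trans y2; apply: le_trans k1; rewrite -[leLHS]mulr1 ler_pM2l//.
pose t2 := C1 * (enorm (y *: e - (k%:R * m) *: e) + 1 + n%:R).
have lam0 := lam_ge0 hchi hd r00 pJ0.
have dist : enorm (y *: e - (k%:R * m) *: e) <= m.
  rewrite -scalerBl enormZ e1 mulr1 ger0_norm ?subr_ge0//.
  by move: k2; rewrite -natr1 mulrDl mul1r; set a := k%:R * m; lra.
have time : k%:R * ((lam + eps / 2) * m) + t2 <= (lam + eps) * y.
  have h1 : k%:R * ((lam + eps / 2) * m) <= (lam + eps / 2) * y.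
    by rewrite mulrCA ler_pM2l// ltr_wpDl.
  have h2 : t2 <= eps / 2 * y.
    apply: le_trans (_ : C1 * ((m + 1) * n.+1%:R) <= _).
      rewrite ler_pM2l// -natr1.
      have n0' : (0 : R) <= n%:R by [].
      have : 0 <= m * n%:R by rewrite mulr_ge0// ltW.
      by rewrite mulrDr mulr1 mulrDl mul1r; set a := m * n%:R; move: dist; lra.
    apply: le_trans (_ : eps / 2 * (L * 2 ^+ n) <= _); last by rewrite ler_pM2l.
    have := hn1 n nn1; rewrite mulrAC ler_pdivrMr ?mulr_gt0// => h.
    have -> : eps / 2 * (L * 2 ^+ n) = 2 ^+ n * (eps / 2 * L) by ring.
    by rewrite (mulrA C1).
  by move: h1 h2; rewrite !mulrDl; lra.
apply: le_trans (@pr_cat_le setT rho rho rho 0 ((k%:R * m) *: e) (y *: e) _ _ _ openLT time) _.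
have l1 := hC k n k0.
have l2 : pr (~` cev chi setT rho rho ((k%:R * m) *: e) (y *: e) t2) <= 4 ^- n.
  by apply: (pr_local' hchi hd r00 pJ0) => //; exact: openLT.
apply: le_trans (lerD l1 l2) _; 
rewrite [leRHS](_ : _ = 2 * L * (n.+1%:R / 2 ^+ n) + C * (Nof m)%:R * (2 * m / L) * (n.+1%:R / 2 ^+ n) + n.+1%:R / 2 ^+ n); last by ring.
apply: lerD; last exact: pow4V_le.
apply: lerD.
  apply: le_trans (_ : 2 * L * 2 ^+ n * 4 ^- n <= _).
    by rewrite ler_wpM2r ?invr_ge0 ?exprn_ge0.
  rewrite -!mulrA !ler_pM2l//.
  have -> : (4 : R) ^- n = 2 ^- n * 2 ^- n by rewrite -invfM -exprMn; congr (_ ^- _); ring.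
  by rewrite mulrA divff ?gt_eqF// mul1r -[leLHS]mul1r ler_pM2r ?invr_gt0// ler1n.
apply: le_trans (_ : C * (Nof m)%:R * n.+1%:R / k%:R <= _).
  rewrite ler_pM2r ?invr_gt0// -mulrA ler_wpM2l// -natrM ler_nat mulnS leq_add2l.
  by rewrite leq_pmull.
rewrite -!mulrA !ler_wpM2l//.
rewrite [leRHS](_ : _ = n.+1%:R * (2 * m / (L * 2 ^+ n))); last first.
  by field; rewrite !gt_eqF.
rewrite ler_wpM2l// -[leRHS]invrK lef_pV2 ?posrE ?invr_gt0 ?divr_gt0 ?mulr_gt0//.
by apply: le_trans kb; rewrite invf_div.
Qed.

Lemma upper_rate (v : pt) (eps : R) : 0 < eps ->
  exists C n0, forall n, (n0 <= n)%N ->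
  pr (~` cev chi setT rho rho 0 (2 ^+ n *: v) ((lam + eps) * (2 ^+ n * enorm v) + eps * 2 ^+ n))
   <= C * (n.+1%:R / 2 ^+ n).
Proof.
move=> eps0; have [v0|v0] := eqVneq (enorm v) 0.
  have [n1 hn1] := lin_pow2 (C1 / eps).
  exists 1, n1 => n nn; rewrite mul1r; apply: le_trans (pow4V_le n).
  apply: (pr_local' hchi hd r00 pJ0) => //; first exact: openLT.
  rewrite subr0 enormZ v0 !mulr0 !add0r.
  have := hn1 n nn; rewrite mulrAC ler_pdivrMr// -natr1 (mulrC (2 ^+ n)).
  by rewrite (addrC 1).
have vp : 0 < enorm v by rewrite lt0r v0 enorm_ge0.
pose e : pt := (enorm v)^-1 *: v.
have e1 : enorm e = 1 by rewrite enormZ ger0_norm ?invr_ge0 ?enorm_ge0// mulVf.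
have [C [n0 h]] := upper_rate_unit e1 vp eps0; exists C, n0 => n nn.
have p2 : (0 : R) < 2 ^+ n by rewrite exprn_gt0.
have hy : enorm v * 2 ^+ n <= 2 ^+ n * enorm v <= 2 * enorm v * 2 ^+ n.
  rewrite mulrC lexx/= mulrC (mulrC 2) -mulrA ler_pM2l//; have := p2; lra.
apply: le_trans (h n nn _ hy); apply: pr_mono; try by apply: (measC hchi); exact: openLT.
apply: subsetC => w; rewrite /e scalerA mulfK//.
by apply: connW => //; rewrite lerDl mulr_ge0// ltW.
Qed.

Lemma bc_lin_pow (F : nat -> set Omega) (C : R) n0 : (forall n, measurable (F n)) ->
  (forall n, (n0 <= n)%N -> pr (F n) <= C * (n.+1%:R / 2 ^+ n)) ->
  {ae P, forall w, exists n1, forall n, (n1 <= n)%N -> ~ F n w}.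
Proof.
move=> mF hF; apply: (@borel_cantelli _ _ _ P F (n0%:R + `|C| * 4)) => // N.
apply: le_trans (_ : \sum_(n < N) ((n < n0)%N%:R + `|C| * (n.+1%:R / 2 ^+ n)) <= _).
  apply: ler_sum => n _; have p0 : (0 : R) <= n.+1%:R / 2 ^+ n by rewrite divr_ge0 ?exprn_ge0.
  case: ltnP => nn; first by apply: le_trans (pr_le1 P (mF n)) _; rewrite lerDl mulr_ge0.
  by rewrite add0r; apply: le_trans (hF n nn) _; rewrite ler_wpM2r// ler_norm.
rewrite big_split/= -mulr_sumr; apply: lerD; last by rewrite ler_wpM2l// sum_lin_pow2V.
rewrite -natr_sum ler_nat -(big_mkord xpredT (fun n => nat_of_bool (n < n0)%N)).
rewrite (eq_bigr (fun n => if (n < n0)%N then 1%N else 0%N)) => [|n _]; last by case: ltnP.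
rewrite -big_mkcond sum1_count -size_filter -[leqRHS](size_iota 0); apply: uniq_leq_size.
  by rewrite filter_uniq// iota_uniq.
by move=> n; rewrite mem_filter !mem_iota => /andP[-> _].
Qed.

Section Fill.
Variables (M G : nat).
Hypothesis M0 : (0 < M)%N.
Let g0 : R := rho / d%:R.
Hypothesis hG : 1 <= g0 * G%:R.
Let Mf n := (G * 2 ^ n)%N.
Let Dn n : R := d%:R * (2 ^+ n / M%:R) + rho.

Definition xz n (z : {ffun 'I_d -> 'I_(2 * M).+1}) : pt := 2 ^+ n *: gpt M%:R^-1 z.

Definition fillbad n (zy : {ffun 'I_d -> 'I_(2 * M).+1} * {ffun 'I_d -> 'I_(2 * Mf n).+1}) : set Omega :=
  [set w | enorm (gpt g0 zy.2 - xz n zy.1) <= Dn n /\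
    ~ cev chi setT rho (2 * rho) (xz n zy.1) (gpt g0 zy.2) (C1 * (Dn n + 1 + (d.+1 * n)%:R)) w].

Lemma fillbad_meas n zy : measurable (@fillbad n zy).
Proof.
rewrite /fillbad; case: (lerP (enorm (gpt g0 zy.2 - xz n zy.1)) (Dn n)) => h.
  rewrite [X in measurable X](_ : _ = ~` cev chi setT rho (2 * rho) (xz n zy.1) (gpt g0 zy.2) (C1 * (Dn n + 1 + (d.+1 * n)%:R))).
    by apply: (measC hchi); exact: openLT.
  by apply/seteqP; split => w /=; [case|split].
rewrite [X in measurable X](_ : _ = set0); first exact: (@measurable0 _ Omega).
by rewrite -subset0 => w [].
Qed.

Lemma fillbad_pr n zy : pr (@fillbad n zy) <= 4 ^- (d.+1 * n).
Proof.
have [h|h] := pselect (enorm (gpt g0 zy.2 - xz n zy.1) <= Dn n); last first.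
  rewrite [X in pr X](_ : _ = set0) ?pr0 ?invr_ge0 ?exprn_ge0//.
  by rewrite -subset0 => w [].
apply: le_trans (pr_mono P (fillbad_meas zy) (measC hchi _ _ _ _ _ openLT) _) (pr_local hchi hd r00 pJ0 (x := xz n zy.1) (y := gpt g0 zy.2) (t := C1 * (Dn n + 1 + (d.+1 * n)%:R)) openLT _ _) => //.
  by move=> w [].
by rewrite ler_pM2l// !lerD2r.
Qed.

Lemma fill_rate : exists C, forall n, pr [set w | exists zy, @fillbad n zy w] <= C * (n.+1%:R / 2 ^+ n).
Proof.
exists (((2 * M).+1 ^ d * (3 * G) ^ d)%N%:R) => n.
apply: le_trans (pr_exists_fin P (@fillbad_meas n)) _.
apply: le_trans (ler_sum _ (fun zy _ => fillbad_pr zy)) _.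
rewrite sumr_const cardT -cardE card_prod !card_ffun !card_ord -(mulr_natl (4 ^- _)).
have G0 : (0 < G)%N.
  rewrite lt0n; apply/eqP => G0; move: hG; rewrite G0 mulr0; lra.
apply: le_trans (_ : ((2 * M).+1 ^ d * ((3 * G) ^ d * (2 ^ n) ^ d))%N%:R * 4 ^- (d.+1 * n) <= _).
  rewrite ler_wpM2r ?invr_ge0 ?exprn_ge0// ler_nat leq_mul2l -expnMn leq_exp2r//.
  apply/orP; right; rewrite /Mf -mulnA -[X in (_ <= X)%N]/(3 * (G * 2 ^ n))%N.
  by rewrite ltn_mul2r muln_gt0 G0 expn_gt0.
rewrite mulnA natrM -mulrA ler_wpM2l// -expnM natrX.
have -> : (4 : R) ^- (d.+1 * n) = 2 ^- (n * d) * 2 ^- (n * d) * 2 ^- n * 2 ^- n.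
  have -> : (4 : R) = 2 * 2 by ring.
  by rewrite exprMn mulSn mulnC exprD !invfM; ring.
rewrite !mulrA divff ?expf_neq0// mul1r ler_pM2r ?invr_gt0 ?exprn_gt0//.
apply: le_trans (_ : 1 <= _); last by rewrite ler1n.
by rewrite -invfM -exprD invf_le1 ?exprn_gt0// -natrX ler1n expn_gt0.
Qed.

End Fill.

Section UpperAE.
Hypothesis r01 : r0 <= 1.

Lemma upper_ae_eps (eps : R) : 0 < eps ->
  {ae P, forall w, exists n0, forall n, (n0 <= n)%N -> forall x, enorm x <= 2 ^+ n ->
    (passT (chi w) (eball 1) x <= (lam * enorm x + eps * 2 ^+ n)%:E)%E}.
Proof.
move=> eps0.
have lam0 := lam_ge0 hchi hd r00 pJ0.
have rp : 0 < rho := rho_gt0 r00.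
have d0 : (0 : R) < d%:R by rewrite ltr0n.
pose e' := eps / (4 * (d%:R + 2)).
have e'0 : 0 < e' by rewrite divr_gt0// mulr_gt0// addr_gt0.
have [M' hM'] := natceil (4 * (lam + C1) * d%:R / eps).
pose M := M'.+1.
have M0 : (0 : R) < M%:R by rewrite ltr0n.
have hM : (lam + C1) * (d%:R / M%:R) <= eps / 4.
  rewrite mulrA ler_pdivrMr//.
  have : 4 * (lam + C1) * d%:R / eps <= M%:R by apply: le_trans hM' _; rewrite ler_nat.
  by rewrite ler_pdivrMr// => h; move: h; rewrite -mulrA (mulrC M%:R); lra.
pose g0 : R := rho / d%:R.
have g00 : 0 < g0 by rewrite divr_gt0.
have [G hG'] := natceil g0^-1.
have hG : 1 <= g0 * G%:R by rewrite -ler_pdivrMl// mulr1.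
have A1 : {ae P, forall w, exists n1, forall n, (n1 <= n)%N -> ~ (exists zy, @fillbad M G n zy w)}.
  have [C hC] := @fill_rate M G hG.
  apply: (@bc_lin_pow _ C 0); last by move=> n _; exact: hC.
  by move=> n; apply: measurable_exists_fin => zy; exact: fillbad_meas.
have A2 : {ae P, forall w, forall k, forall z : {ffun 'I_d -> 'I_(2 * M).+1}, pickle z = k -> exists n1, forall n, (n1 <= n)%N ->
   cev chi setT rho rho 0 (2 ^+ n *: gpt M%:R^-1 z) ((lam + e') * (2 ^+ n * enorm (gpt M%:R^-1 z)) + e' * 2 ^+ n) w}.
  apply: ae_forall_nat => k.
  have [[z zk]|nz] := pselect (exists z : {ffun 'I_d -> 'I_(2 * M).+1}, pickle z = k); last first.
    by apply: aeW => w z zk; exfalso; apply: nz; exists z.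
  have [C [n0 hC]] := upper_rate (gpt M%:R^-1 z) e'0.
  have : {ae P, forall w, exists n1, forall n, (n1 <= n)%N -> ~ (~` cev chi setT rho rho 0 (2 ^+ n *: gpt M%:R^-1 z) ((lam + e') * (2 ^+ n * enorm (gpt M%:R^-1 z)) + e' * 2 ^+ n)) w}.
    by apply: (@bc_lin_pow _ C n0) => // n; apply: (measC hchi); exact: openLT.
  apply: filterS => w [n1 h] z' zk'; exists n1 => n nn.
  have -> : z' = z by apply: (pcan_inj pickleK_inv); rewrite zk' zk.
  by apply: contrapT; exact: h.
have [n3 hn3] := lin_pow2 (C1 * (rho + 1 + d.+1%:R) / (eps / 4)).
apply: filterS2 A1 A2 => w [n1 h1] h2.
have [n2 hn2] : exists n2, forall z : {ffun 'I_d -> 'I_(2 * M).+1}, forall n, (n2 <= n)%N ->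
   cev chi setT rho rho 0 (2 ^+ n *: gpt M%:R^-1 z) ((lam + e') * (2 ^+ n * enorm (gpt M%:R^-1 z)) + e' * 2 ^+ n) w.
  have /choice[f hf] := fun z => h2 _ z erefl.
  by exists (\max_z f z) => z n nn; apply: hf; apply: leq_trans nn; exact: leq_bigmax.
exists (maxn n3 (maxn n1 n2)) => n; rewrite !geq_max => /and3P[m3 m1 m2] x xn.
have p2 : (0 : R) < 2 ^+ n by rewrite exprn_gt0.
have [z hz] : exists z : {ffun 'I_d -> 'I_(2 * M).+1}, enorm (x - xz n z) <= d%:R * (2 ^+ n / M%:R).
  have gp : 0 < 2 ^+ n / M%:R :> R by rewrite divr_gt0.
  have [|z hz] := @gpt_approx R d (2 ^+ n / M%:R) M x gp.
    by move=> i; rewrite divfK ?gt_eqF//; apply: le_trans (coord_le_enorm x i) xn.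
  exists z; suff -> : xz n z = gpt (2 ^+ n / M%:R) z by [].
  by apply/rowP => i; rewrite !mxE mulrA.
have [y hy] : exists y : {ffun 'I_d -> 'I_(2 * (G * 2 ^ n)).+1}, enorm (x - gpt g0 y) <= rho.
  have [|y hy] := @gpt_approx R d g0 (G * 2 ^ n) x g00.
    move=> i; apply: le_trans (coord_le_enorm x i) _; apply: le_trans xn _.
    by rewrite natrM natrX mulrA -[leLHS]mul1r ler_pM2r.
  by exists y; move: hy; rewrite /g0 mulrCA divff ?gt_eqF// mulr1.
pose Dn : R := d%:R * (2 ^+ n / M%:R) + rho.
have dyz : enorm (gpt g0 y - xz n z) <= Dn.
  by apply: le_trans (enorm_tri x _ _) _; rewrite (enormB _ x) addrC lerD.
have c1 := hn2 z n m2.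
have c2 : cev chi setT rho (2 * rho) (xz n z) (gpt g0 y) (C1 * (Dn + 1 + (d.+1 * n)%:R)) w.
  by apply: contrapT => nc; apply: (h1 n m1); exists (z, y); split.
have c := conn_cat c1 c2.
have c' : conn (chi w) rho (2 * rho) 0 (gpt g0 y) (lam * enorm x + eps * 2 ^+ n).
  move: c; apply: connW; first by move=> p [].
  have xzn : enorm (gpt M%:R^-1 z) * 2 ^+ n <= enorm x + d%:R * (2 ^+ n / M%:R).
    have -> : enorm (gpt M%:R^-1 z) * 2 ^+ n = enorm (xz n z) by rewrite /xz enormZ gtr0_norm// mulrC.
    have := enorm_triB (xz n z) x; rewrite (enormB (xz n z)); move: hz; lra.
  set u := d%:R * (2 ^+ n / M%:R) in xzn *.
  have uE : u = d%:R / M%:R * 2 ^+ n by rewrite /u; ring.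
  have dM : d%:R / M%:R <= d%:R :> R by rewrite ler_pdivrMr// -[leLHS]mulr1 ler_pM2l// ler1n.
  have hu : (lam + C1) * u <= eps / 4 * 2 ^+ n by rewrite uE mulrA ler_pM2r.
  have ud : u <= d%:R * 2 ^+ n by rewrite uE ler_pM2r.
  have he' : e' * ((d%:R + 2) * 2 ^+ n) = eps / 4 * 2 ^+ n.
    by rewrite /e'; field; rewrite gt_eqF// addr_gt0.
  have h3 : C1 * (rho + 1 + (d.+1 * n)%:R) <= eps / 4 * 2 ^+ n.
    have := hn3 n m3; rewrite mulrAC ler_pdivrMr ?divr_gt0// (mulrC (2 ^+ n)); apply: le_trans.
    rewrite -(mulrA C1) ler_pM2l// natrM -[n.+1%:R]natr1.
    have : 0 <= (rho + 1) * n%:R by rewrite mulr_ge0// addr_ge0// ltW.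
    by have : (0 : R) <= d.+1%:R by []; rewrite !mulrDl !mulrDr !mulr1 !mul1r; set a := rho * _; set b := d.+1%:R * _; lra.
  have t1 : (lam + e') * (2 ^+ n * enorm (gpt M%:R^-1 z)) <= (lam + e') * (enorm x + u).
    by rewrite ler_wpM2l ?addr_ge0 ?(ltW e'0)// mulrC.
  apply: le_trans (lerD (lerD t1 (lexx _)) (lexx _)) _.
  have t2 : e' * (enorm x + u + 2 ^+ n) <= e' * ((d%:R + 2) * 2 ^+ n).
    rewrite ler_pM2l// mulrDl; move: xn ud; set a := d%:R * _; lra.
  rewrite he' in t2.
  have -> : (lam + e') * (enorm x + u) + e' * 2 ^+ n + C1 * (Dn + 1 + (d.+1 * n)%:R) =
    lam * enorm x + (lam + C1) * u + e' * (enorm x + u + 2 ^+ n) + C1 * (rho + 1 + (d.+1 * n)%:R).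
    by rewrite /Dn -/u; ring.
  have -> : eps * 2 ^+ n = 4 * (eps / 4 * 2 ^+ n) by field.
  have q0 : 0 < eps / 4 * 2 ^+ n by rewrite mulr_gt0// divr_gt0.
  have aux (A B C_ r q : R) : 0 < q -> A <= q -> B <= q -> C_ <= q -> r + A + B + C_ <= r + 4 * q by lra.
  exact: aux.
apply: (passT_le_conn (r1 := rho) (r2 := 2 * rho)) c' _.
- by move=> p; exact: (ppp_tim hchi).
- rewrite rhoE ler_pdivrMr//; move: r00 r01; lra.
- by apply: le_trans hy _; lra.
Qed.

Theorem upper_ae :
  {ae P, forall w, forall eps : R, 0 < eps ->
    exists n0, forall n, (n0 <= n)%N -> forall x, enorm x <= 2 ^+ n ->
    (passT (chi w) (eball 1) x <= (lam * enorm x + eps * 2 ^+ n)%:E)%E}.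
Proof.
have := ae_forall_nat (fun k : nat => upper_ae_eps (_ : 0 < k.+1%:R^-1)).
move=> /(_ (fun k => ltac:(by rewrite invr_gt0 ltr0n))); apply: filterS => w h eps eps0.
have [k hk] := natceil eps^-1; have [n0 hn0] := h k; exists n0 => n nn x xn.
apply: le_trans (hn0 n nn x xn) _; rewrite lee_fin lerD2l ler_pM2r ?exprn_gt0//.
rewrite -[leRHS]invrK lef_pV2 ?posrE ?invr_gt0 ?ltr0n//; apply: le_trans hk _.
by rewrite ler_nat.
Qed.

End UpperAE.

Lemma lower_prob (eps dl : R) : 0 < eps -> 0 < dl ->
  exists y0, forall y, y0 <= y -> pr (cev chi setT rho rho 0 (y *: e1 hd) ((lam - eps) * y)) <= dl.
Proof.
move=> eps0 dl0; have lam0 := lam_ge0 hchi hd r00 pJ0.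
pose e' := dl * eps / 8; have e'0 : 0 < e' by rewrite divr_gt0// mulr_gt0.
have [C [n0 hC]] := upper_rate_unit (enorm_e1 hd) (ltr01) e'0.
have K10 : (0 : R) < K1%:R by rewrite ltr0n.
have [n1 hn1] := lin_pow2 (4 * `|C| * K1%:R / e').
have [n2 hn2] := exists_pow2_gt ((2 * K1%:R + 1) / e' + 2 / eps + 3).
exists (2 ^+ (maxn n0 (maxn n1 n2))) => y hy.
have [n [nn y1 y2]] : exists n, [/\ (maxn n0 (maxn n1 n2) <= n)%N, 2 ^+ n <= y & y <= 2 ^+ n.+1].
  have [N hN] := exists_pow2_gt y.
  have ex : exists n, y < 2 ^+ n by exists N; exact: hN.
  case: (ex_minnP ex) => n yn mn; case: n yn mn => [|n] yn mn.
    have : (1 : R) <= 2 ^+ maxn n0 (maxn n1 n2) by rewrite -natrX ler1n expn_gt0.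
    by move: yn hy; rewrite expr0; lra.
  exists n; split; last exact: ltW.
    rewrite -ltnS ltnNge; apply/negP => h.
    have := lt_le_trans yn (_ : 2 ^+ n.+1 <= 2 ^+ maxn n0 (maxn n1 n2)).
    by rewrite ltNge hy => /(_ ltac:(by rewrite ler_eXn2l ?ltr1n)).
  by rewrite leNgt; apply/negP => /mn; rewrite ltnn.
move: nn; rewrite !geq_max => /and3P[m0 m1 m2].
have p2 : (0 : R) < 2 ^+ n by rewrite exprn_gt0.
have y0 : 0 < y by apply: lt_le_trans y1.
have big : (2 * K1%:R + 1) / e' + 2 / eps + 3 < y by apply: lt_le_trans y1; exact: hn2.
have q1 : 0 <= (2 * K1%:R + 1) / e' by rewrite divr_ge0 ?(ltW e'0)// addr_ge0// mulr_ge0.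
have q2 : 0 < 2 / eps by rewrite divr_gt0.
have bg1 : 2 * K1%:R + 1 <= e' * y.
  by rewrite -ler_pdivrMl// mulrC; move: big q1 q2; lra.
have big2 : 2 <= eps * y by rewrite -ler_pdivrMl// mulrC; move: big q1 q2; lra.
have big3 : 3 <= y by move: big q1 q2; lra.
set p := pr _.
have [le0|lp] := ltrP (lam - eps) 0.
  rewrite /p [X in pr X](_ : _ = set0) ?pr0 ?(ltW dl0)//.
  rewrite -subset0 => w [a [s [hp _ _ _ st]]].
  have : 0 <= stime (a :: s).
    by rewrite /stime big_seq; apply: sumr_ge0 => q qs; apply: (ppp_tim hchi) (hp q qs).1.
  by rewrite leNgt (lt_trans st)// nmulr_rlt0.
pose eta := pr (~` cev chi setT rho rho 0 (y *: e1 hd) ((lam + e') * y)).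
have heta : eta * (K1%:R * (2 * y)) <= e' * y.
  have h : eta <= C * (n.+1%:R / 2 ^+ n) by apply: (hC n m0); rewrite mul1r mulr1 -exprS y1 y2.
  have h2 := hn1 n m1; rewrite mulrAC ler_pdivrMr// in h2.
  apply: le_trans (_ : `|C| * (n.+1%:R / 2 ^+ n) * (K1%:R * (2 * y)) <= _).
    rewrite ler_wpM2r ?mulr_ge0 ?(ltW y0)//; apply: le_trans h _.
    by rewrite ler_wpM2r ?ler_norm// divr_ge0 ?exprn_ge0.
  rewrite mulrA -[leLHS]mulrA mulrA [in leLHS]mulrA ler_pM2r//.
  have -> : `|C| * (n.+1%:R / 2 ^+ n) * (K1%:R * 2) = (4 * `|C| * K1%:R * n.+1%:R) / 2 ^+ n / 2 by field; rewrite gt_eqF.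
  rewrite ler_pdivrMr// ler_pdivrMr//; apply: le_trans h2 _.
  have -> : e' * 2 * 2 ^+ n = 2 * (2 ^+ n * e') by ring.
  have : 0 < 2 ^+ n * e' by rewrite mulr_gt0.
  by set a := 2 ^+ n * e'; lra.
pose J1 := (Num.truncn ((lam - eps) * y)).+1.
pose J2 := (Num.truncn ((lam + e') * y)).+1.
have /truncn_itv/andP[a1 a2] : 0 <= (lam - eps) * y by rewrite mulr_ge0// ltW.
have /truncn_itv/andP[b1 b2] : 0 <= (lam + e') * y by rewrite mulr_ge0// ?ltW// ltr_wpDl.
have mc j : measurable (cev chi setT rho rho 0 (y *: e1 hd) j) by apply: (measurable_cev hchi); exact: openLT.
have mono s t : s <= t -> pr (~` cev chi setT rho rho 0 (y *: e1 hd) t) <= pr (~` cev chi setT rho rho 0 (y *: e1 hd) s).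
  move=> st; apply: pr_mono; [exact: measurableC|exact: measurableC|].
  by apply: subsetC => w; exact: connW.
have f1 j : (J1 <= j)%N -> qf y j <= 1 - p.
  move=> hj; rewrite /p -prC//; apply: mono; apply: le_trans (ltW a2) _.
  by rewrite ler_nat.
have f2 j : (J2 <= j)%N -> qf y j <= eta.
  by move=> hj; apply: mono; apply: le_trans (ltW b2) _; rewrite ler_nat.
have p0 : 0 <= p by exact: pr_ge0.
have p1 : p <= 1 by exact: pr_le1.
have eta0 : 0 <= eta by exact: pr_ge0.
have J12 : (J1 <= J2)%N.
  rewrite ltnS; apply: Num.Theory.le_truncn; rewrite ler_pM2r//; move: eps0 e'0; lra.
pose J3 := (K1 * Nof y)%N.
have qsumH H : qsum P chi hd r0 y H <= J1%:R + (1 - p) * (J2%:R - J1%:R) + eta * J3%:R + 2 * K1%:R.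
  have T := tail_sum (qf_ge0 P chi hd r0 y) (fun s j => @qf_tail _ _ _ _ P mu chi hchi hd r0 R1 r00 pJ0 y s j (ltW y0)) 0 (H + J1 + J2 + J3).
  rewrite addn0 expr0 invr1 mulr1 -/J3 in T.
  apply: le_trans (_ : \sum_(0 <= j < H + J1 + J2 + J3) qf y j <= _).
    rewrite /qsum -(big_mkord xpredT (qf y)) [leRHS](big_cat_nat _ (n := H))//=; last by rewrite -!addnA leq_addr.
    by rewrite lerDl sumr_ge0// => j _; exact: qf_ge0.
  apply: le_trans (_ : \sum_(0 <= j < H + J1 + J2 + J3) ((j < J1)%N%:R + ((J1 <= j < J2)%N%:R * (1 - p) + ((j < J3)%N%:R * eta + (J3 <= j)%N%:R * qf y j))) <= _).
    apply: ler_sum => j _; have qj0 := qf_ge0 P chi hd r0 y j; have qj1 := qf_le1 hchi hd r0 y j.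
    have [jJ1|jJ1] := ltnP j J1; first by apply: le_trans qj1 _; rewrite lerDl !addr_ge0// mulr_ge0// subr_ge0.
    have := f1 j jJ1; have [jJ2|jJ2] := ltnP j J2 => /= h.
      by rewrite add0r mul1r; apply: le_trans h _; rewrite lerDl addr_ge0// mulr_ge0.
    have := f2 j jJ2; case: ltnP => _ h'; by rewrite ?mul0r ?mul1r ?add0r ?addr0.
  rewrite !big_split/= -!mulr_suml -!natr_sum.
  have cnt (a b N : nat) : (a <= b)%N -> (\sum_(0 <= j < N) (a <= j < b)%N <= b - a)%N.
    move=> ab; rewrite (eq_bigr (fun n => if (a <= n < b)%N then 1%N else 0%N)) => [|j _]; last by case: (_ && _).
    rewrite -big_mkcond sum1_count -size_filter -[leqRHS](size_iota a); apply: uniq_leq_size.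
      by rewrite filter_uniq// iota_uniq.
    by move=> j; rewrite mem_filter mem_iota subnKC// => /andP[/= ->].
  have c1 := cnt 0%N J1 (H + J1 + J2 + J3)%N (leq0n _); have c2 := cnt J1 J2 (H + J1 + J2 + J3)%N J12; have c3 := cnt 0%N J3 (H + J1 + J2 + J3)%N (leq0n _).
  rewrite subn0 in c1 c3.
  rewrite -!addrA; apply: lerD; first by rewrite ler_nat.
  apply: lerD; first by rewrite mulrC ler_wpM2l ?subr_ge0// -natrB// ler_nat.
  apply: lerD; first by rewrite mulrC ler_wpM2l// ler_nat.
  apply: le_trans T; rewrite (big_cat_nat _ (n := J3))//=; last by rewrite leq_addl.
  rewrite big_nat big1 ?add0r => [|j /andP[_ jJ]]; last by rewrite leqNgt jJ mul0r.
  by rewrite big_nat [leRHS]big_nat; apply: ler_sum => j /andP[jJ _]; rewrite jJ mul1r.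
have al := alpha_le hchi r00 pJ0 (ltW y0) qsumH.
have y1' : 1 <= y by move: big3; lra.
have ll := lam_le hchi hd r00 pJ0 y1'.
have J3y : J3%:R <= K1%:R * (2 * y).
  rewrite /J3 natrM ler_pM2l//; rewrite /Nof -!natr1.
  have /truncn_itv/andP[c1 _] : 0 <= y by exact: ltW.
  by move: c1 big3; lra.
have h4 : eta * J3%:R <= e' * y by apply: le_trans heta; rewrite ler_wpM2l.
have J1e : J1%:R = (Num.truncn ((lam - eps) * y))%:R + 1 :> R by rewrite /J1 -natr1.
have J2e : J2%:R = (Num.truncn ((lam + e') * y))%:R + 1 :> R by rewrite /J2 -natr1.
have key : p * (J2%:R - J1%:R) <= e' * y + 1 + e' * y + 2 * K1%:R.
  have := le_trans ll al; have -> : (1 - p) * (J2%:R - J1%:R) = J2%:R - J1%:R - p * (J2%:R - J1%:R) by ring.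
  by move: h4 b1; rewrite J2e mulrDl; set a := eta * _; set b := p * _; set c := e' * y; set q := lam * y; lra.
have J21 : eps * y / 2 <= J2%:R - J1%:R.
  move: a1 b2 big2; rewrite -/J2 J1e mulrBl mulrDl; have : 0 <= e' * y by rewrite mulr_ge0// ltW.
  by set a := e' * y; set b := lam * y; set c := eps * y; lra.
have : p * (eps * y / 2) <= 3 * (e' * y).
  apply: le_trans (ler_wpM2l p0 J21) _; apply: le_trans key _; move: bg1; set a := e' * y; lra.
have ey : 0 < eps * y by rewrite mulr_gt0.
have -> : 3 * (e' * y) = dl * (3 / 4) * (eps * y / 2) by rewrite /e'; field.
rewrite ler_pM2r ?divr_gt0//; lra.
Qed.

End Rates.

(** * The lower bound along a direction *)

Section Extra.
Context {R : realType} {dO : measure_display} {Omega : measurableType dO}.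
Variable P : probability Omega R.
Local Notation pr := (pr P).
Local Notation ind := (@ind R dO Omega).

Lemma pr_mono_ae A B : measurable A -> measurable B ->
  {ae P, forall w, A w -> B w} -> pr A <= pr B.
Proof.
move=> mA mB [N [mN N0 hN]].
apply: le_trans (_ : pr (B `|` N) <= _).
  apply: pr_mono => //; first exact: measurableU.
  move=> w Aw; have [Bw|nB] := pselect (B w); [by left|right; apply: hN => h; exact: nB (h Aw)].
apply: le_trans (prU_le P mB mN) _; have -> : pr N = fine (P N) by [].
rewrite N0 /= addr0; exact: lexx.
Qed.

Lemma pr0_ae A : measurable A -> pr A = 0 -> {ae P, forall w, ~ A w}.
Proof.
move=> mA A0; exists A; split => //; first by rewrite prE// A0.
by move=> w /= h; apply: contrapT.
Qed.

Lemma markov_ind (I : finType) (B : I -> set Omega) (c : I -> R) (a : R) :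
  (forall i, measurable (B i)) -> (forall i, 0 <= c i) ->
  forall D, measurable D -> (forall w, D w -> a <= \sum_i c i * ind (B i) w) ->
  a * pr D <= \sum_i c i * pr (B i).
Proof.
move=> mB c0 D mD hD.
have := @exp_le _ _ _ P (I + bool)%type (fun o => match o with inl i => B i | inr _ => D end)
  (fun o => match o with inl i => c i | inr b => if b then - a else 0 end).
rewrite big_sumType big_bool /= mul0r addr0 mulNr subr_ge0; apply; first by case.
move=> w; rewrite big_sumType big_bool /= mul0r addr0 mulNr subr_ge0.
case: (indP (R := R) D w) => -[-> h]; rewrite ?mulr1 ?mulr0; first exact: hD.
by apply: sumr_ge0 => i _; rewrite mulr_ge0// ind_ge0.
Qed.

End Extra.

Section Chop.
Lemma chop_n1 n k j m : (n - k < m.+1)%N -> (0 < j)%N -> (k + j < n)%N -> (n - (k + j) < m)%N.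
Proof. by move=> h1 h2 h3; rewrite ltn_subLR ?(ltnW h3)// -addnA -ltn_subLR; [rewrite (leq_trans h1)// -addn1 addnC leq_add2r|apply: ltnW; apply: leq_ltn_trans h3; exact: leq_addr]. Qed.

Lemma chop_n2 n k j : (k + j < n)%N -> (j + (n - (k + j)) = n - k)%N.
Proof.
move=> h; apply/eqP; rewrite -(eqn_add2l k) addnA subnKC ?(ltnW h)// subnKC//.
by apply: leq_trans (ltnW h); exact: leq_addr.
Qed.

Lemma chop_n3 n k m : (n - k < m.+1)%N -> (k < n)%N -> (n - k.+1 < m)%N.
Proof. by move=> h1 h2; rewrite subnS prednK ?subn_gt0. Qed.

Context {R : realType} {d : nat}.
Local Notation pt := 'rV[R]_d.

Lemma chop (X : set (@mpoint R d)) (rh : R) (v : pt) (th : R) M n (z : nat -> R) (L : nat -> bool) :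
  0 <= th -> (forall k, 0 <= z k) ->
  (forall k, (k < n)%N -> conn X rh rh (k%:R *: v) (k.+1%:R *: v) (z k)) ->
  (forall k, L k -> (k + M < n)%N /\
    exists2 j, j \in iota 1 M & conn X rh rh (k%:R *: v) ((k + j)%:R *: v) (th * j%:R)) ->
  forall k, (k < n)%N ->
  conn X rh rh (k%:R *: v) (n%:R *: v) (th * (n - k)%:R + \sum_(k <= i < n) (if L i then 0 else z i)).
Proof.
move=> th0 z0 hz hL k; have [m] := ubnP (n - k); elim: m k => // m ih k hm kn.
have s0 a b : 0 <= \sum_(a <= i < b) (if L i then 0 else z i).
  by apply: sumr_ge0 => i _; case: ifP.
case Lk : (L k).
  have [kM [j]] := hL k Lk; rewrite mem_iota add1n => /andP[j1 jM] c1.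
  have kj : (k + j < n)%N by apply: leq_ltn_trans kM; rewrite leq_add2l -ltnS.
  have c2 := ih (k + j)%N (chop_n1 hm j1 kj) kj.
  apply: connW (conn_cat c1 c2) => //.
  rewrite addrA -mulrDr -natrD.
  have -> : (j + (n - (k + j)) = n - k)%N.
    by exact: chop_n2 kj.
  rewrite lerD2l [leRHS](big_cat_nat (n := k + j)) ?leq_addr// ?(ltnW kj)//=.
  by rewrite lerDr.
have c1 := hz k kn.
have [kn'|kn'] := ltnP k.+1 n; last first.
  have e : n = k.+1 by apply/eqP; rewrite eqn_leq kn' kn.
  subst n; apply: connW c1 => //; rewrite big_nat1 Lk lerDr mulr_ge0//.
have c2 := ih k.+1 (chop_n3 hm kn) kn'.
apply: connW (conn_cat c1 c2) => //.
rewrite [in leRHS]big_ltn// Lk (addrCA (z k)) lerD2r ler_wpM2l// ler_nat.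
by rewrite leq_sub2l.
Qed.

End Chop.

Section KW.
Context {R : realType} {d : nat} {dO : measure_display} {Omega : measurableType dO}.
Variables (P : probability Omega R) (mu : probability R R).
Variable chi : Omega -> set (@mpoint R d).
Hypothesis hchi : is_PPP P mu chi.
Hypothesis hd : (0 < d)%N.
Local Notation pr := (pr P).
Local Notation pt := 'rV[R]_d.
Local Notation mpt := (@mpoint R d).
Variables (r0 R1 : R).
Hypothesis r00 : 0 < r0.
Hypothesis pJ0 : 0 < fine (mu `]r0, R1[%classic).
Local Notation rho := (rho r0).
Local Notation C1 := (@C1 R d mu r0 R1).
Local Notation K1 := (@K1 R d mu r0 R1).
Local Notation lam := (lam P chi hd r0).
Local Notation qf := (qf P chi hd r0).
Local Notation ind := (@ind R dO Omega).
Let C10 : 0 < C1 := C1_gt0 hd r00 pJ0.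

Lemma cev_neg Lam r1 r2 x y t w : t <= 0 -> ~ cev chi Lam r1 r2 x y t w.
Proof.
move=> t0 [a [s [hp _ _ _ st]]].
have : 0 <= stime (a :: s).
  by rewrite /stime big_seq; apply: sumr_ge0 => q qs; apply: (ppp_tim hchi) (hp q qs).1.
by rewrite leNgt (lt_le_trans st).
Qed.

Lemma ae_conn x y : {ae P, forall w, exists t, conn (chi w) rho (2 * rho) x y t}.
Proof.
pose F s := ~` cev chi setT rho (2 * rho) x y (C1 * (enorm (y - x) + 1 + s%:R)).
have : {ae P, forall w, exists n1, forall n, (n1 <= n)%N -> ~ F n w}.
  apply: (@bc_lin_pow _ _ _ P F 1 0); first by move=> n; apply: (measC hchi); exact: openLT.
  move=> n _; rewrite mul1r; apply: le_trans (pow4V_le n).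
  by apply: (pr_local hchi hd r00 pJ0) => //; exact: openLT.
apply: filterS => w [n1 /(_ n1 (leqnn _))] /contrapT h.
by exists (C1 * (enorm (y - x) + 1 + n1%:R)); apply: connW h => // p [].
Qed.

Lemma ind_sum_conn x y J w : cev chi setT rho rho x y J%:R w ->
  cev chi setT rho rho x y (\sum_(j < J) ind (~` cev chi setT rho rho x y j%:R) w) w.
Proof.
move=> c; have ex : exists j, `[< cev chi setT rho rho x y j%:R w >] by exists J; apply/asboolP.
case: (ex_minnP ex) => z /asboolP cz mz; have zJ : (z <= J)%N by apply: mz; apply/asboolP.
apply: connW cz => //.
rewrite -(big_mkord xpredT (fun j => ind (~` cev chi setT rho rho x y j%:R) w)) (big_cat_nat _ (n := z))//=.
rewrite -[leLHS]addr0; apply: lerD; last by apply: sumr_ge0 => i _; exact: ind_ge0.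
rewrite [leLHS](_ : _ = \sum_(0 <= j < z) 1); last by rewrite big_mkord sum_ord_const mulr1.
apply: ler_sum_nat => j /andP[_ jz].
case: (indP (R := R) (~` cev chi setT rho rho x y j%:R) w) => -[-> h] //; exfalso; apply: h => cj.
by move: jz; rewrite ltnNge => /negP; apply; apply: mz; apply/asboolP.
Qed.

Variables (v : pt) (eps : R).
Hypothesis v0 : 0 < enorm v.
Hypothesis eps0 : 0 < eps.
Local Notation ell := (enorm v).
Local Notation th := ((lam - eps) * ell).

Definition LM k M : set Omega :=
  [set w | exists2 j, j \in iota 1 M & cev chi setT rho rho (k%:R *: v) ((k + j)%:R *: v) (th * j%:R) w].

Definition CM k M (ps : seq mpt) := exists2 j, j \in iota 1 M &
  Cconn setT rho rho (k%:R *: v) ((k + j)%:R *: v) (th * j%:R) ps.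

Lemma LME k M : LM k M = ev chi (CM k M).
Proof.
apply/seteqP; split => w.
  by move=> [j hj]; rewrite cevE => -[ps h1 h2]; exists ps => //; exists j.
by move=> [ps h1 [j hj h2]]; exists j => //; rewrite cevE; exists ps.
Qed.

Lemma openev_CM k M : openev (CM k M).
Proof.
move=> ps hp [j hj hc]; have [e e0 he] := openev_conn (x := k%:R *: v) (y := (k + j)%:R *: v) openLT hp hc.
by exists e => // qs h1 h2; exists j => //; exact: he.
Qed.

Lemma measurable_LM k M : measurable (LM k M).
Proof. by rewrite LME; apply: (measurable_ev hchi); exact: openev_CM. Qed.

Lemma LM_shift k k' M : pr (LM k' M) <= pr (LM k M).
Proof.
rewrite !LME; pose f (u : pt) : pt := u + (k'%:R - k%:R) *: v.
have iso x y : enorm (f x - f y) = enorm (x - y) by congr enorm; rewrite /f opprD addrACA subrr addr0.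
have fk (a : nat) : f ((k + a)%:R *: v) = (k' + a)%:R *: v.
  by rewrite /f -scalerDl !natrD; congr (_ *: _); ring.
have e : ev chi (CM k' M \o map (lift f)) = ev chi (CM k M).
  have H j ps : Cconn setT rho rho (k'%:R *: v) ((k' + j)%:R *: v) (th * j%:R) (map (lift f) ps) <->
     Cconn setT rho rho (k%:R *: v) ((k + j)%:R *: v) (th * j%:R) ps.
    have H0 := Cconn_lift (Lam := setT) (Lam' := setT) rho rho ((k + 0)%:R *: v) ((k + j)%:R *: v) (th * j%:R) ps iso (fun _ => iff_refl _).
    by rewrite !fk !addn0 in H0.
  by apply/seteqP; split => w [ps h1 [j hj h2]]; exists ps => //; exists j => //; exact/H.
rewrite -e; apply: (law_le hchi); [exact: icp_trans|exact: openev_CM|].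
by rewrite e; apply: (measurable_ev hchi); exact: openev_CM.
Qed.

Lemma LM_mono k M M' w : (M <= M')%N -> LM k M w -> LM k M' w.
Proof.
move=> MM [j hj c]; exists j => //; move: hj; rewrite !mem_iota !add1n => /andP[-> h] /=.
by apply: leq_trans h _.
Qed.

Definition G : set Omega := [set w | forall j0, exists j, (j0 <= j)%N /\
  cev chi setT rho rho 0 (j%:R *: v) ((lam - 2 * eps) * ell * j%:R) w].

Lemma measurable_G : measurable G.
Proof.
rewrite [G](_ : _ = ~` [set w | exists j0, ~ exists j, (j0 <= j)%N /\
  cev chi setT rho rho 0 (j%:R *: v) ((lam - 2 * eps) * ell * j%:R) w]); last first.
  apply/seteqP; split => w /=; first by move=> h [j0]; apply.
  by move=> h j0; apply: contrapT => nh; apply: h; exists j0.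
apply: measurableC; apply: measurable_exists_nat => j0; apply: measurableC.
apply: measurable_exists_nat => j; case: (leqP j0 j) => jj.
  rewrite [X in measurable X](_ : _ = cev chi setT rho rho 0 (j%:R *: v) ((lam - 2 * eps) * ell * j%:R)); last first.
    by apply/seteqP; split => w; [case|split].
  by apply: (measurable_cev hchi); exact: openLT.
rewrite [X in measurable X](_ : _ = set0); first exact: (@measurable0 _ Omega).
by rewrite -subset0 => w [].
Qed.

(* Going through the origin, fast passages from it are fast from any starting point. *)
Lemma G_sub k : {ae P, forall w, G w -> exists M, LM k M w}.
Proof.
apply: filterS (ae_conn (k%:R *: v) 0) => w [t ht] Gw.
have ee : 0 < eps * ell by rewrite mulr_gt0.
have [X hX] := natceil ((t + `|lam - 2 * eps| * ell * k%:R) / (eps * ell)).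
have [j [hj c]] := Gw (k + X.+1)%N.
have kj : (k <= j)%N by apply: leq_trans hj; exact: leq_addr.
exists (j - k)%N; exists (j - k)%N.
  by rewrite mem_iota add1n ltnS leqnn andbT subn_gt0; apply: leq_trans hj; rewrite -ltn_subLR ?subnn.
rewrite subnKC//.
have ht' : cev chi setT rho rho (k%:R *: v) 0 t w.
  move: ht; apply: conn_mono => //; rewrite subrr enorm0 add0r//.
  by have := rho_gt0 r00; lra.
apply: connW (conn_cat ht' c) => //.
have Xj : X%:R <= (j - k)%:R :> R.
  by rewrite ler_nat -(leq_add2l k) subnKC//; apply: leq_trans hj; rewrite leq_add2l.
have h1 : t + `|lam - 2 * eps| * ell * k%:R <= (j - k)%:R * (eps * ell).
  by rewrite -ler_pdivrMr//; apply: le_trans hX Xj.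
have jE : j%:R = (j - k)%:R + k%:R :> R by rewrite -natrD subnK.
rewrite jE; set a := (j - k)%:R in h1 *.
have h2 : (lam - 2 * eps) * ell * k%:R <= `|lam - 2 * eps| * ell * k%:R.
  by rewrite !ler_wpM2r ?(ltW v0)// ler_norm.
have -> : (lam - eps) * ell * a = (lam - 2 * eps) * ell * a + a * (eps * ell) by ring.
rewrite mulrDr.
have aux (t' A b c' e : R) : t' + c' <= e -> b <= c' -> t' + (A + b) <= A + e by lra.
exact: aux h1 h2.
Qed.

Lemma GM_small eta : 0 < eta -> exists M, forall k, pr (G `&` ~` LM k M) <= eta.
Proof.
move=> eta0; have e20 : 0 < eta / 2 by rewrite divr_gt0.
have ap k := pr_nd_approx P (F := LM k) (measurable_LM k) (fun M w => @LM_mono k M M.+1 w (leqnSn M)) e20.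
have [M hM] := ap 0%N; exists M => k; have [M' hM'] := ap k.
have mU i : measurable [set w | exists M, LM i M w].
  by apply: measurable_exists_nat => n; exact: measurable_LM.
have mLC : measurable (~` LM k M) by apply: measurableC; exact: measurable_LM.
apply: le_trans (_ : pr ([set w | exists M, LM k M w] `&` ~` LM k M) <= _).
  apply: pr_mono_ae; [by apply: measurableI => //; exact: measurable_G|exact: measurableI|].
  by apply: filterS (G_sub k) => w h [/h ? ?]; split.
rewrite prIC//; last exact: measurable_LM.
have -> : [set w | exists M, LM k M w] `&` LM k M = LM k M.
  by apply/seteqP; split => w; [case|move=> h; split => //; exists M].
have h1 := LM_shift 0 k M'; have h2 := LM_shift k 0 M.
have h3 : pr (LM 0 M') <= pr [set w | exists M, LM 0 M w].
  by apply: pr_mono => //; [exact: measurable_LM|move=> w h; exists M'].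
move: hM hM' h1 h2 h3; set a := pr _; set b := pr (LM 0 M); set c := pr _; set e := pr (LM k M'); set f := pr (LM 0 M'); set g := pr _.
lra.
Qed.

Local Notation step i := (cev chi setT rho rho (i%:R *: v) (i.+1%:R *: v)).

Lemma step_meas i t : measurable (step i t).
Proof. by apply: (measurable_cev hchi); exact: openLT. Qed.

Lemma step_qf i (j : nat) : pr (~` step i j%:R) = qf ell j.
Proof.
rewrite (qfE hchi).
by have -> : i.+1%:R *: v - i%:R *: v = v by rewrite -scalerBl -natr1 addrC addKr scale1r.
Qed.

Lemma sum_step_le i A (J s : nat) : measurable A ->
  \sum_(j < J) pr (A `&` ~` step i j%:R) <= (K1 * (Nof ell + s))%:R * pr A + 2 * K1%:R * 4 ^- s.
Proof.
move=> mA; set H := (K1 * (Nof ell + s))%N.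
have mI j : measurable (A `&` ~` step i j%:R) by apply: measurableI => //; apply: measurableC; exact: step_meas.
have T := tail_sum (qf_ge0 P chi hd r0 ell) (fun s j => @qf_tail _ _ _ _ P mu chi hchi hd r0 R1 r00 pJ0 ell s j (ltW v0)) s (H + J).
apply: le_trans (_ : \sum_(0 <= j < H + J) pr (A `&` ~` step i j%:R) <= _).
  rewrite -(big_mkord xpredT (fun j => pr (A `&` ~` step i j%:R))) [leRHS](big_cat_nat (n := J)) ?leq_addl//=.
  by rewrite lerDl sumr_ge0// => j _; exact: pr_ge0.
rewrite (big_cat_nat (n := H)) ?leq_addr//=; apply: lerD.
  rewrite big_mkord -sum_ord_const; apply: ler_sum => j _.
  by apply: pr_mono => // w [].
apply: le_trans T; apply: ler_sum => j _; rewrite -(step_qf i).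
by apply: pr_mono => [//||w []//]; apply: measurableC; exact: step_meas.
Qed.

(* The event on which the greedy chopping of [0, n v] pays for a single step at [i v]. *)
Definition Ai n M i : set Omega := if (i + M < n)%N then G `&` ~` LM i M else setT.

Lemma measurable_Ai n M i : measurable (Ai n M i).
Proof.
rewrite /Ai; case: ifP => _ //; apply: measurableI; first exact: measurable_G.
by apply: measurableC; exact: measurable_LM.
Qed.

Lemma kw_det n M J w : 0 <= lam - eps -> (0 < n)%N -> G w -> (forall i : 'I_n, step i J%:R w) ->
  cev chi setT rho rho 0 (n%:R *: v)
    (th * n%:R + \sum_(ij : 'I_n * 'I_J) 1 * ind (Ai n M ij.1 `&` ~` step ij.1 ij.2%:R) w) w.
Proof.
move=> lp n0 Gw hs.
pose z (i : nat) := \sum_(j < J) ind (~` step i j%:R) w.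
pose L (i : nat) := (i + M < n)%N && `[< LM i M w >].
have th0 : 0 <= th by rewrite mulr_ge0// ltW.
have z0 i : 0 <= z i by apply: sumr_ge0 => j _; exact: ind_ge0.
have c := @chop R d (chi w `&` setT) rho v th M n z L th0 z0 _ _ 0%N n0.
have {c}c := c (fun i (hi : (i < n)%N) => ind_sum_conn (hs (Ordinal hi))).
have {c}c : conn (chi w `&` setT) rho rho (0%:R *: v) (n%:R *: v)
   (th * (n - 0)%:R + \sum_(0 <= i < n) (if L i then 0 else z i)).
  by apply: c => k /andP[k1 /asboolP[j hj cj]]; split => //; exists j.
rewrite scale0r subn0 in c; apply: connW c => //.
rewrite lerD2l big_mkord sum_pair; apply: ler_sum => i _; rewrite /L /z /Ai.
case: ifP => hL; first by apply: sumr_ge0 => j _; rewrite mul1r ind_ge0.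
apply: ler_sum => j _; rewrite mul1r; case: ifP => hi; last by rewrite setTI.
rewrite hi /= in hL; move: hL => /asboolP hL.
rewrite indI; case: (indP (R := R) (G `&` ~` LM i M) w) => -[-> h]; first by rewrite mul1r.
by exfalso; apply: h.
Qed.

Lemma kw_pr n M J (a : R) : 0 <= lam - eps -> (0 < n)%N -> 0 < a ->
  pr G <= pr (cev chi setT rho rho 0 (n%:R *: v) (th * n%:R + a)) +
    (\sum_(i < n) \sum_(j < J) pr (Ai n M i `&` ~` step i j%:R)) / a + n%:R * qf ell J.
Proof.
move=> lp n0 a0.
have mA i (j : nat) : measurable (Ai n M i `&` ~` step i j%:R).
  by apply: measurableI; [exact: measurable_Ai|apply: measurableC; exact: step_meas].
have mc t : measurable (cev chi setT rho rho 0 (n%:R *: v) t).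
  by apply: (measurable_cev hchi); exact: openLT.
pose S := [set w | forall i : 'I_n, step i J%:R w].
have mS : measurable S by apply: measurable_forall_fin => i; exact: step_meas.
pose D := (G `&` S) `&` ~` cev chi setT rho rho 0 (n%:R *: v) (th * n%:R + a).
have mD : measurable D by apply: measurableI; [apply: measurableI => //; exact: measurable_G|exact: measurableC].
have hD : pr D <= (\sum_(i < n) \sum_(j < J) pr (Ai n M i `&` ~` step i j%:R)) / a.
  rewrite ler_pdivlMr// mulrC.
  have := @markov_ind R dO Omega P ('I_n * 'I_J)%type (fun ij => Ai n M ij.1 `&` ~` step ij.1 ij.2%:R) (fun=> 1) a (fun ij => mA _ _) (fun=> ler01) D mD.
  have -> : \sum_(ij : 'I_n * 'I_J) 1 * pr (Ai n M ij.1 `&` ~` step ij.1 ij.2%:R) =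
     \sum_(i < n) \sum_(j < J) pr (Ai n M i `&` ~` step i j%:R).
    by rewrite sum_pair; apply: eq_bigr => i _; apply: eq_bigr => j _; rewrite mul1r.
  apply => w [[Gw Sw] nc]; rewrite leNgt; apply/negP => lt; apply: nc.
  by apply: connW (kw_det M lp n0 Gw Sw) => //; rewrite lerD2l ltW.
have hS : pr (~` S) <= n%:R * qf ell J.
  rewrite -sum_ord_const.
  apply: le_trans (_ : pr [set w | exists i : 'I_n, (~` step i J%:R) w] <= _).
    apply: pr_mono; [exact: measurableC|by apply: measurable_exists_fin => i; apply: measurableC; exact: step_meas|].
    by move=> w nS; apply: contrapT => h; apply: nS => i; apply: contrapT => ns; apply: h; exists i.
  apply: le_trans (pr_exists_fin P (I := 'I_n) (F := fun i => ~` step i J%:R) _) _.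
    by move=> i; apply: measurableC; exact: step_meas.
  by apply: ler_sum => i _; rewrite step_qf.
apply: le_trans (lerD (lerD (lexx _) hD) hS).
have mU : measurable (cev chi setT rho rho 0 (n%:R *: v) (th * n%:R + a) `|` D) by exact: measurableU.
apply: le_trans (lerD (prU_le P (mc _) mD) (lexx _)).
apply: le_trans (prU_le P mU (measurableC mS)).
apply: pr_mono; [exact: measurable_G|by apply: measurableU => //; exact: measurableC|].
move=> w Gw; have [Sw|nS] := pselect (S w); last by right.
by left; have [c|nc] := pselect (cev chi setT rho rho 0 (n%:R *: v) (th * n%:R + a) w); [left|right].
Qed.

Lemma sum_Ai n M J (s : nat) (eta : R) : (forall k, pr (G `&` ~` LM k M) <= eta) -> 0 <= eta ->
  \sum_(i < n) \sum_(j < J) pr (Ai n M i `&` ~` step i j%:R) <=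
  n%:R * ((K1 * (Nof ell + s))%:R * eta + 2 * K1%:R * 4 ^- s) + M%:R * ((K1 * Nof ell)%:R + 2 * K1%:R).
Proof.
move=> hM eta0; set A := _ + 2 * K1%:R * _; set B := _ + 2 * K1%:R.
have A0 : 0 <= A by rewrite addr_ge0// mulr_ge0// ?invr_ge0 ?exprn_ge0.
have B0 : 0 <= B by rewrite addr_ge0// mulr_ge0.
apply: le_trans (_ : \sum_(i < n) (A + (n <= i + M)%N%:R * B) <= _).
  apply: ler_sum => i _.
  rewrite /Ai; case: (ltnP (i + M) n) => hi /=.
    rewrite mul0r addr0; apply: le_trans (sum_step_le i J s _) _.
      by apply: measurableI; [exact: measurable_G|apply: measurableC; exact: measurable_LM].
    by rewrite /A lerD2r ler_wpM2l.
  rewrite mul1r; apply: le_trans (sum_step_le i J 0 measurableT) _.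
  by rewrite addn0 expr0 invr1 mulr1 prT mulr1 lerDr.
rewrite big_split/= sum_ord_const lerD2l -mulr_suml ler_wpM2r// -natr_sum ler_nat.
rewrite -(big_mkord xpredT (fun i => nat_of_bool (n <= i + M)%N)).
rewrite (eq_bigr (fun i => if (n <= i + M)%N then 1%N else 0%N)) => [|j _]; last by case: leqP.
rewrite -big_mkcond sum1_count -size_filter -[leqRHS](size_iota (n - M)); apply: uniq_leq_size.
  by rewrite filter_uniq// iota_uniq.
move=> j; rewrite mem_filter !mem_iota add0n subn0 => /= /andP[h1 h2].
by rewrite leq_subLR addnC h1 /=; apply: leq_trans h2 _; rewrite addnC -leq_subLR.
Qed.

Lemma pr_G0 : 0 <= lam - eps -> pr G = 0.
Proof.
move=> lp; apply/eqP; rewrite eq_le pr_ge0 andbT leNgt; apply/negP => q0.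
set q := pr G in q0.
have ee : 0 < eps * ell by rewrite mulr_gt0.
have K10 : (0 : R) < K1%:R by rewrite ltr0n.
pose ze := q * (eps * ell) / 32.
have ze0 : 0 < ze by rewrite divr_gt0// mulr_gt0.
have z1 : 0 < ze / (2 * K1%:R) by rewrite divr_gt0// mulr_gt0.
have [s hs] := pow4V_small z1.
have H0 : (0 : R) < (K1 * (Nof ell + s))%:R by rewrite ltr0n.
have z2 : 0 < ze / (K1 * (Nof ell + s))%:R by rewrite divr_gt0.
have [M hM] := GM_small z2.
have e20 : 0 < eps / 2 by rewrite divr_gt0.
have q80 : 0 < q / 8 by rewrite divr_gt0.
have [y0 hy0] := lower_prob hchi hd r00 pJ0 e20 q80.
have [n1 hn1] := natceil (y0 / ell).
have [n2 hn2] := natceil (M%:R * ((K1 * Nof ell)%:R + 2 * K1%:R) / ze).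
have [n3 hn3] := lin_pow2 (8 / q).
pose n := (n1 + n2 + n3).+1.
have nR0 : (0 : R) < n%:R by rewrite ltr0n.
pose J := (K1 * (Nof ell + n))%N.
pose a := eps / 2 * ell * n%:R.
have a0 : 0 < a by rewrite !mulr_gt0.
have := kw_pr M J lp (ltn0Sn _ : (0 < n)%N) a0; apply/negP; rewrite -ltNge -/q.
have b1 : pr (cev chi setT rho rho 0 (n%:R *: v) (th * n%:R + a)) <= q / 8.
  have <- : (lam - eps / 2) * (n%:R * ell) = th * n%:R + a by rewrite /a; field.
  have E : enorm (n%:R *: v - 0) = enorm ((n%:R * ell) *: e1 hd - 0).
    by rewrite !subr0 !enormZ enorm_e1 mulr1 normrM !ger0_norm// ltW.
  rewrite (cev_law hchi hd _ _ _ E).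
  apply: hy0; rewrite -ler_pdivrMr//; apply: le_trans hn1 _; rewrite ler_nat.
  by apply: leqW; rewrite -addnA leq_addr.
have b3 : n%:R * qf ell J <= q / 8.
  have h : qf ell J <= 4 ^- n by apply: (qf_tail hchi hd r00 pJ0) => //; exact: ltW.
  apply: le_trans (ler_wpM2l (ltW nR0) h) _.
  have := hn3 n; rewrite mulrAC ler_pdivrMr// => /(_ ltac:(by apply: leqW; rewrite leq_addl)) h3.
  have p2 : (0 : R) < 2 ^+ n by rewrite exprn_gt0.
  have -> : (4 : R) ^- n = 2 ^- n * 2 ^- n by rewrite -invfM -exprMn; congr (_ ^- _); ring.
  rewrite mulrA ler_pdivrMr// ler_pdivrMr//.
  have n1' : (n%:R : R) <= n.+1%:R by rewrite ler_nat.
  have p21 : (1 : R) <= 2 ^+ n by rewrite -natrX ler1n expn_gt0.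
  apply: le_trans (_ : q / 8 * 2 ^+ n <= _); first by move: h3 n1'; lra.
  by rewrite ler_peMr// mulr_ge0 ?(ltW q80)// ltW.
have b2 : (\sum_(i < n) \sum_(j < J) pr (Ai n M i `&` ~` step i j%:R)) / a <= q / 4.
  rewrite ler_pdivrMr//; apply: le_trans (sum_Ai n J s hM _) _; first by rewrite ltW// divr_gt0.
  have h1 : (K1 * (Nof ell + s))%:R * (ze / (K1 * (Nof ell + s))%:R) = ze.
    by rewrite mulrCA divff ?gt_eqF// mulr1.
  have h2 : 2 * K1%:R * 4 ^- s <= ze.
    by rewrite mulrC -ler_pdivlMr ?mulr_gt0// ltW.
  have h3 : M%:R * ((K1 * Nof ell)%:R + 2 * K1%:R) <= n%:R * ze.
    rewrite -ler_pdivrMr//; apply: le_trans hn2 _; rewrite ler_nat.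
    by apply: leqW; rewrite addnAC leq_addl.
  have -> : q / 4 * a = n%:R * (4 * ze) by rewrite /a /ze; field.
  rewrite h1; apply: le_trans (_ : n%:R * (2 * ze) + n%:R * ze <= _).
    by apply: lerD h3; rewrite ler_pM2l//; move: h2; lra.
  by rewrite -mulrDr ler_pM2l//; move: ze0; lra.
have aux (x y z : R) : x <= q / 8 -> y <= q / 4 -> z <= q / 8 -> x + y + z < q by lra.
exact: aux.
Qed.

Lemma lower_dir : {ae P, forall w, exists j0, forall j, (j0 <= j)%N ->
  ~ cev chi setT rho rho 0 (j%:R *: v) ((lam - 2 * eps) * ell * j%:R) w}.
Proof.
have [lp|lp] := ltrP (lam - eps) 0.
  apply: aeW => w; exists 0%N => j _; apply: cev_neg.
  rewrite mulr_le0_ge0// mulr_le0_ge0 ?(ltW v0)//; move: lp eps0; lra.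
apply: filterS (pr0_ae measurable_G (pr_G0 lp)) => w nG.
apply: contrapT => h; apply: nG => j0; apply: contrapT => h'; apply: h; exists j0 => j jj c.
by apply: h'; exists j.
Qed.

End KW.

(** * Lattice animals *)

Section CellSeqs.
Context {R : realType}.
Local Notation h := (2^-1 : R).

Definition ndist (a b : nat) : nat := (a - b + (b - a))%N.

Lemma sum_half m : \sum_(j < m) h ^+ j <= 2.
Proof.
suff -> : \sum_(j < m) h ^+ j = 2 - 2 * h ^+ m by rewrite lerBlDr lerDl mulr_ge0// exprn_ge0// invr_ge0.
elim: m => [|m ih]; first by rewrite big_ord0 expr0 mulr1 subrr.
by rewrite big_ord_recr /= ih exprS; field.
Qed.

Lemma sum_half_below a : \sum_(b < a) h ^+ (a - b) <= 1.
Proof.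
rewrite (reindex_inj rev_ord_inj)/=.
rewrite (eq_bigr (fun j : 'I_a => h * h ^+ j)) => [|j _].
  by rewrite -mulr_sumr ler_pdivrMl// mulr1; exact: sum_half.
by rewrite subKn// exprS.
Qed.

Lemma sum_ndist K a : \sum_(b < K) h ^+ ndist a b <= 3.
Proof.
have h0 n : 0 <= h ^+ n by rewrite exprn_ge0// invr_ge0.
apply: le_trans (_ : \sum_(0 <= b < a + K) h ^+ ndist a b <= _).
  rewrite -(big_mkord xpredT (fun b => h ^+ ndist a b)) [leRHS](big_cat_nat (n := K)) ?leq_addl//=.
  by rewrite lerDl sumr_ge0.
rewrite (big_cat_nat (n := a)) ?leq_addr//=.
have -> : (3 : R) = 1 + 2 by ring.
apply: lerD.
  rewrite big_mkord; apply: le_trans (sum_half_below a); apply: ler_sum => b _.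
  by rewrite /ndist (_ : b - a = 0)%N ?addn0//; apply/eqP; rewrite subn_eq0 ltnW.
rewrite -{1}[a]add0n big_addn addnC addnK big_mkord; apply: le_trans (sum_half K).
apply: ler_sum => b _; rewrite /ndist addnK (_ : a - (b + a) = 0)%N ?add0n//.
by apply/eqP; rewrite subn_eq0 leq_addl.
Qed.

Variables (d N : nat).
Definition cell := {ffun 'I_d -> 'I_N}.
HB.instance Definition _ := Finite.on cell.

Definition cdist (u v : cell) : nat := (\sum_i ndist (u i) (v i))%N.

Lemma sum_cdist u : \sum_(v : cell) h ^+ cdist u v <= 3 ^+ d.
Proof.
rewrite (eq_bigr (fun v : cell => \prod_i h ^+ ndist (u i) (v i))) => [|v _]; last by rewrite prodrXr.
rewrite -(bigA_distr_bigA (fun i (b : 'I_N) => h ^+ ndist (u i) b)) /=.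
rewrite -[X in 3 ^+ X]card_ord -prodr_const; apply: ler_prod => i _.
by rewrite sum_ndist sumr_ge0// => b _; rewrite exprn_ge0// invr_ge0.
Qed.

Fixpoint cvar (u : cell) (s : seq cell) : nat := if s is v :: s' then (cdist u v + cvar v s')%N else 0%N.

Fixpoint allseqs k : seq (seq cell) :=
  if k is k'.+1 then [seq v :: s | v <- enum {: cell}, s <- allseqs k'] else [:: [::]].

Lemma mem_allseqs k s : (s \in allseqs k) = (size s == k).
Proof.
elim: k s => [|k ih] s /=; first by rewrite inE size_eq0.
apply/allpairsP/eqP => [[[v s'] /= [_ hs ->]]|].
  by move: hs; rewrite ih => /eqP <-.
case: s => // v s' [hs]; exists (v, s'); split => //=; first by rewrite mem_enum.
by rewrite ih hs.
Qed.

(* The weights [2 ^ - cvar] make the number of cell sequences of small variation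
   exponential in their length. *)
Lemma sum_cvar k u : \sum_(s <- allseqs k) h ^+ cvar u s <= (3 ^+ d) ^+ k.
Proof.
elim: k u => [|k ih] u /=; first by rewrite big_seq1 expr0.
rewrite big_allpairs_dep /= big_enum /=.
rewrite (eq_bigr (fun v => h ^+ cdist u v * \sum_(s <- allseqs k) h ^+ cvar v s)) => [|v _]; last first.
  by rewrite mulr_sumr; apply: eq_bigr => s _; rewrite exprD.
apply: le_trans (_ : \sum_v h ^+ cdist u v * (3 ^+ d) ^+ k <= _).
  by apply: ler_sum => v _; rewrite ler_wpM2l// exprn_ge0// invr_ge0.
by rewrite -mulr_suml exprS ler_wpM2r ?exprn_ge0// sum_cdist.
Qed.

Lemma count_cvar k u B :
  \sum_(s <- [seq s <- allseqs k | (cvar u s <= B)%N]) 1 <= 2 ^+ B * (3 ^+ d) ^+ k :> R.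
Proof.
apply: le_trans (ler_wpM2l (exprn_ge0 _ (ler0n _ 2)) (sum_cvar k u)).
rewrite big_filter big_mkcond mulr_sumr; apply: ler_sum => s _.
case: ifP => hs; last by rewrite mulr_ge0 ?exprn_ge0// invr_ge0.
by rewrite exprVn ler_pdivlMr ?exprn_gt0// mul1r ler_eXn2l// ltr1n.
Qed.

Lemma sum_count_mem (s : seq cell) : (\sum_(z : cell) count_mem z s = size s)%N.
Proof.
elim: s => [|v s ih] /=; first by rewrite big1.
by rewrite big_split/= ih (bigD1 v)//= eqxx big1 ?addn0// => z /negbTE; rewrite eq_sym => ->.
Qed.

End CellSeqs.

Section Cells.
Context {R : realType} {d : nat} {dO : measure_display} {Omega : measurableType dO}.
Variables (P : probability Omega R) (mu : probability R R).
Variable chi : Omega -> set (@mpoint R d).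
Hypothesis hchi : is_PPP P mu chi.
Local Notation pr := (pr P).
Local Notation pt := 'rV[R]_d.
Local Notation mpt := (@mpoint R d).
Variables (J : set R) (u a : R) (m : nat) (a0 : pt).
Hypothesis mJ : measurable J.
Hypothesis J0 : J `<=` `]0, +oo[%classic.
Hypothesis u0 : 0 <= u.
Hypothesis ap : 0 < a.
Local Notation T := (cell d (2 * m).+1).

Definition cellr (z : T) : @rect R d :=
  Rect (a0 + \row_i (a * ((z i)%:R - m%:R))) (a0 + \row_i (a * ((z i)%:R - m%:R + 1))) 0 u J.

Lemma cellr_ok z : rect_ok (cellr z).
Proof. by split => //= i; rewrite !mxE lerD2l ler_pM2l// lerDl. Qed.

Lemma cellr_int z : rect_intensity mu (cellr z) = a ^+ d * u * fine (mu J).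
Proof.
rewrite /rect_intensity /= subr0; congr (_ * _ * _).
rewrite (eq_bigr (fun=> a)) ?prodr_const ?card_ord// => i _; rewrite !mxE; ring.
Qed.

Lemma cellr_disj z z' : z != z' -> rect_set (cellr z) `&` rect_set (cellr z') = set0.
Proof.
move=> zz; rewrite -subset0 => p [[/= h1 _] [/= h2 _]]; move/eqP: zz; apply.
apply/ffunP => i; apply: val_inj => /=; move: (h1 i) (h2 i); rewrite !mxE => /andP[k1 k2] /andP[k3 k4].
have aux (A B C : R) : C + a * A <= p.1 ord0 i -> p.1 ord0 i < C + a * (B + 1) -> A < B + 1.
  by move=> l1 l2; rewrite -(ltr_pM2l ap) -(ltrD2l C); exact: le_lt_trans l2.
have := aux _ _ _ k1 k4; have := aux _ _ _ k3 k2.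
have sh (x y : nat) : (x%:R - m%:R < y%:R - m%:R + 1 :> R) = (x < y.+1)%N.
  by rewrite addrAC ltrD2r natr1 ltr_nat.
by rewrite !sh !ltnS => l1 l2; apply/eqP; rewrite eqn_leq l1 l2.
Qed.

Definition cidx (x : pt) : T := [ffun i => inord (Num.truncn ((x ord0 i - a0 ord0 i) / a + m%:R))].

Definition inr_ (x : pt) := forall i, `|x ord0 i - a0 ord0 i| <= m%:R * a.

Lemma cidx_itv x i : inr_ x ->
  (cidx x i)%:R <= (x ord0 i - a0 ord0 i) / a + m%:R < (cidx x i)%:R + 1.
Proof.
move=> /(_ i); rewrite ler_norml => /andP[h1 h2].
have l1 : 0 <= (x ord0 i - a0 ord0 i) / a + m%:R.
  by rewrite -lerBlDr sub0r ler_pdivlMr// mulNr.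
have l2 : (x ord0 i - a0 ord0 i) / a + m%:R <= (2 * m)%:R.
  by rewrite mul2n -addnn natrD lerD2r ler_pdivrMr.
have /truncn_itv/andP[k1 k2] := l1.
rewrite ffunE inordK; first by rewrite natr1 k1 k2.
by rewrite ltnS -(ler_nat R); exact: le_trans l2.
Qed.

Lemma cidx_in p : inr_ (mctr p) -> 0 <= mtim p < u -> J (mrad p) -> rect_set (cellr (cidx (mctr p))) p.
Proof.
move=> hi ht hr; split => //= i; have := cidx_itv i hi; rewrite !mxE -/(mctr p).
set c := (cidx _ _)%:R; set x := mctr p ord0 i; set y := a0 ord0 i => /andP[h1 h2].
rewrite -lerBrDl -ltrBlDl -!(mulrC _ a) -ler_pdivlMr// -ltr_pdivrMr//.
by move: h1 h2; set q := (x - y) / a; lra.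
Qed.

Lemma ndist_trunc (p q : nat) (A B : R) : p%:R <= A < p%:R + 1 -> q%:R <= B < q%:R + 1 ->
  (ndist p q)%:R <= `|A - B| + 1.
Proof.
move=> /andP[h1 h2] /andP[h3 h4]; rewrite /ndist; case: (leqP p q) => pq.
  have -> : (p - q = 0)%N by apply/eqP; rewrite subn_eq0.
  rewrite add0n natrB//; have := ler_norm (B - A); rewrite distrC; set n := `|_|; lra.
have -> : (q - p = 0)%N by apply/eqP; rewrite subn_eq0 ltnW.
rewrite addn0 natrB ?(ltnW pq)//; have := ler_norm (A - B); set n := `|_|; lra.
Qed.

Lemma cdist_le x y : inr_ x -> inr_ y ->
  (cdist (cidx x) (cidx y))%:R <= d%:R * enorm (y - x) / a + d%:R.
Proof.
move=> hx hy; rewrite natr_sum.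
apply: le_trans (_ : \sum_(i < d) (`|(y - x) ord0 i| / a + 1) <= _).
  apply: ler_sum => i _; apply: le_trans (ndist_trunc (cidx_itv i hx) (cidx_itv i hy)) _.
  rewrite lerD2r opprD addrACA subrr addr0 -mulrBl normrM (ger0_norm (_ : 0 <= a^-1)) ?invr_ge0 ?(ltW ap)//.
  by rewrite ler_pM2r ?invr_gt0// !mxE distrC; apply: le_of_eq; congr (`|_|); ring.
by rewrite big_split/= sum_ord_const mulr1 -mulr_suml lerD2r ler_pM2r ?invr_gt0// sum_le_enorm.
Qed.

Lemma cvar_le x s : inr_ x -> (forall y, y \in s -> inr_ y) ->
  (cvar (cidx x) (map cidx s))%:R <= d%:R * plen x s / a + d%:R * (size s)%:R.
Proof.
elim: s x => [|y s ih] x hx hs /=; first by rewrite !mulr0 mul0r addr0.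
rewrite natrD; have hy : inr_ y by apply: hs; rewrite inE eqxx.
have h1 := cdist_le hx hy; have h2 := ih y hy (fun z zs => hs z (mem_behead (s := y :: s) zs)).
apply: le_trans (lerD h1 h2) _; apply: le_of_eq; rewrite -natr1; ring.
Qed.

Definition cseqs := [seq s <- allseqs d (2 * m).+1 m | (cvar (cidx a0) s <= 2 * (d * m))%N].

Definition cellev : set Omega := [set w | exists2 s, s \in cseqs &
  forall z, cge chi (cellr z) (count_mem z s) w].

Lemma measurable_cellev1 s : measurable [set w | forall z, cge chi (cellr z) (count_mem z s) w].
Proof. by apply: measurable_forall_fin => z; apply: (measurable_cge hchi); exact: cellr_ok. Qed.

Lemma measurable_cellev : measurable cellev.
Proof. by apply: measurable_exists_in => s _; exact: measurable_cellev1. Qed.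

Lemma pr_cellev : pr cellev <= (12 ^+ d * (a ^+ d * u * fine (mu J))) ^+ m.
Proof.
apply: le_trans (pr_exists_in P (s := cseqs) (fun s _ => measurable_cellev1 s)) _.
set th := a ^+ d * u * fine (mu J).
have th0 : 0 <= th by rewrite !mulr_ge0 ?exprn_ge0 ?(ltW ap)// fine_ge0.
apply: le_trans (_ : \sum_(s <- cseqs) (1 * th ^+ m) <= _).
  rewrite big_seq [leRHS]big_seq; apply: ler_sum => s; rewrite mem_filter mem_allseqs => /andP[_ /eqP sm].
  rewrite mul1r -[in th ^+ m]sm -sum_count_mem.
  apply: (ppp_cge_le hchi); [exact: cellr_ok|exact: cellr_disj|].
  by move=> z; rewrite cellr_int.
rewrite -mulr_suml [X in _ <= X](exprMn m (12 ^+ d) th) ler_wpM2r ?exprn_ge0//.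
apply: le_trans (count_cvar _ _ _) _.
rewrite mulnA exprM -exprMn [X in X ^+ m <= _](_ : _ = 12 ^+ d)//.
by rewrite exprM -exprMn; congr (_ ^+ _); ring.
Qed.

Lemma cellevP w ps : uniq ps -> size ps = m -> (forall p, p \in ps -> chi w p) ->
  (forall p, p \in ps -> mtim p < u) -> (forall p, p \in ps -> J (mrad p)) ->
  plen a0 (map mctr ps) <= m%:R * a -> cellev w.
Proof.
move=> ups sm hp ht hr hl.
have i0 : inr_ a0 by move=> i; rewrite subrr normr0 mulr_ge0// ltW.
have hi x : x \in map mctr ps -> inr_ x.
  move=> xs i; apply: le_trans hl.
  have := coord_le_enorm (x - a0) i; rewrite !mxE => h1; apply: le_trans h1 _.
  have -> : x = last a0 [:: x] by [].
  apply: le_trans (dist_le_plen a0 [:: x]) _; apply: plen_subseq.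
  by rewrite sub1seq.
exists (map cidx (map mctr ps)).
  rewrite mem_filter mem_allseqs !size_map sm eqxx andbT -(ler_nat R).
  apply: le_trans (cvar_le i0 hi) _; rewrite size_map sm mul2n -addnn natrD natrM lerD2r.
  by rewrite -mulrA ler_wpM2l// ler_pdivrMr.
move=> z; exists [seq p <- ps | cidx (mctr p) == z]; split.
- exact: filter_uniq.
- by rewrite size_filter -map_comp count_map.
move=> p; rewrite mem_filter => /andP[/eqP <- pps]; split; first exact: hp.
apply: cidx_in; [by apply: hi; apply: map_f|by rewrite (ppp_tim hchi (hp p pps)) ht|exact: hr].
Qed.

End Cells.

(** * The uniform lower bound *)

Section TinyDet.
Context {R : realType} {d : nat}.
Local Notation pt := 'rV[R]_d.
Local Notation mpt := (@mpoint R d).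

Definition srad (l : seq mpt) : R := \sum_(q <- l) mrad q.

Lemma srad_cons q l : srad (q :: l) = mrad q + srad l.
Proof. exact: big_cons. Qed.

Lemma last_split (T : Type) (a : pred T) (l : seq T) : has a l ->
  exists l1 b l2, [/\ l = l1 ++ b :: l2, a b & all (predC a) l2].
Proof.
elim: l => //= q l ih; case hl : (has a l) => /=.
  by move=> _; have [l1 [b [l2 [-> h1 h2]]]] := ih hl; exists (q :: l1), b, l2.
rewrite orbF => aq; exists [::], q, l; split => //.
by rewrite all_predC hl.
Qed.

Lemma sum_suffix (l : seq mpt) (D : R) : 0 < D -> D <= srad l ->
  exists l1 b l2, [/\ l = l1 ++ b :: l2, D <= srad (b :: l2) & srad l2 < D].
Proof.
move=> D0; elim: l => [|q l ih]; first by rewrite /srad big_nil leNgt D0.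
move=> h; have [hl|hl] := lerP D (srad l).
  by have [l1 [b [l2 [-> h1 h2]]]] := ih hl; exists (q :: l1), b, l2.
by exists [::], q, l.
Qed.

Lemma dist_srad (x : pt) q l : path lk q l -> enorm (x - mctr (last q l)) < mrad (last q l) ->
  enorm (x - mctr q) <= srad (q :: l).
Proof.
elim: l q => [|q' l ih] q /=; first by rewrite /srad big_seq1 => _ /ltW.
move=> /andP[h1 h2] h3; have := ih q' h2 h3; rewrite (srad_cons q) => h.
apply: le_trans (enorm_tri (mctr q') _ _) _; rewrite addrC; apply: lerD => //; exact: ltW.
Qed.

Lemma plen_srad q l : (forall p, p \in q :: l -> 0 < mrad p) -> path lk q l ->
  plen (mctr q) (map mctr l) <= srad (q :: l).
Proof.
elim: l q => [|q' l ih] q hr /=; first by rewrite /srad big_seq1 => _; apply: ltW; apply: hr; rewrite mem_head.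
move=> /andP[h1 h2]; rewrite (srad_cons q); apply: lerD; first exact: ltW.
by apply: ih => // p hp; apply: hr; rewrite inE hp orbT.
Qed.

Lemma tiny_det (x : pt) q l (rt A D tau : R) :
  0 < rt -> 0 < A -> 0 < D -> A * tau <= D / 2 ->
  (forall p, p \in q :: l -> 0 <= mtim p /\ 0 < mrad p <= rt) -> path lk q l ->
  enorm (x - mctr (last q l)) < mrad (last q l) -> uniq (map mctr (q :: l)) ->
  stime (q :: l) <= tau -> D < enorm (x - mctr q) ->
  exists b ps, [/\ enorm (x - mctr b) <= D + rt, uniq ps, (forall p, p \in ps -> p \in q :: l /\ mtim p < rt / A),
    plen (mctr b) (map mctr ps) <= D + rt & D / (2 * rt) <= (size ps)%:R].
Proof.
move=> rt0 A0 D0 AD hl pl hx ul ht hD.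
have := ltW (lt_le_trans hD (dist_srad pl hx)) => hs.
have [l1 [b [l2 [e h1 h2]]]] := sum_suffix D0 hs.
have sub p : p \in b :: l2 -> p \in q :: l by rewrite e mem_cat => ->; rewrite orbT.
have pb : path lk b l2.
  have /cat_sorted2[_ //] : sorted lk (l1 ++ b :: l2) by rewrite -e.
have lastE : last q l = last b l2 by rewrite -[LHS]/(last q (q :: l)) e last_cat.
have rb : mrad b <= rt by have [_ /andP[_]] := hl b (sub b (mem_head _ _)).
have sb : srad (b :: l2) <= D + rt by rewrite srad_cons addrC; apply: lerD => //; exact: ltW.
pose fast (p : mpt) := mtim p < rt / A.
pose ps := [seq p <- b :: l2 | fast p].
have mps p : p \in ps -> p \in q :: l /\ mtim p < rt / A.
  by rewrite mem_filter => /andP[? /sub].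
exists b, ps; split => //.
- by apply: le_trans sb; rewrite lastE in hx; exact: dist_srad.
- apply: filter_uniq; apply: (@map_uniq _ _ mctr); move: ul; rewrite e map_cat cat_uniq.
  by case/and3P.
- apply: le_trans (_ : plen (mctr b) (map mctr (b :: l2)) <= _).
    by apply: plen_subseq; apply: map_subseq; exact: filter_subseq.
  rewrite /= subrr enorm0 add0r; apply: le_trans sb; apply: plen_srad => // p /sub /hl[_ /andP[]//].
rewrite ler_pdivrMr ?mulr_gt0//.
have key : srad (b :: l2) <= A * stime (b :: l2) + rt * (size ps)%:R.
  rewrite /ps size_filter -sum1_count natr_sum big_mkcond /= mulr_sumr /srad /stime mulr_sumr -big_split /=.
  rewrite big_seq [leRHS]big_seq; apply: ler_sum => p /sub /hl[t0 /andP[_ rp]].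
  rewrite /fast; case: ltrP => hf; rewrite ?mulr1 ?mulr0 ?addr0.
    by apply: le_trans rp _; rewrite lerDr mulr_ge0// ltW.
  by apply: le_trans rp _; move: hf; rewrite ler_pdivrMr// mulrC.
have st : stime (b :: l2) <= tau.
  apply: le_trans ht; rewrite e stime_cat lerDr /stime big_seq sumr_ge0// => p hp.
  by have [] := hl p; rewrite // e mem_cat hp.
have := ler_wpM2l (ltW A0) st; move: key h1 AD; rewrite mulrCA.
set S := srad _; set a := A * _; set c := A * tau; set f := rt * _ => *.
have -> : (size ps)%:R * rt = f by rewrite mulrC.
lra.
Qed.

Lemma inner_point (c z : pt) (r rt : R) : 0 < rt -> rt < r -> enorm (z - c) < r ->
  exists y, enorm (y - z) <= rt / 2 /\ enorm (c - y) + rt / 2 <= r.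
Proof.
move=> rt0 rr zc; have [h|h] := lerP (enorm (z - c)) (rt / 2).
  by exists c; rewrite (enormB c) subrr enorm0; split => //; lra.
have n0 : 0 < enorm (z - c) by apply: lt_trans h; rewrite divr_gt0.
pose th := (rt / 2) / enorm (z - c).
have th1 : th <= 1 by rewrite ler_pdivrMr// mul1r ltW.
have th0 : 0 <= th by rewrite !divr_ge0// ltW.
exists (z + th *: (c - z)); split.
  by rewrite addrC addKr enormZ ger0_norm// (enormB c) divfK ?gt_eqF.
have -> : c - (z + th *: (c - z)) = (1 - th) *: (c - z) by rewrite scalerBl scale1r opprD addrA.
rewrite enormZ ger0_norm ?subr_ge0// (enormB c) mulrBl mul1r divfK ?gt_eqF// subrK; exact: ltW.
Qed.

End TinyDet.

Section Unions.
Context {R : realType} {d : nat} {dO : measure_display} {Omega : measurableType dO}.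
Variable P : probability Omega R.
Local Notation pr := (pr P).

Lemma ae_and (Q Q' : Omega -> Prop) : {ae P, forall w, Q w} -> {ae P, forall w, Q' w} ->
  {ae P, forall w, Q w /\ Q' w}.
Proof. by apply: filterS2 => w h h'; split. Qed.

Lemma ae_forall_fin (I : finType) (Q : I -> Omega -> Prop) :
  (forall i, {ae P, forall w, Q i w}) -> {ae P, forall w, forall i, Q i w}.
Proof.
move=> h.
have : {ae P, forall w, forall k : nat, forall i : I, pickle i = k -> Q i w}.
  apply: ae_forall_nat => k.
  have [[i ik]|ni] := pselect (exists i : I, pickle i = k); last first.
    by apply: aeW => w i ik; exfalso; apply: ni; exists i.
  apply: filterS (h i) => w hi i' ik'.
  by have -> : i' = i by apply: (pcan_inj pickleK_inv); rewrite ik' ik.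
by apply: filterS => w hw i; apply: (hw (pickle i)).
Qed.

Lemma grid_num (G n K : nat) : (0 < G)%N ->
  (K * (2 * (G * 2 ^ n)).+1 ^ d)%N%:R * 4 ^- (d.+1 * n) <= (K * (3 * G) ^ d)%N%:R * (n.+1%:R / 2 ^+ n) :> R.
Proof.
move=> G0.
apply: le_trans (_ : (K * ((3 * G) ^ d * (2 ^ n) ^ d))%N%:R * 4 ^- (d.+1 * n) <= _).
  rewrite ler_wpM2r ?invr_ge0 ?exprn_ge0// ler_nat leq_mul2l -expnMn.
  apply/orP; right; case: d => [|d'] //; rewrite leq_exp2r// -mulnA -[X in (_ <= X)%N]/(3 * (G * 2 ^ n))%N.
  by rewrite ltn_mul2r muln_gt0 G0 expn_gt0.
rewrite mulnA natrM -mulrA ler_wpM2l// -expnM natrX.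
have -> : (4 : R) ^- (d.+1 * n) = 2 ^- (n * d) * 2 ^- (n * d) * 2 ^- n * 2 ^- n.
  have -> : (4 : R) = 2 * 2 by ring.
  by rewrite exprMn mulSn mulnC exprD !invfM; ring.
rewrite !mulrA divff ?expf_neq0// mul1r ler_pM2r ?invr_gt0 ?exprn_gt0//.
apply: le_trans (_ : 1 <= _); last by rewrite ler1n.
by rewrite -invfM -exprD invf_le1 ?exprn_gt0// -natrX ler1n expn_gt0.
Qed.

Lemma union_rate (I : finType) (G n0 : nat)
  (F : forall n, I -> {ffun 'I_d -> 'I_(2 * (G * 2 ^ n)).+1} -> set Omega) : (0 < G)%N ->
  (forall n i z, measurable (F n i z)) ->
  (forall n, (n0 <= n)%N -> forall i z, pr (F n i z) <= 4 ^- (d.+1 * n)) ->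
  {ae P, forall w, exists n1, forall n, (n1 <= n)%N -> forall i z, ~ F n i z w}.
Proof.
move=> G0 mF hF.
pose B n := [set w | exists iz : I * {ffun 'I_d -> 'I_(2 * (G * 2 ^ n)).+1}, F n iz.1 iz.2 w].
have : {ae P, forall w, exists n1, forall n, (n1 <= n)%N -> ~ B n w}.
  apply: (@bc_lin_pow _ _ _ P B (#|I| * (3 * G) ^ d)%N%:R n0).
    by move=> n; apply: measurable_exists_fin => iz; exact: mF.
  move=> n nn; apply: le_trans (grid_num n #|I| G0).
  apply: le_trans (pr_exists_fin P (F := fun iz => F n iz.1 iz.2) (fun iz => mF n iz.1 iz.2)) _.
  apply: le_trans (_ : \sum_(iz : I * {ffun 'I_d -> 'I_(2 * (G * 2 ^ n)).+1}) 4 ^- (d.+1 * n) <= _).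
    by apply: ler_sum => iz _; exact: hF.
  by rewrite sumr_const cardT -cardE card_prod card_ffun !card_ord -(mulr_natl (4 ^- _)).
by apply: filterS => w [n1 h]; exists n1 => n nn i z Fw; apply: (h n nn); exists (i, z).
Qed.

End Unions.

Section LowerAE.
Context {R : realType} {d : nat} {dO : measure_display} {Omega : measurableType dO}.
Variables (P : probability Omega R) (mu : probability R R).
Variable chi : Omega -> set (@mpoint R d).
Hypothesis hchi : is_PPP P mu chi.
Hypothesis hd : (0 < d)%N.
Local Notation pr := (pr P).
Local Notation pt := 'rV[R]_d.
Local Notation mpt := (@mpoint R d).
Variables (r0 R1 : R).
Hypothesis r00 : 0 < r0.
Hypothesis pJ0 : 0 < fine (mu `]r0, R1[%classic).
Local Notation rho := (rho r0).
Local Notation C1 := (@C1 R d mu r0 R1).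
Local Notation lam := (lam P chi hd r0).
Let C10 : 0 < C1 := C1_gt0 hd r00 pJ0.
Let rp : 0 < rho := rho_gt0 r00.
Let d0 : (0 : R) < d%:R. Proof. by rewrite ltr0n. Qed.

Lemma pr_mu_le1 (J : set R) : measurable J -> 0 <= fine (mu J) <= 1.
Proof. by move=> mJ; rewrite fine_ge0//=; exact: (@pr_le1 _ _ _ mu J mJ). Qed.

Lemma tiny_ae (D T : R) : 0 < D -> 0 < T -> exists2 rt, 0 < rt <= 1 /\ rt <= rho &
  {ae P, forall w, exists n0, forall n, (n0 <= n)%N -> forall x q l, enorm x <= 2 ^+ n ->
    (forall p, p \in q :: l -> chi w p /\ mrad p <= rt) -> path lk q l ->
    enorm (x - mctr (last q l)) < mrad (last q l) -> uniq (map mctr (q :: l)) ->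
    stime (q :: l) <= T * 2 ^+ n -> enorm (x - mctr q) <= D * 2 ^+ n}.
Proof.
move=> D0 T0; pose A := D / (2 * T).
have A0 : 0 < A by rewrite divr_gt0// mulr_gt0.
pose rt := Num.min (Num.min rho 96^-1) (A / 4).
have rt0 : 0 < rt by rewrite !lt_min rp invr_gt0 divr_gt0// andbT/=.
have rtA : rt <= A / 4 by rewrite /rt ge_min lexx orbT.
have rt96 : rt <= 96^-1 by rewrite /rt !ge_min lexx !orbT.
have rtr : rt <= rho by rewrite /rt !ge_min lexx.
have rt1 : rt <= 1 by apply: le_trans rt96 _; rewrite invf_le1// ler1n.
exists rt; first by split=> //; apply/andP; split.
pose g : R := d%:R^-1; have g0 : 0 < g by rewrite invr_gt0.
have [G' hG'] := natceil ((2 + D) * d%:R); pose G := G'.+1.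
have hG : 2 + D <= g * G%:R.
  by rewrite mulrC ler_pdivlMr//; apply: le_trans hG' _; rewrite ler_nat.
pose m n := Num.truncn (D * 2 ^+ n / (2 * rt)).
pose J : set R := `]0, rt]%classic.
have mJ : measurable J by exact: measurable_itv.
have J0 : J `<=` `]0, +oo[%classic by move=> y; rewrite /J /= !in_itv /= andbT => /andP[].
have u0 : 0 <= rt / A by rewrite divr_ge0// ltW.
have a0 : 0 < 8 * rt by rewrite mulr_gt0.
have [n1 hn1] := lin_pow2 ((d.+2)%:R * (2 * rt) / D).
have [n2 hn2] := exists_pow2_gt ((1 + 9 * rt) / (3 * D)).
have mb n : D * 2 ^+ n / (2 * rt) < (m n)%:R + 1.
  have /truncn_itv/andP[_] : 0 <= D * 2 ^+ n / (2 * rt) by rewrite divr_ge0 ?mulr_ge0 ?exprn_ge0// ltW.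
  by rewrite natr1.
have mle n : (m n)%:R <= D * 2 ^+ n / (2 * rt).
  by have /truncn_itv/andP[] : 0 <= D * 2 ^+ n / (2 * rt) by rewrite divr_ge0 ?mulr_ge0 ?exprn_ge0// ltW.
pose F n (i : unit) (z : {ffun 'I_d -> 'I_(2 * (G * 2 ^ n)).+1}) :=
  cellev chi J (rt / A) (8 * rt) (m n) (gpt g z).
have AE : {ae P, forall w, exists n1, forall n, (n1 <= n)%N -> forall i z, ~ F n i z w}.
  apply: (@union_rate R d dO Omega P unit G n1 F) => //.
    by move=> n i z; apply: (measurable_cellev hchi).
  move=> n nn i z; apply: le_trans (pr_cellev hchi _ _ mJ J0 u0 a0) _.
  have /andP[mu0 mu1] := pr_mu_le1 mJ.
  have base : 12 ^+ d * ((8 * rt) ^+ d * (rt / A) * fine (mu J)) <= 4^-1.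
    rewrite !mulrA -exprMn -[leRHS]mul1r -[leRHS]mulr1; apply: ler_pM => //.
      by rewrite !mulr_ge0 ?exprn_ge0 ?mulr_ge0 ?(ltW rt0) ?invr_ge0 ?(ltW A0).
    rewrite -mulrA; apply: ler_pM; rewrite ?exprn_ge0 ?mulr_ge0 ?(ltW rt0) ?invr_ge0 ?(ltW A0)//.
      apply: exprn_ile1; first by rewrite !mulr_ge0// ltW.
      have : 96 * rt <= 1 by rewrite -ler_pdivlMl// mulr1.
      by lra.
    by rewrite ler_pdivrMr// mulrC.
  have base0 : 0 <= 12 ^+ d * ((8 * rt) ^+ d * (rt / A) * fine (mu J)).
    by rewrite !mulr_ge0 ?exprn_ge0 ?mulr_ge0 ?(ltW rt0) ?invr_ge0 ?(ltW A0).
  apply: le_trans (lerXn2r _ _ _ base) _; rewrite ?nnegrE// ?invr_ge0//.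
  rewrite -exprVn ler_wiXn2l ?invr_ge0 ?invf_le1 ?ler1n//.
  rewrite -ltnS -(ltr_nat R) -[ltRHS]natr1; apply: le_lt_trans (mb n).
  rewrite ler_pdivlMr ?mulr_gt0//; have := hn1 n nn; rewrite mulrAC ler_pdivrMr// => h.
  rewrite [leRHS]mulrC; apply: le_trans h; rewrite mulrAC ler_pM2r ?mulr_gt0// -natrM ler_nat.
  by apply: leq_mul.
apply: filterS AE => w [n3 hn3]; exists (maxn n2 n3) => n; rewrite geq_max => /andP[m2 m3] x q l xn hl pl hx ul ht.
rewrite leNgt; apply/negP => hD.
have p2 : (1 : R) <= 2 ^+ n by rewrite -natrX ler1n expn_gt0.
have D20 : 0 < D * 2 ^+ n by rewrite mulr_gt0// (lt_le_trans ltr01).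
have hl' p : p \in q :: l -> 0 <= mtim p /\ 0 < mrad p <= rt.
  by move=> /hl[h1 h2]; rewrite (ppp_tim hchi h1) (ppp_rad hchi h1).
have AT : A * (T * 2 ^+ n) <= D * 2 ^+ n / 2 by rewrite /A; apply: le_of_eq; field; rewrite gt_eqF.
have [b [ps [b1 b2 b3 b4 b5]]] := tiny_det rt0 A0 D20 AT hl' pl hx ul ht hD.
have bn i : `|mctr b ord0 i| <= g * (G * 2 ^ n)%:R.
  apply: le_trans (coord_le_enorm _ i) _; rewrite natrM natrX mulrA.
  apply: le_trans (_ : (2 + D) * 2 ^+ n <= _); last by rewrite ler_pM2r// (lt_le_trans ltr01).
  have := enorm_triB x (mctr b).
  have -> : enorm (mctr b) = enorm (mctr b - x + x) by rewrite subrK.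
  move=> _; apply: le_trans (enormD _ _) _; rewrite (enormB _ x) mulrDl.
  by move: b1 xn p2 rt1; set a := D * _; lra.
have [z hz] := gpt_approx g0 bn.
apply: (hn3 n m3 tt z).
apply: (@cellevP _ _ _ _ _ _ _ hchi _ _ _ _ _ a0 w (take (m n) ps)).
- exact: take_uniq.
- apply: size_takel; rewrite -(ler_nat R); exact: le_trans (mle n) b5.
- by move=> p /mem_take /b3[/hl[]].
- by move=> p /mem_take /b3[].
- move=> p /mem_take /b3[/hl [hp1 hp2] _]; rewrite /J /= in_itv /= hp2 andbT; exact: (ppp_rad hchi hp1).
apply: le_trans (plen_head _ (mctr b) _) _.
apply: le_trans (_ : 1 + (D * 2 ^+ n + rt) <= _).
  apply: lerD; first by apply: le_trans hz _; rewrite divff// gt_eqF.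
  apply: le_trans b4; apply: plen_subseq; rewrite map_take; exact: take_subseq.
have := mb n; rewrite ltr_pdivrMr ?mulr_gt0// mulrDl mul1r.
have := hn2 n m2; rewrite ltr_pdivrMr ?mulr_gt0// [2 ^+ n * _]mulrC -mulrA.
have -> : (m n)%:R * (8 * rt) = 4 * ((m n)%:R * (2 * rt)) by ring.
set a := D * _; set c := (m n)%:R * _; move: rt0; lra.
Qed.

Lemma hop_ae (kap sg g : R) (G : nat) : 0 < kap -> 0 < sg -> sg <= rho -> (0 < G)%N ->
  {ae P, forall w, exists n0, forall n, (n0 <= n)%N -> forall z : {ffun 'I_d -> 'I_(2 * (G * 2 ^ n)).+1},
    cev chi setT sg (2 * rho) (gpt g z) (gpt g z) (kap * 2 ^+ n) w}.
Proof.
move=> k0 s0 sr G0.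
pose c := (sg / (2 * d%:R)) ^+ d * fine (mu `]r0, R1[%classic) * kap.
have c0 : 0 < c by rewrite !mulr_gt0// exprn_gt0// divr_gt0// mulr_gt0.
have [n1 hn1] := lin_pow2 (2 * d.+1%:R / c).
pose F n (i : unit) (z : {ffun 'I_d -> 'I_(2 * (G * 2 ^ n)).+1}) :=
  ~` cev chi setT sg (2 * rho) (gpt g z) (gpt g z) (kap * 2 ^+ n).
have AE : {ae P, forall w, exists n1, forall n, (n1 <= n)%N -> forall i z, ~ F n i z w}.
  apply: (@union_rate R d dO Omega P unit G n1 F) => //.
    by move=> n i z; apply: (measC hchi); exact: openLT.
  move=> n nn i z; have p2 : (0 : R) < 2 ^+ n by rewrite exprn_gt0.
  have kn : 0 <= kap * 2 ^+ n by rewrite mulr_ge0// ltW.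
  have hp : pr (~` cev chi setT sg (2 * rho) (gpt g z) (gpt g z) (kap * 2 ^+ n)) <=
     expR (- ((sg / (2 * d%:R)) ^+ d * fine (mu `]r0, R1[%classic) * (kap * 2 ^+ n))).
    by apply: (pr_hop hchi hd r00) => //; exact: openLT.
  apply: le_trans hp _.
  have e2 : expR (- 2) <= 4^-1 :> R.
    rewrite expRN lef_pV2 ?posrE ?expR_gt0//.
    have -> : (2 : R) = 1 + 1 by ring.
    rewrite expRD; have h := expR_ge1Dx (1 : R).
    have -> : (4 : R) = (1 + 1) * (1 + 1) by ring.
    by apply: ler_pM.
  apply: le_trans (_ : expR (- (2 * (d.+1 * n)%:R)) <= _).
    rewrite ler_expR lerN2 mulrA -/c.
    have h := hn1 n nn; rewrite mulrAC ler_pdivrMr// in h; rewrite (mulrC c); apply: le_trans h.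
    by rewrite natrM mulrA ler_wpM2l ?mulr_ge0// ler_nat.
  rewrite -mulNr expRM_natr -exprVn; apply: lerXn2r => //; rewrite ?nnegrE ?expR_ge0 ?invr_ge0//.
apply: filterS AE => w [n2 h]; exists n2 => n nn z; apply: contrapT; exact: (h n nn tt z).
Qed.

Lemma local_ae (M G : nat) (g Dl : R) : (0 < G)%N ->
  {ae P, forall w, exists n0, forall n, (n0 <= n)%N ->
    forall (v : {ffun 'I_d -> 'I_(2 * M).+1}) (z : {ffun 'I_d -> 'I_(2 * (G * 2 ^ n)).+1}),
    enorm (2 ^+ n *: gpt M%:R^-1 v - gpt g z) <= Dl * 2 ^+ n + 1 ->
    cev chi setT rho (2 * rho) (gpt g z) (2 ^+ n *: gpt M%:R^-1 v)
      (C1 * (Dl * 2 ^+ n + 1 + 1 + (d.+1 * n)%:R)) w}.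
Proof.
move=> G0.
pose F n (v : {ffun 'I_d -> 'I_(2 * M).+1}) (z : {ffun 'I_d -> 'I_(2 * (G * 2 ^ n)).+1}) : set Omega :=
  if enorm (2 ^+ n *: gpt M%:R^-1 v - gpt g z) <= Dl * 2 ^+ n + 1 then
  ~` cev chi setT rho (2 * rho) (gpt g z) (2 ^+ n *: gpt M%:R^-1 v)
      (C1 * (Dl * 2 ^+ n + 1 + 1 + (d.+1 * n)%:R)) else set0.
have AE : {ae P, forall w, exists n1, forall n, (n1 <= n)%N -> forall i z, ~ F n i z w}.
  apply: (@union_rate R d dO Omega P _ G 0 F) => //.
    move=> n v z; rewrite /F; case: ifP => _; last exact: (@measurable0 _ Omega).
    by apply: (measC hchi); exact: openLT.
  move=> n _ v z; rewrite /F; case: ifP => h; last by rewrite pr0 invr_ge0 exprn_ge0.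
  apply: (pr_local hchi hd r00 pJ0) => //; first exact: openLT.
  by rewrite ler_pM2l// !lerD2r.
apply: filterS AE => w [n2 h]; exists n2 => n nn v z hvz; apply: contrapT => nc.
by apply: (h n nn v z); rewrite /F hvz.
Qed.

Definition ochain (X : set mpt) (x : pt) (t : R) := exists p s,
  [/\ forall q, q \in p :: s -> X q, enorm (mctr p) <= 1 & path lk p s] /\
  [/\ enorm (x - mctr (last p s)) < mrad (last p s), stime (p :: s) < t &
      uniq (map mctr (p :: s))].

(* Cutting a chain at its last ball of radius more than [rt]: what follows are tiny balls. *)
Lemma ochain_cut (X : set mpt) x t (rt D T : R) : (forall p, X p -> 0 <= mtim p /\ 0 < mrad p) ->
  0 < rt -> ochain X x t -> t <= T ->
  (forall q l, (forall p, p \in q :: l -> X p /\ mrad p <= rt) -> path lk q l ->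
    enorm (x - mctr (last q l)) < mrad (last q l) -> uniq (map mctr (q :: l)) ->
    stime (q :: l) <= T -> enorm (x - mctr q) <= D) -> 0 <= D ->
  enorm x <= 1 + D \/
  exists c y0, [/\ enorm c <= 1, enorm (y0 - x) <= D + rt / 2 &
    forall r1 g y, enorm (c - g) < r1 -> enorm (y0 - y) < rt / 4 -> conn X r1 (rt / 4) g y t].
Proof.
move=> X0 rt0 [p [s [[hX p1 ps] [hx st us]]]] tT tiny D0.
have s0 l : {subset l <= p :: s} -> 0 <= stime l.
  by move=> sl; rewrite /stime big_seq; apply: sumr_ge0 => q /sl /hX /X0[].
have [ha|ha] := boolP (has (fun q : mpt => rt < mrad q) (p :: s)); last first.
  left; have h : enorm (x - mctr p) <= D.
    apply: tiny ps hx us _; last by apply: le_trans (ltW st) tT.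
    move=> q hq; split; first exact: hX.
    by rewrite leNgt; apply/negP => h; move/hasPn: ha => /(_ q hq); rewrite h.
  have -> : x = x - mctr p + mctr p by rewrite subrK.
  by apply: le_trans (enormD _ _) _; rewrite addrC lerD.
right; have [l1 [b [l2 [e hb hl2]]]] := last_split ha.
have srt : sorted lk (l1 ++ b :: l2) by rewrite -e.
have lastE : last p s = last b l2 by rewrite -[LHS]/(last p (p :: s)) e last_cat.
have sub2 q : q \in l2 -> q \in p :: s by rewrite e mem_cat inE => ->; rewrite !orbT.
have st2 : stime (l1 ++ [:: b]) + stime l2 = stime (p :: s) by rewrite e -stime_cat -catA.
have [z [hz1 hz2]] : exists z, enorm (z - mctr b) < mrad b /\ enorm (x - z) <= D.
  case: l2 e hl2 srt lastE sub2 st2 => [|q l2] e hl2 srt lastE sub2 st2.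
    by exists x; rewrite lastE in hx; rewrite subrr enorm0.
  exists (mctr q); have /cat_sorted2[_ /= /andP[h1 h2]] := srt; split => //.
  apply: tiny h2 _ _ _.
  - move=> q' hq; split; first by apply: hX; exact: sub2.
    by rewrite leNgt; exact: (allP hl2 q' hq).
  - by rewrite lastE in hx.
  - by move: us; rewrite e map_cat cat_uniq => /and3P[_ _ /= /andP[]].
  apply: le_trans tT; apply: ltW; apply: le_lt_trans st; rewrite -st2 lerDr s0// => q'.
  by rewrite e !mem_cat inE => /orP[->//|]; rewrite inE => ->; rewrite orbT.
have [y0 [y1 y2]] := inner_point rt0 hb hz1.
exists (mctr p), y0; split => //.
  by apply: le_trans (enorm_tri z _ _) _; rewrite (enormB z) addrC lerD.
move=> r1 g y h1 h2.
have [p' [s' [e' e'']]] : exists p' s', l1 ++ [:: b] = p' :: s' /\ p' = p.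
  by case: l1 e {srt st2} => [|q l1] /= [-> _]; [exists b, [::]|exists q, (l1 ++ [:: b])].
subst p'; exists p, s'; split => //.
- move=> q; rewrite -e' => hq; apply: hX; rewrite e; move: hq; rewrite !mem_cat !inE.
  by case/orP => ->; rewrite ?orbT.
- have : sorted lk (l1 ++ [:: b]).
    by move: srt; rewrite -cat1s catA => /cat_sorted2[].
  by rewrite e'.
- have -> : last p s' = b by rewrite -[LHS]/(last p (p :: s')) -e' last_cat.
  apply: le_lt_trans (lerD (enorm_tri y0 _ _) (lexx _)) _; move: y2 h2; lra.
by apply: le_lt_trans st; rewrite -e' -st2 lerDl s0.
Qed.

Lemma lower_ae_eps (eps : R) : 0 < eps ->
  {ae P, forall w, exists n0, forall n, (n0 <= n)%N -> forall x, enorm x <= 2 ^+ n ->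
    ~ ochain (chi w) x (lam * enorm x - eps * 2 ^+ n)}.
Proof.
move=> eps0.
have lam0 : 0 <= lam := lam_ge0 hchi hd r00 pJ0.
have lC : 0 < lam + C1 by rewrite ltr_wpDl.
have [M' hM'] := natceil (16 * (lam + C1) * d%:R / eps).
pose M := M'.+1.
have M0 : (0 : R) < M%:R by rewrite ltr0n.
pose dM : R := d%:R / M%:R.
have dM0 : 0 < dM by rewrite divr_gt0.
have dMd : dM <= d%:R by rewrite ler_pdivrMr// -[leLHS]mulr1 ler_pM2l// ler1n.
have hM : (lam + C1) * dM <= eps / 16.
  rewrite mulrA ler_pdivrMr//.
  have : 16 * (lam + C1) * d%:R / eps <= M%:R by apply: le_trans hM' _; rewrite ler_nat.
  by rewrite ler_pdivrMr// => h; move: h; rewrite -mulrA (mulrC M%:R); lra.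
pose D := eps / (16 * (lam + C1)).
have D0 : 0 < D by rewrite divr_gt0// mulr_gt0.
have hD : (lam + C1) * D = eps / 16 by rewrite /D; field; rewrite gt_eqF.
have T0 : 0 < lam + 1 by rewrite ltr_wpDl.
have [rt [/andP[rt0 rt1] rtr] AE1] := tiny_ae D0 T0.
pose g : R := rt / (8 * d%:R + 1).
have dd0 : (0 : R) < 8 * d%:R + 1 by rewrite addr_gt0// mulr_gt0.
have g0 : 0 < g by rewrite divr_gt0.
have dg : d%:R * g < rt / 8.
  have -> : d%:R * g = rt / 8 * (8 * d%:R / (8 * d%:R + 1)) by rewrite /g; field; rewrite gt_eqF.
  by rewrite -[ltRHS]mulr1 ltr_pM2l ?divr_gt0// ltr_pdivrMr// mul1r ltrDl.
have [G' hG'] := natceil ((2 + D) / g); pose G := G'.+1.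
have hG : 2 + D <= g * G%:R.
  by rewrite -ler_pdivrMl// mulrC; apply: le_trans hG' _; rewrite ler_nat.
have k0 : 0 < eps / 16 by rewrite divr_gt0.
have sg0 : 0 < rt / 4 by rewrite divr_gt0.
have sgr : rt / 4 <= rho by move: rtr rt0; lra.
have AE2 := @hop_ae (eps / 16) (rt / 4) g G k0 sg0 sgr isT.
have AE3 := @local_ae M G g (D + dM) isT.
pose e := eps / (32 * (d%:R + 1)).
have e0 : 0 < e by rewrite divr_gt0// mulr_gt0// addr_gt0.
have AE4 : {ae P, forall w, forall v : {ffun 'I_d -> 'I_(2 * M).+1}, exists j0, forall j, (j0 <= j)%N ->
   0 < enorm (gpt M%:R^-1 v : pt) -> ~ cev chi setT rho rho 0 (j%:R *: gpt M%:R^-1 v) ((lam - 2 * e) * enorm (gpt M%:R^-1 v) * j%:R) w}.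
  apply: ae_forall_fin => v; have [v0|v0] := lerP (enorm (gpt M%:R^-1 v : pt)) 0.
    by apply: aeW => w; exists 0%N.
  by apply: filterS (lower_dir hchi hd r00 pJ0 v0 e0) => w [j0 h]; exists j0 => j jj _; exact: h.
pose gs : R := rho / d%:R; have gs0 : 0 < gs by rewrite divr_gt0.
have [Gs hGs] := natceil gs^-1.
have AE5 : {ae P, forall w, forall s : {ffun 'I_d -> 'I_(2 * Gs).+1}, exists t, conn (chi w) rho (2 * rho) 0 (gpt gs s) t}.
  by apply: ae_forall_fin => s; apply: (ae_conn hchi hd r00 pJ0).
have AE45 := ae_and AE4 AE5; have AE123 := ae_and AE1 (ae_and AE2 AE3).
apply: filterS2 AE123 AE45 => w [[n1 h1] [[n2 h2] [n3 h3]]] [h4 h5].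
have [j0 h4'] : exists j0, forall (v : {ffun 'I_d -> 'I_(2 * M).+1}) j, (j0 <= j)%N ->
   0 < enorm (gpt M%:R^-1 v : pt) -> ~ cev chi setT rho rho 0 (j%:R *: gpt M%:R^-1 v) ((lam - 2 * e) * enorm (gpt M%:R^-1 v) * j%:R) w.
  have /choice[f hf] := h4.
  by exists (\max_v f v) => v j jj; exact: (hf v j (leq_trans (leq_bigmax v) jj)).
have [t0 h5'] : exists t0, forall s : {ffun 'I_d -> 'I_(2 * Gs).+1}, conn (chi w) rho (2 * rho) 0 (gpt gs s) t0.
  have /choice[f hf] := h5; exists (\sum_s `|f s|) => s; apply: connW (hf s) => //.
  by rewrite (bigD1 s)//=; apply: le_trans (ler_norm _) _; rewrite lerDl sumr_ge0.
have [n4 h4n] := lin_pow2 ((`|t0| + C1 * (2 + d.+1%:R)) / (eps / 16)).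
have [n5 h5n] := exists_pow2_gt ((lam + 1) / (eps / 16)).
exists (maxn n5 (maxn n4 (maxn j0 (maxn n1 (maxn n2 n3))))) => n.
rewrite !geq_max => /andP[m5 /andP[m4 /andP[mj /andP[m1 /andP[m2 m3]]]]] x xn oc.
have p2 : (1 : R) <= 2 ^+ n by rewrite -natrX ler1n expn_gt0.
have p20 : (0 : R) < 2 ^+ n by apply: lt_le_trans p2.
have e2 : 0 < eps * 2 ^+ n by rewrite mulr_gt0.
have xlam : lam * enorm x <= lam * 2 ^+ n by rewrite ler_wpM2l.
have tpos : 0 < lam * enorm x - eps * 2 ^+ n.
  have [p [s [[hX _ _] [_ st _]]]] := oc; apply: le_lt_trans st.
  by rewrite /stime big_seq sumr_ge0// => q /hX; exact: (ppp_tim hchi).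
have lamD : lam * D <= eps / 16 by rewrite -hD ler_pM2r// lerDl ltW.
have lamM : lam * dM <= eps / 16 by apply: le_trans hM; rewrite ler_pM2r// lerDl ltW.
have tT : lam * enorm x - eps * 2 ^+ n <= (lam + 1) * 2 ^+ n by rewrite mulrDl; move: xlam e2 p20; clear - R d dO Omega P mu chi hchi hd r0 R1 r00 pJ0 C10 rp d0; lra.
have X0 p : chi w p -> 0 <= mtim p /\ 0 < mrad p.
  by move=> hp; split; [exact: (ppp_tim hchi hp)|exact: (ppp_rad hchi hp)].
have D2 : 0 <= D * 2 ^+ n by rewrite mulr_ge0 ?(ltW D0)// ltW.
have [xs|[c [y0 [c1 y0x hc]]]] := ochain_cut X0 rt0 oc tT (fun q l => h1 n m1 x q l xn) D2.
  have := ler_wpM2l lam0 xs; rewrite mulrDr mulr1 mulrA.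
  have := ler_wpM2r (ltW p20) lamD.
  have := h5n n m5; rewrite ltr_pdivrMr// (mulrC (2 ^+ n)).
  move: tpos e2; have -> : eps * 2 ^+ n = 16 * (eps / 16 * 2 ^+ n) by field.
  set a := lam * D * _; set b := lam * enorm x; set q := eps / 16 * _; clear - R d dO Omega P mu chi hchi hd r0 R1 r00 pJ0 C10 rp d0; lra.
have [v hv] : exists v : {ffun 'I_d -> 'I_(2 * M).+1}, enorm (x - 2 ^+ n *: gpt M%:R^-1 v) <= dM * 2 ^+ n.
  have gp : 0 < 2 ^+ n / M%:R :> R by rewrite divr_gt0.
  have [|v hv] := @gpt_approx R d (2 ^+ n / M%:R) M x gp.
    by move=> i; rewrite divfK ?gt_eqF//; apply: le_trans (coord_le_enorm x i) xn.
  exists v; have -> : 2 ^+ n *: gpt M%:R^-1 v = gpt (2 ^+ n / M%:R) v :> pt.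
    by apply/rowP => i; rewrite !mxE mulrA.
  by apply: le_trans hv _; rewrite /dM; apply: le_of_eq; ring.
have [z hz] : exists z : {ffun 'I_d -> 'I_(2 * (G * 2 ^ n)).+1}, enorm (y0 - gpt g z) < rt / 8.
  have [|z hz] := @gpt_approx R d g (G * 2 ^ n) y0 g0; last by exists z; apply: le_lt_trans dg.
  move=> i; apply: le_trans (coord_le_enorm y0 i) _; rewrite natrM natrX mulrA.
  apply: le_trans (_ : (2 + D) * 2 ^+ n <= _); last by rewrite ler_pM2r.
  have -> : y0 = y0 - x + x by rewrite subrK.
  by apply: le_trans (enormD _ _) _; rewrite mulrDl; move: y0x xn p2 rt1 rt0; set a := D * _; clear - R d dO Omega P mu chi hchi hd r0 R1 r00 pJ0 C10 rp d0; lra.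
have [s hs] : exists s : {ffun 'I_d -> 'I_(2 * Gs).+1}, enorm (c - gpt gs s) <= rho.
  have [|s hs] := @gpt_approx R d gs Gs c gs0.
    move=> i; apply: le_trans (coord_le_enorm c i) _; apply: le_trans c1 _.
    by rewrite -ler_pdivrMl// mulr1.
  by exists s; apply: le_trans hs _; rewrite /gs mulrCA divff ?gt_eqF// mulr1.
set tg : pt := 2 ^+ n *: gpt M%:R^-1 v in hv.
have tgy : enorm (tg - gpt g z) <= (D + dM) * 2 ^+ n + 1.
  apply: le_trans (enorm_tri x _ _) _; rewrite (enormB tg x).
  apply: le_trans (lerD (lexx _) (enorm_tri y0 x (gpt g z))) _; rewrite (enormB x y0).
  by rewrite mulrDl; move: hv y0x hz rt1 rt0; set a := D * _; set b := dM * _; clear - R d dO Omega P mu chi hchi hd r0 R1 r00 pJ0 C10 rp d0; lra.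
have k1 := h5' s.
have k2 : conn (chi w) (2 * rho) (rt / 4) (gpt gs s) (gpt g z) (lam * enorm x - eps * 2 ^+ n).
  apply: hc; first by apply: le_lt_trans hs _; move: rp; clear - R d dO Omega P mu chi hchi hd r0 R1 r00 pJ0 C10 rp d0; lra.
  by apply: lt_trans hz _; move: rt0; clear - R d dO Omega P mu chi hchi hd r0 R1 r00 pJ0 C10 rp d0; lra.
have k3 := h2 n m2 z.
have k4 := h3 n m3 v z tgy.
have {}k3 : conn (chi w) (rt / 4) (2 * rho) (gpt g z) (gpt g z) (eps / 16 * 2 ^+ n).
  by apply: connW k3 => // p [].
have {}k4 : conn (chi w) (2 * rho) rho (gpt g z) tg (C1 * ((D + dM) * 2 ^+ n + 1 + 1 + (d.+1 * n)%:R)).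
  by move: k4; apply: conn_mono; [move=> p []//| | |exact: lexx]; rewrite subrr enorm0 add0r; move: rp; clear - R d dO Omega P mu chi hchi hd r0 R1 r00 pJ0 C10 rp d0; lra.
have k := conn_cat (conn_cat (conn_cat k1 k2) k3) k4.
have tgn : enorm tg = enorm (gpt M%:R^-1 v : pt) * 2 ^+ n by rewrite /tg enormZ gtr0_norm// mulrC.
have xtg : enorm x <= enorm tg + dM * 2 ^+ n.
  have -> : x = x - tg + tg by rewrite subrK.
  by apply: le_trans (enormD _ _) _; rewrite addrC lerD2l.
have tgx : enorm tg <= enorm x + dM * 2 ^+ n.
  have -> : tg = tg - x + x by rewrite subrK.
  by apply: le_trans (enormD _ _) _; rewrite addrC lerD2l (enormB tg).
have lM2 := ler_wpM2r (ltW p20) lamM.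
have [v0|v0] := lerP (enorm (gpt M%:R^-1 v : pt)) 0.
  have tg0 : enorm tg <= 0 by rewrite tgn mulr_le0_ge0// ltW.
  have : lam * enorm x <= lam * dM * 2 ^+ n.
    by rewrite -mulrA ler_wpM2l//; move: xtg tg0; clear - R d dO Omega P mu chi hchi hd r0 R1 r00 pJ0 C10 rp d0; lra.
  move: lM2 tpos e2; have -> : eps * 2 ^+ n = 16 * (eps / 16 * 2 ^+ n) by field.
  set a := lam * dM * _; set b := lam * enorm x; set q := eps / 16 * _; clear - R d dO Omega P mu chi hchi hd r0 R1 r00 pJ0 C10 rp d0; lra.
have jn : (j0 <= 2 ^ n)%N by apply: leq_trans mj _; apply: ltnW; exact: ltn_expl.
have := h4' v (2 ^ n)%N jn v0; apply.
rewrite natrX -/tg /cev /=; apply: conn_mono k => //; rewrite ?subrr ?enorm0 ?add0r//.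
rewrite -[leRHS]mulrA -tgn.
have q1 : t0 + C1 * (1 + 1 + (d.+1 * n)%:R) <= eps / 16 * 2 ^+ n.
  have := h4n n m4; rewrite mulrAC ler_pdivrMr// (mulrC (2 ^+ n)); apply: le_trans.
  rewrite mulrDl; apply: lerD.
    apply: le_trans (ler_norm _) _; rewrite ler_peMr// ler1n.
    by [].
  rewrite -(mulrA C1) ler_pM2l// natrM -[n.+1%:R]natr1 mulrDl mulrDr mulr1 mulrDr mulr1.
  by have : (0 : R) <= n%:R by []; have : (0 : R) <= d.+1%:R by []; set a := d.+1%:R * _; clear - R d dO Omega P mu chi hchi hd r0 R1 r00 pJ0 C10 rp d0; lra.
have q2 : C1 * ((D + dM) * 2 ^+ n) <= (eps / 16 + eps / 16) * 2 ^+ n.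
  rewrite mulrA ler_pM2r// mulrDr; apply: lerD.
    by rewrite -hD ler_pM2r// lerDr.
  by apply: le_trans hM; rewrite ler_pM2r// lerDr.
have q3 : 2 * e * enorm tg <= eps / 16 * 2 ^+ n.
  have tgb : enorm tg <= (d%:R + 1) * 2 ^+ n.
    apply: le_trans tgx _; rewrite mulrDl mul1r addrC; apply: lerD => //.
    by rewrite ler_pM2r.
  apply: le_trans (_ : 2 * e * ((d%:R + 1) * 2 ^+ n) <= _).
    by rewrite ler_pM2l// mulr_gt0.
  by apply: le_of_eq; rewrite /e; field; rewrite gt_eqF// addr_gt0.
have q4 : lam * enorm x <= lam * enorm tg + eps / 16 * 2 ^+ n.
  apply: le_trans (ler_wpM2l lam0 xtg) _; rewrite mulrDr lerD2l mulrA.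
  exact: lM2.
have -> : C1 * ((D + dM) * 2 ^+ n + 1 + 1 + (d.+1 * n)%:R) =
  C1 * ((D + dM) * 2 ^+ n) + C1 * (1 + 1 + (d.+1 * n)%:R) by ring.
have qE : eps * 2 ^+ n = 16 * (eps / 16 * 2 ^+ n) by field.
have q0 : 0 < eps / 16 * 2 ^+ n by rewrite mulr_gt0.
rewrite mulrBl qE; rewrite (mulrDl (eps / 16)) in q2.
have aux (t a b c' q lx lt et : R) : 0 < q -> t + a <= q -> b <= q + q -> et <= q -> lx <= lt + q ->
  t + (lx - 16 * q) + q + (b + a) <= lt - et by clear - R d dO Omega P mu chi hchi hd r0 R1 r00 pJ0 C10 rp d0; lra.
exact: aux q0 q1 q2 q3 q4.
Qed.

Theorem lower_ae :
  {ae P, forall w, forall eps : R, 0 < eps ->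
    exists n0, forall n, (n0 <= n)%N -> forall x, enorm x <= 2 ^+ n ->
    ~ ochain (chi w) x (lam * enorm x - eps * 2 ^+ n)}.
Proof.
have := ae_forall_nat (fun k : nat => lower_ae_eps (_ : 0 < k.+1%:R^-1)).
move=> /(_ (fun k => ltac:(by rewrite invr_gt0 ltr0n))); apply: filterS => w h eps eps0.
have [k hk] := natceil eps^-1; have [n0 hn0] := h k; exists n0 => n nn x xn oc.
apply: (hn0 n nn x xn); have [p [s [h1 [h2 h3 h4]]]] := oc; exists p, s; split => //; split => //.
apply: lt_le_trans h3 _; rewrite lerD2l lerN2 ler_pM2r ?exprn_gt0//.
rewrite -[leRHS]invrK lef_pV2 ?posrE ?invr_gt0 ?ltr0n//; apply: le_trans hk _.
by rewrite ler_nat.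
Qed.

End LowerAE.

(** * From open to closed transmissions *)

Section Scale.
Context {R : realType} {d : nat} {dO : measure_display} {Omega : measurableType dO}.
Variables (P : probability Omega R) (mu : probability R R).
Variable chi : Omega -> set (@mpoint R d).
Hypothesis hchi : is_PPP P mu chi.
Hypothesis hd : (0 < d)%N.
Local Notation pr := (pr P).
Local Notation pt := 'rV[R]_d.
Local Notation mpt := (@mpoint R d).

Lemma mscaleK (k : R) (p : mpt) : 0 < k -> mscale k^-1 (mscale k p) = p.
Proof.
move=> k0; case: p => c [t r]; rewrite /mscale /= scalerA mulVf ?gt_eqF// scale1r.
by rewrite exprVn invrK mulrA divff ?mul1r// expf_neq0// gt_eqF.
Qed.

Lemma mscaleKV (k : R) (p : mpt) : 0 < k -> mscale k (mscale k^-1 p) = p.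
Proof. by move=> k0; have := @mscaleK k^-1 p; rewrite invrK invr_gt0 => /(_ k0). Qed.

Definition schi (k : R) w : set mpt := [set p | chi w (mscale k^-1 p)].

Lemma schiE k w p : 0 < k -> schi k w (mscale k p) <-> chi w p.
Proof. by move=> k0; rewrite /schi /= mscaleK. Qed.

Lemma card_is_scale k w Q Q' n : 0 < k -> rect_set Q' = @mscale R d k @^-1` rect_set Q ->
  card_is (schi k w `&` rect_set Q) n <-> card_is (chi w `&` rect_set Q') n.
Proof.
move=> k0 QQ.
have inj1 : injective (@mscale R d k) by apply: (can_inj (g := mscale k^-1)) => p; exact: mscaleK.
have inj2 : injective (@mscale R d k^-1) by apply: (can_inj (g := mscale k)) => p; exact: mscaleKV.
split=> -[s [us ss hs]].
  exists (map (mscale k^-1) s); split; [by rewrite map_inj_uniq|by rewrite size_map|].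
  have hs' p : (schi k w `&` rect_set Q) p <-> p \in s by rewrite hs.
  apply/seteqP; split => p /=.
    move=> [h1 h2]; rewrite -[p](mscaleK _ k0) map_f//; apply/hs'; split; first by apply/schiE.
    by move: h2; rewrite QQ.
  by move=> /mapP[q /hs'[h1 h2] ->]; split => //; rewrite QQ /= mscaleKV.
exists (map (mscale k) s); split; [by rewrite map_inj_uniq|by rewrite size_map|].
have hs' p : (chi w `&` rect_set Q') p <-> p \in s by rewrite hs.
apply/seteqP; split => p /=.
  move=> [h1 h2]; rewrite -[p](mscaleKV _ k0) map_f//; apply/hs'; split => //.
  by rewrite QQ /= mscaleKV.
by move=> /mapP[q /hs'[h1 h2] ->]; split; [apply/schiE|rewrite QQ in h2].
Qed.

Lemma schi_ppp k : 0 < k -> is_PPP P mu (schi k).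
Proof.
move=> k0; case: (hchi) => h1 h2; split.
  move=> w p /h1 /= [t0 r0]; split => //; move: t0.
  by rewrite pmulr_rge0// invr_gt0 exprn_gt0// invr_gt0.
move=> n Q m okQ djQ.
have /choice[Q' hQ'] := fun i => mscale_preim mu k0 (okQ i).
have E i : [set w | card_is (schi k w `&` rect_set (Q i)) (m i)] = [set w | card_is (chi w `&` rect_set (Q' i)) (m i)].
  by have [_ e _] := hQ' i; apply/funext => w; apply/propext; exact: card_is_scale.
have [||m1 m2] := h2 n Q' m.
- by move=> i; have [] := hQ' i.
- move=> i j ij; have [_ -> _] := hQ' i; have [_ -> _] := hQ' j.
  by rewrite -preimage_setI djQ// preimage_set0.
split; first by move=> i; rewrite E.
rewrite (eq_bigcapr (fun i _ => E i)) m2; congr (_%:E); apply: eq_bigr => i _.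
by have [_ _ ->] := hQ' i.
Qed.

Lemma ev_schi k C : 0 < k -> ev (schi k) C = ev chi (C \o map (mscale k)).
Proof.
move=> k0; apply/seteqP; split => w [ps h1 h2].
  exists (map (mscale k^-1) ps); first by move=> q /mapP[p /h1 ? ->].
  rewrite /= -map_comp (@eq_map _ _ _ id) ?map_id// => p /=; exact: mscaleKV.
by exists (map (mscale k) ps) => // q /mapP[p /h1 ? ->]; apply/schiE.
Qed.

Lemma ev_schiV k C : 0 < k -> ev chi C = ev (schi k) (C \o map (mscale k^-1)).
Proof.
move=> k0; rewrite ev_schi//; congr (ev chi); apply/funext => ps /=.
by rewrite -map_comp (@eq_map _ _ _ id) ?map_id// => p /=; exact: mscaleK.
Qed.

Lemma cev_schi k r1 r2 x y t : 0 < k ->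
  pr (cev (schi k) setT r1 r2 x y t) = pr (cev chi setT r1 r2 x y t).
Proof.
move=> k0; have oC := @openev_conn R d setT r1 r2 x y t openLT; rewrite !cevE.
have hs := schi_ppp k0.
have m1 : measurable (ev (schi k) (Cconn setT r1 r2 x y t)) by apply: (measurable_ev hs).
have m2 : measurable (ev chi (Cconn setT r1 r2 x y t)) by apply: (measurable_ev hchi).
apply/eqP; rewrite eq_le; apply/andP; split.
  rewrite [leRHS](_ : _ = pr (ev (schi k) (Cconn setT r1 r2 x y t \o map (mscale k^-1)))); last by rewrite -ev_schiV.
  apply: (law_le hs) => //; last by rewrite -ev_schiV.
  by apply: icp_mscale; rewrite invr_gt0.
rewrite [leRHS](_ : _ = pr (ev chi (Cconn setT r1 r2 x y t \o map (mscale k)))); last by rewrite -ev_schi.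
apply: (law_le hchi) => //; last by rewrite -ev_schi.
exact: icp_mscale.
Qed.

Lemma qf_schi k r0 y j : 0 < k -> qf P (schi k) hd r0 y j = qf P chi hd r0 y j.
Proof.
move=> k0; rewrite /qf !prC ?cev_schi//; first by apply: (measurable_cev hchi); exact: openLT.
by apply: (measurable_cev (schi_ppp k0)); exact: openLT.
Qed.

Lemma lam_schi k r0 : 0 < k -> lam P (schi k) hd r0 = lam P chi hd r0.
Proof.
move=> k0; have e : qf P (schi k) hd r0 = qf P chi hd r0.
  by apply/funext => y; apply/funext => j; exact: qf_schi.
by rewrite /lam /alpha /qsum e.
Qed.

Lemma ochain_schi (k : R) w x t : 0 < k -> k < 1 ->
  (passT (chi w) (eball 1) x < t%:E)%E -> 1 < enorm x -> ochain (schi k w) (k *: x) (k ^- d * t).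
Proof.
move=> k0 k1 hp x1.
have [|[p [s [[h1 h2 h3] [h4 h5 h6]]]]] := passT_lt_chain (fun p => ppp_tim hchi (w := w) (p := p)) hp.
  by rewrite leNgt x1.
have kd : 0 < k ^- d by rewrite invr_gt0 exprn_gt0.
have lt_k (a r : R) : 0 <= a -> 0 < r -> a <= r -> k * a < r.
  move=> a0 r0 ar; apply: le_lt_trans (_ : k * r < r); first by rewrite ler_pM2l.
  by rewrite gtr_pMl.
have hr q : q \in p :: s -> 0 < mrad q by move=> /h1; exact: (ppp_rad hchi).
have sub (u v : pt) : enorm (k *: u - k *: v) = k * enorm (u - v) by rewrite -scalerBr enormZ gtr0_norm.
exists (mscale k p), (map (mscale k) s); split; split.
- by move=> q; rewrite -map_cons => /mapP[q' /h1 ? ->]; apply/schiE.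
- by rewrite /mctr /= enormZ gtr0_norm//; apply: le_trans h2; rewrite -[leRHS]mul1r; apply: ler_wpM2r; [exact: enorm_ge0|exact: ltW].
- elim: s p h3 hr {h1 h2 h4 h5 h6} => //= q s ih p /andP[g1 g2] hr.
  rewrite ih//; last by move=> q' hq; apply: hr; rewrite inE hq orbT.
  rewrite andbT /lk /mctr /mrad /= sub; apply: lt_k => //; first exact: enorm_ge0.
  by apply: hr; rewrite mem_head.
- rewrite last_map /mctr /mrad /= sub; apply: lt_k => //; first exact: enorm_ge0.
  by apply: hr; exact: mem_last.
- rewrite -map_cons /stime big_map.
  have -> : \sum_(q <- p :: s) mtim (mscale k q) = k ^- d * stime (p :: s) by rewrite /stime mulr_sumr.
  by rewrite ltr_pM2l.
rewrite -map_cons -map_comp (@eq_map _ _ _ (fun q => k *: mctr q))// (map_comp (fun u => k *: u)) map_inj_uniq//.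
by apply: scalerI; rewrite gt_eqF.
Qed.

Variables (r0 R1 : R).
Hypothesis r00 : 0 < r0.
Hypothesis pJ0 : 0 < fine (mu `]r0, R1[%classic).
Local Notation lam := (lam P chi hd r0).

Lemma lower_final_eps (eps : R) : 0 < eps ->
  {ae P, forall w, exists n0, forall n, (n0 <= n)%N -> forall x, enorm x <= 2 ^+ n ->
    ((lam * enorm x - eps * 2 ^+ n)%:E <= passT (chi w) (eball 1) x)%E}.
Proof.
move=> eps0; have lam0 : 0 <= lam := lam_ge0 hchi hd r00 pJ0.
have [k [k0 k1 kl]] : exists k : R, [/\ 0 < k, k < 1 & lam * (1 - k ^+ d.+1) <= eps / 2].
  pose q := eps / (2 * (lam * d.+1%:R + eps)).
  have den : 0 < 2 * (lam * d.+1%:R + eps) by rewrite mulr_gt0// ltr_wpDl// mulr_ge0.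
  have q0 : 0 < q by rewrite divr_gt0.
  have q1 : q < 1 by rewrite ltr_pdivrMr// mul1r; have : 0 <= lam * d.+1%:R by [rewrite mulr_ge0]; move: eps0; lra.
  have bern m : 1 - m%:R * q <= (1 - q) ^+ m.
    elim: m => [|m ih]; first by rewrite mul0r subr0 expr0.
    rewrite exprS; apply: le_trans (ler_wpM2l _ ih); last by rewrite subr_ge0 ltW.
    have : 0 <= m%:R * q * q by exact: mulr_ge0 (mulr_ge0 (ler0n _ _) (ltW q0)) (ltW q0).
    have -> : (1 - q) * (1 - m%:R * q) = 1 - m%:R * q - q + m%:R * q * q by ring.
    move=> h; have aux (a b c : R) : 0 <= c -> 1 - (a + b) <= 1 - a - b + c by lra.
    by rewrite -[m.+1%:R]natr1 mulrDl mul1r; exact: aux.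
  exists (1 - q); split; [by rewrite subr_gt0|by rewrite ltrBlDr ltrDl|].
  apply: le_trans (_ : lam * (d.+1%:R * q) <= _).
    by rewrite ler_wpM2l//; have := bern d.+1; lra.
  rewrite /q mulrA mulrA ler_pdivrMr//.
  have : 0 <= eps * eps by rewrite mulr_ge0// ltW.
  have -> : eps / 2 * (2 * (lam * d.+1%:R + eps)) = lam * d.+1%:R * eps + eps * eps by field.
  by lra.
have e20 : 0 < eps / 2 by rewrite divr_gt0.
have := lower_ae (schi_ppp k0) hd r00 pJ0; rewrite lam_schi//.
apply: filterS => w /(_ _ e20)[n0 h].
have [n1 hn1] := exists_pow2_gt (lam / eps).
exists (maxn n0 n1) => n; rewrite geq_max => /andP[m0 m1] x xn; rewrite leNgt; apply/negP => lt.
have p2 : (0 : R) < 2 ^+ n by rewrite exprn_gt0.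
have x1 : 1 < enorm x.
  rewrite ltNge; apply/negP => x1.
  have neg : lam * enorm x - eps * 2 ^+ n < 0.
    have := hn1 n m1; rewrite ltr_pdivrMr// (mulrC _ eps).
    by have := ler_wpM2l lam0 x1; rewrite mulr1; set a := lam * _; lra.
  have : (0%:E <= passT (chi w) (eball 1) x)%E.
    apply: le_ereal_inf_tmp => _ [a [s [_ _ _ ->]]].
    have t0 u v : (0%:E <= tau (chi w) u v)%E.
      rewrite /tau; case: ifP => _ //; apply: le_ereal_inf_tmp => _ [p [hp _] <-].
      by rewrite lee_fin; exact: (ppp_tim hchi hp).
    by elim: s a => [|y s ih] a //=; exact: adde_ge0.
  by move=> hge; have := le_lt_trans hge lt; rewrite lte_fin ltNge (ltW neg).
have := ochain_schi k0 k1 lt x1.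
have kx : enorm (k *: x) = k * enorm x by rewrite enormZ gtr0_norm.
have kxn : enorm (k *: x) <= 2 ^+ n.
  by rewrite kx; apply: le_trans xn; rewrite ger_pMl ?ltW//; apply: lt_trans x1.
move=> [p [s [g1 [g2 g3 g4]]]]; apply: (h n m0 _ kxn); exists p, s; split => //; split => //.
apply: lt_le_trans g3 _; rewrite kx.
have kd : 0 < k ^+ d by rewrite exprn_gt0.
rewrite -(ler_pM2l kd) mulrA divff ?gt_eqF// mul1r.
have kd1 : k ^+ d <= 1 by apply: exprn_ile1; exact: ltW.
rewrite mulrBr.
have a1 : lam * enorm x - eps / 2 * 2 ^+ n <= k ^+ d * (lam * (k * enorm x)).
  have -> : k ^+ d * (lam * (k * enorm x)) = lam * enorm x - lam * (1 - k ^+ d.+1) * enorm x by rewrite exprS; ring.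
  rewrite lerD2l lerN2; apply: ler_pM => //; last exact: enorm_ge0.
  by rewrite mulr_ge0// subr_ge0; apply: exprn_ile1; exact: ltW.
have a2 : k ^+ d * (eps / 2 * 2 ^+ n) <= eps / 2 * 2 ^+ n.
  by rewrite ger_pMl// mulr_gt0.
have -> : eps * 2 ^+ n = 2 * (eps / 2 * 2 ^+ n) by field.
by move: a1 a2; set a := eps / 2 * _; set b := k ^+ d * a; set c := k ^+ d * _; lra.
Qed.

Theorem lower_final :
  {ae P, forall w, forall eps : R, 0 < eps ->
    exists n0, forall n, (n0 <= n)%N -> forall x, enorm x <= 2 ^+ n ->
    ((lam * enorm x - eps * 2 ^+ n)%:E <= passT (chi w) (eball 1) x)%E}.
Proof.
have := ae_forall_nat (fun k : nat => lower_final_eps (_ : 0 < k.+1%:R^-1)).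
move=> /(_ (fun k => ltac:(by rewrite invr_gt0 ltr0n))); apply: filterS => w h eps eps0.
have [k hk] := natceil eps^-1; have [n0 hn0] := h k; exists n0 => n nn x xn.
apply: le_trans (hn0 n nn x xn); rewrite lee_fin lerD2l lerN2 ler_pM2r ?exprn_gt0//.
rewrite -[leRHS]invrK lef_pV2 ?posrE ?invr_gt0 ?ltr0n//; apply: le_trans hk _.
by rewrite ler_nat.
Qed.

End Scale.

(** * Infinite moment of order d + 1 *)

Section Part2.
Context {R : realType} {d : nat} {dO : measure_display} {Omega : measurableType dO}.
Variables (P : probability Omega R) (mu : probability R R).
Variable chi : Omega -> set (@mpoint R d).
Hypothesis hchi : is_PPP P mu chi.
Hypothesis hd : (0 < d)%N.
Local Notation pr := (pr P).
Local Notation pt := 'rV[R]_d.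
Local Notation mpt := (@mpoint R d).
Variables (r0 R1 : R).
Hypothesis r00 : 0 < r0.
Hypothesis pJ0 : 0 < fine (mu `]r0, R1[%classic).
Hypothesis r01 : r0 <= 1.
Local Notation lam := (lam P chi hd r0).
Let d0 : (0 : R) < d%:R. Proof. by rewrite ltr0n. Qed.

Lemma passT_step (X : set mpt) b x t : (forall p, X p -> 0 <= mtim p) -> X b ->
  (passT X (eball 1) (mctr b) < t%:E)%E -> 0 <= t -> enorm (x - mctr b) <= mrad b ->
  (passT X (eball 1) x <= (t + mtim b)%:E)%E.
Proof.
move=> X0 Xb hb t0 xb.
have [c1|[p [s [[h1 h2 h3] [h4 h5 _]]]]] := passT_lt_chain X0 hb.
  apply: le_trans (passT_le_chain (p := b) (s := [::]) X0 _ c1 _ xb) _ => //.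
    by move=> q; rewrite inE => /eqP ->.
  by rewrite lee_fin stime_cons /stime big_nil addr0 lerDr.
apply: le_trans (passT_le_chain (p := p) (s := rcons s b) X0 _ h2 _ _) _.
- by move=> q; rewrite -rcons_cons mem_rcons inE => /orP[/eqP ->//|]; exact: h1.
- by rewrite rcons_path h3 /lkc.
- by rewrite last_rcons.
rewrite lee_fin -rcons_cons -cats1 stime_cat; apply: lerD; first exact: ltW.
by rewrite stime_cons /stime big_nil addr0.
Qed.

Definition band n : set R := `]2 ^+ n.+1, 2 ^+ n.+2]%classic.

Definition shortcut (h dl : R) (n : nat) : @rect R d :=
  Rect (const_mx (- (h * 2 ^+ n))) (const_mx (h * 2 ^+ n)) 0 (dl * 2 ^+ n) (band n).

Lemma measurable_band n : measurable (band n). Proof. exact: measurable_itv. Qed.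

Lemma shortcut_ok h dl n : 0 <= h -> 0 <= dl -> rect_ok (shortcut h dl n).
Proof.
move=> h0 dl0; have p2 : (0 : R) <= 2 ^+ n by rewrite exprn_ge0.
split => //=; try by rewrite mulr_ge0.
- by move=> i; rewrite !mxE ge0_cp// mulr_ge0.
- exact: measurable_band.
move=> y; rewrite /band /= !in_itv /= andbT => /andP[y1 _]; apply: lt_trans y1; exact: exprn_gt0.
Qed.

Lemma shortcut_int h dl n : rect_intensity mu (shortcut h dl n) =
  (2 * h) ^+ d * dl * ((2 ^+ n) ^+ d.+1 * fine (mu (band n))).
Proof.
rewrite /rect_intensity /= subr0 (eq_bigr (fun=> 2 * h * 2 ^+ n)) => [|i _]; last by rewrite !mxE; ring.
rewrite prodr_const card_ord exprMn [(2 ^+ n) ^+ d.+1]exprS; ring.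
Qed.

Lemma band_lt m n y : (m < n)%N -> band m y -> band n y -> False.
Proof.
rewrite /band /= !in_itv /= => mn /andP[_ h1] /andP[h2 _].
have : 2 ^+ n.+1 < 2 ^+ m.+2 :> R by apply: lt_le_trans h1.
by rewrite ltr_eXn2l ?ltr1n// ltnS ltnS leqNgt mn.
Qed.

Lemma shortcut_disj h dl m n : m != n ->
  rect_set (shortcut h dl m) `&` rect_set (shortcut h dl n) = set0.
Proof.
move=> mn; rewrite -subset0 => p [[_ [_ /= b1]] [_ [_ /= b2]]].
by move: mn; rewrite neq_ltn => /orP[] /band_lt; [move=> /(_ _ b1 b2)|move=> /(_ _ b2 b1)].
Qed.

Lemma no_shortcut (h dl : R) n0 : 0 < h -> 0 < dl ->
  (forall K, exists N, K <= \sum_(n < N) (2 ^+ n) ^+ d.+1 * fine (mu (band n))) ->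
  {ae P, forall w, ~ forall n, (n0 <= n)%N -> ~ occ chi (shortcut h dl n) w}.
Proof.
move=> h0 dl0 hdiv.
pose A := [set w | forall n, (n0 <= n)%N -> ~ occ chi (shortcut h dl n) w].
have mocc n : measurable (occ chi (shortcut h dl n)) by apply: (measurable_occ hchi); apply: shortcut_ok; exact: ltW.
have mA : measurable A.
  rewrite [A](_ : _ = ~` [set w | exists n, (n0 <= n)%N /\ occ chi (shortcut h dl n) w]).
    apply: measurableC; apply: measurable_exists_nat => n; case: (leqP n0 n) => nn.
      by rewrite [X in measurable X](_ : _ = occ chi (shortcut h dl n))//; apply/seteqP; split => w; [case|split].
    by rewrite [X in measurable X](_ : _ = set0); [exact: (@measurable0 _ Omega)|rewrite -subset0 => w []].
  apply/seteqP; split => w /=; first by move=> H [n [nn o]]; exact: H nn o.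
  by move=> H n nn o; apply: H; exists n.
apply: (pr0_ae mA); apply/eqP; rewrite eq_le pr_ge0 andbT.
apply/ler_addgt0Pr => e e0; rewrite add0r.
pose c := (2 * h) ^+ d * dl.
have c0 : 0 < c by rewrite mulr_gt0// exprn_gt0// mulr_gt0.
pose S0 := \sum_(n < n0) (2 ^+ n) ^+ d.+1 * fine (mu (band n)).
have t0 (n : nat) : 0 <= (2 ^+ n) ^+ d.+1 * fine (mu (band n)) by rewrite mulr_ge0 ?exprn_ge0// fine_ge0.
have [N hN] := hdiv (S0 + e^-1 / c).
have V := ppp_void hchi (Q := fun n : 'I_N => shortcut h dl n).
have {}V := V (fun n => shortcut_ok n (ltW h0) (ltW dl0)) (fun i j ij => shortcut_disj h dl ij) [set n : 'I_N | (n0 <= n)%N]%SET.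
apply: le_trans (_ : pr [set w | forall n : 'I_N, n \in [set n : 'I_N | (n0 <= n)%N]%SET -> ~ occ chi (shortcut h dl n) w] <= _).
  apply: pr_mono => //; first by apply: measurable_forall_in => n; apply: measurableC.
  by move=> w Aw n; rewrite inE; exact: Aw.
rewrite V (eq_bigr (fun n : 'I_N => c * ((2 ^+ n) ^+ d.+1 * fine (mu (band n))))) => [|n _]; last by rewrite shortcut_int.
rewrite -mulr_sumr; set S := \sum_(n in _) _.
have hS : e^-1 <= c * S.
  rewrite -ler_pdivrMl// mulrC.
  have : \sum_(n < N) (2 ^+ n) ^+ d.+1 * fine (mu (band n)) <= S0 + S.
    rewrite (bigID (fun n : 'I_N => (n0 <= n)%N))/= addrC; apply: lerD; last first.
      by apply: le_of_eq; apply: eq_bigl => n; rewrite inE.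
    rewrite (eq_bigl (fun n : 'I_N => (n < n0)%N)) => [|n]; last by rewrite ltnNge.
    rewrite -(big_mkord (fun n => (n < n0)%N) (fun n => (2 ^+ n) ^+ d.+1 * fine (mu (band n)))).
    rewrite /S0 -(big_mkord xpredT (fun n => (2 ^+ n) ^+ d.+1 * fine (mu (band n)))).
    apply: le_trans (_ : \sum_(0 <= n < n0 + N | (n < n0)%N) (2 ^+ n) ^+ d.+1 * fine (mu (band n)) <= _).
      rewrite [leRHS](big_cat_nat (n := N)) ?leq_addl//= lerDl sumr_ge0//.
    rewrite (big_cat_nat (n := n0)) ?leq_addr//= [X in _ + X]big_nat_cond [X in _ + X]big1 ?addr0.
      by rewrite big_mkcond /=; apply: ler_sum => n _; case: ifP.
    by move=> n /andP[/andP[n1 _] n2]; move: n2; rewrite ltnNge n1.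
  by move: hN; rewrite -/S0; set a := e^-1 / c; lra.
apply: le_trans (_ : expR (- e^-1) <= _); first by rewrite ler_expR lerN2.
rewrite expRN -[leRHS]invrK lef_pV2 ?posrE ?expR_gt0 ?invr_gt0//.
by apply: le_trans (expR_ge1Dx _); rewrite lerDr.
Qed.

Lemma lam_zero_div : (forall K, exists N, K <= \sum_(n < N) (2 ^+ n) ^+ d.+1 * fine (mu (band n))) -> lam = 0.
Proof.
move=> hdiv; apply/eqP; rewrite eq_le (lam_ge0 hchi hd r00 pJ0) andbT leNgt; apply/negP => lam0.
pose h := (4 * d%:R)^-1 : R; have h0 : 0 < h by rewrite invr_gt0 mulr_gt0.
pose dl := lam / 4; have dl0 : 0 < dl by rewrite divr_gt0.
pose eps := lam / 16; have eps0 : 0 < eps by rewrite divr_gt0.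
have A1 := upper_ae hchi hd r00 pJ0 r01; have A2 := lower_final hchi hd r00 pJ0.
have A3 : {ae P, forall w, forall n0 : nat, ~ forall n, (n0 <= n)%N -> ~ occ chi (shortcut h dl n) w}.
  by apply: ae_forall_nat => n0; exact: no_shortcut.
have : pr setT <= pr set0; last by rewrite prT pr0 lt_geF.
apply: pr_mono_ae => //.
apply: filterS3 A1 A2 A3 => w /(_ _ eps0)[n1 U] /(_ _ eps0)[n2 Lo] /(_ (maxn n1 n2)) S _.
exfalso; apply: S => n; rewrite geq_max => /andP[m1 m2] [b [Xb [/= hb [/andP[_ tb] rb]]]].
have p2 : (0 : R) < 2 ^+ n by rewrite exprn_gt0.
have cb : enorm (mctr b) <= 2 ^+ n / 4.
  apply: le_trans (enorm_le_coord (e := h * 2 ^+ n) _) _.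
    by move=> i; rewrite ler_norml; have := hb i; rewrite !mxE => /andP[-> /ltW ->].
  by apply: le_of_eq; rewrite /h; field; rewrite gt_eqF.
have cb1 : enorm (mctr b) <= 2 ^+ n by move: cb p2; lra.
pose x : pt := 2 ^+ n *: e1 hd.
have xn : enorm x = 2 ^+ n by rewrite enormZ enorm_e1 mulr1 gtr0_norm.
have u1 := U n m1 _ cb1.
have lc : lam * enorm (mctr b) <= lam * (2 ^+ n / 4) by rewrite ler_pM2l.
have q0 : 0 < lam / 16 * 2 ^+ n by rewrite mulr_gt0.
have u2 : (passT (chi w) (eball 1) (mctr b) < (6 * (lam / 16 * 2 ^+ n))%:E)%E.
  apply: le_lt_trans u1 _; rewrite lte_fin; move: lc q0; rewrite /eps.
  have -> : lam * (2 ^+ n / 4) = 4 * (lam / 16 * 2 ^+ n) by field.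
  by set a := lam * enorm _; set q := lam / 16 * _; lra.
have xr : enorm (x - mctr b) <= mrad b.
  apply: le_trans (_ : 2 ^+ n.+1 <= _); last first.
    by move: rb; rewrite /band /= in_itv /= => /andP[/ltW].
  apply: le_trans (enormD _ _) _; rewrite enormN xn exprS; move: cb p2; lra.
have u3 := passT_step (fun p => ppp_tim hchi (w := w) (p := p)) Xb u2 (ltW (mulr_gt0 (ltr0Sn _ 5) q0)) xr.
have xle : enorm x <= 2 ^+ n by rewrite xn.
have l1 := le_trans (Lo n m2 x xle) u3.
move: l1; rewrite lee_fin xn /eps; move: tb q0; rewrite /dl -/(mtim b).
have -> : lam / 4 * 2 ^+ n = 4 * (lam / 16 * 2 ^+ n) by field.
have -> : lam * 2 ^+ n = 16 * (lam / 16 * 2 ^+ n) by field.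
by set q := lam / 16 * _; lra.
Qed.

Local Open Scope ereal_scope.

Lemma moment_div : \int[mu]_(r in `]0%R, +oo[%classic) (r ^+ d.+1)%:E = +oo ->
  forall K, exists N, (K <= \sum_(n < N) (2 ^+ n) ^+ d.+1 * fine (mu (band n)))%R.
Proof.
move=> hint K; apply: contrapT => /forallNP hK.
have {}hK N : (\sum_(n < N) (2 ^+ n) ^+ d.+1 * fine (mu (band n)) <= K)%R.
  by apply: ltW; rewrite ltNge; apply/negP => h; exact: (hK N h).
pose F n : set R := if n is n'.+1 then band n' else `]0%R, 2%R]%classic.
have mF n : measurable (F n) by case: n => [|n]; exact: measurable_itv.
have K0 : (0 <= K)%R by have := hK 0%N; rewrite big_ord0.
have FE : `]0%R, +oo[%classic = \bigcup_n F n.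
  apply/seteqP; split => y /=; rewrite in_itv /= andbT.
    move=> y0; have [N hN] := exists_pow2_gt y.
    have ex : exists n, (y <= 2 ^+ n.+1)%R.
      by exists N; apply: le_trans (ltW (hN N (leqnn _))) _; rewrite ler_eXn2l ?ltr1n.
    case: (ex_minnP ex) => -[|n] yn mn.
      by exists 0%N => //=; rewrite in_itv /= y0 (le_trans yn)// expr1.
    exists n.+1 => //=; rewrite /band /= in_itv /= yn andbT ltNge; apply/negP => /mn.
    by rewrite ltnn.
  move=> [[|n] _ /=]; rewrite /band /= in_itv /= => /andP[h1 _] //.
  by apply: lt_trans h1; exact: exprn_gt0.
have tF : trivIset setT F.
  apply/trivIsetP => i j _ _ ij.
  wlog : i j ij / (i < j)%N.
    by move=> W; move: (ij); rewrite neq_ltn => /orP[|h]; [exact: W|rewrite setIC; apply: W => //; rewrite eq_sym].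
  move=> lt; rewrite -subset0 => y []; case: j lt {ij} => // j; case: i => [|i] lt /=.
    rewrite /band /= !in_itv /= => /andP[_ h1] /andP[h2 _]; move: (lt_le_trans h2 h1).
    by rewrite -[ltRHS]expr1 ltr_eXn2l ?ltr1n.
  exact: band_lt.
have mf (D : set R) : measurable D -> measurable_fun D (fun r : R => r ^+ d.+1)%R.
  by move=> mD; exact: exprn_measurable.
have f0 r : (\bigcup_n F n) r -> 0 <= (r ^+ d.+1)%:E.
  by rewrite -FE /= in_itv /= andbT => r0'; rewrite lee_fin exprn_ge0// ltW.
have mU : measurable (\bigcup_n F n) by exact: bigcup_measurable.
have := hint; rewrite FE ge0_integral_bigcup//; last by apply/measurable_EFinP; exact: mf.
apply/eqP; rewrite lt_eqF//.
pose B : R := (2 ^+ d.+1 + 4 ^+ d.+1 * K)%R.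
apply: le_lt_trans (ltry B).
have t0 n : 0 <= \int[mu]_(x in F n) (x ^+ d.+1)%:E.
  by apply: integral_ge0 => x Fx; apply: f0; exists n.
apply: lime_le; first by apply: is_cvg_nneseries => n _ _; exact: t0.
apply: nearW => N.
have tb n : \int[mu]_(x in F n) (x ^+ d.+1)%:E <= ((2 ^+ n.+1) ^+ d.+1 * fine (mu (F n)))%:E.
  apply: le_trans (_ : \int[mu]_(x in F n) (cst ((2 ^+ n.+1) ^+ d.+1)%:E) x <= _).
    apply: ge0_le_integral => //.
    - by move=> x Fx; apply: f0; exists n.
    - by apply/measurable_EFinP; exact: mf.
    move=> x Fx; rewrite lee_fin lerXn2r ?nnegrE ?exprn_ge0//.
      by have := f0 x; case: n Fx => [|n]; rewrite /F /band /= in_itv /= => /andP[h1 _] _; apply: ltW; apply: le_lt_trans h1; rewrite ?exprn_ge0.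
    by case: n Fx => [|n]; rewrite /F /band /= in_itv /= => /andP[_]; rewrite ?expr1.
  by rewrite integral_cst// EFinM fineK// fin_num_measure.
apply: le_trans (_ : \sum_(0 <= n < N.+1) ((2 ^+ n.+1) ^+ d.+1 * fine (mu (F n)))%:E <= _).
  rewrite [leRHS]big_nat_recr//=.
  apply: le_trans (lee_sum _ (fun n _ => tb n)) _; rewrite leeDl// lee_fin mulr_ge0 ?exprn_ge0// fine_ge0//.
rewrite sumEFin lee_fin big_nat_recl//= /B; apply: lerD.
  rewrite expr1 -[leRHS]mulr1 ler_pM2l ?exprn_gt0//.
  exact: (@pr_le1 _ _ _ mu _ (mF 0%N)).
apply: le_trans (_ : 4 ^+ d.+1 * \sum_(n < N) (2 ^+ n) ^+ d.+1 * fine (mu (band n)) <= _)%R; last first.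
  by rewrite ler_pM2l ?exprn_gt0.
rewrite big_mkord mulr_sumr; apply: ler_sum => n _; rewrite mulrA -exprMn.
rewrite [X in (X ^+ _ * _ <= _)%R](_ : _ = (4 * 2 ^+ n)%R)//.
by rewrite !exprS; ring.
Qed.

End Part2.

(** * Positivity of the time constant *)

Section PosDet.
Context {R : realType} {d : nat}.
Local Notation pt := 'rV[R]_d.
Local Notation mpt := (@mpoint R d).

Definition Jcl (i : nat) : set R :=
  if i is i'.+1 then `]2 ^+ i', 2 ^+ i'.+1]%classic else `]0, 1]%classic.

Lemma measurable_Jcl i : measurable (Jcl i).
Proof. by case: i => [|i]; exact: measurable_itv. Qed.

Lemma Jcl_itv i r : Jcl i r -> 0 < r <= 2 ^+ i.
Proof.
case: i => [|i] /=; rewrite in_itv /=; first by rewrite expr0.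
by move=> /andP[h1 ->]; rewrite andbT; apply: lt_trans h1; exact: exprn_gt0.
Qed.

Lemma Jcl_pos i : Jcl i `<=` `]0, +oo[%classic.
Proof. by move=> r /Jcl_itv /andP[r0 _]; rewrite /= in_itv /= r0. Qed.

Lemma Jcl_cover N r : 0 < r -> r < 2 ^+ N -> exists2 i : 'I_N.+1, true & Jcl i r.
Proof.
move=> r0 rN; have ex : exists n, r <= 2 ^+ n by exists N; exact: ltW.
case: (ex_minnP ex) => n rn mn; have nN : (n < N.+1)%N by rewrite ltnS mn// ltW.
exists (Ordinal nN) => //=; case: n rn mn nN => [|n] rn mn nN /=; rewrite in_itv /=.
  by rewrite r0 (le_trans rn)// expr0.
by rewrite rn andbT ltNge; apply/negP => /mn; rewrite ltnn.
Qed.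

Lemma sum_prefix (l : seq mpt) (D : R) : 0 < D -> D <= srad l ->
  exists (l1 : seq mpt) (b : mpt) (l2 : seq mpt), [/\ l = l1 ++ b :: l2, D <= srad (rcons l1 b) & srad l1 < D].
Proof.
elim: l D => [|q l ih] D D0; first by rewrite /srad big_nil leNgt D0.
rewrite srad_cons => h; have [hq|hq] := lerP D (mrad q).
  by exists [::], q, l; rewrite /srad big_seq1 big_nil.
have [||l1 [b [l2 [-> h1 h2]]]] := ih (D - mrad q); rewrite ?subr_gt0// ?lerBlDl//.
exists (q :: l1), b, l2; split => //.
  by rewrite rcons_cons srad_cons -lerBlDl.
by rewrite srad_cons -ltrBrDl.
Qed.

Lemma dist_sradc (x : pt) (q : mpt) (l : seq mpt) : path lkc q l -> enorm (x - mctr (last q l)) <= mrad (last q l) ->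
  enorm (x - mctr q) <= srad (q :: l).
Proof.
elim: l q => [|q' l ih] q /=; first by rewrite /srad big_seq1.
move=> /andP[h1 h2] h3; have := ih q' h2 h3; rewrite (srad_cons q) => h.
apply: le_trans (enorm_tri (mctr q') _ _) _; rewrite addrC; exact: lerD.
Qed.

Lemma plen_sradc (q : mpt) (l : seq mpt) : path lkc q l -> plen (mctr q) (map mctr l) <= srad (belast q l).
Proof.
elim: l q => [|q' l ih] q /=; first by rewrite /srad big_nil.
by move=> /andP[h1 h2]; rewrite srad_cons; apply: lerD => //; exact: ih.
Qed.

Lemma sum_decay (p : nat -> R) (z : R) M : (0 < d)%N -> 0 <= z ->
  (forall m, p m.+1 <= 1) -> (forall m, p m.+1 <= ((z / m.+1%:R) ^+ d) ^+ m.+1) ->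
  \sum_(m < M) p m.+1 <= 4 * z.
Proof.
move=> hd z0 p1 pz.
have z20 : 0 <= 2 * z by rewrite mulr_ge0.
apply: le_trans (_ : \sum_(m < M) ((m < Num.truncn (2 * z))%N%:R + z * 2^-1 ^+ m) <= _).
  apply: ler_sum => m _; case: ltnP => hm.
    by apply: le_trans (p1 m) _; rewrite lerDl mulr_ge0// exprn_ge0// invr_ge0.
  have m0 : (0 : R) < m.+1%:R by rewrite ltr0n.
  rewrite add0r; apply: le_trans (pz m) _.
  have zm : z / m.+1%:R <= 2^-1.
    rewrite ler_pdivrMr// -(ler_pM2l (_ : 0 < 2))// mulrA divff// mul1r; apply: ltW.
    have /truncn_itv/andP[_ h] := z20; apply: lt_le_trans h _; by rewrite ler_nat.
  have zm0 : 0 <= z / m.+1%:R by rewrite divr_ge0.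
  rewrite -exprM; apply: le_trans (_ : (z / m.+1%:R) ^+ m.+1 <= _).
    apply: ler_wiXn2l => //; first by apply: le_trans zm _; rewrite invf_le1// ler1n.
    by rewrite leq_pmull.
  rewrite exprS; apply: ler_pM; rewrite ?exprn_ge0//.
    by rewrite ler_pdivrMr// ler_peMr// ler1n.
  by apply: lerXn2r; rewrite ?nnegrE// invr_ge0.
rewrite big_split/= -mulr_sumr.
have -> : 4 * z = 2 * z + z * 2 by ring.
apply: lerD; last by rewrite ler_wpM2l// sum_half.
have /truncn_itv/andP[h _] := z20; apply: le_trans h.
rewrite -natr_sum ler_nat -(big_mkord xpredT (fun n => nat_of_bool (n < Num.truncn (2 * z))%N)).
rewrite (eq_bigr (fun n => if (n < Num.truncn (2 * z))%N then 1%N else 0%N)) => [|n _]; last by case: ltnP.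
rewrite -big_mkcond sum1_count -size_filter -[leqRHS](size_iota 0); apply: uniq_leq_size.
  by rewrite filter_uniq// iota_uniq.
by move=> n; rewrite mem_filter !mem_iota => /andP[-> _].
Qed.

End PosDet.

Section IntegralCondition.
Context {R : realType} (d : nat).
Hypothesis hd : (0 < d)%N.
Variable mu : probability R R.
Local Notation J := (@Jcl R).
Local Open Scope ereal_scope.

Definition tailint (x : R) : \bar R := \int[mu]_(r in `[x, +oo[%classic) r%:E.

Lemma tailint_ge0 x : (0 <= x)%R -> 0 <= tailint x.
Proof.
move=> x0; apply: integral_ge0 => r /=; rewrite in_itv /= andbT => xr.
by rewrite lee_fin (le_trans x0).
Qed.

Lemma measurable_EFinid (D : set R) : measurable_fun D (fun r : R => r%:E).
Proof. exact: EFin_measurable. Qed.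

Lemma tailint_anti x y : (0 <= x)%R -> (x <= y)%R -> tailint y <= tailint x.
Proof.
move=> x0 xy; apply: ge0_subset_integral; [exact: measurable_itv|exact: measurable_itv|exact: measurable_EFinid| |].
  by move=> r /=; rewrite in_itv /= andbT => xr; rewrite lee_fin (le_trans x0).
by move=> r /=; rewrite !in_itv /= !andbT; exact: le_trans.
Qed.

Lemma tailint_Jcl k x : (0 <= x)%R -> (x <= 2 ^+ k)%R ->
  (2 ^+ k * fine (mu (J k.+1)))%:E <= tailint x.
Proof.
move=> x0 xk.
apply: le_trans (_ : \int[mu]_(r in J k.+1) (cst (2 ^+ k)%:E) r <= _).
  by rewrite integral_cst; [rewrite EFinM fineK// fin_num_measure//; exact: measurable_Jcl|exact: measurable_Jcl].
apply: le_trans (_ : \int[mu]_(r in J k.+1) r%:E <= _).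
  apply: ge0_le_integral; [exact: measurable_Jcl| |exact: measurable_cst|exact: measurable_EFinid|].
    by move=> r _; rewrite lee_fin exprn_ge0.
  by move=> r /=; rewrite in_itv /= lee_fin => /andP[/ltW].
apply: ge0_subset_integral; [exact: measurable_Jcl|exact: measurable_itv|exact: measurable_EFinid| |].
  by move=> r /=; rewrite in_itv /= andbT => xr; rewrite lee_fin (le_trans x0).
by move=> r /=; rewrite !in_itv /= andbT => /andP[/ltW h _]; exact: le_trans h.
Qed.

Local Notation g x := ((tailint x) `^ (d%:R^-1)).

Let dV0 : (0 <= d%:R^-1 :> R)%R. Proof. by rewrite invr_ge0. Qed.

Lemma poweR_mono (x y : \bar R) : 0 <= x -> x <= y -> x `^ (d%:R^-1) <= y `^ (d%:R^-1).
Proof.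
move=> x0 xy; apply: (gt0_ler_poweR dV0) => //; rewrite in_itv /= leey andbT//.
exact: le_trans xy.
Qed.

Lemma measurable_tailpow : measurable_fun (`[0%R, +oo[%classic : set R) (fun x : R => g x).
Proof.
move=> mD; apply: (measurability _ (ErealGenCInfty.measurableE R)) => //.
move=> _ [_ [r ->] <-]; apply: is_interval_measurable => s t /=.
rewrite !in_itv /= !andbT => -[s0 _] [_ t1] u /andP[su ut].
have u0 : (0 <= u)%R := le_trans s0 su.
split; first by rewrite in_itv /= andbT.
rewrite in_itv /= andbT; apply: le_trans t1 _; apply: poweR_mono.
  by apply: tailint_ge0; apply: le_trans ut.
exact: tailint_anti.
Qed.

Local Notation pc k := (2 ^+ k * (2 ^+ k.+1 * fine (mu (J k.+2))) `^ (d%:R^-1))%R.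

Lemma piece_le k : (pc k)%:E <= \int[@lebesgue_measure R]_(x in `[(2 ^+ k)%R, (2 ^+ k.+1)%R[%classic) g x.
Proof.
have p2 : (2 ^+ k < 2 ^+ k.+1 :> R)%R by rewrite ltr_eXn2l ?ltr1n.
have sub : `[(2 ^+ k)%R, (2 ^+ k.+1)%R[%classic `<=` (`[0%R, +oo[%classic : set R).
  by move=> r /=; rewrite !in_itv /= andbT => /andP[h _]; apply: le_trans h; rewrite exprn_ge0.
apply: le_trans (_ : \int[@lebesgue_measure R]_(x in `[(2 ^+ k)%R, (2 ^+ k.+1)%R[%classic) (cst ((2 ^+ k.+1 * fine (mu (J k.+2))) `^ (d%:R^-1))%:E) x <= _).
  rewrite integral_cst; last exact: measurable_itv.
  have lm : @lebesgue_measure R (`[(2 ^+ k)%R, (2 ^+ k.+1)%R[%classic) = (2 ^+ k)%:E.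
    rewrite lebesgue_measure_itv /= lte_fin p2 -EFinB; congr (_%:E).
    by rewrite exprS; ring.
  by rewrite [X in _ <= _ * X]lm -EFinM lee_fin mulrC.
apply: ge0_le_integral; [exact: measurable_itv| |exact: measurable_cst| |].
- by move=> x _; rewrite lee_fin powR_ge0.
- by apply: measurable_funS measurable_tailpow => //; exact: measurable_itv.
move=> x /=; rewrite in_itv /= => /andP[h1 h2]; rewrite -poweR_EFin; apply: poweR_mono.
  by rewrite lee_fin mulr_ge0 ?exprn_ge0// fine_ge0.
by apply: tailint_Jcl; [apply: le_trans h1; rewrite exprn_ge0|exact: ltW].
Qed.

Lemma pieces_le N : (\sum_(k < N) pc k)%:E <= \int[@lebesgue_measure R]_(x in `[0%R, (2 ^+ N)%R[%classic) g x.
Proof.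
elim: N => [|N ih].
  by rewrite big_ord0; apply: integral_ge0 => x _; exact: poweR_ge0.
have p2 : (2 ^+ N <= 2 ^+ N.+1 :> R)%R by rewrite ler_eXn2l ?ltr1n.
have p0 : (0 <= 2 ^+ N :> R)%R by rewrite exprn_ge0.
have -> : `[0%R, (2 ^+ N.+1)%R[%classic = `[0%R, (2 ^+ N)%R[%classic `|` `[(2 ^+ N)%R, (2 ^+ N.+1)%R[%classic :> set R.
  apply/seteqP; split => x /=; rewrite !in_itv /=.
    by move=> /andP[h1 h2]; case: (ltrP x (2 ^+ N)) => h; [left|right]; apply/andP; split.
  by case=> /andP[h1 h2]; [rewrite h1 (lt_le_trans h2)|rewrite (le_trans p0 h1) h2].
rewrite ge0_integral_setU//.
- by rewrite big_ord_recr /= EFinD; apply: leeD => //; exact: piece_le.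
- apply: measurable_funS measurable_tailpow; first exact: measurable_itv.
  move=> x /=; rewrite !in_itv /= andbT => -[] /andP[h _] //.
  exact: le_trans h.
- by move=> x _; exact: poweR_ge0.
apply/disj_setPS => x /= []; rewrite !in_itv /= => /andP[_ h1] /andP[h2 _].
by move: (lt_le_trans h1 h2); rewrite ltxx.
Qed.

Lemma integral_cond : \int[@lebesgue_measure R]_(x in `[0%R, +oo[%classic) g x < +oo ->
  exists S : R, forall N, (\sum_(i < N) 2 ^+ i * (2 ^+ i * fine (mu (J i))) `^ (d%:R^-1) <= S)%R.
Proof.
move=> fin.
have I0 : 0 <= \int[@lebesgue_measure R]_(x in `[0%R, +oo[%classic) g x.
  by apply: integral_ge0 => x _; exact: poweR_ge0.
pose I := fine (\int[@lebesgue_measure R]_(x in `[0%R, +oo[%classic) g x).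
have IE : I%:E = \int[@lebesgue_measure R]_(x in `[0%R, +oo[%classic) g x by rewrite /I fineK// ge0_fin_numE.
pose s i : R := (2 ^+ i * (2 ^+ i * fine (mu (J i))) `^ (d%:R^-1))%R.
have s0 i : (0 <= s i)%R by rewrite mulr_ge0 ?exprn_ge0// powR_ge0.
exists (s 0 + s 1 + 8 * I)%R => N.
apply: le_trans (_ : \sum_(i < N.+2) s i <= _)%R.
  rewrite -!(big_mkord xpredT s) [leRHS](big_cat_nat (n := N)) ?leqW//=.
  by rewrite lerDl sumr_ge0.
rewrite !big_ord_recl /= addrA lerD2l.
apply: le_trans (_ : 8 * \sum_(k < N) pc k <= _)%R.
  rewrite mulr_sumr; apply: ler_sum => k _; apply: (le_trans (_ : s k.+2 <= _)%R); first exact: lexx.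
  rewrite /s; set c := fine (mu (J k.+2)).
  have c0 : (0 <= c)%R by exact: fine_ge0.
  have b0 : (0 <= 2 ^+ k.+1 * c)%R by rewrite mulr_ge0 ?exprn_ge0.
  have -> : (2 ^+ k.+2 * c = 2 * (2 ^+ k.+1 * c))%R by rewrite [in LHS]exprS mulrA.
  rewrite powRM//; set u := powR (2 ^+ k.+1 * c) _.
  have t2 : (2 `^ (d%:R^-1) <= 2 :> R)%R.
    rewrite -[leRHS]powRr1//; apply: ler_powR; first by rewrite ler1n.
    by rewrite invf_le1 ?ltr0n// ler1n.
  set q := powR 2 _ in t2 *.
  have u0 : (0 <= 2 ^+ k * u)%R by rewrite mulr_ge0 ?exprn_ge0// powR_ge0.
  have -> : (2 ^+ k.+2 * (q * u) = 4 * q * (2 ^+ k * u))%R by rewrite !exprS; ring.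
  by apply: ler_wpM2r => //; move: t2; lra.
rewrite ler_pM2l// -lee_fin IE; apply: le_trans (pieces_le N) _.
apply: ge0_subset_integral; [exact: measurable_itv|exact: measurable_itv|exact: measurable_tailpow|by move=> x _; exact: poweR_ge0|].
by move=> x /=; rewrite !in_itv /= andbT => /andP[].
Qed.

End IntegralCondition.

Section Pos.
Context {R : realType} {d : nat} {dO : measure_display} {Omega : measurableType dO}.
Variables (P : probability Omega R) (mu : probability R R).
Variable chi : Omega -> set (@mpoint R d).
Hypothesis hchi : is_PPP P mu chi.
Hypothesis hd : (0 < d)%N.
Local Notation pr := (pr P).
Local Notation pt := 'rV[R]_d.
Local Notation mpt := (@mpoint R d).
Variables (r0 R1 : R).
Hypothesis r00 : 0 < r0.
Hypothesis pJ0 : 0 < fine (mu `]r0, R1[%classic).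
Hypothesis r01 : r0 <= 1.
Local Notation rho := (rho r0).
Local Notation lam := (lam P chi hd r0).
Local Notation ind := (@ind R dO Omega).
Local Notation J := (@Jcl R).

Definition Lr (N : nat) : set mpt := [set p | mrad p < 2 ^+ N].

Lemma openL_Lr N : openL (Lr N).
Proof.
move=> p hp; exists (2 ^+ N - mrad p); first by rewrite subr_gt0.
move=> q [_ _ h]; rewrite /Lr /=; move: h hp; rewrite /Lr /=.
by rewrite ltr_norml => /andP[h1 h2] _; move: h1 h2; lra.
Qed.

Definition Bcl (A L : R) i m : set Omega := cellev chi (J i) (2 ^+ i / A) (L / m%:R) m 0.

Lemma pos_det w N (L A t : R) x M : 0 < A -> 4 <= L -> L <= M%:R -> enorm x = L -> 0 < t -> A * (2 * t) <= L / 4 ->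
  cev chi (Lr N) rho rho 0 x t w ->
  L / 2 <= \sum_(im : 'I_N.+1 * 'I_M) 2 ^+ im.1 * ind (Bcl A L im.1 im.2.+1) w.
Proof.
move=> A0 L4 LM xL t0 At c; have L0 : 0 < L by move: L4; lra.
have rho1 : rho <= 1 by rewrite rhoE ler_pdivrMr//; move: r00 r01; lra.
have X0 p : (chi w `&` Lr N) p -> 0 <= mtim p by move=> [/(ppp_tim hchi)].
have pT : (passT (chi w `&` Lr N) (eball 1) x < (2 * t)%:E)%E.
  apply: le_lt_trans (passT_le_conn X0 rho1 c _) _; first by rewrite subrr enorm0 ltW// rho_gt0.
  by rewrite lte_fin; move: t0; lra.
have [|[p [s [[h1 h2 h3] [h4 h5 h6]]]]] := passT_lt_chain X0 pT.
  by rewrite xL => ?; exfalso; move: L4; lra.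
have sr : L - 1 <= srad (p :: s).
  apply: le_trans (dist_sradc h3 h4); have := enorm_tri 0 x (mctr p).
  have : enorm x <= enorm (x - mctr p) + enorm (mctr p) by have := enormD (x - mctr p) (mctr p); rewrite subrK.
  by rewrite xL; move: h2; set a := enorm (x - _); set b := enorm (mctr p); lra.
have L10 : 0 < L - 1 by move: L4; lra.
have [l1 [b [l2 [e s1 s2]]]] := sum_prefix L10 sr.
set l := rcons l1 b in s1.
have el : p :: s = l ++ l2 by rewrite e /l cat_rcons.
have sub q : q \in l -> q \in p :: s by rewrite el mem_cat => ->.
have pl : plen 0 (map mctr l) <= L.
  have [s' e'] : exists s', l = p :: s'.
    by move: el; rewrite /l; case: (l1) => [|q l1'] /= [-> _]; eexists.
  have ps' : path lkc p s'.
    have : sorted lkc (l ++ l2) by rewrite -el.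
    by move=> /cat_sorted2[]; rewrite e'.
  rewrite e' /= subr0; have := plen_sradc ps'.
  have -> : belast p s' = l1.
    have := lastI p s'; rewrite -e' /l => /eqP; rewrite eqseq_rcons => /andP[/eqP <- _] //.
  by move: s2 h2; lra.
have hq q : q \in l -> [/\ chi w q, 0 <= mtim q, 0 < mrad q & mrad q < 2 ^+ N].
  by move=> /sub /h1[hc hL]; split => //; [exact: (ppp_tim hchi hc)|exact: (ppp_rad hchi hc)].
pose F (i : 'I_N.+1) := [seq q <- l | `[< J i (mrad q) >] && (mtim q < 2 ^+ i / A)].
have key : srad l <= A * stime l + \sum_(i < N.+1) 2 ^+ i * (size (F i))%:R.
  have -> : \sum_(i < N.+1) 2 ^+ i * (size (F i))%:R =
    \sum_(q <- l) \sum_(i < N.+1) 2 ^+ i * (`[< J i (mrad q) >] && (mtim q < 2 ^+ i / A))%:R :> R.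
    rewrite exchange_big /=; apply: eq_bigr => i _; rewrite -mulr_sumr; congr (_ * _).
    by rewrite /F size_filter -sum1_count natr_sum big_mkcond /=; apply: eq_bigr => q _; case: (_ && _).
  rewrite /srad /stime mulr_sumr -big_split /= big_seq [leRHS]big_seq; apply: ler_sum => q /hq[_ tq rq rN].
  have [i _ Ji] := Jcl_cover rq rN; have /andP[_ ri] := Jcl_itv Ji.
  have s0 : 0 <= \sum_(j < N.+1 | j != i) 2 ^+ j * (`[< J j (mrad q) >] && (mtim q < 2 ^+ j / A))%:R :> R.
    by apply: sumr_ge0 => j _; rewrite mulr_ge0// exprn_ge0.
  rewrite (bigD1 i)//=; have -> : `[< J i (mrad q) >] = true by apply/asboolP.
  have Aq : 0 <= A * mtim q by rewrite mulr_ge0// ltW.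
  case: ltrP => /= ht; rewrite ?mulr1 ?mulr0 ?add0r.
    by apply: le_trans ri _; move: s0 Aq; set a := A * _; set c' := \sum_(_ | _) _; lra.
  apply: le_trans ri _; move: ht; rewrite ler_pdivrMr// mulrC => ht.
  by apply: le_trans ht _; rewrite lerDl.
have stl : stime l <= 2 * t.
  apply: le_trans (ltW h5); rewrite el stime_cat lerDl /stime big_seq; apply: sumr_ge0 => q hq'.
  by apply: X0; apply: h1; rewrite el mem_cat hq' orbT.
have big : L / 2 <= \sum_(i < N.+1) 2 ^+ i * (size (F i))%:R.
  have : A * stime l <= L / 4 by apply: le_trans At; rewrite ler_pM2l.
  by move: key s1 L4; set a := A * stime l; set S := \sum_(_ < _) _; lra.
have inB i m : (m < size (F i))%N -> Bcl A L i m.+1 w.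
  move=> hm; have m0 : (0 : R) < m.+1%:R by rewrite ltr0n.
  have mF q : q \in take m.+1 (F i) -> q \in l /\ (J i (mrad q) /\ mtim q < 2 ^+ i / A).
    by move=> /mem_take; rewrite mem_filter => /andP[/andP[/asboolP ? ?] ?].
  apply: (@cellevP _ _ _ _ _ _ _ hchi _ _ _ _ _ _ w (take m.+1 (F i))).
  - by rewrite divr_gt0.
  - apply: take_uniq; apply: filter_uniq; apply: (@map_uniq _ _ mctr).
    by move: h6; rewrite el map_cat cat_uniq => /andP[].
  - exact: size_takel.
  - by move=> q /mF[/hq[]].
  - by move=> q /mF[_ []].
  - by move=> q /mF[_ []].
  rewrite mulrCA divff ?gt_eqF// mulr1; apply: le_trans pl; apply: plen_subseq.
  apply: map_subseq; apply: subseq_trans (take_subseq _ _) _; exact: filter_subseq.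
rewrite sum_pair /=.
have i0 i m : 0 <= 2 ^+ i * ind (Bcl A L i m) w by rewrite mulr_ge0 ?exprn_ge0// ind_ge0.
have ind1 i m : (m < size (F i))%N -> ind (Bcl A L i m.+1) w = 1.
  by move=> /inB h; case: (indP (R := R) (Bcl A L i m.+1) w) => -[].
have [[i hi]|nh] := pselect (exists i, (M < size (F i))%N).
  rewrite (bigD1 i)//=; apply: le_trans (_ : \sum_(m < M) 1 <= _).
    by rewrite sum_ord_const mulr1; move: LM L0; lra.
  rewrite -[leLHS]addr0; apply: lerD; last by apply: sumr_ge0 => j _; apply: sumr_ge0 => m _; exact: i0.
  apply: ler_sum => m _; rewrite ind1; last by apply: ltn_trans hi.
  by rewrite mulr1 -natrX ler1n expn_gt0.
apply: le_trans big _; apply: ler_sum => i _.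
have hi : (size (F i) <= M)%N by rewrite leqNgt; apply/negP => h; apply: nh; exists i.
rewrite -(big_mkord xpredT (fun m => 2 ^+ i * ind (Bcl A L i m.+1) w)) (big_cat_nat (n := size (F i)))//=.
rewrite -[leLHS]addr0; apply: lerD; last by apply: sumr_ge0 => m _; exact: i0.
rewrite big_mkord (eq_bigr (fun=> 2 ^+ i)) => [|m _]; last by rewrite ind1// mulr1.
by rewrite sum_ord_const mulrC.
Qed.

Local Notation xi i := ((2 ^+ i * fine (mu (J i))) `^ (d%:R^-1)).

Lemma xi_pow i : xi i ^+ d = 2 ^+ i * fine (mu (J i)).
Proof.
have b0 : 0 <= 2 ^+ i * fine (mu (J i)) by rewrite mulr_ge0 ?exprn_ge0// fine_ge0.
rewrite -powR_mulrn ?powR_ge0// -powRrM mulVf ?powRr1// pnatr_eq0 -lt0n //.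
Qed.

Variable S : R.
Hypothesis hS : forall N, \sum_(i < N) 2 ^+ i * xi i <= S.
Let B0 := 384 * S + 1.
Let A := B0 ^+ d.

Lemma pos_B0 : 0 < B0.
Proof. by have := hS 0; rewrite big_ord0 /B0; lra. Qed.

Lemma pos_A : 0 < A.
Proof. by rewrite exprn_gt0// pos_B0. Qed.

Lemma measurable_Bcl L i m : 0 < L -> (0 < m)%N -> measurable (Bcl A L i m).
Proof.
move=> L0 m0; apply: (measurable_cellev hchi); [exact: measurable_Jcl|exact: Jcl_pos| |].
  by apply: divr_ge0; [rewrite exprn_ge0|exact: ltW pos_A].
by rewrite divr_gt0// ltr0n.
Qed.

Lemma sum_Bcl L i M : 0 < L -> \sum_(m < M) pr (Bcl A L i m.+1) <= 48 * L * (xi i / B0).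
Proof.
move=> L0; have -> : 48 * L * (xi i / B0) = 4 * (12 * L * (xi i / B0)) by ring.
have y0 : 0 <= xi i / B0 by rewrite divr_ge0 ?powR_ge0// ltW// pos_B0.
apply: (sum_decay (p := fun m => pr (Bcl A L i m)) M hd).
- by rewrite mulr_ge0// mulr_ge0// ltW.
- by move=> m; apply: pr_le1; exact: measurable_Bcl.
move=> m; have m0 : (0 : R) < m.+1%:R by rewrite ltr0n.
apply: le_trans (pr_cellev hchi _ _ (measurable_Jcl i) (Jcl_pos (i := i)) _ _) _.
- by apply: divr_ge0; [rewrite exprn_ge0|exact: ltW pos_A].
- by rewrite divr_gt0.
apply: le_of_eq; congr (_ ^+ _).
rewrite [RHS](_ : _ = 12 ^+ d * ((L / m.+1%:R) ^+ d * (xi i ^+ d / A))).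
  by rewrite xi_pow; ring.
by rewrite /A -expr_div_n -!exprMn; congr (_ ^+ _); ring.
Qed.

Lemma pos_pr N (L t : R) x : 4 <= L -> enorm x = L -> 0 < t -> A * (2 * t) <= L / 4 ->
  pr (cev chi (Lr N) rho rho 0 x t) <= 4^-1.
Proof.
move=> L4 xL t0 At; have L0 : 0 < L by move: L4; lra.
have [M hM] := natceil L.
have mc : measurable (cev chi (Lr N) rho rho 0 x t) by apply: (measurable_cev hchi); exact: openL_Lr.
have mB (im : 'I_N.+1 * 'I_M) : measurable (Bcl A L im.1 im.2.+1) by exact: measurable_Bcl.
have := @markov_ind R dO Omega P ('I_N.+1 * 'I_M)%type (fun im => Bcl A L im.1 im.2.+1) (fun im => 2 ^+ im.1) (L / 2) mB (fun im => exprn_ge0 _ (ler0n _ 2)) _ mc.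
move=> /(_ (fun w c => pos_det pos_A L4 hM xL t0 At c)) h.
have : \sum_(im : 'I_N.+1 * 'I_M) 2 ^+ im.1 * pr (Bcl A L im.1 im.2.+1) <= L / 8.
  rewrite sum_pair /=; apply: le_trans (_ : \sum_(i < N.+1) 48 * L / B0 * (2 ^+ i * xi i) <= _).
    apply: ler_sum => i _; rewrite -mulr_sumr.
    apply: le_trans (ler_wpM2l (exprn_ge0 _ (ler0n _ 2)) (sum_Bcl i M L0)) _.
    by apply: le_of_eq; ring.
  rewrite -mulr_sumr; have B00 := pos_B0.
  apply: le_trans (_ : 48 * L / B0 * S <= _).
    by rewrite ler_wpM2l// divr_ge0 ?mulr_ge0// ltW.
  rewrite mulrAC ler_pdivrMr// /B0 mulrDr mulr1.
  have -> : L / 8 * (384 * S) = 48 * L * S by field.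
  by rewrite lerDl divr_ge0// ltW.
move=> h2; have := le_trans h h2; rewrite mulrC -ler_pdivlMr ?divr_gt0//.
by have -> : L / 8 / (L / 2) = 4^-1 by field; rewrite gt_eqF.
Qed.

Lemma pos_pr_full (L t : R) x : 4 <= L -> enorm x = L -> 0 < t -> A * (2 * t) <= L / 4 ->
  pr (cev chi setT rho rho 0 x t) <= 3 / 8.
Proof.
move=> L4 xL t0 At.
have mc N : measurable (cev chi (Lr N) rho rho 0 x t) by apply: (measurable_cev hchi); exact: openL_Lr.
have nd N : cev chi (Lr N) rho rho 0 x t `<=` cev chi (Lr N.+1) rho rho 0 x t.
  move=> w; apply: connW => // p [h1 h2]; split => //; rewrite /Lr /=; apply: lt_le_trans h2 _.
  by rewrite ler_eXn2l ?ltr1n.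
have e8 : (0 : R) < 8^-1 by rewrite invr_gt0.
have [N hN] := pr_nd_approx P mc nd e8.
have -> : cev chi setT rho rho 0 x t = [set w | exists N, cev chi (Lr N) rho rho 0 x t w].
  apply/seteqP; split => w; last by move=> [n]; apply: connW => // p [].
  move=> [p [s [h1 h2 h3 h4 h5]]].
  have [N' hN'] : exists N', forall q, q \in p :: s -> mrad q < 2 ^+ N'.
    elim: (p :: s) => [|q l [N1 hN1]]; first by exists 0%N.
    have [l0 hl0] := exists_pow2_gt (mrad q); exists (maxn N1 l0) => q'; rewrite inE => /orP[/eqP ->|/hN1 h].
      by apply: hl0; exact: leq_maxr.
    by apply: lt_le_trans h _; rewrite ler_eXn2l ?ltr1n// leq_maxl.
  by exists N', p, s; split => // q qs; split; [case: (h1 q qs)|exact: hN'].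
apply: le_trans hN _; have := pos_pr N L4 xL t0 At.
have -> : 3 / 8 = 4^-1 + 8^-1 :> R by field.
by rewrite lerD2r.
Qed.

Lemma lam_pos : 0 < lam.
Proof.
rewrite lt0r (lam_ge0 hchi hd r00 pJ0) andbT; apply/eqP => l0.
have A0 := pos_A.
have eps0 : 0 < (8 * A)^-1 by rewrite invr_gt0 mulr_gt0.
have [C [n0 h]] := upper_rate_unit hchi hd r00 pJ0 (enorm_e1 hd) ltr01 eps0.
have [n1 hn1] := lin_pow2 (2 * `|C|).
pose n := (n0 + n1 + 2)%N.
have p2 : (0 : R) < 2 ^+ n by rewrite exprn_gt0.
have p4 : (4 : R) <= 2 ^+ n.
  have -> : (4 : R) = 2 ^+ 2 by ring.
  by rewrite ler_eXn2l ?ltr1n// leq_addl.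
have nn0 : (n0 <= n)%N by rewrite /n -addnA leq_addr.
have := h n nn0 (2 ^+ n).
rewrite mulr1 mul1r lexx /= l0 add0r => /(_ ltac:(by move: p2; lra)) hh.
have hn : C * (n.+1%:R / 2 ^+ n) <= 2^-1.
  apply: le_trans (_ : `|C| * (n.+1%:R / 2 ^+ n) <= _).
    by rewrite ler_wpM2r ?ler_norm// divr_ge0 ?exprn_ge0.
  have h3 : 2 * `|C| * n.+1%:R <= 2 ^+ n by apply: hn1; rewrite /n -addnA addnCA leq_addr.
  rewrite -mulrA in h3; rewrite mulrA ler_pdivrMr//.
  by move: h3; set a := `|C| * _; lra.
have t0 : 0 < (8 * A)^-1 * 2 ^+ n by rewrite mulr_gt0.
have At : A * (2 * ((8 * A)^-1 * 2 ^+ n)) <= 2 ^+ n / 4 by apply: le_of_eq; field; rewrite gt_eqF.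
have xn : enorm (2 ^+ n *: e1 hd : pt) = 2 ^+ n by rewrite enormZ enorm_e1 mulr1 gtr0_norm.
have := pos_pr_full p4 xn t0 At.
move: hh; rewrite prC; last by apply: (measurable_cev hchi); exact: openLT.
by move: hn; set a := pr _; set b := C * _; lra.
Qed.

End Pos.

Section Final.
Context {R : realType}.

Lemma pow2_bracket (y : R) : 1 <= y -> exists n, y <= 2 ^+ n <= 2 * y.
Proof.
move=> y1; have [N hN] := exists_pow2_gt y.
have ex : exists n, y <= 2 ^+ n by exists N; apply: ltW; exact: hN.
case: (ex_minnP ex) => n yn mn; exists n; rewrite yn /=.
case: n yn mn => [|n] yn mn; first by rewrite expr0; move: y1; lra.
rewrite exprS ler_pM2l//; apply: ltW; rewrite ltNge; apply/negP => /mn.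
by rewrite ltnn.
Qed.

Lemma pow2_ge (n0 n : nat) (y : R) : 2 ^+ n0 <= y -> y <= 2 ^+ n -> (n0 <= n)%N.
Proof. by move=> h1 h2; rewrite -(ler_eXn2l (ltr1n R 2)); exact: le_trans h2. Qed.

Lemma exists_mass (mu : probability R R) : mu `]-oo, 0]%classic = 0%E ->
  exists r0 R1 : R, [/\ 0 < r0, r0 <= 1 & 0 < fine (mu `]r0, R1[%classic)].
Proof.
move=> hmu; pose F n : set R := `]n.+1%:R^-1, n.+1%:R[%classic.
have mF n : measurable (F n) by exact: measurable_itv.
have ndF n : F n `<=` F n.+1.
  move=> r; rewrite /F /= !in_itv /= => /andP[h1 h2]; apply/andP; split.
    by apply: le_lt_trans h1; rewrite lef_pV2 ?posrE ?ltr0n// ler_nat.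
  by apply: lt_le_trans h2 _; rewrite ler_nat.
have e2 : (0 : R) < 2^-1 by rewrite invr_gt0.
have [n hn] := pr_nd_approx mu mF ndF e2.
have U1 : pr mu [set r | exists n, F n r] = 1.
  have -> : [set r | exists n, F n r] = ~` `]-oo, 0]%classic.
    apply/seteqP; split => r /=.
      move=> [k]; rewrite /F /= !in_itv /= => /andP[h1 _]; apply/negP; rewrite -ltNge.
      by apply: lt_trans h1; rewrite invr_gt0 ltr0n.
    rewrite in_itv /= => /negP; rewrite -ltNge => r0.
    have [k1 hk1] := natceil r; have [k2 hk2] := natceil r^-1.
    exists (k1 + k2).+1; rewrite /F /= in_itv /=; apply/andP; split.
      rewrite -[ltRHS]invrK ltf_pV2 ?posrE ?invr_gt0 ?ltr0n//; apply: le_lt_trans hk2 _.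
      by rewrite ltr_nat ltnS (leq_trans (leq_addl k1 k2)).
    by apply: le_lt_trans hk1 _; rewrite ltr_nat ltnS (leq_trans (leq_addr k2 k1)).
  by rewrite prC; [rewrite /pr hmu /= subr0|exact: measurable_itv].
exists n.+1%:R^-1, n.+1%:R; split; [by rewrite invr_gt0 ltr0n|by rewrite invf_le1 ?ltr0n// ler1n|].
by move: hn; rewrite U1 -/(pr mu _) -/(F n); set a := pr mu (F n); lra.
Qed.

End Final.

Theorem theorem1p1 (R : realType) (d : nat) (hd : (0 < d)%N)
  (mu : probability R R) (hmu : mu `]-oo, 0]%classic = 0%E)
  (dO : measure_display) (Omega : measurableType dO) (P : probability Omega R)
  (chi : Omega -> set (mpoint d)) (hchi : is_PPP P mu chi) :
  (((\int[@lebesgue_measure R]_(x in `[0%R, +oo[%classic)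
       ((\int[mu]_(r in `[x, +oo[%classic) r%:E) `^ (d%:R^-1))) < +oo)%E ->
   exists lam : R, 0 < lam /\
     {ae P, forall w, forall eps : R, 0 < eps ->
        exists t0 : R, forall t : R, t0 <= t ->
          eball ((1 - eps) / lam) `<=` (fun y => t^-1 *: y) @` covered (chi w) t
          /\ (fun y => t^-1 *: y) @` covered (chi w) t `<=` eball ((1 + eps) / lam)})
  /\
  (((\int[mu]_(r in `]0%R, +oo[%classic) (r ^+ d.+1)%:E) = +oo)%E ->
   {ae P, forall w, forall M : R, 0 < M ->
      exists t0 : R, forall t : R, t0 <= t ->
        eball M `<=` (fun y => t^-1 *: y) @` covered (chi w) t}).
Proof.
have [r0 [R1 [r00 r01 pJ0]]] := exists_mass hmu.
have U := upper_ae hchi hd r00 pJ0 r01.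
have img (X : set (mpoint d)) (t : R) (z : 'rV[R]_d) : 0 < t -> (passT X (eball 1) (t *: z) <= t%:E)%E ->
    ((fun y => t^-1 *: y) @` covered X t) z.
  by move=> t0 h; exists (t *: z) => //=; rewrite scalerA mulVf ?gt_eqF// scale1r.
split => [hint|hint].
  have [S hS] := integral_cond hd hint.
  set lam := lam P chi hd r0 in U.
  have lam0 : 0 < lam by exact: (lam_pos hchi hd r00 pJ0 r01 hS).
  have Lo := lower_final hchi hd r00 pJ0.
  exists lam; split => //; apply: filterS2 U Lo => w hU hL eps eps0.
  have il : 0 < lam^-1 by rewrite invr_gt0.
  pose e1 := eps * lam / 2; have e10 : 0 < e1 by rewrite divr_gt0// mulr_gt0.
  pose e2 := lam * eps / (1 + eps) / 4.
  have e20 : 0 < e2 by rewrite !divr_gt0 ?mulr_gt0// addr_gt0.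
  have [n1 h1] := hU _ e10; have [n2 h2] := hL _ e20.
  exists (lam * (2 ^+ n1 + 2 ^+ n2 + 1)) => t ht.
  have q1 : (0 : R) < 2 ^+ n1 by rewrite exprn_gt0.
  have q2 : (0 : R) < 2 ^+ n2 by rewrite exprn_gt0.
  have tl : 2 ^+ n1 + 2 ^+ n2 + 1 <= t / lam by rewrite ler_pdivlMr// mulrC.
  have tl0 : 0 < t / lam by apply: lt_le_trans tl; rewrite !addr_gt0.
  have t0 : 0 < t by move: tl0; rewrite pmulr_lgt0.
  split.
    move=> z; rewrite /eball /= => hz; apply: img => //.
    have [n /andP[b1 b2]] : exists n, t / lam <= 2 ^+ n <= 2 * (t / lam).
      by apply: pow2_bracket; move: tl q1 q2; lra.
    have nn : (n1 <= n)%N by apply: (@pow2_ge R _ _ (t / lam)) => //; move: tl q2; lra.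
    have zn : enorm (t *: z) = t * enorm z by rewrite enormZ gtr0_norm.
    have zl : t * enorm z <= t / lam - eps * (t / lam).
      by apply: le_trans (ler_wpM2l (ltW t0) hz) _; apply: le_of_eq; field; rewrite gt_eqF.
    have et : 0 < eps * (t / lam) by rewrite mulr_gt0.
    have xn : enorm (t *: z) <= 2 ^+ n by rewrite zn; move: zl et b1; lra.
    apply: le_trans (h1 n nn _ xn) _; rewrite lee_fin zn.
    have a1 : lam * (t * enorm z) <= t - eps * t.
      apply: le_trans (ler_wpM2l (ltW lam0) zl) _; apply: le_of_eq; field; rewrite gt_eqF//.
    have a2 : e1 * 2 ^+ n <= eps * t.
      apply: le_trans (ler_wpM2l (ltW e10) b2) _; apply: le_of_eq; rewrite /e1; field; rewrite gt_eqF//.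
    by move: a1 a2; set a := lam * _; set b := e1 * _; lra.
  move=> _ [y hy <-]; rewrite /eball /= enormZ gtr0_norm ?invr_gt0//.
  rewrite ler_pdivrMl// leNgt; apply/negP => yb.
  have ep0 : 0 < 1 + eps by rewrite addr_gt0.
  have yb' : t / lam < enorm y.
    apply: lt_trans yb; rewrite mulrCA mulrDl mul1r ltrDl mulr_gt0//.
  have [n /andP[b1 b2]] : exists n, enorm y <= 2 ^+ n <= 2 * enorm y.
    by apply: pow2_bracket; move: tl yb' q1 q2; lra.
  have nn : (n2 <= n)%N by apply: (@pow2_ge R _ _ (enorm y)) => //; move: tl yb' q1; lra.
  have y0 : 0 < enorm y by apply: lt_trans yb'.
  have := le_trans (h2 n nn y b1) hy; rewrite lee_fin -/lam.
  have a1 : e2 * 2 ^+ n <= lam * eps / (1 + eps) * enorm y / 2.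
    by apply: le_trans (ler_wpM2l (ltW e20) b2) _; apply: le_of_eq; rewrite /e2; field; rewrite gt_eqF.
  have a2 : t * (1 + eps) < lam * enorm y.
    by move: yb; rewrite mulrA ltr_pdivrMr// (mulrC (enorm y)).
  have a3 : t < lam * enorm y - lam * eps / (1 + eps) * enorm y.
    have -> : lam * enorm y - lam * eps / (1 + eps) * enorm y = lam * enorm y / (1 + eps) by field; rewrite gt_eqF.
    by rewrite ltr_pdivlMr.
  have a4 : 0 < lam * eps / (1 + eps) * enorm y by rewrite mulr_gt0// divr_gt0// mulr_gt0.
  by move: a1 a3 a4; set a := e2 * _; set b := lam * enorm y; set c := lam * eps / (1 + eps) * enorm y; lra.
have l0 := lam_zero_div hchi hd r00 pJ0 r01 (moment_div hint).
rewrite l0 in U; apply: filterS U => w hU M M0.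
have e0 : 0 < (2 * M)^-1 by rewrite invr_gt0 mulr_gt0.
have [n1 h1] := hU _ e0.
exists ((2 ^+ n1 + 1) / M) => t ht.
have q1 : (0 : R) < 2 ^+ n1 by rewrite exprn_gt0.
have tM : 2 ^+ n1 + 1 <= t * M by rewrite -ler_pdivrMr.
have t0 : 0 < t by apply: lt_le_trans ht; rewrite divr_gt0// addr_gt0.
move=> z; rewrite /eball /= => hz; apply: img => //.
have [n /andP[b1 b2]] : exists n, t * M <= 2 ^+ n <= 2 * (t * M).
  by apply: pow2_bracket; move: tM q1; lra.
have nn : (n1 <= n)%N by apply: (@pow2_ge R _ _ (t * M)) => //; move: tM; lra.
have xn : enorm (t *: z) <= 2 ^+ n.
  by rewrite enormZ gtr0_norm//; apply: le_trans b1; rewrite ler_pM2l.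
apply: le_trans (h1 n nn _ xn) _; rewrite lee_fin mul0r add0r.
by apply: le_trans (ler_wpM2l (ltW e0) b2) _; apply: le_of_eq; field; rewrite gt_eqF.
Qed.
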